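(* Suppose that $\Lambda_1+\cdots+\Lambda_n=2$. Then the universal hypergeometric function $u$ is a projective solution of the qKZB heat equation $$u(\vec z,\tau,p,\eta)=C\,T(\vec z,\tau,p,\eta)\otimes D_0\;u(\vec z,\tau+p,p,\eta),\qquad C=-\frac{e^{4\pi i\eta}}{2\pi\sqrt{4i\eta}},$$ where $T$ acts on the first dynamical variable $\lambda$ (and first tensor factor) and $D_0$ is multiplication by $e^{-\pi i\mu^2/4\eta}$ in the second dynamical variable $\mu$. Explicitly, for all $a,b\in\{1,\dots,n\}$, $$u_{a,b}(\vec z,\lambda,\nu,\tau,p,\eta)=C\,e^{-\frac{i\pi}{4\eta}(\lambda^2+\nu^2)}\int_{\eta\mathbb R+\tilde\sigma}\sum_{c=1}^n u_{a,c}(\vec z,\lambda,\mu,\tau,\tau+p,\eta)\,Q_c(\mu,\tau+p,\eta)\,e^{-\frac{i\pi\mu^2}{4\eta}}\,u_{c,b}(\vec z,-\mu,\nu,\tau+p,p,\eta)\,d\mu .$$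
   Context: Fix $n\ge1$, $\Lambda_1,\dots,\Lambda_n\in\mathbb C$ with $\sum_j\Lambda_j=2$, $\vec z=(z_1,\dots,z_n)\in\mathbb C^n$, $\tau,p\in\mathbb C$ with positive imaginary parts, and $\eta\in\mathbb C$ with $\mathrm{Im}\,\eta<0$; parameters are generic, so that all objects below are defined. The square root $\sqrt{4i\eta}$ is the one in the right half plane. The line $\eta\mathbb R+\tilde\sigma$ is the path $x\mapsto \eta x+\tilde\sigma$, $x$ from $-\infty$ to $\infty$, with $\tilde\sigma$ a generic real number. Theta function: $\theta(x,\tau)=-\sum_{j\in\mathbb Z}e^{i\pi\tau(j+1/2)^2+2\pi i(j+1/2)(x+1/2)}$; $\theta'$ is the derivative in the first argument. Phase function: $$\Omega_a(x,\tau,p)=\prod_{j,k=0}^\infty\frac{(1-e^{2\pi i(x-a+j\tau+kp)})(1-e^{2\pi i(-x-a+(j+1)\tau+(k+1)p)})}{(1-e^{2\pi i(x+a+j\tau+kp)})(1-e^{2\pi i(-x+a+(j+1)\tau+(k+1)p)})}.$$ Weight functions ($a,b=1,\dots,n$): $$\omega_a(t,\vec z,\lambda,\tau,\eta)=\frac{\theta(\lambda+2\eta+t-z_a-\eta\Lambda_a-2\eta\sum_{j<a}\Lambda_j,\tau)}{\theta(t-z_a-\eta\Lambda_a,\tau)}\prod_{j=1}^{a-1}\frac{\theta(t-z_j+\eta\Lambda_j,\tau)}{\theta(t-z_j-\eta\Lambda_j,\tau)},$$ $$\omega^\vee_b(t,\vec z,\mu,p,\eta)=\frac{\theta(\mu+2\eta+t-z_b-\eta\Lambda_b-2\eta\sum_{j>b}\Lambda_j,p)}{\theta(t-z_b-\eta\Lambda_b,p)}\prod_{j=b+1}^{n}\frac{\theta(t-z_j+\eta\Lambda_j,p)}{\theta(t-z_j-\eta\Lambda_j,p)}.$$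 The universal hypergeometric function $u=\sum_{a,b}u_{a,b}\,\epsilon_a\otimes\epsilon_b$, with values in $V\otimes V$ where $V$ has basis $\epsilon_1,\dots,\epsilon_n$, has components $$u_{a,b}(\vec z,\lambda,\mu,\tau,p,\eta)=e^{-\frac{i\pi\lambda\mu}{2\eta}}\int_\gamma\prod_{j=1}^n\Omega_{\eta\Lambda_j}(t-z_j,\tau,p)\,\omega_a(t,\vec z,\lambda,\tau,\eta)\,\omega_b^\vee(t,\vec z,\mu,p,\eta)\,dt .$$ The integrand is 1-periodic in $t$. If (for general complex $\Lambda_j$) the $z_j$ are real and $\mathrm{Im}(\eta\Lambda_j)>0$, then $\gamma=[0,1]$; in general the integral is the analytic continuation from that region: $\gamma$ is a path from some $t_0$ to $t_0+1$, defining a closed curve in $\mathbb C/\mathbb Z$ which passes above the poles $z_j-\eta\Lambda_j-k\tau-lp$ and below the poles $z_j+\eta\Lambda_j+k\tau+lp$ ($k,l\in\mathbb Z_{\ge0}$, modulo $\mathbb Z$). Shapovalov form: $$Q_a(\lambda,\tau,\eta)=\frac{\theta(2\eta\Lambda_a,\tau)\theta'(0,\tau)}{\theta(\lambda-2\eta+2\eta\sum_{j<a}\Lambda_j,\tau)\,\theta(\lambda-2\eta+2\eta\sum_{j\le a}\Lambda_j,\tau)} .$$ The heat operator $T$ acts on $V$-valued functions $v(\lambda)=\sum_a v_a(\lambda)\epsilon_a$ by $$(T(\vec z,\tau,p,\eta)v)_a(\lambda)=e^{-\frac{\pi i\lambda^2}{4\eta}}\int_{\eta\mathbb R+\tilde\sigma}\sum_{c}u_{a,c}(\vec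 z,\lambda,\mu,\tau,\tau+p,\eta)\,Q_c(\mu,\tau+p,\eta)\,v_c(-\mu)\,e^{-\frac{\pi i\mu^2}{4\eta}}d\mu .$$ $u(\vec z,\tau,p,\eta)$ denotes $u$ viewed as a function with values in functions of $(\lambda,\mu)$. *)

(* Defs.v *)
(* Families indexed by 1, ..., n are functions on nat whose values outside this
   range are never used; [sum_n_m f m k] and [Cprod f m k] run over
   m <= j <= k and are empty when k < m. *)
From Stdlib Require Import Reals ZArith Arith.
From Coquelicot Require Import Coquelicot.

Open Scope C_scope.

Definition Cexp (z : C) : C :=
  (exp (Re z) * cos (Im z), exp (Re z) * sin (Im z))%R.

Definition Cprod (f : nat -> C) (m k : nat) : C :=
  Iter.iter_nat Cmult (RtoC 1) f m k.

Definition Cseries (f : nat -> C) : C :=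
  iota (T := C_R_CompleteNormedModule)
    (fun l => is_series (V := C_R_NormedModule) f l).

Definition Cseries_Z (f : Z -> C) : C :=
  Cseries (fun j => f (Z.of_nat j))
  + Cseries (fun j => f (- Z.of_nat (S j))%Z).

Definition theta (x tau : C) : C :=
  - Cseries_Z (fun j =>
      let h : C := RtoC (IZR j + 1 / 2)%R in
      Cexp (Ci * PI * tau * (h * h) + 2 * PI * Ci * h * (x + 1 / 2))).

Definition dtheta (x tau : C) : C := C_derive (fun y => theta y tau) x.

Definition e2pi (x : C) : C := Cexp (2 * PI * Ci * x).

Definition Omega_factor (a x tau p : C) (j k : nat) : C :=
  ((1 - e2pi (x - a + INR j * tau + INR k * p))
   * (1 - e2pi (- x - a + INR (S j) * tau + INR (S k) * p)))
  / ((1 - e2pi (x + a + INR j * tau + INR k * p))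
     * (1 - e2pi (- x + a + INR (S j) * tau + INR (S k) * p))).

(* The double product converges absolutely, so it is the limit of its partial
   products over the squares 0 <= j, k <= N. *)
Definition Omega (a x tau p : C) : C :=
  iota (T := C_R_CompleteNormedModule)
    (fun l => filterlim
       (fun N : nat =>
          Cprod (fun j => Cprod (fun k => Omega_factor a x tau p j k) 0 N) 0 N)
       eventually (locally (T := C_UniformSpace) l)).

Definition omega (Lam : nat -> C) (a : nat) (t : C) (z : nat -> C)
    (lam tau eta : C) : C :=
  theta (lam + 2 * eta + t - z a - eta * Lam a
         - 2 * eta * sum_n_m Lam 1 (a - 1)) tau
  / theta (t - z a - eta * Lam a) tau
  * Cprod (fun j => theta (t - z j + eta * Lam j) tau
                    / theta (t - z j - eta * Lam j) tau) 1 (a - 1).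

Definition omega_dual (n : nat) (Lam : nat -> C) (b : nat) (t : C)
    (z : nat -> C) (mu p eta : C) : C :=
  theta (mu + 2 * eta + t - z b - eta * Lam b
         - 2 * eta * sum_n_m Lam (b + 1) n) p
  / theta (t - z b - eta * Lam b) p
  * Cprod (fun j => theta (t - z j + eta * Lam j) p
                    / theta (t - z j - eta * Lam j) p) (b + 1) n.

Definition u_integrand (n : nat) (Lam : nat -> C) (a b : nat) (z : nat -> C)
    (lam mu tau p eta t : C) : C :=
  Cprod (fun j => Omega (eta * Lam j) (t - z j) tau p) 1 n
  * omega Lam a t z lam tau eta * omega_dual n Lam b t z mu p eta.

Definition upper_pole (n : nat) (Lam z : nat -> C) (tau p eta w : C) : Prop :=
  exists j k l : nat, (1 <= j <= n)%nat /\
    w = z j + eta * Lam j + INR k * tau + INR l * p.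

Definition lower_pole (n : nat) (Lam z : nat -> C) (tau p eta w : C) : Prop :=
  exists j k l : nat, (1 <= j <= n)%nat /\
    w = z j - eta * Lam j - INR k * tau - INR l * p.

(* A C^1 path g on [0,1] with velocity dg, from t0 = g 0 to t0 + 1. *)
Definition period_path (g dg : R -> C) : Prop :=
  (forall s : R, is_derive (K := R_AbsRing) (V := C_R_NormedModule) g s (dg s))
  /\ (forall s : R, continuous (U := C_UniformSpace) dg s)
  /\ g 1%R = g 0%R + 1.

(* [joined_to g w e]: modulo Z, the complement of the path contains a
   continuous curve from w to the end Im = e (e = -oo or +oo) of C / Z. *)
Definition joined_to (g : R -> C) (w : C) (e : Rbar) : Prop :=
  exists c : R -> C,
    (forall s : R, continuous (U := C_UniformSpace) c s)
    /\ c 0%R = w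
    /\ is_lim (fun s => Im (c s)) p_infty e
    /\ (forall (s r : R) (m : Z), (0 <= s)%R -> (0 <= r <= 1)%R ->
          c s <> g r + IZR m).

Definition passes_above (g : R -> C) (w : C) : Prop := joined_to g w m_infty.

Definition passes_below (g : R -> C) (w : C) : Prop := joined_to g w p_infty.

Definition contour (n : nat) (Lam z : nat -> C) (tau p eta : C)
    (g dg : R -> C) : Prop :=
  period_path g dg
  /\ (forall w, lower_pole n Lam z tau p eta w -> passes_above g w)
  /\ (forall w, upper_pole n Lam z tau p eta w -> passes_below g w).

(* The common value of the integrals over all admissible contours; [iota]
   picks the unique element of a predicate. *)
Definition u_integral (n : nat) (Lam : nat -> C) (a b : nat) (z : nat -> C)
    (lam mu tau p eta : C) : C :=
  iota (T := C_R_CompleteNormedModule) (fun I : C =>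
    exists g dg : R -> C, contour n Lam z tau p eta g dg
      /\ is_RInt (V := C_R_NormedModule)
           (fun s : R =>
              u_integrand n Lam a b z lam mu tau p eta (g s) * dg s)
           0 1 I).

Definition u (n : nat) (Lam : nat -> C) (a b : nat) (z : nat -> C)
    (lam mu tau p eta : C) : C :=
  Cexp (- (Ci * PI * lam * mu / (2 * eta)))
  * u_integral n Lam a b z lam mu tau p eta.

Definition Q (Lam : nat -> C) (a : nat) (lam tau eta : C) : C :=
  theta (2 * eta * Lam a) tau * dtheta 0 tau
  / (theta (lam - 2 * eta + 2 * eta * sum_n_m Lam 1 (a - 1)) tau
     * theta (lam - 2 * eta + 2 * eta * sum_n_m Lam 1 a) tau).

Definition Q_defined (Lam : nat -> C) (a : nat) (lam tau eta : C) : Prop :=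
  theta (lam - 2 * eta + 2 * eta * sum_n_m Lam 1 (a - 1)) tau <> 0
  /\ theta (lam - 2 * eta + 2 * eta * sum_n_m Lam 1 a) tau <> 0.

Definition line (eta : C) (sigma x : R) : C := eta * x + sigma.

Definition ex_line_integral (eta : C) (sigma : R) (F : C -> C) : Prop :=
  ex_RInt_gen (V := C_R_NormedModule) (fun x : R => F (line eta sigma x) * eta)
    (Rbar_locally m_infty) (Rbar_locally p_infty).

Definition line_integral (eta : C) (sigma : R) (F : C -> C) : C :=
  RInt_gen (V := C_R_CompleteNormedModule)
    (fun x : R => F (line eta sigma x) * eta)
    (Rbar_locally m_infty) (Rbar_locally p_infty).

Definition gauss (eta mu : C) : C := Cexp (- (PI * Ci * (mu * mu) / (4 * eta))).

Definition heat_T (n : nat) (Lam z : nat -> C) (tau p eta : C) (sigma : R)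
    (v : nat -> C -> C) (a : nat) (lam : C) : C :=
  gauss eta lam
  * line_integral eta sigma (fun mu =>
      sum_n_m (fun c => u n Lam a c z lam mu tau (tau + p) eta
                        * Q Lam c mu (tau + p) eta * v c (- mu)) 1 n
      * gauss eta mu).

Definition heat_D0 (eta : C) (f : C -> C) (mu : C) : C := gauss eta mu * f mu.

(* T acts on the first index and first variable of w, D_0 on the second
   variable. *)
Definition heat_T_D0 (n : nat) (Lam z : nat -> C) (tau p eta : C) (sigma : R)
    (w : nat -> nat -> C -> C -> C) (a b : nat) (lam mu : C) : C :=
  heat_T n Lam z tau p eta sigma
    (fun c lam' => heat_D0 eta (w c b lam') mu) a lam.

(* s stands for the square root of 4 i eta. *)
Definition heat_const (eta s : C) : C :=
  - (Cexp (4 * PI * Ci * eta) / (2 * PI * s)).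

(* No point is required to lie both above and below the contour; this is what
   is needed for the integrals defining u at (tau, p), (tau, tau + p) and
   (tau + p, p) to make sense. *)
Definition nonresonant (n : nat) (Lam z : nat -> C) (tau p eta : C) : Prop :=
  forall (w w' : C) (m : Z),
    upper_pole n Lam z tau p eta w -> lower_pole n Lam z tau p eta w' ->
    w <> w' + IZR m.

Definition null_set (E : R -> Prop) : Prop :=
  forall eps : R, (0 < eps)%R ->
    exists l r : nat -> R,
      (forall k, (l k <= r k)%R)
      /\ (forall x, E x -> exists k, (l k <= x <= r k)%R)
      /\ (forall N, (sum_n (fun k => (r k - l k)%R) N <= eps)%R).

(* The reading of "generic" for the shift sigma of the line of integration.
   The poles of Q come from the lattice Z + Z (tau + p), so their projections
   along eta are in general dense in R, and avoiding them does not suffice: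
   for sigma approximated very fast by these projections the improper
   integral diverges. Such sigma form a null set. *)
Definition almost_every (P : R -> Prop) : Prop := null_set (fun x => ~ P x).

(* Main.v *)
(* Put T = tau + p. The three-term relation Omega_a(x, tau, T) Omega_a(x + p, T, p) = Omega_a(x, tau, p) splits the
   integrand of u, and the theta three-term relation makes the sum over c of the products of weight functions with Q_c
   telescope. What remains at each end is a double integral D(m), over t and t', of a function of t, a function of t'
   and the kernel k_m(t - t') = theta'(0) theta(t - t' + m) / (theta(t - t') theta(m)) at m = mu - 2 eta and at
   m = mu + 2 eta, once t is translated by tau and t' by p. The translation carries the contours across t = t', and
   the residue there is u(tau, p). Completing squares, the integrand of the heat operator becomes
   F(mu - 2 eta) - F(mu + 2 eta) plus u(tau, p) times a Gaussian in mu; the difference integrates to zero along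
   eta R + sigma, because F has Gaussian decay, and the Gaussian integral gives C.

   No position of the z_j is assumed, so the contours have to be constructed, and the independence of D(m) of their
   choice is proved by approximating the integrand by rational functions of e(t) and translating poles to infinity. *)
Require Import Defs.
From Stdlib Require Import Reals ZArith Arith Lra Lia Psatz Cantor.
From Coquelicot Require Import Coquelicot.
From Stdlib Require Import List Permutation.
From Stdlib Require Import Classical FunctionalExtensionality ClassicalEpsilon.

Infix "<=" := Rle (only parsing) : C_scope.
Infix "<" := Rlt (only parsing) : C_scope.

Open Scope C_scope.

(** [u_integral] is the value common to all admissible contours, including those through removable
    singularities, where division by zero gives arbitrary values to the integrand. Hence the cleaned
    integrand [u_clean], in which zeros of [Omega] cancel poles of the weights, and the comparison
    of Riemann integrals whose integrands agree on a dense set. The two contours of D(m) interact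
    through the kernel, so deforming them one at a time is not enough. The difference between two
    choices is regarded as a functional of the factor in t alone: crossing t = t' creates the same
    single integrals for both choices, so translation by T only multiplies this functional by a
    constant. The sum of the Lambda_j being 2 places the ends of the telescope at mu - 2 eta and mu
    + 2 eta. Since 2 eta is a real multiple of the direction of the line, both ends are values of
    one function on one line. What remains is a small divisor problem: sigma keeps a distance d /
    ((j+1)(j+2)) from the j-th projected pole, so 1/theta grows at most like the exponential of a
    linear function and the Gaussian dominates. *)

Lemma C_ext (x y : C) : Re x = Re y -> Im x = Im y -> x = y.
Proof. destruct x, y; simpl; intros; subst; reflexivity. Qed.

Ltac csimp := repeat (rewrite RtoC_plus || rewrite RtoC_mult || rewrite RtoC_opp || rewrite RtoC_minus).

Ltac C_eq := apply C_ext; unfold Re, Im; simpl; ring.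

(* [recast B] replaces the first subterm that [ring] proves equal to [B]. *)
Ltac recast_by B t :=
 match goal with |- context [?A] => tryif constr_eq A B then fail else replace A with B by t end.

Ltac recast_in_by B H t :=
 match type of H with context [?A] => tryif constr_eq A B then fail else replace A with B in H by t end.

Ltac recast_all_by B t :=
 match goal with
 | |- context [?A] => tryif constr_eq A B then fail else replace A with B in * by t
 | H : context [?A] |- _ => tryif constr_eq A B then fail else replace A with B in * by t
 end.

Tactic Notation "recast" uconstr(B) := let B := constr:(B) in recast_by B ltac:(ring).

Tactic Notation "recast" uconstr(B) "by" tactic3(t) := let B := constr:(B) in recast_by B t.

Tactic Notation "recast" uconstr(B) "in" hyp(H) := let B := constr:(B) in recast_in_by B H ltac:(ring).

Tactic Notation "recast" uconstr(B) "in" hyp(H) "by" tactic3(t) := let B := constr:(B) in recast_in_by B H t.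

Tactic Notation "recast" uconstr(B) "in" "*" := let B := constr:(B) in recast_all_by B ltac:(ring).

Tactic Notation "recast" uconstr(B) "in" "*" "by" tactic3(t) := let B := constr:(B) in recast_all_by B t.

Lemma Re_plus x y : Re (x + y) = (Re x + Re y)%R. Proof. reflexivity. Qed.

Lemma Im_plus x y : Im (x + y) = (Im x + Im y)%R. Proof. reflexivity. Qed.

Lemma Re_opp x : Re (- x) = (- Re x)%R. Proof. reflexivity. Qed.

Lemma Im_opp x : Im (- x) = (- Im x)%R. Proof. reflexivity. Qed.

Lemma Re_minus x y : Re (x - y) = (Re x - Re y)%R. Proof. reflexivity. Qed.

Lemma Im_minus x y : Im (x - y) = (Im x - Im y)%R. Proof. reflexivity. Qed.

Lemma Re_mult x y : Re (x * y) = (Re x * Re y - Im x * Im y)%R. Proof. reflexivity. Qed.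

Lemma Im_mult x y : Im (x * y) = (Re x * Im y + Im x * Re y)%R. Proof. reflexivity. Qed.

Lemma Re_RtoC (x : R) : Re x = x. Proof. reflexivity. Qed.

Lemma Im_RtoC (x : R) : Im x = 0%R. Proof. reflexivity. Qed.

(** * The exponential function and its period *)

Lemma Cexp_plus z w : Cexp (z + w) = Cexp z * Cexp w.
Proof. unfold Cexp. rewrite Re_plus, Im_plus, exp_plus, cos_plus, sin_plus. C_eq. Qed.

Lemma Cexp_0 : Cexp 0 = 1.
Proof. unfold Cexp; simpl. rewrite exp_0, cos_0, sin_0. C_eq. Qed.

Lemma Cexp_real (x : R) : Cexp x = exp x.
Proof. unfold Cexp; simpl. rewrite cos_0, sin_0. C_eq. Qed.

Lemma Cmod_Cexp z : Cmod (Cexp z) = exp (Re z).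
Proof.
 unfold Cmod, Cexp; simpl.
 replace (_ + _)%R with (exp (Re z) * exp (Re z) * (Rsqr (sin (Im z)) + Rsqr (cos (Im z))))%R
  by (unfold Rsqr; ring).
 rewrite sin2_cos2, Rmult_1_r. apply sqrt_square. left; apply exp_pos.
Qed.

Lemma Cexp_neq_0 z : Cexp z <> 0.
Proof.
 intro H. apply (f_equal Cmod) in H. rewrite Cmod_Cexp, Cmod_0 in H.
 generalize (exp_pos (Re z)); lra.
Qed.

Lemma Cexp_opp z : Cexp (- z) = / Cexp z.
Proof.
 assert (H := Cexp_neq_0 z).
 assert (E : Cexp z * Cexp (- z) = 1).
 { rewrite <- Cexp_plus. replace (z + - z) with (RtoC 0) by ring. apply Cexp_0. }
 rewrite <- (Cmult_1_l (Cexp (- z))), <- (Cinv_l _ H), <- Cmult_assoc, E. ring.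
Qed.

Lemma e2pi_plus x y : e2pi (x + y) = e2pi x * e2pi y.
Proof. unfold e2pi. rewrite <- Cexp_plus. f_equal; ring. Qed.

Lemma e2pi_0 : e2pi 0 = 1.
Proof. unfold e2pi. rewrite Cmult_0_r. apply Cexp_0. Qed.

Lemma e2pi_opp x : e2pi (- x) = / e2pi x.
Proof. unfold e2pi. rewrite <- Cexp_opp. f_equal; ring. Qed.

Lemma e2pi_minus x y : e2pi (x - y) = e2pi x / e2pi y.
Proof. unfold Cminus, Cdiv. now rewrite e2pi_plus, e2pi_opp. Qed.

Lemma e2pi_neq_0 x : e2pi x <> 0.
Proof. apply Cexp_neq_0. Qed.

Lemma Cmod_e2pi x : Cmod (e2pi x) = exp (- (2 * PI * Im x)).
Proof. unfold e2pi. rewrite Cmod_Cexp. f_equal. unfold Re, Im. simpl. ring. Qed.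

Lemma cos_sin_period_Z (m : Z) :
 cos (2 * PI * IZR m) = 1%R /\ sin (2 * PI * IZR m) = 0%R.
Proof.
 assert (H : forall n : nat, cos (2 * PI * INR n) = 1%R /\ sin (2 * PI * INR n) = 0%R).
 { intro n. replace (2 * PI * INR n)%R with (0 + 2 * INR n * PI)%R by ring.
  rewrite cos_period, sin_period, cos_0, sin_0. auto. }
 destruct (Z_le_dec 0 m) as [h | h].
 - rewrite <- (Z2Nat.id m h), <- INR_IZR_INZ. apply H.
 - replace m with (- Z.of_nat (Z.to_nat (- m)))%Z by lia.
  rewrite opp_IZR, <- INR_IZR_INZ.
  replace (2 * PI * - INR (Z.to_nat (- m)))%R with (- (2 * PI * INR (Z.to_nat (- m))))%R by ring.
  rewrite cos_neg, sin_neg. destruct (H (Z.to_nat (- m))) as [-> ->]. split; ring.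
Qed.

Lemma e2pi_IZR (m : Z) : e2pi (IZR m) = 1.
Proof.
 unfold e2pi, Cexp. simpl.
 destruct (cos_sin_period_Z m) as [Hc Hs].
 replace (_ - _)%R with 0%R by ring.
 match goal with |- context [cos ?x] => replace x with (2 * PI * IZR m)%R by ring end.
 rewrite Hc, Hs, exp_0. C_eq.
Qed.

Lemma e2pi_1 : e2pi 1 = 1.
Proof. exact (e2pi_IZR 1). Qed.

Lemma e2pi_plus_IZR x (m : Z) : e2pi (x + IZR m) = e2pi x.
Proof. rewrite e2pi_plus, e2pi_IZR. ring. Qed.

(** Taking moduli forces Im x0 = 0. The real part then says cos(2a) = 1 with a = pi x0, which
    [cos_2a_sin] turns into sin a = 0. *)
Lemma e2pi_eq_1 x0 : e2pi x0 = 1 -> exists m : Z, x0 = IZR m.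
Proof.
 intro H.
 assert (HI : Im x0 = 0%R).
 { assert (E := f_equal Cmod H). rewrite Cmod_e2pi, Cmod_1 in E.
  rewrite <- exp_0 in E. apply exp_inv in E. generalize PI_RGT_0; nra. }
 unfold e2pi, Cexp in H. apply (f_equal Re) in H. unfold Re, Im in *. simpl in H.
 rewrite HI in H.
 replace (_ - _)%R with 0%R in H by ring. rewrite exp_0 in H.
 match type of H with context [cos ?x] => replace x with (2 * (PI * fst x0))%R in H by ring end.
 rewrite cos_2a_sin in H.
 assert (Hs : sin (PI * fst x0) = 0%R) by nra.
 apply sin_eq_0_0 in Hs. destruct Hs as [k Hk].
 exists k. apply C_ext; unfold Re, Im; simpl; [| exact HI].
 apply (Rmult_eq_reg_l PI); [lra | apply PI_neq0].
Qed.

Lemma Cmod_triang_inv x y : Cmod x - Cmod y <= Cmod (x - y).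
Proof. generalize (Cmod_triangle (x - y) y). replace (x - y + y) with x by ring. lra. Qed.

Lemma Cmod_minus_sym x y : Cmod (x - y) = Cmod (y - x).
Proof. rewrite <- Cmod_opp. f_equal; ring. Qed.

Lemma Cmod_Re x : Rabs (Re x) <= Cmod x.
Proof. eapply Rle_trans; [apply Rmax_l | apply Rmax_Cmod]. Qed.

Lemma Cmod_Im x : Rabs (Im x) <= Cmod x.
Proof. eapply Rle_trans; [apply Rmax_r | apply Rmax_Cmod]. Qed.

Lemma Cmod_le_Re_Im x : Cmod x <= Rabs (Re x) + Rabs (Im x).
Proof.
 replace x with (RtoC (Re x) + Ci * RtoC (Im x)) at 1 by C_eq.
 eapply Rle_trans; [apply Cmod_triangle |].
 rewrite Cmod_mult, Cmod_Ci, !Cmod_R. lra.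
Qed.

Lemma exp_minus_1_le (x : R) : Rabs (exp x - 1) <= Rabs x * exp (Rabs x).
Proof.
 destruct (Rle_dec 0 x) as [h | h].
 - rewrite (Rabs_pos_eq x) by lra.
  assert (h1 := exp_ineq1_le x). assert (h2 := exp_ineq1_le (- x)).
  rewrite Rabs_pos_eq by lra.
  assert (E : (exp x * exp (- x) = 1)%R) by (rewrite <- exp_plus, Rplus_opp_r; apply exp_0).
  nra.
 - rewrite (Rabs_left x) by lra.
  assert (h1 := exp_ineq1_le x).
  assert (h2 : exp x < 1) by (rewrite <- exp_0; apply exp_increasing; lra).
  assert (h4 : 1 < exp (- x)) by (rewrite <- exp_0; apply exp_increasing; lra).
  rewrite Rabs_left by lra. nra.
Qed.

Lemma exp_le (x y : R) : x <= y -> exp x <= exp y.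
Proof. intros [h | ->]; [left; now apply exp_increasing | lra]. Qed.

(** * Continuity and derivatives of complex-valued functions *)

Notation ccont f x := (continuous (U := C_UniformSpace) f x).

Notation cderive f x l := (is_derive (K := R_AbsRing) (V := C_R_NormedModule) f x (l : C)).

Lemma ccont_eps {T : UniformSpace} (f : T -> C) (x : T) :
 ccont f x <-> forall eps : R, 0 < eps -> locally x (fun y => (Cmod (f y - f x) < eps)%R).
Proof.
 split.
 - intros H eps he.
  (* A ball of [C_UniformSpace] is a square, so returning to [Cmod] costs a factor sqrt 2; [eps / 2]
     leaves room for it. *)
  assert (he2 : 0 < eps / 2) by lra.
  assert (L := H (fun y => ball (M := C_UniformSpace) (f x) (mkposreal _ he2) y) (locally_ball _ _)).
  unfold filtermap in L. revert L. apply filter_imp. intros y hy.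
  apply C_NormedModule_mixin_compat2 in hy. simpl in hy.
  change (minus (f y) (f x)) with (f y - f x) in hy.
  assert (sqrt 2 <= 2)%R. { rewrite <- (sqrt_square 2) at 2 by lra. apply sqrt_le_1; lra. }
  nra.
 - intros H P [eps hP]. unfold filtermap.
  assert (L := H eps (cond_pos eps)). revert L. apply filter_imp. intros y hy.
  apply hP. apply C_NormedModule_mixin_compat1. exact hy.
Qed.

Lemma ccont_Re {T : UniformSpace} (f : T -> C) (x : T) :
 ccont f x -> continuous (U := R_UniformSpace) (fun t => Re (f t)) x.
Proof.
 intro H. apply (continuous_comp (V := C_UniformSpace) f (fun z => Re z)); [exact H |].
 destruct (f x) as [u v]. apply (continuous_fst (U := R_UniformSpace) (V := R_UniformSpace)).
Qed.

Lemma ccont_Im {T : UniformSpace} (f : T -> C) (x : T) :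
 ccont f x -> continuous (U := R_UniformSpace) (fun t => Im (f t)) x.
Proof.
 intro H. apply (continuous_comp (V := C_UniformSpace) f (fun z => Im z)); [exact H |].
 destruct (f x) as [u v]. apply (continuous_snd (U := R_UniformSpace) (V := R_UniformSpace)).
Qed.

Lemma ccont_pair {T : UniformSpace} (f g : T -> R) (x : T) :
 continuous f x -> continuous g x -> ccont (fun t => (f t, g t) : C) x.
Proof.
 intros Hf Hg P [eps HP]. unfold filtermap.
 assert (H1 := Hf _ (locally_ball (f x) eps)).
 assert (H2 := Hg _ (locally_ball (g x) eps)).
 unfold filtermap in H1, H2.
 generalize (filter_and _ _ H1 H2). apply filter_imp. auto.
Qed.

Lemma ccont_ext {T : UniformSpace} (f g : T -> C) (x : T) :
 (forall t, f t = g t) -> ccont f x -> ccont g x.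
Proof. intro H. apply continuous_ext. exact H. Qed.

Lemma ccont_const {T : UniformSpace} (c : C) (x : T) : ccont (fun _ : T => c) x.
Proof. apply continuous_const. Qed.

Lemma ccont_plus {T : UniformSpace} (f g : T -> C) (x : T) :
 ccont f x -> ccont g x -> ccont (fun t => f t + g t) x.
Proof. apply (continuous_plus (V := C_R_NormedModule)). Qed.

Lemma ccont_opp {T : UniformSpace} (f : T -> C) (x : T) : ccont f x -> ccont (fun t => - f t) x.
Proof. apply (continuous_opp (V := C_R_NormedModule)). Qed.

Lemma ccont_minus {T : UniformSpace} (f g : T -> C) (x : T) :
 ccont f x -> ccont g x -> ccont (fun t => f t - g t) x.
Proof. apply (continuous_minus (V := C_R_NormedModule)). Qed.

Ltac rcont := repeat (try assumption; lazymatch goal with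
 | |- continuous (fun t => (_ + _)%R) _ => apply (continuous_plus (V := R_NormedModule))
 | |- continuous (fun t => (_ - _)%R) _ => apply (continuous_minus (V := R_NormedModule))
 | |- continuous (fun t => (- _)%R) _ => apply (continuous_opp (V := R_NormedModule))
 | |- continuous (fun t => (_ * _)%R) _ => apply (continuous_mult (K := R_AbsRing))
 | |- continuous (fun t => Re _) _ => apply ccont_Re
 | |- continuous (fun t => Im _) _ => apply ccont_Im
 | |- continuous (fun t => 1%R) _ => apply continuous_const
 end).

Lemma ccont_mult {T : UniformSpace} (f g : T -> C) (x : T) :
 ccont f x -> ccont g x -> ccont (fun t => f t * g t) x.
Proof.
 intros Hf Hg.
 apply (ccont_pair (fun t => Re (f t) * Re (g t) - Im (f t) * Im (g t))%R
          (fun t => Re (f t) * Im (g t) + Im (f t) * Re (g t))%R); rcont.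
Qed.

Lemma ccont_inv {T : UniformSpace} (f : T -> C) (x : T) :
 ccont f x -> f x <> 0 -> ccont (fun t => / f t) x.
Proof.
 intros Hf Hz.
 assert (n : continuous (U := R_UniformSpace) (fun t => / (Re (f t) ^ 2 + Im (f t) ^ 2))%R x).
 { apply (continuous_comp (V := R_UniformSpace) (fun t => (Re (f t) ^ 2 + Im (f t) ^ 2)%R) Rinv); [simpl; rcont |].
  apply continuous_Rinv. intro E. apply Hz. apply C_ext; unfold Re, Im in *; simpl in *; nra. }
 apply (ccont_pair (fun t => Re (f t) * / (Re (f t) ^ 2 + Im (f t) ^ 2))%R
          (fun t => - Im (f t) * / (Re (f t) ^ 2 + Im (f t) ^ 2))%R); rcont.
Qed.

Lemma ccont_div {T : UniformSpace} (f g : T -> C) (x : T) :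
 ccont f x -> ccont g x -> g x <> 0 -> ccont (fun t => f t / g t) x.
Proof. intros. apply ccont_mult; [assumption | now apply ccont_inv]. Qed.

Lemma ccont_comp {T : UniformSpace} (f : T -> C) (g : C -> C) (x : T) :
 ccont f x -> continuous (T := C_UniformSpace) (U := C_UniformSpace) g (f x) ->
 ccont (fun t => g (f t)) x.
Proof. intros. now apply (continuous_comp (V := C_UniformSpace)). Qed.

Lemma ccont_id (x : C) : continuous (T := C_UniformSpace) (U := C_UniformSpace) (fun t => t) x.
Proof. apply continuous_id. Qed.

Lemma ccont_RtoC {T : UniformSpace} (f : T -> R) (x : T) :
 continuous f x -> ccont (fun t => RtoC (f t)) x.
Proof. intro. apply ccont_pair; [assumption | apply continuous_const]. Qed.

Lemma ccont_Cexp {T : UniformSpace} (f : T -> C) (x : T) :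
 ccont f x -> ccont (fun t => Cexp (f t)) x.
Proof.
 intros Hf. assert (a := ccont_Re _ _ Hf). assert (b := ccont_Im _ _ Hf).
 apply (ccont_pair (fun t => exp (Re (f t)) * cos (Im (f t)))%R
          (fun t => exp (Re (f t)) * sin (Im (f t)))%R); rcont.
 - now apply (continuous_comp (V := R_UniformSpace) (fun t => Re (f t)) exp), continuous_exp.
 - now apply (continuous_comp (V := R_UniformSpace) (fun t => Im (f t)) cos), continuous_cos.
 - now apply (continuous_comp (V := R_UniformSpace) (fun t => Re (f t)) exp), continuous_exp.
 - now apply (continuous_comp (V := R_UniformSpace) (fun t => Im (f t)) sin), continuous_sin.
Qed.

Lemma ccont_e2pi {T : UniformSpace} (f : T -> C) (x : T) :
 ccont f x -> ccont (fun t => e2pi (f t)) x.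
Proof. intro. apply ccont_Cexp, ccont_mult; [apply ccont_const | assumption]. Qed.

Create HintDb cc.

#[export] Hint Resolve ccont_const ccont_id ccont_plus ccont_opp ccont_minus ccont_mult ccont_inv ccont_div
 ccont_RtoC ccont_Cexp ccont_e2pi continuous_id continuous_const : cc.

Ltac cc := intros; auto 20 with cc.

Lemma ccont_Cmod {T : UniformSpace} (f : T -> C) (x : T) :
 ccont f x -> continuous (U := R_UniformSpace) (fun t => Cmod (f t)) x.
Proof.
 intro H0. assert (H := proj1 (ccont_eps f x) H0).
 intros P [eps HP]. unfold filtermap. generalize (H eps (cond_pos eps)). apply filter_imp.
 intros y hy. apply HP. change (Rabs (Cmod (f y) - Cmod (f x)) < eps)%R.
 apply Rle_lt_trans with (2 := hy). apply Rabs_le. split.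
 - rewrite Cmod_minus_sym. generalize (Cmod_triang_inv (f x) (f y)). lra.
 - apply Cmod_triang_inv.
Qed.

(** The three-epsilon argument, with a separate approximant for each [eps]. Through it, integrands
    that are uniform limits of rational functions become continuous along paths. *)
Lemma ccont_unif {T : UniformSpace} (f : T -> C) (x : T) :
 (forall eps : R, 0 < eps -> exists g : T -> C,
   ccont g x /\ forall t, Cmod (f t - g t) < eps) -> ccont f x.
Proof.
 intro H. apply ccont_eps. intros eps he.
 destruct (H (eps / 3)%R) as [g [Hg Hd]]; [lra |].
 assert (Hg' := proj1 (ccont_eps g x) Hg).
 generalize (Hg' (eps / 3)%R ltac:(lra)). apply filter_imp. intros y hy.
 recast ((f y - g y) + ((g y - g x) + (g x - f x))).
 assert (h1 := Hd y). assert (h2 := Hd x). rewrite (Cmod_minus_sym (f x)) in h2.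
 eapply Rle_lt_trans; [apply Cmod_triangle |].
 generalize (Cmod_triangle (g y - g x) (g x - f x)). lra.
Qed.

Lemma cderive_pair (f g : R -> R) (x l m : R) :
 is_derive f x l -> is_derive g x m -> cderive (fun t => (f t, g t) : C) x ((l, m) : C).
Proof.
 intros Hf Hg.
 apply (is_derive_ext (fun t => plus (scal (f t) ((1%R, 0%R) : C_R_NormedModule))
                   (scal (g t) ((0%R, 1%R) : C_R_NormedModule)))).
 { intro t. apply C_ext; unfold Re, Im; simpl; unfold plus, scal, mult; simpl; unfold mult; simpl; ring. }
 replace ((l, m) : C) with (plus (scal l ((1%R, 0%R) : C_R_NormedModule))
                 (scal m ((0%R, 1%R) : C_R_NormedModule))).
 2: apply C_ext; unfold Re, Im; simpl; unfold plus, scal, mult; simpl; unfold mult; simpl; ring.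
 apply (is_derive_plus (K := R_AbsRing) (V := C_R_NormedModule)).
 - apply (is_derive_scal_l (K := R_AbsRing) (V := C_R_NormedModule)). assumption.
 - apply (is_derive_scal_l (K := R_AbsRing) (V := C_R_NormedModule)). assumption.
Qed.

Lemma cderive_Re (f : R -> C) (x : R) (l : C) :
 cderive f x l -> is_derive (fun t => Re (f t)) x (Re l).
Proof.
 intro H. unfold is_derive in *.
 apply (filterdiff_ext_lin _ (fun t => Re (scal (V := C_R_NormedModule) t l))).
 2: intro y; reflexivity.
 apply (filterdiff_comp' (V := C_R_NormedModule) f (fun z => fst z) x
      (fun t => scal (V := C_R_NormedModule) t l) (fun z => fst z) H).
 apply (filterdiff_linear (U := prod_NormedModule R_AbsRing R_NormedModule R_NormedModule)), is_linear_fst.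
Qed.

Lemma cderive_Im (f : R -> C) (x : R) (l : C) :
 cderive f x l -> is_derive (fun t => Im (f t)) x (Im l).
Proof.
 intro H. unfold is_derive in *.
 apply (filterdiff_ext_lin _ (fun t => Im (scal (V := C_R_NormedModule) t l))).
 2: intro y; reflexivity.
 apply (filterdiff_comp' (V := C_R_NormedModule) f (fun z => snd z) x
      (fun t => scal (V := C_R_NormedModule) t l) (fun z => snd z) H).
 apply (filterdiff_linear (U := prod_NormedModule R_AbsRing R_NormedModule R_NormedModule)), is_linear_snd.
Qed.

Lemma cderive_ext (f g : R -> C) (x : R) (l : C) :
 (forall t, f t = g t) -> cderive f x l -> cderive g x l.
Proof. intro H. apply is_derive_ext. exact H. Qed.

Lemma cderive_const (c : C) (x : R) : cderive (fun _ => c) x (RtoC 0).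
Proof. apply (is_derive_const (K := R_AbsRing) (V := C_R_NormedModule)). Qed.

Lemma cderive_plus (f g : R -> C) (x : R) (l m : C) :
 cderive f x l -> cderive g x m -> cderive (fun t => f t + g t) x (l + m).
Proof. apply (is_derive_plus (K := R_AbsRing) (V := C_R_NormedModule)). Qed.

Lemma cderive_minus (f g : R -> C) (x : R) (l m : C) :
 cderive f x l -> cderive g x m -> cderive (fun t => f t - g t) x (l - m).
Proof. apply (is_derive_minus (K := R_AbsRing) (V := C_R_NormedModule)). Qed.

Lemma cderive_mult (f g : R -> C) (x : R) (l m : C) :
 cderive f x l -> cderive g x m -> cderive (fun t => f t * g t) x (l * g x + f x * m).
Proof.
 intros Hf Hg.
 assert (a := cderive_Re _ _ _ Hf). assert (b := cderive_Im _ _ _ Hf).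
 assert (c := cderive_Re _ _ _ Hg). assert (d := cderive_Im _ _ _ Hg).
 replace (l * g x + f x * m) with
  ((Re l * Re (g x) + Re (f x) * Re m - (Im l * Im (g x) + Im (f x) * Im m),
   Re l * Im (g x) + Re (f x) * Im m + (Im l * Re (g x) + Im (f x) * Re m))%R : C) by C_eq.
 apply (cderive_pair (fun t => Re (f t) * Re (g t) - Im (f t) * Im (g t))%R
           (fun t => Re (f t) * Im (g t) + Im (f t) * Re (g t))%R).
 - apply (is_derive_minus (K := R_AbsRing) (V := R_NormedModule));
   apply (is_derive_mult (K := R_AbsRing)); try assumption; intros; apply Rmult_comm.
 - apply (is_derive_plus (K := R_AbsRing) (V := R_NormedModule));
   apply (is_derive_mult (K := R_AbsRing)); try assumption; intros; apply Rmult_comm.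
Qed.

Lemma cderive_scal (c : C) (f : R -> C) (x : R) (l : C) :
 cderive f x l -> cderive (fun t => c * f t) x (c * l).
Proof.
 intro H. recast (RtoC 0 * f x + c * l).
 apply (cderive_mult (fun _ => c)); [apply cderive_const | assumption].
Qed.

Lemma cderive_RtoC (f : R -> R) (x l : R) :
 is_derive f x l -> cderive (fun t => RtoC (f t)) x (RtoC l).
Proof. intro. apply cderive_pair; [assumption | apply (is_derive_const (K := R_AbsRing) (V := R_NormedModule))]. Qed.

Lemma cderive_id (x : R) : cderive (fun t => RtoC t) x (RtoC 1).
Proof. apply cderive_RtoC. apply (is_derive_id (K := R_AbsRing)). Qed.

Lemma cderive_Cexp (f : R -> C) (x : R) (l : C) :
 cderive f x l -> cderive (fun t => Cexp (f t)) x (l * Cexp (f x)).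
Proof.
 intro Hf.
 assert (a := cderive_Re _ _ _ Hf). assert (b := cderive_Im _ _ _ Hf).
 unfold Cexp.
 replace (l * _) with
  (((Re l * exp (Re (f x))) * cos (Im (f x)) + exp (Re (f x)) * (Im l * - sin (Im (f x))),
   (Re l * exp (Re (f x))) * sin (Im (f x)) + exp (Re (f x)) * (Im l * cos (Im (f x))))%R : C) by C_eq.
 assert (e : is_derive (fun t => exp (Re (f t))) x (Re l * exp (Re (f x)))%R).
 { apply (is_derive_comp (K := R_AbsRing) (V := R_NormedModule) exp); [apply is_derive_exp | assumption]. }
 assert (c : is_derive (fun t => cos (Im (f t))) x (Im l * - sin (Im (f x)))%R).
 { apply (is_derive_comp (K := R_AbsRing) (V := R_NormedModule) cos); [apply is_derive_cos | assumption]. }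
 assert (d : is_derive (fun t => sin (Im (f t))) x (Im l * cos (Im (f x)))%R).
 { apply (is_derive_comp (K := R_AbsRing) (V := R_NormedModule) sin); [apply is_derive_sin | assumption]. }
 apply cderive_pair.
 - apply (is_derive_mult (K := R_AbsRing) _ _ _ _ _ e c). intros; apply Rmult_comm.
 - apply (is_derive_mult (K := R_AbsRing) _ _ _ _ _ e d). intros; apply Rmult_comm.
Qed.

Lemma cderive_e2pi (f : R -> C) (x : R) (l : C) :
 cderive f x l -> cderive (fun t => e2pi (f t)) x (2 * PI * Ci * l * e2pi (f x)).
Proof. intro Hf. apply cderive_Cexp. now apply (cderive_scal (2 * PI * Ci)). Qed.

Lemma cderive_cont (f : R -> C) (x : R) (l : C) : cderive f x l -> ccont f x.
Proof. intro H. apply (ex_derive_continuous (K := R_AbsRing) (V := C_R_NormedModule)). now exists l. Qed.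

Lemma cderive_inv (f : R -> C) (x : R) (l : C) :
 cderive f x l -> f x <> 0 -> cderive (fun t => / f t) x (- l / (f x * f x)).
Proof.
 intros Hf Hz.
 assert (a := cderive_Re _ _ _ Hf). assert (b := cderive_Im _ _ _ Hf).
 assert (Hn : (Re (f x) ^ 2 + Im (f x) ^ 2)%R <> 0%R).
 { intro E. apply Hz. apply C_ext; unfold Re, Im in *; simpl in *; nra. }
 assert (n : is_derive (fun t => (Re (f t) ^ 2 + Im (f t) ^ 2)%R) x
        (2 * Re l * Re (f x) + 2 * Im l * Im (f x))%R).
 { recast (INR 2 * Re l * Re (f x) ^ pred 2 + INR 2 * Im l * Im (f x) ^ pred 2)%R by (simpl; ring).
  apply (is_derive_plus (K := R_AbsRing) (V := R_NormedModule)); now apply is_derive_pow. }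
 apply (is_derive_inv _ _ _ ) in n; [| assumption].
 replace (- l / (f x * f x)) with
  ((Re l * / (Re (f x) ^ 2 + Im (f x) ^ 2) +
   Re (f x) * (- (2 * Re l * Re (f x) + 2 * Im l * Im (f x)) / (Re (f x) ^ 2 + Im (f x) ^ 2) ^ 2),
   - Im l * / (Re (f x) ^ 2 + Im (f x) ^ 2) +
   - Im (f x) * (- (2 * Re l * Re (f x) + 2 * Im l * Im (f x)) / (Re (f x) ^ 2 + Im (f x) ^ 2) ^ 2))%R : C).
 2: { assert (Hz2 : f x * f x <> 0) by now apply Cmult_neq_0.
    set (P := ((_, _) : C)).
    assert (E : P * (f x * f x) = - l).
    { unfold P. apply C_ext; unfold Re, Im in *; simpl in *; field; intro E; apply Hn; rewrite <- E; ring. }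
    rewrite <- E. field; auto. }
 assert (b' : is_derive (fun t => - Im (f t))%R x (- Im l)%R)
  by now apply (is_derive_opp (K := R_AbsRing) (V := R_NormedModule)).
 apply (cderive_pair (fun t => Re (f t) * / (Re (f t) ^ 2 + Im (f t) ^ 2))%R
           (fun t => - Im (f t) * / (Re (f t) ^ 2 + Im (f t) ^ 2))%R).
 - apply (is_derive_mult (K := R_AbsRing) _ _ _ _ _ a n). intros; apply Rmult_comm.
 - apply (is_derive_mult (K := R_AbsRing) _ _ _ _ _ b' n). intros; apply Rmult_comm.
Qed.

(** * Integrals of complex-valued functions *)
Notation is_cint f a b l := (is_RInt (V := C_R_NormedModule) f a b l).

Notation ex_cint f a b := (ex_RInt (V := C_R_NormedModule) f a b).

Notation cint f a b := (RInt (V := C_R_CompleteNormedModule) f a b).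

Lemma is_cint_unique f a b l : is_cint f a b l -> cint f a b = l.
Proof. apply (is_RInt_unique (V := C_R_CompleteNormedModule)). Qed.

Lemma cint_correct f a b : ex_cint f a b -> is_cint f a b (cint f a b).
Proof. apply (RInt_correct (V := C_R_CompleteNormedModule)). Qed.

Lemma ex_cint_cont f a b : (forall x, ccont f x) -> ex_cint f a b.
Proof. intro H. apply (ex_RInt_continuous (V := C_R_CompleteNormedModule)). auto. Qed.

Lemma is_cint_cont f a b : (forall x, ccont f x) -> is_cint f a b (cint f a b).
Proof. intro H. now apply cint_correct, ex_cint_cont. Qed.

Lemma is_cint_ext (f g : R -> C) a b l : (forall x, f x = g x) -> is_cint f a b l -> is_cint g a b l.
Proof. intro H. apply is_RInt_ext. auto. Qed.

Lemma cint_ext (f g : R -> C) a b : (forall x, f x = g x) -> cint f a b = cint g a b.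
Proof. intro H. f_equal. now apply functional_extensionality. Qed.

Lemma is_cint_plus f g a b l m :
 is_cint f a b l -> is_cint g a b m -> is_cint (fun x => f x + g x) a b (l + m).
Proof. apply (is_RInt_plus (V := C_R_NormedModule)). Qed.

Lemma is_cint_pair (f : R -> C) a b l :
 is_RInt (V := R_NormedModule) (fun t => Re (f t)) a b (Re l) ->
 is_RInt (V := R_NormedModule) (fun t => Im (f t)) a b (Im l) -> is_cint f a b l.
Proof.
 destruct l as [l m]. intros H1 H2.
 apply (is_RInt_fct_extend_pair (U := R_NormedModule) (V := R_NormedModule)); assumption.
Qed.

Lemma is_cint_Re (f : R -> C) a b l :
 is_cint f a b l -> is_RInt (V := R_NormedModule) (fun t => Re (f t)) a b (Re l).
Proof. apply (is_RInt_fct_extend_fst (U := R_NormedModule) (V := R_NormedModule)). Qed.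

Lemma is_cint_Im (f : R -> C) a b l :
 is_cint f a b l -> is_RInt (V := R_NormedModule) (fun t => Im (f t)) a b (Im l).
Proof. apply (is_RInt_fct_extend_snd (U := R_NormedModule) (V := R_NormedModule)). Qed.

Lemma is_cint_scal c f a b l : is_cint f a b l -> is_cint (fun x => c * f x) a b (c * l).
Proof.
 intro H. assert (h1 := is_cint_Re _ _ _ _ H). assert (h2 := is_cint_Im _ _ _ _ H).
 apply is_cint_pair.
 - apply (is_RInt_minus (V := R_NormedModule));
   apply (is_RInt_scal (V := R_NormedModule)); assumption.
 - apply (is_RInt_plus (V := R_NormedModule));
   apply (is_RInt_scal (V := R_NormedModule)); assumption.
Qed.

Lemma is_cint_minus f g a b l m :
 is_cint f a b l -> is_cint g a b m -> is_cint (fun x => f x - g x) a b (l - m).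
Proof. apply (is_RInt_minus (V := C_R_NormedModule)). Qed.

Lemma cint_plus f g a b : (forall x, ccont f x) -> (forall x, ccont g x) ->
 cint (fun x => f x + g x) a b = cint f a b + cint g a b.
Proof. intros. apply is_cint_unique, is_cint_plus; now apply is_cint_cont. Qed.

Lemma cint_minus f g a b : (forall x, ccont f x) -> (forall x, ccont g x) ->
 cint (fun x => f x - g x) a b = cint f a b - cint g a b.
Proof. intros. apply is_cint_unique, is_cint_minus; now apply is_cint_cont. Qed.

Lemma cint_scal c f a b : (forall x, ccont f x) ->
 cint (fun x => c * f x) a b = c * cint f a b.
Proof. intros. apply is_cint_unique, is_cint_scal; now apply is_cint_cont. Qed.

Lemma cint_derive F f a b : (forall x, cderive F x (f x)) -> (forall x, ccont f x) ->
 cint f a b = F b - F a.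
Proof.
 intros H1 H2. apply is_cint_unique.
 apply (is_RInt_derive (V := C_R_CompleteNormedModule)); intros; [apply H1 | apply H2].
Qed.

Lemma cint_const c a b : cint (fun _ => c) a b = RtoC (b - a) * c.
Proof.
 apply is_cint_unique.
 replace (RtoC (b - a) * c) with (scal (V := C_R_NormedModule) (b - a)%R c).
 - apply (is_RInt_const (V := C_R_NormedModule)).
 - apply C_ext; unfold Re, Im; simpl; unfold scal; simpl; unfold mult; simpl; ring.
Qed.

Lemma is_cint_le f a b l M : a <= b -> (forall x, (a <= x <= b)%R -> Cmod (f x) <= M) ->
 is_cint f a b l -> Cmod l <= (b - a) * M.
Proof.
 intros hab H I. rewrite Cmod_norm.
 apply (norm_RInt_le_const (V := C_R_NormedModule) f a b); [assumption | | assumption].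
 intros x hx. generalize (H x hx). now rewrite Cmod_norm.
Qed.

Lemma cint_le f a b M : a <= b -> (forall x, ccont f x) ->
 (forall x, (a <= x <= b)%R -> Cmod (f x) <= M) -> Cmod (cint f a b) <= (b - a) * M.
Proof. intros. apply is_cint_le with f; [assumption .. | now apply is_cint_cont]. Qed.

(** The derivative z exp(x z) is integrated over x in [0,1] and bounded pointwise. *)
Lemma Cexp_minus_1_le z : Cmod (Cexp z - 1) <= Cmod z * exp (Cmod z).
Proof.
 assert (D : forall x : R, cderive (fun x => Cexp (RtoC x * z)) x (z * Cexp (RtoC x * z))).
 { intro x. apply cderive_Cexp. assert (h := cderive_mult _ _ x _ _ (cderive_id x) (cderive_const z x)). cbv beta in h.
  recast z in h. exact h. }
 assert (c : forall x : R, ccont (fun x => z * Cexp (RtoC x * z)) x).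
 { intro x. apply ccont_mult; [apply ccont_const | exact (cderive_cont _ _ _ (D x))]. }
 assert (E := cint_derive _ _ 0 1 D c). cbv beta in E. rewrite Cmult_0_l, Cmult_1_l, Cexp_0 in E. rewrite <- E.
 eapply Rle_trans; [apply (cint_le _ 0 1 (Cmod z * exp (Cmod z)) Rle_0_1 c) | lra].
 intros x hx. rewrite Cmod_mult, Cmod_Cexp. apply Rmult_le_compat_l, exp_le; [apply Cmod_ge_0 |].
 assert (h := Cmod_Re z). assert (h' := Rle_abs (Re z)). replace (Re (x * z)) with (x * Re z)%R by (unfold Re; simpl; ring).
 assert (h0 := Cmod_ge_0 z). nra.
Qed.

Lemma ccont_bounded (f : R -> C) (a b : R) : (forall x, ccont f x) ->
 exists M : R, 0 < M /\ forall x, (a <= x <= b)%R -> Cmod (f x) <= M.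
Proof.
 intros H. destruct (Rle_dec a b) as [hab | hab].
 2: exists 1%R; split; [lra | intros; lra].
 assert (Hc : forall c, (a <= c <= b)%R -> continuity_pt (fun t => Cmod (f t)) c).
 { intros c _. apply continuity_pt_filterlim. now apply ccont_Cmod. }
 destruct (continuity_ab_maj _ a b hab Hc) as [Mx [h _]].
 exists (Cmod (f Mx) + 1)%R. split; [generalize (Cmod_ge_0 (f Mx)); lra |].
 intros x hx. generalize (h x hx). lra.
Qed.

Lemma ccont_lower_bound (f : R -> C) (a b : R) : (forall x, ccont f x) ->
 (forall x, (a <= x <= b)%R -> f x <> 0) ->
 exists d : R, 0 < d /\ forall x, (a <= x <= b)%R -> d <= Cmod (f x).
Proof.
 intros H H0. destruct (Rle_dec a b) as [hab | hab].
 2: exists 1%R; split; [lra | intros; lra].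
 assert (Hc : forall c, (a <= c <= b)%R -> continuity_pt (fun t => Cmod (f t)) c).
 { intros c _. apply continuity_pt_filterlim. now apply ccont_Cmod. }
 destruct (continuity_ab_min _ a b hab Hc) as [mx [h hm]].
 exists (Cmod (f mx)). split; [apply Cmod_gt_0; now apply H0 | exact h].
Qed.

Lemma ccont_cint_param {T : UniformSpace} (F : T -> R -> C) (x : T) :
 (forall y r, continuous (T := prod_UniformSpace T R_UniformSpace) (U := C_UniformSpace)
         (fun u => F (fst u) (snd u)) (y, r)) ->
 ccont (fun y => cint (F y) 0 1) x.
Proof.
 intro H.
 assert (Hr : forall y r, ccont (F y) r).
 { intros y r. apply (continuous_comp_2 (fun _ : R => y) (fun s : R => s) F r).
  - apply continuous_const.
  - apply continuous_id.
  - apply H. }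
 apply ccont_eps. intros eps he.
 assert (L : forall r : R, exists d : posreal, forall y r', ball x d y -> ball r d r' ->
       (Cmod (F y r' - F x r) < eps / 4)%R).
 { intro r. destruct (proj1 (ccont_eps _ _) (H x r) (eps / 4)%R ltac:(lra)) as [d Hd].
  exists d. intros y r' h1 h2. apply (Hd (y, r')). split; assumption. }
 apply choice in L. destruct L as [d Hd].
 (* Compactness of [0,1] turns the radii [d r] into one radius [d0]. It is stated under a double
    negation, so the pointwise bound below is proved by contradiction. *)
 destruct (compactness_value_1d 0 1 d) as [d0 Hd0].
 exists d0. intros y hy.
 rewrite <- cint_minus by apply Hr.
 apply Rle_lt_trans with ((1 - 0) * (eps / 2))%R; [| lra].
 apply cint_le; [lra | |].
 - intros r. apply ccont_minus; apply Hr.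
 - intros r hr. apply Rnot_lt_le. intro hlt.
  apply (Hd0 r hr). intros [t [ht [h1 h2]]].
  assert (B : ball t (d t) r) by exact h1.
  assert (a1 := Hd t y r (ball_le _ _ _ h2 _ hy) B).
  assert (a2 := Hd t x r (ball_center _ _) B).
  rewrite Cmod_minus_sym in a2.
  generalize (Cmod_triangle (F y r - F x t) (F x t - F x r)).
  recast (F y r - F x r). lra.
Qed.

(** * Rational functions of e(t) and their uniform limits *)

Definition geomX (w t : C) : C := / (1 - e2pi (t - w)).

Definition geomXs (W : list C) (t : C) : C := fold_right (fun w a => geomX w t * a) 1 W.

Definition ratmono (I : Z) (W : list C) (t : C) : C := e2pi (IZR I * t) * geomXs W t.

(** Generators and closure rules in place of quotients of polynomials, so that linear functionals
    can be tested by induction. [S] holds the permitted poles modulo Z; [geomX w] is the basic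
    simple pole, tending to 1 as Im t -> +oo and to 0 as Im t -> -oo. *)
Inductive Rat (S : C -> Prop) : (C -> C) -> Prop :=
| Rat_mono I W : Forall S W -> Rat S (ratmono I W)
| Rat_scal c f : Rat S f -> Rat S (fun t => c * f t)
| Rat_plus f g : Rat S f -> Rat S g -> Rat S (fun t => f t + g t).

Definition avoids (t w : C) : Prop := 1 - e2pi (t - w) <> 0.

Lemma avoids_iff t w : avoids t w <-> forall m : Z, t <> w + IZR m.
Proof.
 unfold avoids. split.
 - intros H m E. apply H. rewrite E. recast (0 + IZR m).
  rewrite e2pi_plus_IZR, e2pi_0. ring.
 - intros H E. assert (E1 : e2pi (t - w) = 1).
  { recast (1 - (1 - e2pi (t - w))). rewrite E. ring. }
  apply e2pi_eq_1 in E1. destruct E1 as [m Hm]. apply (H m). rewrite <- Hm. ring.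
Qed.

Lemma e2pi_IZR_succ (I : Z) t : e2pi (IZR (I + 1) * t) = e2pi (IZR I * t) * e2pi t.
Proof. rewrite <- e2pi_plus. f_equal. rewrite plus_IZR, RtoC_plus. ring. Qed.

Lemma geomX_eq w t : avoids t w -> e2pi (t - w) * geomX w t = geomX w t - 1.
Proof. unfold avoids, geomX. intro H. field. exact H. Qed.

Lemma geomXs_app W1 W2 t : geomXs (W1 ++ W2) t = geomXs W1 t * geomXs W2 t.
Proof. induction W1 as [| w W1 IH]; simpl; [ring | rewrite IH; ring]. Qed.

Lemma geomXs_perm W1 W2 t : Permutation W1 W2 -> geomXs W1 t = geomXs W2 t.
Proof. induction 1; simpl; [reflexivity | now rewrite IHPermutation | ring | congruence]. Qed.

Lemma geomXs_same w W t : Forall (fun w' => e2pi w' = e2pi w) W ->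
 geomXs W t = geomXs (repeat w (length W)) t.
Proof.
 induction 1 as [| w' W h _ IH]; simpl; [reflexivity |].
 rewrite IH. f_equal. unfold geomX. now rewrite !e2pi_minus, h.
Qed.

(** By [geomX_eq], raising the exponent by one multiplies by e(w) up to a monomial with one pole
    fewer. Hence one exponent per list of poles is enough to test a functional. *)
Lemma ratmono_succ I w W t : avoids t w ->
 ratmono (I + 1) (w :: W) t = e2pi w * (ratmono I (w :: W) t + (- (1)) * ratmono I W t).
Proof.
 intro H. unfold ratmono. simpl. rewrite e2pi_IZR_succ.
 recast (e2pi w * e2pi (t - w)) by (rewrite <- e2pi_plus; f_equal; ring).
 transitivity (e2pi (IZR I * t) * e2pi w * (e2pi (t - w) * geomX w t) * geomXs W t); [ring |].
 rewrite geomX_eq by exact H. ring.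
Qed.

(** Partial fractions in the variable e(t), for two poles that differ modulo Z. *)
Lemma geomX_split w v t : avoids t w -> avoids t v -> e2pi w <> e2pi v ->
 geomX w t * geomX v t =
 e2pi v / (e2pi v - e2pi w) * geomX w t + - e2pi w / (e2pi v - e2pi w) * geomX v t.
Proof.
 unfold avoids, geomX. rewrite !e2pi_minus. intros H1 H2 H3.
 assert (hw := e2pi_neq_0 w). assert (hv := e2pi_neq_0 v).
 set (a := e2pi w) in *. set (b := e2pi v) in *. set (x := e2pi t) in *.
 assert (b - a <> 0) by (intro E; apply H3; symmetry; now apply Ceq_minus).
 assert (a - x <> 0). { intro E. apply H1. recast ((a - x) / a) by (field; auto). rewrite E. field; auto. }
 assert (b - x <> 0). { intro E. apply H2. recast ((b - x) / b) by (field; auto). rewrite E. field; auto. }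
 field. cc.
Qed.

Lemma Z_shift_zero (f : Z -> C) (q : C) (I0 : Z) : q <> 0 ->
 (forall I, f (I + 1)%Z = q * f I) -> f I0 = 0 -> forall I, f I = 0.
Proof.
 intros hq Hs H0.
 assert (Hu : forall n : nat, f (I0 + Z.of_nat n)%Z = 0).
 { induction n as [| n IH]; [rewrite Z.add_0_r; exact H0 |].
  recast (I0 + Z.of_nat n + 1)%Z by lia.
  rewrite Hs, IH. ring. }
 assert (Hd : forall n : nat, f (I0 - Z.of_nat n)%Z = 0).
 { induction n as [| n IH]; [rewrite Z.sub_0_r; exact H0 |].
  recast (I0 - Z.of_nat (S n) + 1)%Z in IH by lia.
  rewrite Hs in IH. apply NNPP. intro hn. revert IH. now apply Cmult_neq_0. }
 intro I. destruct (Z_le_dec I0 I) as [h | h].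
 - recast (I0 + Z.of_nat (Z.to_nat (I - I0)))%Z by lia. apply Hu.
 - recast (I0 - Z.of_nat (Z.to_nat (I0 - I)))%Z by lia. apply Hd.
Qed.

(* A functional on rational functions of e(t) is determined by partial
  fractions: it suffices to test it on the monomials e(I t) and, for each
  pole and multiplicity, on one function with that pole. *)
Lemma Rat_functional (S K : C -> Prop) (L : (C -> C) -> C) :
 (forall t w, K t -> S w -> avoids t w) ->
 (forall f g, (forall t, K t -> f t = g t) -> L f = L g) ->
 (forall c f, Rat S f -> L (fun t => c * f t) = c * L f) ->
 (forall f g, Rat S f -> Rat S g -> L (fun t => f t + g t) = L f + L g) ->
 (forall I, L (ratmono I nil) = 0) ->
 (forall w k, S w -> exists I, L (ratmono I (repeat w (Datatypes.S k))) = 0) ->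
 forall f, Rat S f -> L f = 0.
Proof.
 intros HK Hext Hs Hp H0 H1.
 assert (Main : forall n W, length W = n -> Forall S W -> forall I, L (ratmono I W) = 0).
 { induction n as [| n IH]; intros W hl hW.
  - destruct W; [exact H0 | discriminate].
  - destruct W as [| w W]; [discriminate |]. simpl in hl. injection hl as hl.
   destruct (proj1 (Forall_cons_iff _ _ _) hW) as [hw hW'].
   (* If all poles agree modulo Z the monomial is a power of one [geomX], covered by the last
      hypothesis on [L]. Otherwise two distinct poles are separated by partial fractions and both
      pieces have fewer poles. *)
   assert (Ex : exists I, L (ratmono I (w :: W)) = 0).
   { destruct (classic (Forall (fun w' => e2pi w' = e2pi w) W)) as [hall | hex].
    - destruct (H1 w n hw) as [I hI]. exists I. rewrite <- hI. apply Hext. intros t _.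
     unfold ratmono. rewrite (geomXs_same w (w :: W)) by (constructor; auto). simpl. now rewrite hl.
    - apply Exists_Forall_neg in hex; [| intro x; apply classic].
     apply Exists_exists in hex. destruct hex as [v [hin hv]].
     apply in_split in hin. destruct hin as [W1 [W2 hW12]].
     assert (P : Permutation W (v :: (W1 ++ W2))).
     { rewrite hW12. symmetry. apply Permutation_middle. }
     assert (hW2 : Forall S (v :: (W1 ++ W2))) by (eapply Permutation_Forall; eassumption).
     destruct (proj1 (Forall_cons_iff _ _ _) hW2) as [hSv hS12].
     assert (hlen : length (W1 ++ W2) = pred n).
     { apply Permutation_length in P. simpl in P. lia. }
     assert (hn : n = Datatypes.S (pred n)).
     { destruct n; [destruct W; [destruct W1; discriminate | discriminate] | reflexivity]. }
     exists 0%Z.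
     transitivity (L (fun t =>
       e2pi v / (e2pi v - e2pi w) * ratmono 0 (w :: W1 ++ W2) t +
       - e2pi w / (e2pi v - e2pi w) * ratmono 0 (v :: W1 ++ W2) t)).
     + apply Hext. intros t ht. unfold ratmono. simpl. rewrite (geomXs_perm _ _ t P). simpl.
      rewrite !(Cmult_assoc (geomX w t)), geomX_split; try (now apply HK); [ring | auto].
     + rewrite Hp, !Hs, !IH; [ring | ..];
       try (constructor; constructor; assumption); try (constructor; assumption);
       try (apply Rat_scal; constructor; constructor; assumption); simpl; lia. }
   (* The recursion in the exponent has an inhomogeneous term with one pole fewer, zero by
      induction; so vanishing at [I0] spreads to every exponent. *)
   destruct Ex as [I0 hI0].
   apply (Z_shift_zero (fun I => L (ratmono I (w :: W))) (e2pi w) I0 (e2pi_neq_0 w)); [| exact hI0].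
   intro I.
   rewrite <- Hs by (constructor; assumption).
   transitivity (L (fun t => e2pi w * (ratmono I (w :: W) t + (- (1)) * ratmono I W t))).
   + apply Hext. intros t ht. apply ratmono_succ. now apply HK.
   + rewrite !Hs; [rewrite Hp, Hs, (IH W) | ..];
     repeat (assumption || constructor); ring. }
 intros f Hf. induction Hf as [I W hW | c f Hf IH | f g Hf IHf Hg IHg].
 - now apply (Main (length W)).
 - rewrite Hs, IH by assumption. ring.
 - rewrite Hp, IHf, IHg by assumption. ring.
Qed.

Lemma Rat_ext S f g : (forall t, f t = g t) -> Rat S f -> Rat S g.
Proof. intros H Hf. recast f by now apply functional_extensionality. exact Hf. Qed.

Lemma ratmono_mult I J W1 W2 t : ratmono I W1 t * ratmono J W2 t = ratmono (I + J) (W1 ++ W2) t.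
Proof.
 unfold ratmono. rewrite geomXs_app, plus_IZR, RtoC_plus.
 recast (IZR I * t + IZR J * t).
 rewrite e2pi_plus. ring.
Qed.

Lemma Rat_mult S f g : Rat S f -> Rat S g -> Rat S (fun t => f t * g t).
Proof.
 intros Hf Hg. induction Hf as [I W hW | c f Hf IH | f f' Hf IHf Hf' IHf'].
 - induction Hg as [J V hV | c g Hg IH | g g' Hg IHg Hg' IHg'].
  + apply (Rat_ext _ (ratmono (I + J) (W ++ V))).
   * intro t. symmetry. apply ratmono_mult.
   * constructor. apply Forall_app. now split.
  + apply (Rat_ext _ (fun t => c * (ratmono I W t * g t))); [intro; ring | now apply Rat_scal].
  + apply (Rat_ext _ (fun t => ratmono I W t * g t + ratmono I W t * g' t)); [intro; ring | now apply Rat_plus].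
 - apply (Rat_ext _ (fun t => c * (f t * g t))); [intro; ring | now apply Rat_scal].
 - apply (Rat_ext _ (fun t => f t * g t + f' t * g t)); [intro; ring | now apply Rat_plus].
Qed.

Lemma Rat_const S c : Rat S (fun _ => c).
Proof.
 apply (Rat_ext _ (fun t => c * ratmono 0 nil t)).
 - intro t. unfold ratmono. simpl. rewrite Cmult_0_l, e2pi_0. ring.
 - apply Rat_scal. constructor. constructor.
Qed.

Lemma Rat_e2pi S I : Rat S (fun t => e2pi (IZR I * t)).
Proof.
 apply (Rat_ext _ (ratmono I nil)); [intro; unfold ratmono; simpl; ring |].
 constructor. constructor.
Qed.

Lemma Rat_geomX (S : C -> Prop) w : S w -> Rat S (geomX w).
Proof.
 intro h. apply (Rat_ext _ (ratmono 0 (w :: nil))).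
 - intro t. unfold ratmono. simpl. rewrite Cmult_0_l, e2pi_0. ring.
 - constructor. cc.
Qed.

Lemma Rat_shift (S S' : C -> Prop) v f : (forall w, S w -> S' (w - v)) ->
 Rat S f -> Rat S' (fun t => f (t + v)).
Proof.
 intros H Hf. induction Hf as [I W hW | c f Hf IH | f f' Hf IHf Hf' IHf'].
 - apply (Rat_ext _ (fun t => e2pi (IZR I * v) * ratmono I (map (fun w => w - v) W) t)).
  + intro t. unfold ratmono. rewrite Cmult_assoc, <- e2pi_plus. f_equal; [f_equal; ring |].
   clear hW. induction W as [| w W IH]; simpl; [reflexivity |]. rewrite IH.
   unfold geomX. recast (t + v - w). reflexivity.
  + apply Rat_scal. constructor. apply Forall_map. revert hW. apply Forall_impl. exact H.
 - now apply Rat_scal.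
 - now apply Rat_plus.
Qed.

Lemma Rat_incl (S S' : C -> Prop) f : (forall w, S w -> S' w) -> Rat S f -> Rat S' f.
Proof.
 intros H Hf. induction Hf as [I W hW | c f Hf IH | f f' Hf IHf Hf' IHf'].
 - constructor. revert hW. now apply Forall_impl.
 - now apply Rat_scal.
 - now apply Rat_plus.
Qed.

(* The regions on which the rational functions with poles in S + Z are
  bounded. *)
Definition Kgood (S K : C -> Prop) : Prop :=
 (exists M : R, forall t, K t -> Rabs (Im t) <= M) /\
 forall w, S w -> exists d : R, 0 < d /\ forall t, K t -> d <= Cmod (1 - e2pi (t - w)).

(** Stands for a holomorphic function with poles in [S]: facts about integrals are proved for
    rational functions of e(t) and passed to uniform limits on [K], so that complex
    differentiability does not enter. *)
Definition RatLim (S K : C -> Prop) (f : C -> C) : Prop :=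
 forall eps : R, 0 < eps -> exists r, Rat S r /\ forall t, K t -> Cmod (f t - r t) < eps.

Definition bounded_on (K : C -> Prop) (f : C -> C) : Prop :=
 exists M : R, 0 < M /\ forall t, K t -> Cmod (f t) <= M.

Lemma Kgood_avoids S K t w : Kgood S K -> K t -> S w -> avoids t w.
Proof.
 intros [_ H] ht hw. destruct (H w hw) as [d [hd h]]. intro E. specialize (h t ht).
 rewrite E, Cmod_0 in h. lra.
Qed.

Lemma Kgood_geomX (S K : C -> Prop) w : Kgood S K -> S w -> bounded_on K (geomX w).
Proof.
 intros HK hw. destruct (proj2 HK w hw) as [d [hd h]]. exists (/ d)%R. split.
 - now apply Rinv_0_lt_compat.
 - intros t ht. unfold geomX. rewrite Cmod_inv.
  + apply Rinv_le_contravar; auto.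
  + now apply (Kgood_avoids S K).
Qed.

Lemma Cmod_e2pi_bound M I t : Rabs (Im t) <= M ->
 Cmod (e2pi (IZR I * t)) <= exp (2 * PI * Rabs (IZR I) * M).
Proof.
 intro h. rewrite Cmod_e2pi. apply exp_le.
 recast (IZR I * Im t)%R by (unfold Im; simpl; ring).
 assert (h1 : - (IZR I * Im t) <= Rabs (IZR I) * M).
 { apply Rle_trans with (Rabs (IZR I) * Rabs (Im t))%R.
  - rewrite <- Rabs_mult, <- Rabs_Ropp. apply Rle_abs.
  - apply Rmult_le_compat_l; [apply Rabs_pos | exact h]. }
 generalize PI_RGT_0. nra.
Qed.

Lemma bounded_mult K f g : bounded_on K f -> bounded_on K g -> bounded_on K (fun t => f t * g t).
Proof.
 intros [M [hM H]] [N [hN H']]. exists (M * N)%R. split; [now apply Rmult_lt_0_compat |].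
 intros t ht. rewrite Cmod_mult. apply Rmult_le_compat; auto; apply Cmod_ge_0.
Qed.

Lemma bounded_plus K f g : bounded_on K f -> bounded_on K g -> bounded_on K (fun t => f t + g t).
Proof.
 intros [M [hM H]] [N [hN H']]. exists (M + N)%R. split; [lra |].
 intros t ht. eapply Rle_trans; [apply Cmod_triangle |]. generalize (H t ht) (H' t ht). lra.
Qed.

Lemma bounded_const K c : bounded_on K (fun _ => c).
Proof. exists (Cmod c + 1)%R. generalize (Cmod_ge_0 c). intuition lra. Qed.

Lemma Rat_bounded S K f : Kgood S K -> Rat S f -> bounded_on K f.
Proof.
 intros HK Hf. induction Hf as [I W hW | c f Hf IH | f f' Hf IHf Hf' IHf'].
 - apply bounded_mult.
  + destruct HK as [[M HM] _]. exists (exp (2 * PI * Rabs (IZR I) * M)). split; [apply exp_pos |].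
   intros t ht. apply Cmod_e2pi_bound; auto.
  + induction hW as [| w W hw hW IH]; simpl; [apply bounded_const |].
   apply bounded_mult; [now apply (Kgood_geomX S) | exact IH].
 - apply bounded_mult; [apply bounded_const | assumption].
 - now apply bounded_plus.
Qed.

Lemma RatLim_bounded S K f : Kgood S K -> RatLim S K f -> bounded_on K f.
Proof.
 intros HK Hf. destruct (Hf 1%R Rlt_0_1) as [r [Hr h]].
 destruct (Rat_bounded S K r HK Hr) as [M [hM HM]]. exists (M + 1)%R. split; [lra |].
 intros t ht. recast ((f t - r t) + r t).
 eapply Rle_trans; [apply Cmod_triangle |]. generalize (h t ht) (HM t ht). lra.
Qed.

Lemma RatLim_Rat S K f : Rat S f -> RatLim S K f.
Proof.
 intros H eps he. exists f. split; [exact H |]. intros t _.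
 recast (RtoC 0). now rewrite Cmod_0.
Qed.

Lemma RatLim_ext S K f g : (forall t, K t -> f t = g t) -> RatLim S K f -> RatLim S K g.
Proof.
 intros E H eps he. destruct (H eps he) as [r [Hr h]]. exists r. split; [exact Hr |].
 intros t ht. rewrite <- E by exact ht. now apply h.
Qed.

Lemma RatLim_const S K c : RatLim S K (fun _ => c).
Proof. apply RatLim_Rat, Rat_const. Qed.

Lemma RatLim_plus S K f g : RatLim S K f -> RatLim S K g -> RatLim S K (fun t => f t + g t).
Proof.
 intros Hf Hg eps he. destruct (Hf (eps / 2)%R) as [r [Hr h]]; [lra |].
 destruct (Hg (eps / 2)%R) as [r' [Hr' h']]; [lra |].
 exists (fun t => r t + r' t). split; [now apply Rat_plus |]. intros t ht.
 recast ((f t - r t) + (g t - r' t)).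
 eapply Rle_lt_trans; [apply Cmod_triangle |]. generalize (h t ht) (h' t ht). lra.
Qed.

Lemma RatLim_mult S K f g : Kgood S K -> RatLim S K f -> RatLim S K g -> RatLim S K (fun t => f t * g t).
Proof.
 intros HK Hf Hg eps he.
 destruct (RatLim_bounded S K f HK Hf) as [M [hM HM]].
 set (e1 := (eps / (2 * M))%R).
 assert (he1 : 0 < e1) by (apply Rdiv_lt_0_compat; lra).
 destruct (Hg e1 he1) as [r' [Hr' h']].
 destruct (Rat_bounded S K r' HK Hr') as [M' [hM' HM']].
 (* The tolerance for [f] depends on the bound of the approximant [r'] of [g], so [r'] is fixed
    before [r]. *)
 set (e2 := (eps / (2 * M'))%R).
 assert (he2 : 0 < e2) by (apply Rdiv_lt_0_compat; lra).
 destruct (Hf e2 he2) as [r [Hr h]].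
 exists (fun t => r t * r' t). split; [now apply Rat_mult |]. intros t ht.
 recast (f t * (g t - r' t) + (f t - r t) * r' t).
 eapply Rle_lt_trans; [apply Cmod_triangle |]. rewrite !Cmod_mult.
 assert (Cmod (f t) * Cmod (g t - r' t) <= M * Cmod (g t - r' t))%R
  by (apply Rmult_le_compat_r; [apply Cmod_ge_0 | auto]).
 assert (M * Cmod (g t - r' t) < M * e1)%R by (apply Rmult_lt_compat_l; auto).
 assert (Cmod (f t - r t) * Cmod (r' t) <= e2 * M')%R.
 { apply Rmult_le_compat; try apply Cmod_ge_0; auto. left; auto. }
 assert (M * e1 = eps / 2)%R by (unfold e1; field; lra).
 assert (e2 * M' = eps / 2)%R by (unfold e2; field; lra).
 lra.
Qed.

Lemma RatLim_scal S K c f : Kgood S K -> RatLim S K f -> RatLim S K (fun t => c * f t).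
Proof. intros HK H. apply RatLim_mult; auto. apply RatLim_const. Qed.

Lemma RatLim_opp S K f : Kgood S K -> RatLim S K f -> RatLim S K (fun t => - f t).
Proof.
 intros HK H. apply (RatLim_ext _ _ (fun t => (- (1)) * f t)); [intros; ring |]. now apply RatLim_scal.
Qed.

Lemma RatLim_unif S K f :
 (forall eps : R, 0 < eps -> exists g, RatLim S K g /\ forall t, K t -> Cmod (f t - g t) < eps) ->
 RatLim S K f.
Proof.
 intros H eps he. destruct (H (eps / 2)%R) as [g [Hg h]]; [lra |].
 destruct (Hg (eps / 2)%R) as [r [Hr h']]; [lra |].
 exists r. split; [exact Hr |]. intros t ht.
 recast ((f t - g t) + (g t - r t)).
 eapply Rle_lt_trans; [apply Cmod_triangle |]. generalize (h t ht) (h' t ht). lra.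
Qed.

Lemma RatLim_incl (S S' K K' : C -> Prop) f : (forall w, S w -> S' w) -> (forall t, K' t -> K t) ->
 RatLim S K f -> RatLim S' K' f.
Proof.
 intros HS HK H eps he. destruct (H eps he) as [r [Hr h]]. exists r. split; [| auto].
 now apply (Rat_incl S).
Qed.

Lemma RatLim_shift (S S' K K' : C -> Prop) v f : (forall w, S w -> S' (w - v)) ->
 (forall t, K' t -> K (t + v)) -> RatLim S K f -> RatLim S' K' (fun t => f (t + v)).
Proof.
 intros HS HK H eps he. destruct (H eps he) as [r [Hr h]]. exists (fun t => r (t + v)).
 split; [now apply (Rat_shift S) |]. cc.
Qed.

Lemma RatLim_e2pi S K I c : Kgood S K -> RatLim S K (fun t => e2pi (IZR I * t + c)).
Proof.
 intro HK. apply (RatLim_ext _ _ (fun t => e2pi c * e2pi (IZR I * t))).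
 - intros t _. rewrite <- e2pi_plus. f_equal. ring.
 - apply RatLim_scal; [exact HK | apply RatLim_Rat, Rat_e2pi].
Qed.

(** * Contour integrals *)
Definition clamp (s : R) : R := Rmax 0 (Rmin 1 s).

Lemma clamp_in s : (0 <= clamp s <= 1)%R.
Proof. unfold clamp. split; [apply Rmax_l |]. apply Rmax_lub; [lra | apply Rmin_l]. Qed.

Lemma clamp_id s : (0 <= s <= 1)%R -> clamp s = s.
Proof. intro. unfold clamp. rewrite Rmin_right, Rmax_right; lra. Qed.

Lemma clamp_cont s : continuous clamp s.
Proof.
 intros P [eps HP]. exists eps. intros y hy. apply HP.
 change (Rabs (y - s) < eps)%R in hy. change (Rabs (clamp y - clamp s) < eps)%R.
 apply Rle_lt_trans with (2 := hy). unfold clamp.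
 unfold Rmax, Rmin.
 repeat destruct Rle_dec; unfold Rabs; repeat destruct Rcase_abs; lra.
Qed.

(* Paths are only controlled on [0,1]; clamping the parameter makes the
  integrands continuous on R without changing the integral. *)
Definition pint (g dg : R -> C) (f : C -> C) : C :=
 cint (fun s => f (g (clamp s)) * dg (clamp s)) 0 1.

Definition pcont (g : R -> C) (f : C -> C) : Prop := forall s : R, ccont (fun s => f (g (clamp s))) s.

Definition on_path (g : R -> C) (t : C) : Prop := exists r : R, (0 <= r <= 1)%R /\ t = g r.

Lemma on_path_clamp g s : on_path g (g (clamp s)).
Proof. exists (clamp s). split; [apply clamp_in | reflexivity]. Qed.

Lemma ccont_clamp (f : R -> C) s : (forall x, ccont f x) -> ccont (fun s => f (clamp s)) s.
Proof. intro H. apply (continuous_comp clamp f); [apply clamp_cont | apply H]. Qed.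

Lemma period_path_cont g dg : period_path g dg -> forall s, ccont g s.
Proof. intros [H _] s. exact (cderive_cont _ _ _ (H s)). Qed.

Lemma pint_cont g dg f : period_path g dg -> pcont g f ->
 forall s, ccont (fun s => f (g (clamp s)) * dg (clamp s)) s.
Proof. intros [_ [H _]] Hf s. apply ccont_mult; [apply Hf | now apply ccont_clamp]. Qed.

Lemma pint_ext g dg f h : (forall t, on_path g t -> f t = h t) -> pint g dg f = pint g dg h.
Proof. intro H. apply cint_ext. intro s. rewrite H; [reflexivity | apply on_path_clamp]. Qed.

Lemma pint_plus g dg f h : period_path g dg -> pcont g f -> pcont g h ->
 pint g dg (fun t => f t + h t) = pint g dg f + pint g dg h.
Proof.
 intros P Hf Hh. unfold pint. rewrite <- cint_plus by now apply pint_cont.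
 apply cint_ext. intro s. ring.
Qed.

Lemma pint_minus g dg f h : period_path g dg -> pcont g f -> pcont g h ->
 pint g dg (fun t => f t - h t) = pint g dg f - pint g dg h.
Proof.
 intros P Hf Hh. unfold pint. rewrite <- cint_minus by now apply pint_cont.
 apply cint_ext. intro s. ring.
Qed.

Lemma pint_scal g dg c f : period_path g dg -> pcont g f ->
 pint g dg (fun t => c * f t) = c * pint g dg f.
Proof.
 intros P Hf. unfold pint. rewrite <- cint_scal by now apply pint_cont.
 apply cint_ext. intro s. ring.
Qed.

Lemma pint_le g dg : period_path g dg ->
 exists B : R, 0 < B /\ forall f M, pcont g f -> (forall t, on_path g t -> Cmod (f t) <= M) ->
  Cmod (pint g dg f) <= M * B.
Proof.
 intro P. destruct (ccont_bounded dg 0 1 (proj1 (proj2 P))) as [B [hB H]].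
 exists B. split; [exact hB |]. intros f M Hf HM.
 recast ((1 - 0) * (M * B))%R.
 apply cint_le; [lra | now apply pint_cont |]. intros x hx.
 rewrite Cmod_mult. apply Rmult_le_compat; try apply Cmod_ge_0.
 - apply HM, on_path_clamp.
 - rewrite clamp_id by exact hx. now apply H.
Qed.

Lemma pint_derive g dg (F f : C -> C) : period_path g dg -> pcont g f ->
 (forall s, (0 <= s <= 1)%R -> cderive (fun s => F (g s)) s (f (g s) * dg s)) ->
 (forall s, (0 <= s <= 1)%R -> ccont (fun s => f (g s) * dg s) s) ->
 pint g dg f = F (g 1%R) - F (g 0%R).
Proof.
 intros P Hf HF Hc. unfold pint.
 transitivity (cint (fun s => f (g s) * dg s) 0 1).
 - apply (RInt_ext (V := C_R_CompleteNormedModule)). intros x hx.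
  rewrite Rmin_left, Rmax_right in hx by lra. rewrite clamp_id by lra. reflexivity.
 - apply is_cint_unique.
  apply (is_RInt_derive (V := C_R_CompleteNormedModule) (fun s => F (g s)));
   rewrite Rmin_left, Rmax_right by lra; auto.
Qed.

Lemma pint_1 g dg : period_path g dg -> pint g dg (fun _ => 1) = 1.
Proof.
 intro P. rewrite (pint_derive g dg (fun t => t)).
 - destruct P as [_ [_ ->]]. ring.
 - exact P.
 - intro s. cc.
 - intros s _. rewrite Cmult_1_l. apply P.
 - intros s _. apply ccont_mult; [cc | apply P].
Qed.

Lemma pcont_comp g (f : C -> C) : (forall s, ccont g s) ->
 (forall r, (0 <= r <= 1)%R -> continuous (T := C_UniformSpace) (U := C_UniformSpace) f (g r)) -> pcont g f.
Proof.
 intros Hg Hf s. apply (ccont_comp (fun s => g (clamp s)) f).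
 - now apply ccont_clamp.
 - apply Hf, clamp_in.
Qed.

Lemma ccont_geomX {T : UniformSpace} (f : T -> C) w x : ccont f x -> avoids (f x) w ->
 ccont (fun t => geomX w (f t)) x.
Proof.
 intros Hf H. apply ccont_inv; [| exact H].
 cc.
Qed.

Lemma ccont_Rat {T : UniformSpace} (h : T -> C) S f x : ccont h x -> (forall w, S w -> avoids (h x) w) ->
 Rat S f -> ccont (fun t => f (h t)) x.
Proof.
 intros Hh H Hf. induction Hf as [I W hW | c f Hf IH | f f' Hf IHf Hf' IHf'].
 - apply ccont_mult.
  + cc.
  + induction hW as [| w W hw hW IH]; simpl; [cc |].
   apply ccont_mult; [apply ccont_geomX; auto | exact IH].
 - cc.
 - cc.
Qed.

Lemma pcont_Rat g S f : (forall s, ccont g s) -> (forall t w, on_path g t -> S w -> avoids t w) ->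
 Rat S f -> pcont g f.
Proof.
 intros Hg H Hf s. apply (ccont_Rat _ S); [now apply ccont_clamp | | exact Hf].
 intros w hw. apply H; [apply on_path_clamp | exact hw].
Qed.

Lemma pcont_RatLim g S K f : (forall s, ccont g s) -> (forall t, on_path g t -> K t) -> Kgood S K ->
 RatLim S K f -> pcont g f.
Proof.
 intros Hg HK HS Hf s.
 apply ccont_unif. intros eps he. destruct (Hf eps he) as [r [Hr h]].
 exists (fun s => r (g (clamp s))). split.
 - apply (pcont_Rat g S r Hg); [| exact Hr]. intros t w ht hw. apply (Kgood_avoids S K); auto.
 - intro u. apply h, HK, on_path_clamp.
Qed.

Lemma pcont_plus g f h : pcont g f -> pcont g h -> pcont g (fun t => f t + h t).
Proof. intros H1 H2 s. cc. Qed.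

Lemma pcont_minus g f h : pcont g f -> pcont g h -> pcont g (fun t => f t - h t).
Proof. intros H1 H2 s. cc. Qed.

Lemma pcont_mult g f h : pcont g f -> pcont g h -> pcont g (fun t => f t * h t).
Proof. intros H1 H2 s. cc. Qed.

Lemma pcont_const g c : pcont g (fun _ => c).
Proof. intro s. cc. Qed.

Lemma pcont_pow g f n : pcont g f -> pcont g (fun t => Cpow (f t) n).
Proof. intro H. induction n as [| n IH]; simpl; [apply pcont_const | now apply pcont_mult]. Qed.

#[export] Hint Resolve ccont_clamp pcont_const pcont_plus pcont_minus pcont_mult pcont_pow : cc.

#[export] Hint Extern 2 (continuous ?g _) => is_var g; eapply period_path_cont; eassumption : cc.

Lemma Cinv_cancel (k x : C) : k <> 0 -> / k * (k * x) = x.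
Proof. intro h. field; auto. Qed.

Lemma two_pi_i_neq_0 : 2 * PI * Ci <> 0.
Proof.
 apply Cmult_neq_0; [apply Cmult_neq_0 | apply Ci_nz]; intro E; apply RtoC_inj in E; [lra |].
 now apply PI_neq0 in E.
Qed.

(** For nonzero [I] the primitive e(I t) / (2 pi i I) is 1-periodic, so its values at the two ends
    of the path agree. *)
Lemma pint_e2pi g dg (I : Z) : period_path g dg ->
 pint g dg (fun t => e2pi (IZR I * t)) = if Z.eq_dec I 0 then 1 else 0.
Proof.
 intro P. destruct (Z.eq_dec I 0) as [-> | hI].
 - rewrite <- (pint_1 g dg P). apply pint_ext. intros t _. rewrite Cmult_0_l. apply e2pi_0.
 - assert (hc : 2 * PI * Ci * IZR I <> 0).
  { apply Cmult_neq_0; [exact two_pi_i_neq_0 |]. intro E. apply RtoC_inj in E. now apply eq_IZR in E. }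
  assert (Hc : forall s, ccont (fun s => e2pi (IZR I * g s)) s).
  { cc. }
  rewrite (pint_derive g dg (fun t => / (2 * PI * Ci * IZR I) * e2pi (IZR I * t))).
  + destruct P as [_ [_ ->]].
   recast (IZR I * g 0%R + IZR I).
   rewrite e2pi_plus_IZR. ring.
  + exact P.
  + intro s. cc.
  + intros s _.
   replace (e2pi (IZR I * g s) * dg s) with
    (/ (2 * PI * Ci * IZR I) * (2 * PI * Ci * (IZR I * dg s) * e2pi (IZR I * g s))).
   2: { rewrite <- (Cmult_1_l (e2pi _ * dg s)), <- (Cinv_l _ hc). ring. }
   apply cderive_scal, cderive_e2pi, cderive_scal, P.
  + intros s _. apply ccont_mult; [apply Hc | apply P].
Qed.

Definition avoided (g : R -> C) (w : C) : Prop := forall t, on_path g t -> avoids t w.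

Lemma joined_avoided g w e : joined_to g w e -> avoided g w.
Proof.
 intros [c [_ [Hc [_ H]]]] t [r [hr ->]]. apply avoids_iff. intros m E.
 apply (H 0%R r (- m)%Z ltac:(lra) hr). rewrite Hc, E, opp_IZR, RtoC_opp. ring.
Qed.

Lemma cderive_geomX g dg w s : cderive g s (dg s) -> avoids (g s) w ->
 cderive (fun s => geomX w (g s)) s
  (2 * PI * Ci * (geomX w (g s) * (geomX w (g s) - 1)) * dg s).
Proof.
 intros Hg Ha. rewrite <- geomX_eq by exact Ha.
 unfold avoids in Ha. unfold geomX.
 recast (- (0 - 2 * PI * Ci * (dg s - 0) * e2pi (g s - w)) / ((1 - e2pi (g s - w)) * (1 - e2pi (g s - w)))) by (field; exact Ha).
 apply (cderive_inv (fun s => 1 - e2pi (g s - w))); [| exact Ha].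
 apply cderive_minus; [apply cderive_const |].
 apply cderive_e2pi, cderive_minus; [exact Hg | apply cderive_const].
Qed.

Lemma cderive_pow (f : R -> C) x l n : cderive f x l ->
 cderive (fun t => Cpow (f t) (S n)) x (INR (S n) * Cpow (f x) n * l).
Proof.
 intro H. induction n as [| n IH].
 - apply (cderive_ext f).
  { intros; ring. }
  recast l by (simpl; ring). exact H.
 - replace (INR (S (S n)) * Cpow (f x) (S n) * l)
   with (l * Cpow (f x) (S n) + f x * (INR (S n) * Cpow (f x) n * l)).
  + apply (cderive_mult f (fun t => Cpow (f t) (S n))); assumption.
  + rewrite (S_INR (S n)), RtoC_plus. simpl Cpow. ring.
Qed.

(* X (X - 1) Y^n with Y = X - 1, or X^n: exact derivatives, because
  X' = 2 pi i X (X - 1). *)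
Lemma pint_geomX_exact g dg w a n : period_path g dg -> avoided g w ->
 pint g dg (fun t => geomX w t * (geomX w t - 1) * Cpow (geomX w t - a) n) = 0.
Proof.
 intros P Ha.
 assert (Hgc := period_path_cont _ _ P).
 assert (HX : pcont g (geomX w)).
 { intro s. apply ccont_geomX; [cc | apply Ha, on_path_clamp]. }
 assert (hn : RtoC (INR (S n)) <> 0) by (intro E; apply RtoC_inj in E; revert E; apply not_0_INR; lia).
 assert (hc := two_pi_i_neq_0).
 assert (HC : forall s, (0 <= s <= 1)%R -> ccont (fun s => geomX w (g s)) s).
 { intros s hs. apply ccont_geomX; [apply Hgc | apply Ha; exists s; auto]. }
 rewrite (pint_derive g dg (fun t => / (2 * PI * Ci * INR (S n)) * Cpow (geomX w t - a) (S n))).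
 - destruct P as [_ [_ ->]].
  replace (geomX w (g 0%R + 1)) with (geomX w (g 0%R)); [ring |].
  unfold geomX. recast (g 0%R - w + IZR 1). now rewrite e2pi_plus_IZR.
 - exact P.
 - cc.
 - intros s hs.
  rewrite <- (Cinv_cancel (2 * PI * Ci * INR (S n)) (_ * dg s)) by now apply Cmult_neq_0.
  apply cderive_scal.
  recast (INR (S n) * Cpow (geomX w (g s) - a) n * (2 * PI * Ci * (geomX w (g s) * (geomX w (g s) - 1)) * dg s - 0)).
  apply (cderive_pow (fun s => geomX w (g s) - a)), cderive_minus; [| apply cderive_const].
  apply cderive_geomX; [apply P |]. apply Ha. exists s; auto.
 - intros s hs. apply ccont_mult; [| apply P].
  apply ccont_mult.
  + cc.
  + clear hn. induction n as [| n IH]; simpl; [cc |].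
   cc.
Qed.

Lemma avoided_cont g w : (forall s, ccont g s) -> avoided g w -> pcont g (geomX w).
Proof. intros Hg Ha s. apply ccont_geomX; [cc | apply Ha, on_path_clamp]. Qed.

Lemma avoided_bound g w : (forall s, ccont g s) -> avoided g w ->
 exists B : R, 0 < B /\ forall t, on_path g t -> Cmod (geomX w t) <= B.
Proof.
 intros Hg Ha. destruct (ccont_bounded (fun s => geomX w (g (clamp s))) 0 1) as [B [hB H]].
 - now apply avoided_cont.
 - exists B. split; [exact hB |]. intros t [r [hr ->]].
  generalize (H r hr). now rewrite clamp_id.
Qed.

Lemma Cmod_geom_zero (z : C) (M r : R) : (0 <= r < 1)%R ->
 (forall n : nat, Cmod z <= M * r ^ n) -> z = 0.
Proof.
 intros hr H. apply Cmod_eq_0. apply Rle_antisym; [| apply Cmod_ge_0].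
 apply Rnot_lt_le. intro hlt.
 assert (hM : 0 < M). { specialize (H O). lra. }
 destruct (pow_lt_1_zero r ltac:(rewrite Rabs_pos_eq; lra) (Cmod z / M)%R) as [N HN].
 { now apply Rdiv_lt_0_compat. }
 specialize (HN N (Nat.le_refl _)). specialize (H N).
 rewrite Rabs_pos_eq in HN by (apply pow_le; lra).
 apply (Rmult_lt_compat_l M) in HN; [| exact hM].
 recast (Cmod z) in HN by (field; lra). lra.
Qed.

(** The factor 1 - e(t - w') is 1 - e(t - w) times 1 - (X - 1) q with X = [geomX w t] and q = e(w -
    w') - 1. For w' close to w this makes [geomX w'] a geometric series in (X - 1) q. *)
Lemma geomX_perturb w w' t : avoids t w -> 1 - (geomX w t - 1) * (e2pi (w - w') - 1) <> 0 ->
 avoids t w' /\ geomX w' t = geomX w t / (1 - (geomX w t - 1) * (e2pi (w - w') - 1)).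
Proof.
 intros Ha Hn.
 assert (E : 1 - e2pi (t - w') = (1 - e2pi (t - w)) * (1 - (geomX w t - 1) * (e2pi (w - w') - 1))).
 { rewrite <- geomX_eq by exact Ha. unfold geomX, avoids in *.
  recast (t - w + (w - w')). rewrite e2pi_plus. field; auto. }
 assert (Ha' : avoids t w'). { unfold avoids. rewrite E. now apply Cmult_neq_0. }
 split; [exact Ha' |]. unfold geomX at 1. rewrite E.
 set (b := 1 - (geomX w t - 1) * _) in *. unfold geomX. field; auto.
Qed.

Lemma Cmod_one_minus (x : C) : Cmod x <= 1 / 2 -> 1 / 2 <= Cmod (1 - x).
Proof. intro h. generalize (Cmod_triang_inv 1 x). rewrite Cmod_1. lra. Qed.

(** Local constancy of the winding number. In the geometric series of [geomX_perturb] every term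
    after the first is an exact derivative, and the tail decays like 2^(-n) on the path. *)
Lemma winding_loc g dg w w' B : period_path g dg -> avoided g w ->
 (forall t, on_path g t -> Cmod (geomX w t) <= B) ->
 Cmod (e2pi (w - w') - 1) * (1 + B) <= 1 / 2 ->
 pint g dg (geomX w') = pint g dg (geomX w).
Proof.
 intros P Ha HB Hq. set (q := e2pi (w - w') - 1) in *.
 assert (Hgc := period_path_cont _ _ P).
 assert (HX := avoided_cont _ _ Hgc Ha).
 assert (HY : forall t, on_path g t -> Cmod ((geomX w t - 1) * q) <= 1 / 2).
 { intros t ht. rewrite Cmod_mult, Rmult_comm. apply Rle_trans with (2 := Hq).
  apply Rmult_le_compat_l; [apply Cmod_ge_0 |].
  eapply Rle_trans; [apply Cmod_triangle |]. rewrite Cmod_opp, Cmod_1. specialize (HB t ht). lra. }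
 assert (Hn : forall t, on_path g t -> 1 - (geomX w t - 1) * q <> 0).
 { intros t ht E. generalize (Cmod_one_minus _ (HY t ht)). rewrite E, Cmod_0. lra. }
 (* [r K] is the tail of the series of [geomX w'] from the power [K] on. *)
 set (r := fun (K : nat) t => geomX w t * Cpow ((geomX w t - 1) * q) K * / (1 - (geomX w t - 1) * q)).
 assert (Hinv : pcont g (fun t => / (1 - (geomX w t - 1) * q))).
 { intro s. apply ccont_inv; [| apply Hn, on_path_clamp].
  cc. }
 assert (Hr : forall K, pcont g (r K)).
 { intro K. apply pcont_mult; [apply pcont_mult; [exact HX |] | exact Hinv].
  cc. }
 assert (Hp1 : forall n, pcont g (fun t => geomX w t * (geomX w t - 1) * Cpow (geomX w t - 1) n)).
 { cc. }
 (* Consecutive tails differ by q^(K+1) X (X - 1) (X - 1)^K, which is exact by [pint_geomX_exact]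
    with [a] equal to 1. *)
 assert (Hstep : forall K, pint g dg (r (S K)) = pint g dg (r (S (S K)))).
 { intro K.
  transitivity (pint g dg (fun t => r (S (S K)) t +
          Cpow q (S K) * (geomX w t * (geomX w t - 1) * Cpow (geomX w t - 1) K))).
  - apply pint_ext. intros t ht. unfold r. rewrite !Cpow_S, !Cpow_mult_l. field; auto.
  - rewrite pint_plus, pint_scal, pint_geomX_exact; auto; [ring |].
   cc. }
 assert (Hz : pint g dg (r 1%nat) = 0).
 { destruct (pint_le g dg P) as [L [hL HL]].
  apply (Cmod_geom_zero _ (B * L) (1 / 2)); [lra |]. intro n.
  assert (E : pint g dg (r 1%nat) = pint g dg (r (S n))).
  { induction n as [| n IH]; [reflexivity | now rewrite IH, Hstep]. }
  rewrite E. recast (B * (1 / 2) ^ n * L)%R.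
  apply HL; [apply Hr |]. intros t ht. unfold r.
  rewrite !Cmod_mult, Cmod_inv, Cmod_pow by now apply Hn.
  assert (h1 := HB t ht). assert (h2 := HY t ht). assert (h3 := Cmod_one_minus _ h2).
  set (x := Cmod (geomX w t)) in *. set (y := Cmod ((geomX w t - 1) * q)) in *.
  assert (hx : 0 <= x) by apply Cmod_ge_0. assert (hy : 0 <= y) by apply Cmod_ge_0.
  assert (h4 : y ^ S n <= (1 / 2) ^ S n) by now apply pow_incr.
  assert (h5 : / Cmod (1 - (geomX w t - 1) * q) <= 2).
  { recast (/ (1 / 2))%R by field. apply Rinv_le_contravar; lra. }
  assert (h6 : 0 <= y ^ S n) by now apply pow_le.
  apply Rle_trans with (B * (1 / 2) ^ S n * 2)%R; [| simpl; lra].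
  apply Rmult_le_compat; [now apply Rmult_le_pos | | | exact h5].
  - left. apply Rinv_0_lt_compat. lra.
  - nra. }
 transitivity (pint g dg (fun t => geomX w t + r 1%nat t)).
 - apply pint_ext. intros t ht.
  rewrite (proj2 (geomX_perturb w w' t (Ha t ht) (Hn t ht))). unfold r. simpl. fold q.
  field; auto.
 - rewrite pint_plus, Hz; auto. ring.
Qed.

(** By [winding_loc] the integral is locally constant in the position of the pole, hence has
    derivative 0 along the curve. *)
Lemma winding_joined g dg c : period_path g dg -> (forall s : R, ccont c s) ->
 (forall s, 0 <= s -> avoided g (c s)) ->
 forall s, 0 <= s -> pint g dg (geomX (c s)) = pint g dg (geomX (c 0%R)).
Proof.
 intros P Hc Ha.
 assert (Hgc := period_path_cont _ _ P).
 (* [Rabs s] folds the parameter: the curve avoids the path only for nonnegative parameters, while a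
    two-sided derivative at 0 is needed as well. *)
 set (f := fun s : R => pint g dg (geomX (c (Rabs s)))).
 assert (Hd : forall s, cderive f s (RtoC 0)).
 { intro s.
  assert (Has := Ha _ (Rabs_pos s)).
  destruct (avoided_bound g _ Hgc Has) as [B [hB HB]].
  assert (Hcs : ccont (fun u => e2pi (c (Rabs s) - c (Rabs u)) - 1) s).
  { apply ccont_minus; [| cc]. apply ccont_e2pi.
   apply ccont_minus; [cc |].
   apply (continuous_comp Rabs c); [apply continuous_Rabs | apply Hc]. }
  assert (L := proj1 (ccont_eps _ _) Hcs (/ (2 * (1 + B)))%R).
  apply (is_derive_ext_loc (K := R_AbsRing) (V := C_R_NormedModule) (fun _ => f s)).
  - assert (h0 : 0 < / (2 * (1 + B))) by (apply Rinv_0_lt_compat; lra).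
   generalize (L h0). apply filter_imp. intros u hu. symmetry.
   apply (winding_loc _ _ _ _ B); auto.
   recast (RtoC 0) in hu. rewrite e2pi_0 in hu.
   recast (e2pi (c (Rabs s) - c (Rabs u)) - 1) in hu.
   apply (Rmult_lt_compat_r (1 + B)) in hu; [| lra].
   recast (1 / 2)%R in hu by (field; lra). lra.
  - apply cderive_const. }
 intros s hs.
 assert (E : f s = f 0%R).
 { destruct hs as [hs | <-]; [| reflexivity]. symmetry.
  apply (eq_is_derive (V := C_R_NormedModule) f); [| exact hs]. cc. }
 unfold f in E. rewrite Rabs_R0, Rabs_pos_eq in E by exact hs. exact E.
Qed.

Lemma path_Im_bounded g : (forall s, ccont g s) ->
 exists M, 0 < M /\ forall t, on_path g t -> Rabs (Im t) <= M.
Proof.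
 intros Hg. destruct (ccont_bounded g 0 1 Hg) as [M [hM H]]. exists M. split; [exact hM |].
 intros t [r [hr ->]]. eapply Rle_trans; [apply Cmod_Im | auto].
Qed.

Lemma joined_to_avoided_all g w e : joined_to g w e ->
 exists c : R -> C, (forall s, ccont c s) /\ c 0%R = w /\ is_lim (fun s => Im (c s)) p_infty e /\
  forall s, 0 <= s -> avoided g (c s).
Proof.
 intros [c [Hc [H0 [Hl H]]]]. exists c. repeat split; auto.
 intros s hs t [r [hr ->]]. apply avoids_iff. intros m E.
 apply (H s r (- m)%Z hs hr). rewrite E, opp_IZR, RtoC_opp. ring.
Qed.

Lemma exp_decay_small (eps : R) : 0 < eps -> exists L : R, 0 < L /\
 forall x, L <= x -> exp (- (2 * PI * x)) < eps.
Proof.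
 intro he. exists (Rmax 1 (/ eps)). split.
 - apply Rlt_le_trans with 1%R; [lra | apply Rmax_l].
 - intros x hx. assert (h1 : 1 <= x) by (eapply Rle_trans; [apply Rmax_l | exact hx]).
  assert (h2 : / eps <= x) by (eapply Rle_trans; [apply Rmax_r | exact hx]).
  rewrite exp_Ropp. rewrite <- (Rinv_inv eps).
  assert (h3 := exp_ineq1_le (2 * PI * x)). assert (h4 := PI2_1). unfold PI2 in h4.
  assert (hi := Rinv_0_lt_compat _ he).
  apply Rinv_lt_contravar; [apply Rmult_lt_0_compat; [exact hi | apply exp_pos] |].
  nra.
Qed.

(** The integral is constant while the pole slides along the joining curve towards Im = -oo, where
    [geomX] tends to 1 uniformly on the path; and the integral of 1 is 1. *)
Lemma winding_lower g dg w : period_path g dg -> passes_above g w -> pint g dg (geomX w) = 1.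
Proof.
 intros P H. apply joined_to_avoided_all in H. destruct H as [c [Hc [H0 [Hl Ha]]]].
 assert (Hgc := period_path_cont _ _ P).
 destruct (path_Im_bounded g Hgc) as [M [hM HM]].
 destruct (pint_le g dg P) as [L [hL HL]].
 rewrite <- H0. clear w H0.
 apply Ceq_minus. apply NNPP. intro hne. apply Cmod_gt_0 in hne.
 set (z := pint g dg (geomX (c 0%R)) - 1) in *.
 (* On the path [geomX - 1] is at most 2 eps and [L] is the constant of [pint_le]; the 4 makes 2 eps
    L at most half of [Cmod z], a contradiction. *)
 set (eps := Rmin (1 / 2) (Cmod z / (4 * L))).
 assert (heps : 0 < eps).
 { apply Rmin_glb_lt; [lra |]. apply Rdiv_lt_0_compat; lra. }
 destruct (exp_decay_small eps heps) as [D [hD HD]].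
 destruct (proj2 (is_lim_spec _ _ _) Hl (- M - D)%R) as [s0 Hs0].
 set (s := (Rmax 0 s0 + 1)%R).
 assert (hs : 0 <= s) by (unfold s; generalize (Rmax_l 0 s0); lra).
 assert (hs0 : s0 < s) by (unfold s; generalize (Rmax_r 0 s0); lra).
 specialize (Hs0 s hs0). simpl in Hs0.
 assert (E := winding_joined g dg c P Hc Ha s hs).
 assert (Has := Ha s hs).
 assert (HX := avoided_cont _ _ Hgc Has).
 assert (Ez : z = pint g dg (fun t => geomX (c s) t - 1)).
 { unfold z. rewrite pint_minus, pint_1, E; auto. cc. }
 assert (Hb : Cmod z <= 2 * eps * L).
 { rewrite Ez. apply HL.
  - cc.
  - intros t ht. rewrite <- geomX_eq by now apply Has.
   assert (hA : Cmod (e2pi (t - c s)) < eps).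
   { rewrite Cmod_e2pi. apply HD. rewrite Im_minus. specialize (HM t ht).
    apply Rabs_le_between in HM. lra. }
   assert (eps <= 1 / 2)%R by apply Rmin_l.
   assert (h := Cmod_one_minus (e2pi (t - c s)) ltac:(lra)).
   rewrite Cmod_mult. unfold geomX. rewrite Cmod_inv by now apply Has.
   assert (/ Cmod (1 - e2pi (t - c s)) <= 2)%R.
   { recast (/ (1 / 2))%R by field. apply Rinv_le_contravar; lra. }
   rewrite Rmult_comm. apply Rmult_le_compat; try lra; [| apply Cmod_ge_0].
   left. apply Rinv_0_lt_compat. lra. }
 assert (eps <= Cmod z / (4 * L))%R by apply Rmin_r.
 assert (2 * eps * L <= 2 * (Cmod z / (4 * L)) * L)%R.
 { nra. }
 recast (Cmod z / 2)%R in * by (field; lra). lra.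
Qed.

(** As for poles below, except that the pole escapes to Im = +oo, where [geomX] tends to 0. *)
Lemma winding_upper g dg w : period_path g dg -> passes_below g w -> pint g dg (geomX w) = 0.
Proof.
 intros P H. apply joined_to_avoided_all in H. destruct H as [c [Hc [H0 [Hl Ha]]]].
 assert (Hgc := period_path_cont _ _ P).
 destruct (path_Im_bounded g Hgc) as [M [hM HM]].
 destruct (pint_le g dg P) as [L [hL HL]].
 rewrite <- H0. clear w H0.
 apply NNPP. intro hne. apply Cmod_gt_0 in hne.
 set (z := pint g dg (geomX (c 0%R))) in *.
 set (eps := Rmin (1 / 2) (Cmod z / (4 * L))).
 assert (heps : 0 < eps).
 { apply Rmin_glb_lt; [lra |]. apply Rdiv_lt_0_compat; lra. }
 destruct (exp_decay_small eps heps) as [D [hD HD]].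
 destruct (proj2 (is_lim_spec _ _ _) Hl (M + D)%R) as [s0 Hs0].
 set (s := (Rmax 0 s0 + 1)%R).
 assert (hs : 0 <= s) by (unfold s; generalize (Rmax_l 0 s0); lra).
 assert (hs0 : s0 < s) by (unfold s; generalize (Rmax_r 0 s0); lra).
 specialize (Hs0 s hs0). simpl in Hs0.
 assert (E := winding_joined g dg c P Hc Ha s hs).
 assert (Has := Ha s hs).
 assert (HX := avoided_cont _ _ Hgc Has).
 assert (Hb : Cmod z <= 2 * eps * L).
 { unfold z. rewrite <- E. apply HL; [exact HX |]. intros t ht.
  assert (hA : Cmod (e2pi (c s - t)) < eps).
  { rewrite Cmod_e2pi. apply HD. rewrite Im_minus. specialize (HM t ht).
   apply Rabs_le_between in HM. lra. }
  assert (eps <= 1 / 2)%R by apply Rmin_l.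
  assert (h := Cmod_one_minus (e2pi (c s - t)) ltac:(lra)).
  assert (hn : 1 - e2pi (c s - t) <> 0) by (intro E0; rewrite E0, Cmod_0 in h; lra).
  assert (Eg : geomX (c s) t = - (e2pi (c s - t) * / (1 - e2pi (c s - t)))).
  { unfold geomX. recast (- (c s - t)). rewrite e2pi_opp.
   assert (hz := e2pi_neq_0 (c s - t)). field. split; [exact hn | split; [exact hz |]].
   intro E0. apply hn. recast (- (e2pi (c s - t) - 1)).
   rewrite E0. ring. }
  rewrite Eg, Cmod_opp, Cmod_mult, Cmod_inv by exact hn.
  assert (/ Cmod (1 - e2pi (c s - t)) <= 2)%R.
  { recast (/ (1 / 2))%R by field. apply Rinv_le_contravar; lra. }
  rewrite Rmult_comm. apply Rmult_le_compat; try lra; [| apply Cmod_ge_0].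
  left. apply Rinv_0_lt_compat. lra. }
 assert (eps <= Cmod z / (4 * L))%R by apply Rmin_r.
 assert (2 * eps * L <= 2 * (Cmod z / (4 * L)) * L)%R.
 { nra. }
 recast (Cmod z / 2)%R in * by (field; lra). lra.
Qed.

Definition same_side (g1 g2 : R -> C) (w : C) : Prop :=
 (passes_above g1 w /\ passes_above g2 w) \/ (passes_below g1 w /\ passes_below g2 w).

Lemma same_side_avoided g1 g2 w : same_side g1 g2 w -> avoided g1 w /\ avoided g2 w.
Proof. intros [[h1 h2] | [h1 h2]]; split; eapply joined_avoided; eassumption. Qed.

Lemma geomXs_repeat w n t : geomXs (repeat w n) t = Cpow (geomX w t) n.
Proof. induction n as [| n IH]; simpl; [reflexivity | now rewrite IH]. Qed.

(** X^(k+2) - X^(k+1) = X (X - 1) X^k is an exact derivative, so all positive powers of X have the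
    integral of X. *)
Lemma pint_geomX_pow g dg w k : period_path g dg -> avoided g w ->
 pint g dg (fun t => Cpow (geomX w t) (S k)) = pint g dg (geomX w).
Proof.
 intros P Ha. assert (HX := avoided_cont _ _ (period_path_cont _ _ P) Ha).
 induction k as [| k IH].
 - apply pint_ext. intros; ring.
 - rewrite <- IH. rewrite <- (Cplus_0_r (pint g dg (fun t => Cpow _ (S k)))).
  rewrite <- (pint_geomX_exact g dg w 0 k P Ha).
  rewrite <- pint_plus; auto.
  + apply pint_ext. intros t _. rewrite !Cpow_S.
   recast (geomX w t). ring.
  + cc.
  + cc.
Qed.

Lemma Kgood_on_paths S g1 g2 : (forall s, ccont g1 s) -> (forall s, ccont g2 s) ->
 (forall w, S w -> avoided g1 w /\ avoided g2 w) ->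
 Kgood S (fun t => on_path g1 t \/ on_path g2 t).
Proof.
 intros H1 H2 Ha. split.
 - destruct (path_Im_bounded g1 H1) as [M1 [h1 B1]]. destruct (path_Im_bounded g2 H2) as [M2 [h2 B2]].
  exists (M1 + M2)%R. intros t [ht | ht]; [generalize (B1 t ht) | generalize (B2 t ht)]; lra.
 - intros w hw. destruct (Ha w hw) as [a1 a2].
  assert (L : forall g, (forall s, ccont g s) -> avoided g w ->
       exists d, 0 < d /\ forall t, on_path g t -> d <= Cmod (1 - e2pi (t - w))).
  { intros g Hg ha. destruct (ccont_lower_bound (fun s => 1 - e2pi (g s - w)) 0 1) as [d [hd Hd]].
   - cc.
   - intros x hx. apply ha. exists x; auto.
   - exists d. split; [exact hd |]. intros t [r [hr ->]]. now apply Hd. }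
  destruct (L g1 H1 a1) as [d1 [hd1 D1]]. destruct (L g2 H2 a2) as [d2 [hd2 D2]].
  exists (Rmin d1 d2). split; [now apply Rmin_glb_lt |].
  intros t [ht | ht].
  + eapply Rle_trans; [apply Rmin_l | now apply D1].
  + eapply Rle_trans; [apply Rmin_r | now apply D2].
Qed.

(** The difference of the two integrals is a functional in the sense of [Rat_functional]. It
    vanishes on e(I t), and on pole powers because equal sides give equal winding numbers. *)
Lemma pint_Rat_indep S g1 dg1 g2 dg2 f : period_path g1 dg1 -> period_path g2 dg2 ->
 (forall w, S w -> same_side g1 g2 w) -> Rat S f -> pint g1 dg1 f = pint g2 dg2 f.
Proof.
 intros P1 P2 HS Hf.
 assert (Hc1 := period_path_cont _ _ P1). assert (Hc2 := period_path_cont _ _ P2).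
 assert (Hav : forall w, S w -> avoided g1 w /\ avoided g2 w) by (intros w hw; now apply same_side_avoided, HS).
 assert (Hp1 : forall f, Rat S f -> pcont g1 f).
 { intros h Hh. apply (pcont_Rat g1 S); auto. intros t w ht hw. destruct (Hav w hw); auto. }
 assert (Hp2 : forall f, Rat S f -> pcont g2 f).
 { intros h Hh. apply (pcont_Rat g2 S); auto. intros t w ht hw. destruct (Hav w hw); auto. }
 apply Ceq_minus.
 apply (Rat_functional S (fun t => on_path g1 t \/ on_path g2 t) (fun f => pint g1 dg1 f - pint g2 dg2 f)).
 - intros t w [ht | ht] hw; destruct (Hav w hw); auto.
 - intros h1 h2 H. rewrite (pint_ext g1 dg1 h1 h2), (pint_ext g2 dg2 h1 h2); auto.
 - intros c h Hh. rewrite !pint_scal; auto. ring.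
 - intros h1 h2 Hh1 Hh2. rewrite !pint_plus; auto. ring.
 - intro I.
  assert (E : forall g dg, period_path g dg -> pint g dg (ratmono I nil) = if Z.eq_dec I 0 then 1 else 0).
  { intros g dg P. rewrite <- (pint_e2pi g dg I P). apply pint_ext. intros t _.
   unfold ratmono. simpl. ring. }
  rewrite !E by assumption. ring.
 - intros w k hw. exists 0%Z.
  assert (E : forall g dg, period_path g dg -> avoided g w ->
       pint g dg (ratmono 0 (repeat w (Datatypes.S k))) = pint g dg (geomX w)).
  { intros g dg P Ha. rewrite <- (pint_geomX_pow g dg w k P Ha). apply pint_ext. intros t _.
   unfold ratmono. rewrite geomXs_repeat, Cmult_0_l, e2pi_0. ring. }
  destruct (Hav w hw) as [a1 a2]. rewrite !E by assumption.
  destruct (HS w hw) as [[h1 h2] | [h1 h2]].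
  + rewrite !winding_lower by assumption. ring.
  + rewrite !winding_upper by assumption. ring.
 - exact Hf.
Qed.

Lemma eq_of_Cmod_small (x y : C) (M : R) :
 (forall eps : R, 0 < eps -> Cmod (x - y) <= M * eps) -> x = y.
Proof.
 intro H. apply Ceq_minus. apply NNPP. intro hne. apply Cmod_gt_0 in hne.
 assert (hM : 0 < M) by (specialize (H 1%R Rlt_0_1); lra).
 assert (h := H (Cmod (x - y) / (2 * M))%R ltac:(apply Rdiv_lt_0_compat; lra)).
 recast (Cmod (x - y) / 2)%R in h by (field; lra). lra.
Qed.

(** Cauchy's theorem without homotopies: the paths are compared only through the side on which each
    pole lies. The error of a rational approximant is controlled by the constants of the two
    paths. *)
Theorem pint_indep S K g1 dg1 g2 dg2 f : period_path g1 dg1 -> period_path g2 dg2 ->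
 (forall w, S w -> same_side g1 g2 w) -> Kgood S K ->
 (forall t, on_path g1 t -> K t) -> (forall t, on_path g2 t -> K t) ->
 RatLim S K f -> pint g1 dg1 f = pint g2 dg2 f.
Proof.
 intros P1 P2 HS HK K1 K2 Hf.
 assert (Hc1 := period_path_cont _ _ P1). assert (Hc2 := period_path_cont _ _ P2).
 destruct (pint_le g1 dg1 P1) as [L1 [hL1 B1]]. destruct (pint_le g2 dg2 P2) as [L2 [hL2 B2]].
 assert (f1 := pcont_RatLim g1 S K f Hc1 K1 HK Hf).
 assert (f2 := pcont_RatLim g2 S K f Hc2 K2 HK Hf).
 apply (eq_of_Cmod_small _ _ (L1 + L2)). intros eps he.
 destruct (Hf eps he) as [r [Hr h]].
 assert (r1 := pcont_RatLim g1 S K r Hc1 K1 HK (RatLim_Rat _ _ _ Hr)).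
 assert (r2 := pcont_RatLim g2 S K r Hc2 K2 HK (RatLim_Rat _ _ _ Hr)).
 replace (pint g1 dg1 f - pint g2 dg2 f) with
  (pint g1 dg1 (fun t => f t - r t) - pint g2 dg2 (fun t => f t - r t)).
 - unfold Cminus at 1. eapply Rle_trans; [apply Cmod_triangle |]. rewrite Cmod_opp.
  assert (Cmod (pint g1 dg1 (fun t => (f t - r t)%C)) <= eps * L1)%R.
  { apply B1; [cc |]. intros t ht. left. apply h; auto. }
  assert (Cmod (pint g2 dg2 (fun t => (f t - r t)%C)) <= eps * L2)%R.
  { apply B2; [cc |]. intros t ht. left. apply h; auto. }
  lra.
 - rewrite !pint_minus by assumption.
  rewrite (pint_Rat_indep S g1 dg1 g2 dg2 r) by assumption. ring.
Qed.

(** Algebraic form of a removable singularity: r - r(w) may be divided by 1 - e(t - w) without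
    leaving the rational functions with poles in [S]. *)
Definition divisible_at (S : C -> Prop) (w : C) (r : C -> C) : Prop :=
 Rat S r /\ exists r', Rat S r' /\ forall t, avoids t w -> (forall v, S v -> avoids t v) -> (r t - r w) * geomX w t = r' t.

Lemma divisible_mult S w f h : divisible_at S w f -> divisible_at S w h -> divisible_at S w (fun t => f t * h t).
Proof.
 intros [Rf [f' [Rf' Ef]]] [Rh [h' [Rh' Eh]]]. split; [now apply Rat_mult |].
 exists (fun t => h t * f' t + f w * h' t). split.
 - apply Rat_plus; [now apply Rat_mult | now apply Rat_scal].
 - intros t h1 h2. rewrite <- Ef, <- Eh by assumption. ring.
Qed.

Lemma divisible_e2pi S w (I : Z) : divisible_at S w (fun t => e2pi (IZR I * t)).
Proof.
 assert (H1 : divisible_at S w (fun t => e2pi (IZR 1 * t))).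
 { split; [apply Rat_e2pi |]. exists (fun _ => - e2pi w). split; [apply Rat_const |]. intros t h _.
  recast (t - w + w) by (simpl; ring). recast w by (simpl; ring).
  unfold avoids in h. unfold geomX. rewrite e2pi_plus. field. exact h. }
 assert (H2 : divisible_at S w (fun t => e2pi (IZR (-1) * t))).
 { split; [apply Rat_e2pi |]. exists (fun t => e2pi (IZR (-1) * t)). split; [apply Rat_e2pi |]. intros t h _.
  recast (IZR (-1) * t + (t - w)) by (simpl; ring).
  unfold avoids in h. unfold geomX. rewrite e2pi_plus. field. exact h. }
 assert (G : forall (f : C -> C) (n : nat), divisible_at S w f -> divisible_at S w (fun t => Cpow (f t) n)).
 { intros f n hf. induction n as [| n IH]; simpl.
  - split; [apply Rat_const |]. exists (fun _ => 0). split; [apply Rat_const |]. intros; ring.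
  - now apply divisible_mult. }
 assert (E : forall J : Z, forall n : nat, (fun t => Cpow (e2pi (IZR J * t)) n) = fun t => e2pi (IZR (J * Z.of_nat n) * t)).
 { intros J n. apply functional_extensionality. intro t. induction n as [| n IH].
  - rewrite Z.mul_0_r. simpl. recast (RtoC 0). now rewrite e2pi_0.
  - rewrite Nat2Z.inj_succ, Z.mul_succ_r, plus_IZR, RtoC_plus. simpl. rewrite IH, <- e2pi_plus. f_equal. ring. }
 destruct (Z_le_gt_dec 0 I) as [h | h].
 - assert (H := G _ (Z.to_nat I) H1). cbv beta in H. rewrite E, Z2Nat.id, Z.mul_1_l in H by exact h. exact H.
 - assert (H := G _ (Z.to_nat (- I)) H2). cbv beta in H. rewrite E, Z2Nat.id in H by lia.
  recast I in H. exact H.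
Qed.

Lemma Rat_divisible S w r : (forall v, S v -> avoids w v) -> Rat S r -> divisible_at S w r.
Proof.
 intros Hw Hr. induction Hr as [I W HW | c f Hf [_ [f' [H1 H2]]] | f h Hf [_ [f' [H1 H2]]] Hh [_ [h' [H3 H4]]]].
 - unfold ratmono. apply divisible_mult; [apply divisible_e2pi |].
  induction HW as [| v W hv HW IH].
  + split; [apply (Rat_const S 1) |]. exists (fun _ => 0). split; [apply Rat_const |]. intros; simpl; ring.
  + apply (divisible_mult S w (geomX v) (geomXs W)); [| exact IH]. split; [now apply Rat_geomX |].
   exists (fun t => - e2pi (w - v) * geomX v w * geomX v t). split; [now apply Rat_scal, Rat_geomX |].
   intros t h1 h2. specialize (h2 v hv). specialize (Hw v hv). unfold avoids, geomX in *.
   recast (t - w + (w - v)) in *. rewrite e2pi_plus in *. field. cc.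
 - split; [now apply Rat_scal |]. exists (fun t => c * f' t). split; [now apply Rat_scal |].
  intros t h1 h2. rewrite <- H2 by assumption. ring.
 - split; [now apply Rat_plus |]. exists (fun t => f' t + h' t). split; [now apply Rat_plus |].
  intros t h1 h2. rewrite <- H2, <- H4 by assumption. ring.
Qed.

(* Off the pole [w] the quotient (f - f(w)) / (1 - e(t - w)) has no new pole, so only the winding numbers
  of [w] are seen. *)
Theorem pint_residue S K g1 dg1 g2 dg2 f w : period_path g1 dg1 -> period_path g2 dg2 ->
 (forall v, S v -> same_side g1 g2 v) -> Kgood S K ->
 (forall t, on_path g1 t -> K t) -> (forall t, on_path g2 t -> K t) -> K w ->
 passes_above g1 w -> passes_below g2 w -> RatLim S K f ->
 pint g1 dg1 (fun t => f t * geomX w t) - pint g2 dg2 (fun t => f t * geomX w t) = f w.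
Proof.
 intros P1 P2 HS HK K1 K2 Kw A1 A2 Hf.
 assert (c1 := period_path_cont _ _ P1). assert (c2 := period_path_cont _ _ P2).
 assert (a1 := joined_avoided _ _ _ A1). assert (a2 := joined_avoided _ _ _ A2).
 destruct (avoided_bound g1 w c1 a1) as [M1 [hM1 HM1]]. destruct (avoided_bound g2 w c2 a2) as [M2 [hM2 HM2]].
 set (K' := fun t => on_path g1 t \/ on_path g2 t).
 assert (HK' : Kgood S K').
 { apply Kgood_on_paths; auto. intros v hv. now apply same_side_avoided, HS. }
 set (h := fun t => (f t - f w) * geomX w t).
 (* The quotient formed from a rational approximant is again rational with poles in [S]. Dividing
    amplifies the error at most by the bound [M] of [geomX w] on the paths; [K w] is what lets r(w)
    approximate f(w). *)
 assert (Hh : RatLim S K' h).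
 { intros eps he. set (M := (M1 + M2)%R).
  destruct (Hf (eps / (2 * M))%R) as [r [Rr Er]]; [apply Rdiv_lt_0_compat; unfold M; lra |].
  destruct (Rat_divisible S w r (fun v hv => Kgood_avoids S K w v HK Kw hv) Rr) as [_ [r' [Rr' Er']]].
  exists r'. split; [exact Rr' |]. intros t ht.
  assert (hX : Cmod (geomX w t) <= M).
  { unfold M. destruct ht as [ht | ht]; [specialize (HM1 t ht) | specialize (HM2 t ht)]; lra. }
  assert (Kt : K t) by (destruct ht; auto).
  rewrite <- Er'.
  - unfold h. recast (((f t - r t) + - (f w - r w)) * geomX w t).
   rewrite Cmod_mult. assert (t1 := Cmod_triangle (f t - r t) (- (f w - r w))). rewrite Cmod_opp in t1.
   assert (b1 := Er t Kt). assert (b2 := Er w Kw). set (e := (eps / (2 * M))%R) in *.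
   assert (E : (2 * e * M = eps)%R) by (unfold e; field; unfold M; lra). rewrite <- E.
   assert (hp := Cmod_ge_0 (geomX w t)).
   apply Rle_lt_trans with (Cmod (f t - r t + - (f w - r w)) * M)%R; [apply Rmult_le_compat_l; [apply Cmod_ge_0 | exact hX] |].
   apply Rmult_lt_compat_r; [unfold M; lra | lra].
  - destruct ht; auto.
  - intros v hv. exact (Kgood_avoids S K t v HK Kt hv). }
 assert (I := pint_indep S K' g1 dg1 g2 dg2 h P1 P2 HS HK' (fun t q => or_introl q) (fun t q => or_intror q) Hh).
 assert (E : forall g dg, period_path g dg -> (forall t, on_path g t -> K' t) -> avoided g w ->
  pint g dg (fun t => f t * geomX w t) = pint g dg h + f w * pint g dg (geomX w)).
 { intros g dg P HP av. assert (cg := period_path_cont _ _ P). assert (X := avoided_cont _ _ cg av).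
  rewrite <- pint_scal by assumption.
  rewrite <- pint_plus; [| exact P | now apply (pcont_RatLim g S K') | apply pcont_mult; [apply pcont_const | exact X]].
  apply pint_ext. intros. unfold h. ring. }
 rewrite (E g1 dg1), (E g2 dg2), I, (winding_lower g1), (winding_upper g2); unfold K'; auto. ring.
Qed.

(** * Limits of complex sequences *)

Definition Clim_to (a : nat -> C) (l : C) : Prop :=
 filterlim a eventually (locally (T := C_UniformSpace) l).

Definition Clim (a : nat -> C) : C := iota (T := C_R_CompleteNormedModule) (fun l => Clim_to a l).

Lemma Clim_to_eps a l :
 Clim_to a l <-> forall eps : R, 0 < eps -> exists N, forall n, (N <= n)%nat -> Cmod (a n - l) < eps.
Proof.
 split.
 - intros H eps he.
  assert (he2 : 0 < eps / 2) by lra.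
  destruct (H (fun y => ball (M := C_UniformSpace) l (mkposreal _ he2) y) (locally_ball _ _)) as [N HN].
  exists N. intros n hn. specialize (HN n hn).
  apply C_NormedModule_mixin_compat2 in HN. simpl in HN.
  change (minus (a n) l) with (a n - l) in HN.
  assert (sqrt 2 <= 2)%R. { rewrite <- (sqrt_square 2) at 2 by lra. apply sqrt_le_1; lra. }
  nra.
 - intros H P [eps hP]. destruct (H eps (cond_pos eps)) as [N HN]. exists N. intros n hn.
  apply hP. apply C_NormedModule_mixin_compat1. cc.
Qed.

Lemma Clim_to_unique a l m : Clim_to a l -> Clim_to a m -> l = m.
Proof. apply (filterlim_locally_unique (V := C_R_NormedModule) a). Qed.

Lemma Clim_eq a l : Clim_to a l -> Clim a = l.
Proof.
 intro H. apply (Clim_to_unique a); [| exact H].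
 apply (iota_correct (V := C_R_CompleteNormedModule) (fun l => Clim_to a l)).
 exists l. split; [exact H |]. intros m Hm. now apply (Clim_to_unique a).
Qed.

Lemma Clim_to_ext a b l : (forall n, a n = b n) -> Clim_to a l -> Clim_to b l.
Proof. intro H. apply filterlim_ext. exact H. Qed.

Lemma Clim_to_const c : Clim_to (fun _ => c) c.
Proof. apply filterlim_const. Qed.

Lemma Clim_to_S a l : Clim_to a l -> Clim_to (fun n => a (S n)) l.
Proof.
 intro H. apply Clim_to_eps. intros eps he. destruct (proj1 (Clim_to_eps _ _) H eps he) as [N HN].
 exists N. cc.
Qed.

Lemma Clim_to_mult a b l m : Clim_to a l -> Clim_to b m -> Clim_to (fun n => a n * b n) (l * m).
Proof.
 intros Ha Hb. apply Clim_to_eps. intros eps he.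
 assert (Ha' := proj1 (Clim_to_eps _ _) Ha). assert (Hb' := proj1 (Clim_to_eps _ _) Hb).
 set (M := (Cmod m + 1)%R). set (L := (Cmod l + 1)%R).
 assert (hM : 0 < M) by (unfold M; generalize (Cmod_ge_0 m); lra).
 assert (hL : 0 < L) by (unfold L; generalize (Cmod_ge_0 l); lra).
 destruct (Ha' (eps / (2 * M))%R) as [N1 H1]; [apply Rdiv_lt_0_compat; lra |].
 destruct (Hb' (Rmin 1 (eps / (2 * L)))%R) as [N2 H2].
 { apply Rmin_glb_lt; [lra | apply Rdiv_lt_0_compat; lra]. }
 exists (Nat.max N1 N2). intros n hn.
 specialize (H1 n ltac:(lia)). specialize (H2 n ltac:(lia)).
 assert (H3 : Cmod (b n - m) < 1) by (eapply Rlt_le_trans; [exact H2 | apply Rmin_l]).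
 assert (H4 : Cmod (b n - m) < eps / (2 * L)) by (eapply Rlt_le_trans; [exact H2 | apply Rmin_r]).
 assert (H5 : Cmod (b n) <= M).
 { unfold M. recast ((b n - m) + m).
  eapply Rle_trans; [apply Cmod_triangle | lra]. }
 recast ((a n - l) * b n + l * (b n - m)).
 eapply Rle_lt_trans; [apply Cmod_triangle |]. rewrite !Cmod_mult.
 assert (Cmod (a n - l) * Cmod (b n) <= Cmod (a n - l) * M)%R
  by (apply Rmult_le_compat_l; [apply Cmod_ge_0 | exact H5]).
 assert (Cmod (a n - l) * M < eps / (2 * M) * M)%R by (apply Rmult_lt_compat_r; lra).
 assert (Cmod l * Cmod (b n - m) <= L * Cmod (b n - m))%R
  by (apply Rmult_le_compat_r; [apply Cmod_ge_0 | unfold L; lra]).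
 assert (L * Cmod (b n - m) < L * (eps / (2 * L)))%R by (apply Rmult_lt_compat_l; lra).
 recast (eps / 2)%R in * by (field; lra).
 recast (eps / 2)%R in * by (field; lra). lra.
Qed.

Lemma Clim_to_le a l M : Clim_to a l -> (forall n, Cmod (a n) <= M) -> Cmod l <= M.
Proof.
 intros H HM. apply Rnot_lt_le. intro hlt.
 destruct (proj1 (Clim_to_eps _ _) H (Cmod l - M)%R ltac:(lra)) as [N HN].
 specialize (HN N (Nat.le_refl _)). specialize (HM N). rewrite Cmod_minus_sym in HN.
 generalize (Cmod_triang_inv l (a N)). lra.
Qed.

Lemma Clim_to_minus_const a l c : Clim_to a l -> Clim_to (fun n => a n - c) (l - c).
Proof.
 intro H. apply Clim_to_eps. intros eps he. destruct (proj1 (Clim_to_eps _ _) H eps he) as [N HN].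
 exists N. intros n hn. recast (a n - l). now apply HN.
Qed.

Lemma geom_cauchy (a : nat -> C) (M r : R) : (0 <= r < 1)%R -> 0 <= M ->
 (forall n, Cmod (a (S n) - a n) <= M * r ^ n) ->
 exists l, Clim_to a l /\ forall n, Cmod (l - a n) <= M / (1 - r) * r ^ n.
Proof.
 intros hr hM H.
 assert (T : forall n k, Cmod (a (n + k)%nat - a n) <= M / (1 - r) * r ^ n * (1 - r ^ k)).
 { intros n k. induction k as [| k IH].
  - rewrite Nat.add_0_r. recast (RtoC 0). rewrite Cmod_0. simpl. lra.
  - recast (S (n + k)) by lia.
   recast ((a (S (n + k)) - a (n + k)%nat) + (a (n + k)%nat - a n)).
   eapply Rle_trans; [apply Cmod_triangle |]. specialize (H (n + k)%nat).
   rewrite pow_add in H. simpl pow.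
   recast (M * (r ^ n * r ^ k) + M / (1 - r) * r ^ n * (1 - r ^ k))%R by (field; lra). lra. }
 assert (T' : forall n k, Cmod (a (n + k)%nat - a n) <= M / (1 - r) * r ^ n).
 { intros n k. eapply Rle_trans; [apply T |].
  assert (0 <= r ^ k)%R by (apply pow_le; lra). assert (0 <= r ^ n)%R by (apply pow_le; lra).
  assert (0 <= M / (1 - r))%R by (apply Rdiv_le_0_compat; lra).
  assert (0 <= M / (1 - r) * r ^ n)%R by now apply Rmult_le_pos. nra. }
 assert (Hc : exists l : C_R_CompleteNormedModule, filterlim a eventually (locally l)).
 { apply (proj1 (filterlim_locally_cauchy (U := C_R_CompleteNormedModule) (F := eventually) a)). intro eps.
  destruct (pow_lt_1_zero r ltac:(rewrite Rabs_pos_eq; lra) (eps / (2 * (M / (1 - r) + 1)))%R) as [N HN].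
  { assert (0 <= M / (1 - r))%R by (apply Rdiv_le_0_compat; lra).
   apply Rdiv_lt_0_compat; [apply cond_pos | lra]. }
  exists (fun n => (N <= n)%nat). split; [now exists N |].
  assert (HN' : forall n, (N <= n)%nat -> Cmod (a n - a N) < eps / 2).
  { intros n hn. recast (N + (n - N))%nat by lia.
   eapply Rle_lt_trans; [apply T' |]. specialize (HN N (Nat.le_refl _)).
   assert (h0 : 0 <= M / (1 - r)) by (apply Rdiv_le_0_compat; lra).
   assert (h1 : 0 <= r ^ N) by (apply pow_le; lra).
   rewrite Rabs_pos_eq in HN by exact h1.
   apply (Rmult_lt_compat_l (M / (1 - r) + 1)) in HN; [| lra].
   recast (eps / 2)%R in HN by (field; split; [lra |]; intro E; apply (f_equal (fun x => x / (1 - r)))%R in E;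
      replace ((M + (1 - r)) / (1 - r))%R with (M / (1 - r) + 1)%R in E by (field; lra); lra).
   nra. }
  intros n m hn hm. apply C_NormedModule_mixin_compat1.
  change (minus (a m) (a n)) with (a m - a n).
  recast ((a m - a N) + - (a n - a N)).
  eapply Rle_lt_trans; [apply Cmod_triangle |]. rewrite Cmod_opp.
  generalize (HN' n hn) (HN' m hm). lra. }
 destruct Hc as [l Hl]. exists l. split; [exact Hl |]. intro n.
 apply (Clim_to_le (fun k => a (n + k)%nat - a n)).
 - apply Clim_to_minus_const. apply Clim_to_eps. intros eps he.
  destruct (proj1 (Clim_to_eps _ _) Hl eps he) as [N HN]. exists N. intros k hk. apply HN. lia.
 - apply T'.
Qed.

(** * Infinite products *)
Fixpoint prodn (f : nat -> C) (n : nat) : C :=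
 match n with O => f O | S m => prodn f m * f (S m) end.

Lemma prodn_ext f g n : (forall i, (i <= n)%nat -> f i = g i) -> prodn f n = prodn g n.
Proof. induction n as [| n IH]; intro H; simpl; [apply H; lia |]. rewrite IH, H; auto. Qed.

Lemma prodn_mult f g n : prodn (fun i => f i * g i) n = prodn f n * prodn g n.
Proof. induction n as [| n IH]; simpl; [reflexivity | rewrite IH; ring]. Qed.

Lemma prodn_shift f n : prodn f (S n) = f O * prodn (fun i => f (S i)) n.
Proof. induction n as [| n IH]; [reflexivity |]. simpl in *. rewrite IH. ring. Qed.

Lemma prodn_inv (f : nat -> C) n : (forall i, (i <= n)%nat -> f i <> 0) -> prodn (fun i => / f i) n = / prodn f n /\ prodn f n <> 0.
Proof.
 induction n as [| n IH]; intro H; simpl; [split; [reflexivity | apply H; lia] |].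
 destruct IH as [IH1 IH2]; [intros; apply H; lia |].
 assert (f (S n) <> 0) by (apply H; lia).
 rewrite IH1. split; [field; auto | now apply Cmult_neq_0].
Qed.

Lemma prodn_swap (f : nat -> nat -> C) n m :
 prodn (fun i => prodn (fun j => f i j) m) n = prodn (fun j => prodn (fun i => f i j) n) m.
Proof.
 induction n as [| n IH]; simpl; [apply prodn_ext; reflexivity |].
 rewrite IH, <- prodn_mult. reflexivity.
Qed.

(** Measuring the distance to 1 by exp(a) - 1 makes the exponents add under products, so infinite
    products are estimated by summing geometric series. *)
Lemma expm1_mult x y a b : Cmod (x - 1) <= exp a - 1 -> Cmod (y - 1) <= exp b - 1 ->
 Cmod (x * y - 1) <= exp (a + b) - 1.
Proof.
 intros Hx Hy. recast ((x - 1) * (y - 1) + ((x - 1) + (y - 1))).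
 eapply Rle_trans; [apply Cmod_triangle |].
 eapply Rle_trans; [apply Rplus_le_compat_l, Cmod_triangle |].
 rewrite Cmod_mult, exp_plus.
 assert (h1 := Cmod_ge_0 (x - 1)). assert (h2 := Cmod_ge_0 (y - 1)). nra.
Qed.

Lemma expm1_le x a : Cmod (x - 1) <= a -> Cmod (x - 1) <= exp a - 1.
Proof. intro h. generalize (exp_ineq1_le a). lra. Qed.

Lemma prodn_near_1 f (R0 r : R) n : (0 <= r < 1)%R -> 0 <= R0 ->
 (forall i, Cmod (f i - 1) <= exp (R0 * r ^ i) - 1) ->
 Cmod (prodn f n - 1) <= exp (R0 / (1 - r)) - 1.
Proof.
 intros hr hR H.
 assert (G : Cmod (prodn f n - 1) <= exp (R0 / (1 - r) * (1 - r ^ S n)) - 1).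
 { induction n as [| n IH].
  - simpl prodn. recast (R0 * r ^ 0)%R by (simpl; field; lra). apply H.
  - simpl prodn.
   recast (R0 / (1 - r) * (1 - r ^ S n) + R0 * r ^ S n)%R by (simpl; field; lra).
   now apply expm1_mult. }
 eapply Rle_trans; [exact G |]. apply Rplus_le_compat_r, exp_le.
 assert (0 <= r ^ S n)%R by (apply pow_le; lra).
 assert (0 <= R0 / (1 - r))%R by (apply Rdiv_le_0_compat; lra). nra.
Qed.

Lemma expm1_lin (a B : R) : (0 <= a <= B)%R -> exp a - 1 <= a * exp B.
Proof.
 intro h. assert (h1 := exp_minus_1_le a). rewrite (Rabs_pos_eq a) in h1 by lra.
 assert (h2 := exp_le a B ltac:(lra)). assert (h3 := Rle_abs (exp a - 1)).
 nra.
Qed.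

(** [D] is chosen before [f]: the rate of convergence is then uniform in a parameter of the factors,
    which is what [RatLim_infprod] requires. *)
Lemma prodn_conv_unif (B r : R) : (0 <= r < 1)%R -> 0 <= B -> exists D : R, 0 <= D /\
 forall f, (forall i, Cmod (f i - 1) <= B * r ^ i) ->
  exists l, Clim_to (prodn f) l /\ forall n, Cmod (l - prodn f n) <= D * r ^ n.
Proof.
 intros hr hB.
 set (M := exp (B / (1 - r))). exists (M * B / (1 - r))%R.
 assert (hM : 0 < M) by apply exp_pos.
 split. { apply Rdiv_le_0_compat; [| lra]. nra. }
 intros f Hf. apply (geom_cauchy (prodn f) (M * B) r hr); [apply Rmult_le_pos; lra |].
 intro n. simpl prodn. recast (prodn f n * (f (S n) - 1)).
 rewrite Cmod_mult, Rmult_assoc. apply Rmult_le_compat; try apply Cmod_ge_0.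
 - assert (h : Cmod (prodn f n - 1) <= exp (B / (1 - r)) - 1).
  { apply prodn_near_1; auto. intro i. now apply expm1_le. }
  recast ((prodn f n - 1) + 1).
  eapply Rle_trans; [apply Cmod_triangle |]. rewrite Cmod_1. unfold M. lra.
 - eapply Rle_trans; [apply Hf |]. apply Rmult_le_compat_l; [exact hB |].
  simpl. assert (0 <= r ^ n)%R by (apply pow_le; lra). nra.
Qed.

Lemma prodn_Clim f B r : (0 <= r < 1)%R -> 0 <= B -> (forall i, Cmod (f i - 1) <= B * r ^ i) ->
 Clim_to (prodn f) (Clim (prodn f)).
Proof.
 intros hr hB H. destruct (prodn_conv_unif B r hr hB) as [D [_ HD]].
 destruct (HD f H) as [l [Hl _]]. now rewrite (Clim_eq _ _ Hl).
Qed.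

Lemma inv_near_1 (f : nat -> C) B M r : (forall i : nat, f i <> 0) -> (forall i, Cmod (/ f i) <= M) ->
 (forall i, Cmod (f i - 1) <= B * r ^ i) -> (forall i, Cmod (/ f i - 1) <= B * M * r ^ i).
Proof.
 intros H0 HM HB i. recast (- ((f i - 1) * / f i)) by (field; apply H0).
 rewrite Cmod_opp, Cmod_mult. recast (B * r ^ i * M)%R.
 apply Rmult_le_compat; auto; apply Cmod_ge_0.
Qed.

(** All but finitely many factors lie within 1/2 of 1, where inverses are at most 2; the remaining
    ones are bounded one by one by hypothesis. *)
Lemma inv_unif_bound (T : Type) (K : T -> Prop) (F : nat -> T -> C) B r :
 (0 <= r < 1)%R -> 0 <= B ->
 (forall i t, K t -> Cmod (F i t - 1) <= B * r ^ i) ->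
 (forall i, exists M, forall t, K t -> Cmod (/ F i t) <= M) ->
 exists M, 0 <= M /\ forall i t, K t -> F i t <> 0 -> Cmod (/ F i t) <= M.
Proof.
 intros hr hB H HM.
 destruct (pow_lt_1_zero r ltac:(rewrite Rabs_pos_eq; lra) (/ (2 * (B + 1)))%R) as [N HN].
 { apply Rinv_0_lt_compat. lra. }
 assert (G : forall n, exists M, 2 <= M /\ forall i t, (i < n)%nat -> K t -> Cmod (/ F i t) <= M).
 { induction n as [| n [M [hM IH]]].
  - exists 2%R. split; [lra | intros; lia].
  - destruct (HM n) as [M' HM']. exists (Rmax M M'). split; [eapply Rle_trans; [exact hM | apply Rmax_l] |].
   intros i t hi ht. destruct (Nat.eq_dec i n) as [-> | hne].
   + eapply Rle_trans; [now apply HM' | apply Rmax_r].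
   + eapply Rle_trans; [apply IH; [lia | exact ht] | apply Rmax_l]. }
 destruct (G N) as [M [hM HMN]]. exists M. split; [lra |]. intros i t ht hne.
 destruct (Nat.lt_ge_cases i N) as [hi | hi]; [now apply HMN |].
 apply Rle_trans with (2 := hM).
 specialize (HN i hi). rewrite Rabs_pos_eq in HN by (apply pow_le; lra).
 specialize (H i t ht).
 assert (h : B * r ^ i <= 1 / 2).
 { apply Rle_trans with ((B + 1) * / (2 * (B + 1)))%R.
  - assert (0 <= r ^ i)%R by (apply pow_le; lra). nra.
  - right. field. lra. }
 assert (h2 : 1 / 2 <= Cmod (F i t)).
 { recast (1 - (1 - F i t)). apply Cmod_one_minus.
  rewrite Cmod_minus_sym. lra. }
 rewrite Cmod_inv by exact hne. recast (/ (1 / 2))%R by field.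
 apply Rinv_le_contravar; lra.
Qed.

(** The inverses are also geometrically close to 1, so their product converges; its limit times the
    original one is 1, which gives nonvanishing at the same time. *)
Lemma infprod_inv (f : nat -> C) B r : (0 <= r < 1)%R -> 0 <= B -> (forall i, Cmod (f i - 1) <= B * r ^ i) ->
 (forall i, f i <> 0) ->
 Clim (prodn (fun i => / f i)) = / Clim (prodn f) /\ Clim (prodn f) <> 0.
Proof.
 intros hr hB H H0.
 destruct (inv_unif_bound unit (fun _ => True) (fun i _ => f i) B r) as [M [hM HM]]; auto.
 { intro i. exists (Cmod (/ f i)). intros; lra. }
 assert (Hi := inv_near_1 f B M r H0 (fun i => HM i tt I (H0 i)) H).
 assert (L1 := prodn_Clim f B r hr hB H).
 assert (L2 := prodn_Clim _ (B * M) r hr (Rmult_le_pos _ _ hB hM) Hi).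
 assert (L3 := Clim_to_mult _ _ _ _ L1 L2).
 assert (E : Clim (prodn f) * Clim (prodn (fun i => / f i)) = 1).
 { apply (Clim_to_unique _ _ _ L3). apply (Clim_to_ext (fun _ => 1)); [| apply Clim_to_const].
  intro n. destruct (prodn_inv f n) as [E1 E2]; [auto |]. rewrite E1. field; auto. }
 assert (hn : Clim (prodn f) <> 0).
 { intro E0. rewrite E0, Cmult_0_l in E. apply C1_nz. cc. }
 split; [| exact hn].
 rewrite <- (Cmult_1_r (/ _)), <- E. field; auto.
Qed.

Lemma infprod_near_1 f R0 r : (0 <= r < 1)%R -> 0 <= R0 ->
 (forall i, Cmod (f i - 1) <= exp (R0 * r ^ i) - 1) ->
 Cmod (Clim (prodn f) - 1) <= exp (R0 / (1 - r)) - 1.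
Proof.
 intros hr hR H.
 apply (Clim_to_le (fun n => prodn f n - 1)).
 - apply Clim_to_minus_const.
  apply (prodn_Clim f (R0 * exp R0) r hr); [apply Rmult_le_pos; [exact hR | left; apply exp_pos] |].
  intro i. eapply Rle_trans; [apply H |].
  assert (h : (0 <= r ^ i <= 1)%R).
  { split; [apply pow_le; lra |]. rewrite <- (pow1 i). apply pow_incr. lra. }
  recast (R0 * r ^ i * exp R0)%R.
  apply expm1_lin. nra.
 - intro n. now apply prodn_near_1.
Qed.

Lemma RatLim_prodn S K (F : nat -> C -> C) n : Kgood S K -> (forall i, RatLim S K (F i)) ->
 RatLim S K (fun t => prodn (fun i => F i t) n).
Proof. intros HK H. induction n as [| n IH]; simpl; [apply H | now apply RatLim_mult]. Qed.

Lemma RatLim_infprod S K (F : nat -> C -> C) B r : Kgood S K -> (0 <= r < 1)%R -> 0 <= B ->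
 (forall i, RatLim S K (F i)) -> (forall i t, K t -> Cmod (F i t - 1) <= B * r ^ i) ->
 RatLim S K (fun t => Clim (prodn (fun i => F i t))).
Proof.
 intros HK hr hB HF H. destruct (prodn_conv_unif B r hr hB) as [D [hD HD]].
 apply RatLim_unif. intros eps he.
 destruct (pow_lt_1_zero r ltac:(rewrite Rabs_pos_eq; lra) (eps / (D + 1))%R) as [N HN].
 { apply Rdiv_lt_0_compat; lra. }
 exists (fun t => prodn (fun i => F i t) N). split; [now apply RatLim_prodn |].
 intros t ht. destruct (HD (fun i => F i t)) as [l [Hl Hd]]; [auto |].
 rewrite (Clim_eq _ _ Hl). eapply Rle_lt_trans; [apply Hd |].
 specialize (HN N (Nat.le_refl _)). assert (h0 : 0 <= r ^ N) by (apply pow_le; lra).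
 rewrite Rabs_pos_eq in HN by exact h0.
 apply (Rmult_lt_compat_l (D + 1)) in HN; [| lra].
 recast eps in HN by (field; lra). nra.
Qed.

Lemma RatLim_infprod_inv S K (F : nat -> C -> C) B r : Kgood S K -> (0 <= r < 1)%R -> 0 <= B ->
 (forall i, RatLim S K (fun t => / F i t)) -> (forall i t, K t -> F i t <> 0) ->
 (forall i t, K t -> Cmod (F i t - 1) <= B * r ^ i) ->
 RatLim S K (fun t => / Clim (prodn (fun i => F i t))).
Proof.
 intros HK hr hB HF H0 H.
 destruct (inv_unif_bound C K F B r hr hB H) as [M [hM HM]].
 { intro i. destruct (RatLim_bounded S K _ HK (HF i)) as [M [_ HM]]. now exists M. }
 apply (RatLim_ext _ _ (fun t => Clim (prodn (fun i => / F i t)))).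
 - intros t ht. apply (infprod_inv (fun i => F i t) B r hr hB); auto.
 - apply (RatLim_infprod S K (fun i t => / F i t) (B * M) r HK hr); [now apply Rmult_le_pos | exact HF |].
  intros i t ht. apply (inv_near_1 (fun i => F i t)); auto.
Qed.

(** * Single and double Pochhammer symbols *)

Lemma e2pi_INR_mult (i : nat) x : e2pi (INR i * x) = Cpow (e2pi x) i.
Proof.
 induction i as [| i IH].
 - simpl. recast (RtoC 0). apply e2pi_0.
 - rewrite S_INR, RtoC_plus, Cpow_S, <- IH, <- e2pi_plus. f_equal. ring.
Qed.

Definition qabs (s : C) : R := Cmod (e2pi s).

Lemma qabs_lt_1 s : 0 < Im s -> (0 < qabs s < 1)%R.
Proof.
 intro h. unfold qabs. rewrite Cmod_e2pi. split; [apply exp_pos |].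
 rewrite <- exp_0. apply exp_increasing. generalize PI_RGT_0. nra.
Qed.

Lemma Cmod_e2pi_INR x (i : nat) s : Cmod (e2pi (x + INR i * s)) = (Cmod (e2pi x) * qabs s ^ i)%R.
Proof. rewrite e2pi_plus, Cmod_mult, e2pi_INR_mult, Cmod_pow. reflexivity. Qed.

(** The infinite q-Pochhammer symbol of e(x) with base e(s). *)
Definition poch (x s : C) : C := Clim (prodn (fun k => 1 - e2pi (x + INR k * s))).

(** The Pochhammer symbol with two bases, as a limit over squares because [Omega] is defined by
    square partial products. *)
Definition dpoch (x tau p : C) : C :=
 Clim (fun N => prodn (fun j => prodn (fun k => 1 - e2pi (x + INR j * tau + INR k * p)) N) N).

Lemma one_minus_near_1 (x : C) : Cmod (1 - x - 1) = Cmod x.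
Proof. recast (- x). apply Cmod_opp. Qed.

Lemma poch_factor x s i : Cmod (1 - e2pi (x + INR i * s) - 1) = (Cmod (e2pi x) * qabs s ^ i)%R.
Proof. now rewrite one_minus_near_1, Cmod_e2pi_INR. Qed.

Lemma poch_lim x s : 0 < Im s ->
 Clim_to (prodn (fun k => 1 - e2pi (x + INR k * s))) (poch x s).
Proof.
 intro hs. assert (hq := qabs_lt_1 s hs).
 apply (prodn_Clim _ (Cmod (e2pi x)) (qabs s)); [lra | apply Cmod_ge_0 |].
 intro i. rewrite poch_factor. lra.
Qed.

Lemma poch_near_1 x s : 0 < Im s ->
 Cmod (poch x s - 1) <= exp (Cmod (e2pi x) / (1 - qabs s)) - 1.
Proof.
 intro hs. assert (hq := qabs_lt_1 s hs).
 apply infprod_near_1; [lra | apply Cmod_ge_0 |].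
 intro i. apply expm1_le. rewrite poch_factor. lra.
Qed.

Lemma poch_step x s : 0 < Im s -> poch x s = (1 - e2pi x) * poch (x + s) s.
Proof.
 intro hs. apply (Clim_to_unique (fun n => prodn (fun k => 1 - e2pi (x + INR k * s)) (S n))).
 - apply (Clim_to_S (prodn _)). now apply poch_lim.
 - apply (Clim_to_ext (fun n => (1 - e2pi x) * prodn (fun k => 1 - e2pi (x + s + INR k * s)) n)).
  + intro n. rewrite prodn_shift. f_equal.
   * simpl. do 2 f_equal. ring.
   * apply prodn_ext. intros i _. rewrite S_INR, RtoC_plus.
    recast (x + (INR i + 1) * s). reflexivity.
  + apply Clim_to_mult; [apply Clim_to_const | now apply poch_lim].
Qed.

Lemma poch_neq_0 x s : 0 < Im s -> (forall k : nat, 1 - e2pi (x + INR k * s) <> 0) -> poch x s <> 0.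
Proof.
 intros hs H. assert (hq := qabs_lt_1 s hs).
 apply (infprod_inv _ (Cmod (e2pi x)) (qabs s)); [lra | apply Cmod_ge_0 | | exact H].
 intro i. rewrite poch_factor. lra.
Qed.

(** The border, one row and one column, by which the square of indices grows at step N. It rewrites
    a double product as a single infinite product, to which the estimates above apply. *)
Definition dpfac (f : nat -> nat -> C) (N : nat) : C :=
 match N with
 | O => f O O
 | S n => prodn (fun k => f (S n) k) (S n) * prodn (fun j => f j (S n)) n
 end.

Lemma prodn_square f N : prodn (fun j => prodn (f j) N) N = prodn (dpfac f) N.
Proof.
 induction N as [| N IH]; [reflexivity |].
 change (prodn (dpfac f) (S N)) with (prodn (dpfac f) N * dpfac f (S N)).
 rewrite <- IH.
 change (prodn (fun j => prodn (f j) (S N)) (S N)) with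
  (prodn (fun j => prodn (f j) N * f j (S N)) N * prodn (f (S N)) (S N)).
 change (dpfac f (S N)) with (prodn (f (S N)) (S N) * prodn (fun j => f j (S N)) N).
 rewrite prodn_mult. ring.
Qed.

Lemma dpfac_near_1 f R0 r N : (0 <= r < 1)%R -> 0 <= R0 ->
 (forall j k, Cmod (f j k - 1) <= R0 * (r ^ j * r ^ k)) ->
 Cmod (dpfac f N - 1) <= exp (2 * R0 / (1 - r) * r ^ N) - 1.
Proof.
 intros hr hR H. assert (hi : 1 <= / (1 - r)).
 { rewrite <- Rinv_1. apply Rinv_le_contravar; lra. }
 destruct N as [| n]; unfold dpfac.
 - apply expm1_le. eapply Rle_trans; [apply H |]. nra.
 - recast (R0 * r ^ S n / (1 - r) + R0 * r ^ S n / (1 - r))%R by (field; lra).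
  assert (0 <= r ^ S n)%R by (apply pow_le; lra).
  apply expm1_mult; apply prodn_near_1; try lra; try (now apply Rmult_le_pos);
   intro i; apply expm1_le; eapply Rle_trans; try apply H; lra.
Qed.

Definition qmax (tau p : C) : R := Rmax (qabs tau) (qabs p).

Lemma qmax_lt_1 tau p : 0 < Im tau -> 0 < Im p -> (0 < qmax tau p < 1)%R.
Proof.
 intros h1 h2. assert (a := qabs_lt_1 tau h1). assert (b := qabs_lt_1 p h2).
 unfold qmax. split; [eapply Rlt_le_trans; [apply a | apply Rmax_l] | apply Rmax_lub_lt; lra].
Qed.

Lemma dpoch_factor x tau p j k : 0 < Im tau -> 0 < Im p ->
 Cmod (1 - e2pi (x + INR j * tau + INR k * p) - 1) <=
  Cmod (e2pi x) * (qmax tau p ^ j * qmax tau p ^ k).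
Proof.
 intros h1 h2. rewrite one_minus_near_1, Cmod_e2pi_INR, Cmod_e2pi_INR, Rmult_assoc.
 assert (a := qabs_lt_1 tau h1). assert (b := qabs_lt_1 p h2).
 apply Rmult_le_compat_l; [apply Cmod_ge_0 |].
 apply Rmult_le_compat; try (apply pow_le; lra); apply pow_incr; split; try lra;
  [apply Rmax_l | apply Rmax_r].
Qed.

Lemma dpoch_eq x tau p :
 dpoch x tau p = Clim (prodn (dpfac (fun j k => 1 - e2pi (x + INR j * tau + INR k * p)))).
Proof. unfold dpoch. f_equal. apply functional_extensionality. intro N. apply prodn_square. Qed.

Definition dpC (tau p : C) : R := (2 / (1 - qmax tau p))%R.

Lemma dpC_pos tau p : 0 < Im tau -> 0 < Im p -> 0 <= dpC tau p.
Proof. intros h1 h2. assert (h := qmax_lt_1 tau p h1 h2). apply Rdiv_le_0_compat; lra. Qed.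

Lemma dpfac_exp x tau p N : 0 < Im tau -> 0 < Im p ->
 Cmod (dpfac (fun j k => (1 - e2pi (x + INR j * tau + INR k * p))%C) N - 1) <=
  exp (dpC tau p * Cmod (e2pi x) * qmax tau p ^ N) - 1.
Proof.
 intros h1 h2. assert (hq := qmax_lt_1 tau p h1 h2).
 recast (2 * Cmod (e2pi x) / (1 - qmax tau p) * qmax tau p ^ N)%R by (unfold dpC; field; lra).
 apply dpfac_near_1; [lra | apply Cmod_ge_0 |]. intros j k. now apply dpoch_factor.
Qed.

Lemma dpfac_lin x tau p R0 N : 0 < Im tau -> 0 < Im p -> Cmod (e2pi x) <= R0 ->
 Cmod (dpfac (fun j k => (1 - e2pi (x + INR j * tau + INR k * p))%C) N - 1) <=
  dpC tau p * R0 * exp (dpC tau p * R0) * qmax tau p ^ N.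
Proof.
 intros h1 h2 hR. assert (hq := qmax_lt_1 tau p h1 h2). assert (hC := dpC_pos tau p h1 h2).
 assert (h0 := Cmod_ge_0 (e2pi x)).
 eapply Rle_trans; [now apply dpfac_exp |].
 assert (h : (0 <= qmax tau p ^ N <= 1)%R).
 { split; [apply pow_le; lra |]. rewrite <- (pow1 N). apply pow_incr. lra. }
 assert (hCR : (0 <= dpC tau p * Cmod (e2pi x) <= dpC tau p * R0)%R) by (split; nra).
 eapply Rle_trans; [apply (expm1_lin _ (dpC tau p * R0)) |].
 - nra.
 - recast (dpC tau p * R0 * qmax tau p ^ N * exp (dpC tau p * R0))%R.
  apply Rmult_le_compat_r; [left; apply exp_pos |]. nra.
Qed.

Lemma dpoch_lim x tau p : 0 < Im tau -> 0 < Im p ->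
 Clim_to (fun N => prodn (fun j => prodn (fun k => 1 - e2pi (x + INR j * tau + INR k * p)) N) N)
  (dpoch x tau p).
Proof.
 intros h1 h2. assert (hq := qmax_lt_1 tau p h1 h2). assert (hC := dpC_pos tau p h1 h2).
 rewrite dpoch_eq. eapply Clim_to_ext; [intro N; symmetry; apply prodn_square |].
 eapply (prodn_Clim _ _ (qmax tau p)); [lra | | intro i; apply dpfac_lin; [assumption .. | apply Rle_refl]].
 apply Rmult_le_pos; [apply Rmult_le_pos; [exact hC | apply Cmod_ge_0] | left; apply exp_pos].
Qed.

Lemma dpoch_near_1 x tau p : 0 < Im tau -> 0 < Im p ->
 Cmod (dpoch x tau p - 1) <= exp (dpC tau p / (1 - qmax tau p) * Cmod (e2pi x)) - 1.
Proof.
 intros h1 h2. assert (hq := qmax_lt_1 tau p h1 h2). assert (hC := dpC_pos tau p h1 h2).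
 rewrite dpoch_eq.
 recast (dpC tau p * Cmod (e2pi x) / (1 - qmax tau p))%R by (field; lra).
 apply infprod_near_1; [lra | | intro i; now apply dpfac_exp].
 apply Rmult_le_pos; [exact hC | apply Cmod_ge_0].
Qed.

Lemma dpfac_neq_0 (f : nat -> nat -> C) N : (forall j k, f j k <> 0) -> dpfac f N <> 0.
Proof.
 intro H. destruct N as [| n]; [apply H |]. unfold dpfac.
 apply Cmult_neq_0; apply prodn_inv; intros; apply H.
Qed.

Lemma dpoch_neq_0 x tau p : 0 < Im tau -> 0 < Im p ->
 (forall j k : nat, 1 - e2pi (x + INR j * tau + INR k * p) <> 0) -> dpoch x tau p <> 0.
Proof.
 intros h1 h2 H. assert (hq := qmax_lt_1 tau p h1 h2). assert (hC := dpC_pos tau p h1 h2).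
 rewrite dpoch_eq.
 eapply (infprod_inv _ _ (qmax tau p)); [lra | | intro i; apply dpfac_lin; [assumption .. | apply Rle_refl] |].
 - apply Rmult_le_pos; [apply Rmult_le_pos; [exact hC | apply Cmod_ge_0] | left; apply exp_pos].
 - intro i. apply dpfac_neq_0. assumption.
Qed.

Lemma dpoch_sym x tau p : dpoch x tau p = dpoch x p tau.
Proof.
 unfold dpoch. f_equal. apply functional_extensionality. intro N. rewrite prodn_swap.
 apply prodn_ext. intros j _. apply prodn_ext. intros k _.
 recast (x + INR j * p + INR k * tau). reflexivity.
Qed.

Lemma Clim_to_geom (a : nat -> C) l M r : (0 <= r < 1)%R -> 0 <= M ->
 (forall n, Cmod (a n - l) <= M * r ^ n) -> Clim_to a l.
Proof.
 intros hr hM H. apply Clim_to_eps. intros eps he.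
 destruct (pow_lt_1_zero r ltac:(rewrite Rabs_pos_eq; lra) (eps / (M + 1))%R) as [N HN].
 { apply Rdiv_lt_0_compat; lra. }
 exists N. intros n hn. eapply Rle_lt_trans; [apply H |].
 specialize (HN n hn). assert (h0 : 0 <= r ^ n) by (apply pow_le; lra).
 rewrite Rabs_pos_eq in HN by exact h0.
 apply (Rmult_lt_compat_l (M + 1)) in HN; [| lra].
 recast eps in HN by (field; lra). nra.
Qed.

Lemma dpoch_step x tau p : 0 < Im tau -> 0 < Im p ->
 dpoch x tau p = poch x tau * dpoch (x + p) tau p.
Proof.
 intros h1 h2. assert (hq := qmax_lt_1 tau p h1 h2).
 set (f := fun (j k : nat) => 1 - e2pi (x + INR j * tau + INR k * p)).
 (* Reindexing k in the square product splits off the column k = 0, which tends to [poch x tau], but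
    leaves the column k = N + 1 in excess; that column tends to 1. *)
 assert (hc : Clim_to (fun N => prodn (fun j => f j (S N)) N) 1).
 { set (R0 := (Cmod (e2pi x) / (1 - qmax tau p))%R).
  assert (hR0 : 0 <= R0) by (apply Rdiv_le_0_compat; [apply Cmod_ge_0 | lra]).
  apply (Clim_to_geom _ _ (R0 * exp R0) (qmax tau p)); [lra | |].
  { apply Rmult_le_pos; [exact hR0 | left; apply exp_pos]. }
  intro N.
  assert (h : (0 <= qmax tau p ^ S N <= qmax tau p ^ N)%R).
  { simpl. assert (0 <= qmax tau p ^ N)%R by (apply pow_le; lra). nra. }
  assert (h' : qmax tau p ^ N <= 1) by (rewrite <- (pow1 N); apply pow_incr; lra).
  eapply Rle_trans; [apply (prodn_near_1 _ (Cmod (e2pi x) * qmax tau p ^ S N) (qmax tau p)) |].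
  - lra.
  - apply Rmult_le_pos; [apply Cmod_ge_0 | lra].
  - intro i. apply expm1_le. eapply Rle_trans; [now apply dpoch_factor |]. lra.
  - recast (R0 * qmax tau p ^ S N)%R by (unfold R0; field; lra).
   eapply Rle_trans; [apply (expm1_lin _ R0) |].
   + nra.
   + recast (R0 * qmax tau p ^ N * exp R0)%R.
    apply Rmult_le_compat_r; [left; apply exp_pos |]. nra. }
 rewrite <- (Cmult_1_r (dpoch x tau p)).
 apply (Clim_to_unique (fun N => prodn (fun j => prodn (f j) N) N * prodn (fun j => f j (S N)) N)).
 - apply Clim_to_mult; [now apply dpoch_lim | exact hc].
 - apply (Clim_to_ext (fun N => prodn (fun j => 1 - e2pi (x + INR j * tau)) N *
    prodn (fun j => prodn (fun k => 1 - e2pi (x + p + INR j * tau + INR k * p)) N) N)).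
  + intro N. rewrite <- !prodn_mult. apply prodn_ext. intros j _.
   change (prodn (f j) N * f j (S N)) with (prodn (f j) (S N)). rewrite prodn_shift. f_equal.
   * unfold f. simpl. recast (x + INR j * tau). reflexivity.
   * apply prodn_ext. intros k _. unfold f. rewrite S_INR, RtoC_plus.
    recast (x + INR j * tau + (INR k + 1) * p).
    reflexivity.
  + apply Clim_to_mult; [now apply poch_lim | now apply dpoch_lim].
Qed.

Lemma dpoch_step' x tau p : 0 < Im tau -> 0 < Im p ->
 dpoch x tau p = poch x p * dpoch (x + tau) tau p.
Proof. intros h1 h2. rewrite dpoch_sym, dpoch_step by assumption. now rewrite (dpoch_sym (x + tau)). Qed.

(* Both sides satisfy f(x) = poch(x,tau) poch(x+p,p) f(x + tau + p) and tend
  to 1 as Im x tends to infinity. *)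
Lemma dpoch_three_term x tau p : 0 < Im tau -> 0 < Im p ->
 dpoch x tau (tau + p) * dpoch (x + p) (tau + p) p = dpoch x tau p.
Proof.
 intros h1 h2. set (T := tau + p).
 assert (hT : 0 < Im T) by (unfold T; rewrite Im_plus; lra).
 set (A := fun y => dpoch y tau T * dpoch (y + p) T p).
 set (B := fun y => dpoch y tau p).
 set (g := fun y => poch y tau * poch (y + p) p).
 assert (HA : forall y, A y = g y * A (y + T)).
 { intro y. unfold A, g. rewrite (dpoch_step y tau T), (dpoch_step' (y + p) T p) by assumption.
  recast (y + T + p). ring. }
 assert (HB : forall y, B y = g y * B (y + T)).
 { intro y. unfold B, g.
  rewrite (dpoch_step y tau p), (dpoch_step' (y + p) tau p) by assumption.
  recast (y + T) by (unfold T; ring). ring. }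
 (* The recursion is iterated: the accumulated factors [g] form a bounded product, while [A] and [B]
    at x + (n+1) T are both within a multiple of [qabs T ^ n] of 1. *)
 assert (HD : forall n, A x - B x =
   prodn (fun k => g (x + INR k * T)) n * (A (x + INR (S n) * T) - B (x + INR (S n) * T))).
 { induction n as [| n IH].
  - simpl. rewrite (HA x), (HB x). recast x.
   recast (x + T). ring.
  - rewrite IH, HA, HB.
   change (prodn (fun k => g (x + INR k * T)) (S n)) with
    (prodn (fun k => g (x + INR k * T)) n * g (x + INR (S n) * T)).
   replace (x + INR (S n) * T + T) with (x + INR (S (S n)) * T); [ring |].
   rewrite (S_INR (S n)), RtoC_plus. ring. }
 assert (hq := qabs_lt_1 T hT).
 assert (c1 := dpC_pos tau T h1 hT). assert (c2 := dpC_pos T p hT h2). assert (c3 := dpC_pos tau p h1 h2).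
 assert (q1 := qmax_lt_1 tau T h1 hT). assert (q2 := qmax_lt_1 T p hT h2). assert (q3 := qmax_lt_1 tau p h1 h2).
 assert (q4 := qabs_lt_1 tau h1). assert (q5 := qabs_lt_1 p h2).
 set (X := Cmod (e2pi x)). assert (hX : 0 <= X) by apply Cmod_ge_0.
 set (k1 := (dpC tau T / (1 - qmax tau T) + dpC T p / (1 - qmax T p) * qabs p)%R).
 set (k2 := (dpC tau p / (1 - qmax tau p))%R).
 set (k3 := (/ (1 - qabs tau) + / (1 - qabs p) * qabs p)%R).
 assert (hk1 : 0 <= k1) by (unfold k1; apply Rplus_le_le_0_compat; [| apply Rmult_le_pos; [| lra]]; apply Rdiv_le_0_compat; lra).
 assert (hk2 : 0 <= k2) by (unfold k2; apply Rdiv_le_0_compat; lra).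
 assert (hk3 : 0 <= k3) by (unfold k3; apply Rplus_le_le_0_compat; [| apply Rmult_le_pos; [| lra]]; left; apply Rinv_0_lt_compat; lra).
 assert (Hyp : forall y, Cmod (e2pi (y + p)) = (Cmod (e2pi y) * qabs p)%R).
 { intro y. now rewrite e2pi_plus, Cmod_mult. }
 assert (GA : forall y, Cmod (A y - 1) <= exp (k1 * Cmod (e2pi y)) - 1).
 { intro y. unfold A, k1. rewrite Rmult_plus_distr_r. apply expm1_mult; [now apply dpoch_near_1 |].
  eapply Rle_trans; [now apply dpoch_near_1 |]. rewrite Hyp. right. do 2 f_equal. ring. }
 assert (GB : forall y, Cmod (B y - 1) <= exp (k2 * Cmod (e2pi y)) - 1).
 { intro y. unfold B, k2. now apply dpoch_near_1. }
 assert (Gg : forall y, Cmod (g y - 1) <= exp (k3 * Cmod (e2pi y)) - 1).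
 { intro y. unfold g, k3. rewrite Rmult_plus_distr_r. apply expm1_mult.
  - recast (Cmod (e2pi y) / (1 - qabs tau))%R by (unfold Rdiv; ring).
   now apply poch_near_1.
  - recast (Cmod (e2pi (y + p)) / (1 - qabs p))%R by (rewrite Hyp; unfold Rdiv; ring).
   now apply poch_near_1. }
 change (A x = B x). apply Ceq_minus.
 set (G := exp (k3 * X / (1 - qabs T))).
 apply (Cmod_geom_zero _ (G * (k1 * X * exp (k1 * X) + k2 * X * exp (k2 * X))) (qabs T)); [lra |].
 intro n. rewrite (HD n), Cmod_mult, Rmult_assoc. apply Rmult_le_compat; try apply Cmod_ge_0.
 - assert (h : Cmod (prodn (fun k => g (x + INR k * T)%C) n - 1) <= exp (k3 * X / (1 - qabs T)) - 1).
  { apply prodn_near_1; [lra | now apply Rmult_le_pos |]. intro i.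
   eapply Rle_trans; [apply Gg |]. rewrite Cmod_e2pi_INR. right. do 2 f_equal. unfold X. ring. }
  recast ((prodn (fun k => g (x + INR k * T)) n - 1) + 1).
  eapply Rle_trans; [apply Cmod_triangle |]. rewrite Cmod_1. unfold G. lra.
 - set (y := x + INR (S n) * T).
  assert (hy : (0 <= Cmod (e2pi y) <= X * qabs T ^ n)%R).
  { split; [apply Cmod_ge_0 |]. unfold y. rewrite Cmod_e2pi_INR. simpl. fold X.
   apply Rmult_le_compat_l; [exact hX |]. assert (0 <= qabs T ^ n)%R by (apply pow_le; lra). nra. }
  assert (hn : (0 <= qabs T ^ n <= 1)%R).
  { split; [apply pow_le; lra |]. rewrite <- (pow1 n). apply pow_incr. lra. }
  assert (hy1 : Cmod (e2pi y) <= X) by nra.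
  assert (L : forall k, 0 <= k -> exp (k * Cmod (e2pi y)) - 1 <= k * X * exp (k * X) * qabs T ^ n).
  { intros k hk. eapply Rle_trans; [apply (expm1_lin _ (k * X)) |].
   - nra.
   - recast (k * (X * qabs T ^ n) * exp (k * X))%R.
    apply Rmult_le_compat_r; [left; apply exp_pos |]. nra. }
  recast ((A y - 1) + - (B y - 1)).
  eapply Rle_trans; [apply Cmod_triangle |]. rewrite Cmod_opp.
  generalize (GA y) (GB y) (L k1 hk1) (L k2 hk2). lra.
Qed.

Lemma Kgood_e2pi_bound S K I c : Kgood S K ->
 exists R0 : R, 0 <= R0 /\ forall t, K t -> Cmod (e2pi (IZR I * t + c)) <= R0.
Proof.
 intros [[M HM] _]. exists (exp (2 * PI * Rabs (IZR I) * M) * Cmod (e2pi c))%R. split.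
 - apply Rmult_le_pos; [left; apply exp_pos | apply Cmod_ge_0].
 - intros t ht. rewrite e2pi_plus, Cmod_mult. apply Rmult_le_compat_r; [apply Cmod_ge_0 |].
  apply Cmod_e2pi_bound; auto.
Qed.

Lemma RatLim_factor S K I c : Kgood S K -> RatLim S K (fun t => 1 - e2pi (IZR I * t + c)).
Proof.
 intro HK. apply RatLim_plus; [apply RatLim_const |]. apply RatLim_opp; [exact HK |].
 now apply RatLim_e2pi.
Qed.

Lemma one_minus_e2pi_opp x : 1 - e2pi x <> 0 -> 1 - e2pi (- x) <> 0 /\ / (1 - e2pi (- x)) = 1 - / (1 - e2pi x).
Proof.
 intro h. rewrite e2pi_opp. assert (hz := e2pi_neq_0 x).
 assert (h2 : e2pi x - 1 <> 0).
 { intro E. apply h. recast (- (e2pi x - 1)). rewrite E. ring. }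
 assert (h3 : 1 - / e2pi x <> 0).
 { intro E. apply h2. recast (e2pi x * (1 - / e2pi x)) by (field; exact hz). rewrite E. ring. }
 split; [exact h3 |]. field. cc.
Qed.

(** For [I] equal to 1 or -1 the zero of 1 - e(I t + c) is t = - I c modulo Z, whence the form of
    the pole condition. For -1 the inverse is 1 minus a [geomX]. *)
Lemma RatLim_factor_inv (S K : C -> Prop) I c : Kgood S K -> I = 1%Z \/ I = (-1)%Z -> S (IZR (- I) * c) ->
 RatLim S K (fun t => / (1 - e2pi (IZR I * t + c))) /\ forall t, K t -> 1 - e2pi (IZR I * t + c) <> 0.
Proof.
 intros HK [-> | ->] hS.
 - simpl in hS. assert (E : forall t, 1 * t + c = t - -1 * c) by (intro; ring).
  split.
  + apply (RatLim_ext _ _ (geomX (-1 * c))); [| apply RatLim_Rat, Rat_geomX; exact hS].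
   intros t _. unfold geomX. now rewrite E.
  + intros t ht. rewrite E. exact (Kgood_avoids S K t _ HK ht hS).
 - simpl in hS. assert (E : forall t, -1 * t + c = - (t - 1 * c)) by (intro; ring).
  assert (Ha : forall t, K t -> 1 - e2pi (t - 1 * c) <> 0).
  { intros t ht. exact (Kgood_avoids S K t _ HK ht hS). }
  split.
  + apply (RatLim_ext _ _ (fun t => 1 + - geomX (1 * c) t)).
   * intros t ht. rewrite E, (proj2 (one_minus_e2pi_opp _ (Ha t ht))). reflexivity.
   * apply RatLim_plus; [apply RatLim_const |]. apply RatLim_opp; [exact HK |].
    apply RatLim_Rat, Rat_geomX. exact hS.
  + intros t ht. rewrite E. now apply one_minus_e2pi_opp, Ha.
Qed.

Lemma RatLim_poch S K I c s : Kgood S K -> 0 < Im s -> RatLim S K (fun t => poch (IZR I * t + c) s).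
Proof.
 intros HK hs. assert (hq := qabs_lt_1 s hs).
 destruct (Kgood_e2pi_bound S K I c HK) as [R0 [hR0 H]].
 apply (RatLim_infprod S K (fun i t => 1 - e2pi (IZR I * t + c + INR i * s)) R0 (qabs s)); auto; try lra.
 - intro i. apply (RatLim_ext _ _ (fun t => 1 - e2pi (IZR I * t + (c + INR i * s)))).
  + intros t _. now rewrite Cplus_assoc.
  + now apply RatLim_factor.
 - intros i t ht. rewrite poch_factor. apply Rmult_le_compat_r; [apply pow_le; lra | auto].
Qed.

Lemma RatLim_poch_inv (S K : C -> Prop) I c s : Kgood S K -> 0 < Im s -> I = 1%Z \/ I = (-1)%Z ->
 (forall i : nat, S (IZR (- I) * (c + INR i * s))) ->
 RatLim S K (fun t => / poch (IZR I * t + c) s) /\ forall t, K t -> poch (IZR I * t + c) s <> 0.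
Proof.
 intros HK hs hI hS. assert (hq := qabs_lt_1 s hs).
 destruct (Kgood_e2pi_bound S K I c HK) as [R0 [hR0 H]].
 assert (HF := fun i => RatLim_factor_inv S K I (c + INR i * s) HK hI (hS i)).
 assert (H0 : forall (i : nat) t, K t -> 1 - e2pi (IZR I * t + c + INR i * s) <> 0).
 { intros i t ht. rewrite <- Cplus_assoc. now apply (proj2 (HF i)). }
 split.
 - apply (RatLim_infprod_inv S K (fun i t => 1 - e2pi (IZR I * t + c + INR i * s)) R0 (qabs s)); auto; try lra.
  + intro i. apply (RatLim_ext _ _ (fun t => / (1 - e2pi (IZR I * t + (c + INR i * s))))).
   * intros t _. now rewrite Cplus_assoc.
   * apply HF.
  + intros i t ht. rewrite poch_factor. apply Rmult_le_compat_r; [apply pow_le; lra | auto].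
 - intros t ht. apply poch_neq_0; auto.
Qed.

Lemma RatLim_dpoch S K I c tau p : Kgood S K -> 0 < Im tau -> 0 < Im p ->
 RatLim S K (fun t => dpoch (IZR I * t + c) tau p).
Proof.
 intros HK h1 h2. assert (hq := qmax_lt_1 tau p h1 h2). assert (hC := dpC_pos tau p h1 h2).
 destruct (Kgood_e2pi_bound S K I c HK) as [R0 [hR0 H]].
 assert (HF : forall j k : nat, RatLim S K (fun t => 1 - e2pi (IZR I * t + c + INR j * tau + INR k * p))).
 { intros j k. apply (RatLim_ext _ _ (fun t => 1 - e2pi (IZR I * t + (c + INR j * tau + INR k * p)))).
  - intros t _. now rewrite !Cplus_assoc.
  - now apply RatLim_factor. }
 apply (RatLim_ext _ _ (fun t => Clim (prodn (fun N =>
   dpfac (fun j k => 1 - e2pi (IZR I * t + c + INR j * tau + INR k * p)) N)))).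
 { intros t _. now rewrite dpoch_eq. }
 apply (RatLim_infprod S K _ (dpC tau p * R0 * exp (dpC tau p * R0)) (qmax tau p)); auto; try lra.
 - apply Rmult_le_pos; [now apply Rmult_le_pos | left; apply exp_pos].
 - intro N. destruct N as [| n]; [apply HF |]. unfold dpfac.
  apply RatLim_mult; [exact HK | |].
  + apply (RatLim_prodn S K (fun k t => 1 - e2pi (IZR I * t + c + INR (Datatypes.S n) * tau + INR k * p))); auto.
  + apply (RatLim_prodn S K (fun j t => 1 - e2pi (IZR I * t + c + INR j * tau + INR (Datatypes.S n) * p))); auto.
 - intros N t ht. apply dpfac_lin; auto.
Qed.

Lemma RatLim_dpoch_inv (S K : C -> Prop) I c tau p : Kgood S K -> 0 < Im tau -> 0 < Im p ->
 I = 1%Z \/ I = (-1)%Z -> (forall j k : nat, S (IZR (- I) * (c + INR j * tau + INR k * p))) ->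
 RatLim S K (fun t => / dpoch (IZR I * t + c) tau p) /\ forall t, K t -> dpoch (IZR I * t + c) tau p <> 0.
Proof.
 intros HK h1 h2 hI hS. assert (hq := qmax_lt_1 tau p h1 h2). assert (hC := dpC_pos tau p h1 h2).
 destruct (Kgood_e2pi_bound S K I c HK) as [R0 [hR0 H]].
 assert (HF := fun j k => RatLim_factor_inv S K I (c + INR j * tau + INR k * p) HK hI (hS j k)).
 assert (H0 : forall (j k : nat) t, K t -> 1 - e2pi (IZR I * t + c + INR j * tau + INR k * p) <> 0).
 { intros j k t ht. rewrite <- !Cplus_assoc, (Cplus_assoc c). now apply (proj2 (HF j k)). }
 assert (HF' : forall j k : nat, RatLim S K (fun t => / (1 - e2pi (IZR I * t + c + INR j * tau + INR k * p)))).
 { intros j k. apply (RatLim_ext _ _ (fun t => / (1 - e2pi (IZR I * t + (c + INR j * tau + INR k * p))))).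
  - intros t _. now rewrite !Cplus_assoc.
  - apply HF. }
 split.
 - apply (RatLim_ext _ _ (fun t => / Clim (prodn (fun N =>
    dpfac (fun j k => 1 - e2pi (IZR I * t + c + INR j * tau + INR k * p)) N)))).
  { intros t _. now rewrite dpoch_eq. }
  apply (RatLim_infprod_inv S K (fun N t =>
    dpfac (fun j k => 1 - e2pi (IZR I * t + c + INR j * tau + INR k * p)) N)
    (dpC tau p * R0 * exp (dpC tau p * R0)) (qmax tau p)); auto; try lra.
  + apply Rmult_le_pos; [now apply Rmult_le_pos | left; apply exp_pos].
  + intro N. destruct N as [| n]; [apply HF' |]. unfold dpfac.
   apply (RatLim_ext _ _ (fun t =>
    prodn (fun k => / (1 - e2pi (IZR I * t + c + INR (Datatypes.S n) * tau + INR k * p))) (Datatypes.S n) *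
    prodn (fun j => / (1 - e2pi (IZR I * t + c + INR j * tau + INR (Datatypes.S n) * p))) n)).
   * intros t ht.
    destruct (prodn_inv (fun k => 1 - e2pi (IZR I * t + c + INR (Datatypes.S n) * tau + INR k * p)) (Datatypes.S n)) as [-> n1]; auto.
    destruct (prodn_inv (fun j => 1 - e2pi (IZR I * t + c + INR j * tau + INR (Datatypes.S n) * p)) n) as [-> n2]; auto.
    field. cc.
   * apply RatLim_mult; [exact HK | |].
    -- apply (RatLim_prodn S K (fun k t => / (1 - e2pi (IZR I * t + c + INR (Datatypes.S n) * tau + INR k * p)))); auto.
    -- apply (RatLim_prodn S K (fun j t => / (1 - e2pi (IZR I * t + c + INR j * tau + INR (Datatypes.S n) * p)))); auto.
  + intros N t ht. apply dpfac_neq_0. auto.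
  + intros N t ht. apply dpfac_lin; auto.
 - intros t ht. apply dpoch_neq_0; auto.
Qed.

(** * The phase function as a quotient of double products *)

Lemma Cprod_prodn f n : Cprod f 0 n = prodn f n.
Proof.
 unfold Cprod. induction n as [| n IH].
 - rewrite Iter.iter_nat_point; [reflexivity | intro; ring].
 - rewrite (Iter.iter_nat_Chasles Cmult 1) with (m := n); try lia; try (intros; ring).
  rewrite IH, Iter.iter_nat_point by (intro; ring). reflexivity.
Qed.

Lemma Clim_to_inv a l : Clim_to a l -> (forall n, a n <> 0) -> l <> 0 -> Clim_to (fun n => / a n) (/ l).
Proof.
 intros H Ha Hl. apply Clim_to_eps. intros eps he.
 assert (hl := proj1 (Cmod_gt_0 l) Hl).
 destruct (proj1 (Clim_to_eps _ _) H (Rmin (Cmod l / 2) (eps * (Cmod l * Cmod l / 2)))%R) as [N HN].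
 { apply Rmin_glb_lt; [lra |]. apply Rmult_lt_0_compat; [exact he | nra]. }
 exists N. intros n hn. specialize (HN n hn).
 assert (h1 : Cmod (a n - l) < Cmod l / 2) by (eapply Rlt_le_trans; [exact HN | apply Rmin_l]).
 assert (h2 : Cmod (a n - l) < eps * (Cmod l * Cmod l / 2)) by (eapply Rlt_le_trans; [exact HN | apply Rmin_r]).
 assert (h3 : Cmod l / 2 <= Cmod (a n)).
 { rewrite Cmod_minus_sym in h1. generalize (Cmod_triang_inv l (a n)). lra. }
 recast (- ((a n - l) * (/ a n * / l))) by (field; auto).
 rewrite Cmod_opp, !Cmod_mult, !Cmod_inv by auto.
 assert (h4 : / Cmod (a n) <= 2 / Cmod l).
 { recast (/ (Cmod l / 2))%R by (field; lra). apply Rinv_le_contravar; lra. }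
 assert (h5 : 0 < / Cmod l) by now apply Rinv_0_lt_compat.
 assert (h6 : / Cmod (a n) * / Cmod l <= 2 / Cmod l * / Cmod l) by (apply Rmult_le_compat_r; lra).
 assert (h7 : 0 < / Cmod (a n)) by (apply Rinv_0_lt_compat; lra).
 apply Rle_lt_trans with (Cmod (a n - l) * (2 / Cmod l * / Cmod l))%R.
 - apply Rmult_le_compat_l; [apply Cmod_ge_0 | exact h6].
 - recast (eps * (Cmod l * Cmod l / 2) * (2 / Cmod l * / Cmod l))%R by (field; lra).
  apply Rmult_lt_compat_r; [| exact h2]. nra.
Qed.

(** Each square partial product of [Omega] splits into four square products with separate limits.
    The hypotheses keep the two denominators nonzero both at finite stage and in the limit. *)
Lemma Omega_dpoch a x tau p : 0 < Im tau -> 0 < Im p ->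
 (forall j k : nat, 1 - e2pi (x + a + INR j * tau + INR k * p) <> 0) ->
 (forall j k : nat, 1 - e2pi (tau + p - x + a + INR j * tau + INR k * p) <> 0) ->
 Omega a x tau p =
 dpoch (x - a) tau p * dpoch (tau + p - x - a) tau p / (dpoch (x + a) tau p * dpoch (tau + p - x + a) tau p).
Proof.
 intros h1 h2 H1 H2.
 set (sq := fun y N => prodn (fun j => prodn (fun k => 1 - e2pi (y + INR j * tau + INR k * p)) N) N).
 apply (Clim_eq (fun N => Cprod (fun j => Cprod (fun k => Omega_factor a x tau p j k) 0 N) 0 N)).
 apply (Clim_to_ext (fun N => (sq (x - a) N * sq (tau + p - x - a) N) *
                (/ sq (x + a) N * / sq (tau + p - x + a) N))).
 - intro N. rewrite Cprod_prodn. unfold sq.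
  destruct (prodn_inv (fun j => prodn (fun k => 1 - e2pi (x + a + INR j * tau + INR k * p)) N) N) as [<- _].
  { intros; apply prodn_inv; auto. }
  destruct (prodn_inv (fun j => prodn (fun k => 1 - e2pi (tau + p - x + a + INR j * tau + INR k * p)) N) N) as [<- _].
  { intros; apply prodn_inv; auto. }
  rewrite <- !prodn_mult. apply prodn_ext. intros j _. rewrite Cprod_prodn.
  destruct (prodn_inv (fun k => 1 - e2pi (x + a + INR j * tau + INR k * p)) N) as [<- _]; auto.
  destruct (prodn_inv (fun k => 1 - e2pi (tau + p - x + a + INR j * tau + INR k * p)) N) as [<- _]; auto.
  rewrite <- !prodn_mult. apply prodn_ext. intros k _. unfold Omega_factor.
  rewrite !S_INR, !RtoC_plus.
  recast (tau + p - x - a + INR j * tau + INR k * p).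
  recast (tau + p - x + a + INR j * tau + INR k * p).
  field; auto.
 - assert (n1 : dpoch (x + a) tau p <> 0) by now apply dpoch_neq_0.
  assert (n2 : dpoch (tau + p - x + a) tau p <> 0) by now apply dpoch_neq_0.
  recast (dpoch (x - a) tau p * dpoch (tau + p - x - a) tau p * (/ dpoch (x + a) tau p * / dpoch (tau + p - x + a) tau p)) by (field; auto).
  apply (Clim_to_mult (fun N => sq (x - a) N * sq (tau + p - x - a) N)
            (fun N => / sq (x + a) N * / sq (tau + p - x + a) N)).
  + apply (Clim_to_mult (sq (x - a)) (sq (tau + p - x - a))); now apply dpoch_lim.
  + apply (Clim_to_mult (fun N => / sq (x + a) N) (fun N => / sq (tau + p - x + a) N));
    apply (Clim_to_inv (sq _)); try assumption; try (now apply dpoch_lim);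
    intro N; apply prodn_inv; intros; apply prodn_inv; auto.
Qed.

(** * Periodic entire functions and their Fourier coefficients *)

Definition strip (M : R) (t : C) : Prop := (Rabs (Im t) <= M)%R.

(** With no permitted poles, rational functions of e(t) are Laurent polynomials; their uniform
    limits on all strips are the 1-periodic entire functions. *)
Definition Entire (f : C -> C) : Prop := forall M, RatLim (fun _ => False) (strip M) f.

Lemma Kgood_strip M : Kgood (fun _ => False) (strip M).
Proof. split; [now exists M | tauto]. Qed.

Lemma Entire_const c : Entire (fun _ => c).
Proof. intro M. apply RatLim_const. Qed.

Lemma Entire_plus f g : Entire f -> Entire g -> Entire (fun t => f t + g t).
Proof. intros Hf Hg M. now apply RatLim_plus. Qed.

Lemma Entire_mult f g : Entire f -> Entire g -> Entire (fun t => f t * g t).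
Proof. intros Hf Hg M. apply RatLim_mult; auto. apply Kgood_strip. Qed.

Lemma Entire_scal c f : Entire f -> Entire (fun t => c * f t).
Proof. intro Hf. apply Entire_mult; [apply Entire_const | exact Hf]. Qed.

Lemma Entire_ext f g : (forall t, f t = g t) -> Entire f -> Entire g.
Proof. intros E H M. apply (RatLim_ext _ _ f); auto. Qed.

Lemma Entire_RatLim S K f : Kgood S K -> Entire f -> RatLim S K f.
Proof.
 intros [[M HM] _] H. apply (RatLim_incl (fun _ => False) S (strip M) K); [tauto | exact HM | apply H].
Qed.

Lemma Entire_e2pi I : Entire (fun t => e2pi (IZR I * t)).
Proof. intro M. apply RatLim_Rat, Rat_e2pi. Qed.

Lemma Entire_cont f x : Entire f -> continuous (T := C_UniformSpace) (U := C_UniformSpace) f x.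
Proof.
 intro H.
 assert (L : locally (T := C_UniformSpace) x (strip (Rabs (Im x) + 1))).
 { exists (mkposreal 1 Rlt_0_1). intros y [_ hy]. unfold strip.
  change (Rabs (Im y - Im x) < 1)%R in hy.
  recast ((Im y - Im x) + Im x)%R.
  eapply Rle_trans; [apply Rabs_triang | lra]. }
 apply ccont_eps. intros eps he.
 destruct (H (Rabs (Im x) + 1)%R (eps / 3)%R) as [r [Hr h]]; [lra |].
 assert (Hc : continuous (T := C_UniformSpace) (U := C_UniformSpace) r x).
 { apply (ccont_Rat (fun t => t) (fun _ => False)); [cc | tauto | exact Hr]. }
 generalize (filter_and _ _ L (proj1 (ccont_eps r x) Hc (eps / 3)%R ltac:(lra))).
 apply filter_imp. intros y [hy1 hy2].
 assert (a1 := h y hy1). assert (a2 := h x (locally_singleton _ _ L)). rewrite Cmod_minus_sym in a2.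
 recast ((f y - r y) + ((r y - r x) + (r x - f x))).
 eapply Rle_lt_trans; [apply Cmod_triangle |].
 generalize (Cmod_triangle (r y - r x) (r x - f x)). lra.
Qed.

Definition hline (v : C) (s : R) : C := RtoC s + v.

Lemma hline_path v : period_path (hline v) (fun _ => RtoC 1).
Proof.
 split; [| split].
 - intro s. unfold hline. recast (RtoC 1 + RtoC 0).
  apply cderive_plus; [apply cderive_id | apply cderive_const].
 - cc.
 - unfold hline. ring.
Qed.

Lemma hline_Im v t : on_path (hline v) t -> Im t = Im v.
Proof. intros [r [_ ->]]. unfold hline. rewrite Im_plus, Im_RtoC. ring. Qed.

Lemma avoids_Im t w : Im t <> Im w -> avoids t w.
Proof. intro h. apply avoids_iff. intros m E. apply h. rewrite E, Im_plus, Im_RtoC. ring. Qed.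

Lemma hline_above v w : Im w < Im v -> passes_above (hline v) w.
Proof.
 intro h. exists (fun s => w - Ci * s). repeat split.
 - cc.
 - ring.
 - apply (is_lim_ext (fun s => Im w - s)%R).
  { intro s. unfold Im. simpl. ring. }
  apply is_lim_spec. intro M. exists (Im w - M)%R. intros; lra.
 - intros s r m hs hr E. apply (f_equal Im) in E. unfold hline, Im in *. simpl in *. lra.
Qed.

Lemma hline_below v w : Im v < Im w -> passes_below (hline v) w.
Proof.
 intro h. exists (fun s => w + Ci * s). repeat split.
 - cc.
 - ring.
 - apply (is_lim_ext (fun s => Im w + s)%R).
  { intro s. unfold Im. simpl. ring. }
  apply is_lim_spec. intro M. exists (M - Im w)%R. intros; lra.
 - intros s r m hs hr E. apply (f_equal Im) in E. unfold hline, Im in *. simpl in *. lra.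
Qed.

(** With this sign, [fcoef f I] is the coefficient of e(- I t). *)
Definition fcoef (f : C -> C) (I : Z) : C := pint (hline 0) (fun _ => 1) (fun t => f t * e2pi (IZR I * t)).

Lemma Entire_pcont g f : (forall s, ccont g s) -> Entire f -> pcont g f.
Proof. intros Hg H. apply pcont_comp; [exact Hg |]. intros r _. now apply Entire_cont. Qed.

Lemma hline_cont v s : ccont (hline v) s.
Proof. apply (period_path_cont _ _ (hline_path v)). Qed.

Lemma pint_hline_Entire f v w : Entire f ->
 pint (hline v) (fun _ => 1) f = pint (hline w) (fun _ => 1) f.
Proof.
 intro H.
 apply (pint_indep (fun _ => False) (strip (Rabs (Im v) + Rabs (Im w)))); try apply hline_path; try tauto.
 - apply Kgood_strip.
 - intros t ht. unfold strip. rewrite (hline_Im _ _ ht). generalize (Rabs_pos (Im w)). lra.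
 - intros t ht. unfold strip. rewrite (hline_Im _ _ ht). generalize (Rabs_pos (Im v)). lra.
 - apply H.
Qed.

(** Substituting X = 1 + A X repeatedly, each moment of f against A^n being 0, gives the integral of
    f A^n X for every n, and this is of order r^n. *)
Lemma pint_power_tail v f (A X : C -> C) (r B : R) :
 (0 <= r < 1)%R -> Entire f -> pcont (hline v) X -> pcont (hline v) A ->
 (forall t, on_path (hline v) t -> Cmod (A t) <= r /\ Cmod (X t) <= B /\ X t = 1 + A t * X t) ->
 (forall n, pint (hline v) (fun _ => 1) (fun t => f t * Cpow (A t) n) = 0) ->
 pint (hline v) (fun _ => 1) (fun t => f t * X t) = 0.
Proof.
 intros hr Hf HX HA H H0.
 assert (P := hline_path v). assert (Hfc := Entire_pcont _ f (hline_cont v) Hf).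
 assert (Hq : forall n, pcont (hline v) (fun t => f t * Cpow (A t) n)).
 { cc. }
 assert (Hq2 : forall n, pcont (hline v) (fun t => f t * Cpow (A t) n * X t)).
 { cc. }
 assert (E : forall n, pint (hline v) (fun _ => 1) (fun t => f t * X t) =
            pint (hline v) (fun _ => 1) (fun t => f t * Cpow (A t) n * X t)).
 { induction n as [| n IH].
  - apply pint_ext. intros; ring.
  - rewrite IH, <- (Cplus_0_l (pint _ _ (fun t => f t * Cpow (A t) (S n) * X t))), <- (H0 n).
   rewrite <- pint_plus by auto. apply pint_ext. intros t ht.
   destruct (H t ht) as [_ [_ EX]]. rewrite Cpow_S. rewrite EX at 1. ring. }
 destruct (pint_le _ _ P) as [L [hL HL]].
 assert (Hm : exists M, 0 < M /\ forall t, on_path (hline v) t -> Cmod (f t) <= M).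
 { destruct (RatLim_bounded _ _ _ (Kgood_strip (Rabs (Im v))) (Hf (Rabs (Im v)))) as [M [hM HM]].
  exists M. split; [exact hM |]. intros t ht. apply HM. unfold strip. rewrite (hline_Im _ _ ht). lra. }
 destruct Hm as [M [hM HM]].
 assert (hB : 0 <= B).
 { destruct (H (hline v 0)) as [_ [h _]]; [exists 0%R; split; [lra | reflexivity] |].
  eapply Rle_trans; [apply Cmod_ge_0 | exact h]. }
 apply (Cmod_geom_zero _ (M * B * L) r hr). intro n. rewrite (E n).
 recast (M * r ^ n * B * L)%R.
 apply HL; [apply Hq2 |]. intros t ht. destruct (H t ht) as [h1 [h2 _]].
 assert (0 <= r ^ n)%R by (apply pow_le; lra).
 rewrite !Cmod_mult, Cmod_pow. apply Rmult_le_compat; try apply Cmod_ge_0; [| | exact h2].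
 - apply Rmult_le_pos; [apply Cmod_ge_0 | apply pow_le, Cmod_ge_0].
 - apply Rmult_le_compat; [apply Cmod_ge_0 | apply pow_le, Cmod_ge_0 | now apply HM |].
  apply pow_incr. split; [apply Cmod_ge_0 | exact h1].
Qed.

(* f(x) is the difference of the integrals of f(t)/(1 - e(t - x)) above and
  below x, and both vanish by expanding in powers of e(t - x). *)
Lemma fourier_zero f : Entire f -> (forall I, fcoef f I = 0) -> forall x, f x = 0.
Proof.
 intros Hf H x.
 assert (H' : forall v I c, pint (hline v) (fun _ => 1) (fun t => f t * (e2pi (IZR I * t) * c)) = 0).
 { intros v I c.
  rewrite (pint_hline_Entire _ v 0).
  - rewrite (pint_ext _ _ _ (fun t => c * (f t * e2pi (IZR I * t)))) by (intros; ring).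
   rewrite pint_scal; [| apply hline_path |].
   + fold (fcoef f I). rewrite H. ring.
   + apply Entire_pcont; [apply hline_cont |]. apply Entire_mult; [exact Hf | apply Entire_e2pi].
  - apply Entire_mult; [exact Hf |]. apply Entire_mult; [apply Entire_e2pi | apply Entire_const]. }
 assert (hq : (0 < exp (- (2 * PI)) < 1)%R).
 { split; [apply exp_pos |]. rewrite <- exp_0. apply exp_increasing. generalize PI_RGT_0. lra. }
 set (q := exp (- (2 * PI))) in *.
 assert (Ei : forall y : R, Im (x + Ci * y) = (Im x + y)%R) by (intro; unfold Im; simpl; ring).
 set (v1 := x + Ci * 1). set (v2 := x + Ci * (- (1))).
 assert (I1 : Im v1 = (Im x + 1)%R) by (unfold v1; apply (Ei 1%R)).
 assert (I2 : Im v2 = (Im x - 1)%R) by (unfold v2; rewrite <- RtoC_opp; rewrite Ei; ring).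
 assert (E := pint_residue (fun _ => False) (strip (Rabs (Im x) + 1)) (hline v1) (fun _ => 1)
  (hline v2) (fun _ => 1) f x (hline_path v1) (hline_path v2)).
 rewrite <- E; clear E; try tauto.
 (* The lines pass at height 1 above and below x, whence q = exp(-2 pi). Above, X = 1 + e(t - x) X
    is expanded; below, X = - e(x - t) (1 - X), where 1 - X = 1 / (1 - e(x - t)) is expanded in
    powers of e(x - t). *)
 - rewrite (pint_power_tail v1 f (fun t => e2pi (t - x)) (geomX x) q (/ (1 - q))),
      (pint_ext (hline v2) _ _ (fun t => (- (1)) * (f t * e2pi (x - t) * (1 - geomX x t)))).
  + rewrite pint_scal.
   * rewrite (pint_power_tail v2 (fun t => f t * e2pi (x - t)) (fun t => e2pi (x - t)) (fun t => 1 - geomX x t) q (/ (1 - q))).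
    -- ring.
    -- lra.
    -- apply Entire_mult; [exact Hf |]. apply (Entire_ext (fun t => e2pi x * e2pi (IZR (-1) * t))).
      { intro t. rewrite <- e2pi_plus. f_equal; ring. }
      apply Entire_scal, Entire_e2pi.
    -- apply pcont_minus; [cc |]. apply avoided_cont; [apply hline_cont |].
      intros t ht. apply avoids_Im. rewrite (hline_Im _ _ ht), I2. lra.
    -- intro s. apply ccont_e2pi, ccont_minus; [cc |]. apply (ccont_clamp (hline v2)), hline_cont.
    -- intros t ht. assert (hI := hline_Im _ _ ht). rewrite I2 in hI.
      assert (ha : avoids t x) by (apply avoids_Im; lra).
      assert (hA : Cmod (e2pi (x - t)) = q).
      { rewrite Cmod_e2pi, Im_minus, hI. unfold q. f_equal. ring. }
      destruct (one_minus_e2pi_opp (t - x) ha) as [hn hE].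
      recast (x - t) in *.
      assert (EX : 1 - geomX x t = / (1 - e2pi (x - t))) by (symmetry; exact hE).
      split; [lra | split].
      ++ rewrite EX, Cmod_inv by exact hn. apply Rinv_le_contravar; [lra |].
       generalize (Cmod_triang_inv 1 (e2pi (x - t))). rewrite Cmod_1, hA. lra.
      ++ rewrite EX. field; auto.
    -- intro n. rewrite (pint_ext _ _ _ (fun t => f t * (e2pi (IZR (- Z.of_nat (S n)) * t) * e2pi (INR (S n) * x)))).
      ++ apply H'.
      ++ intros t _. rewrite <- e2pi_plus.
       recast (f t * Cpow (e2pi (x - t)) (S n)) by (rewrite Cpow_S; ring).
       rewrite <- e2pi_INR_mult. do 2 f_equal.
       rewrite opp_IZR, RtoC_opp, <- INR_IZR_INZ. ring.
   * apply hline_path.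
   * apply pcont_mult; [apply pcont_mult | apply pcont_minus; [cc | apply avoided_cont; [apply hline_cont |]]].
    -- apply Entire_pcont; [apply hline_cont | exact Hf].
    -- intro s. apply ccont_e2pi, ccont_minus; [apply ccont_const |]. apply (ccont_clamp (hline v2)), hline_cont.
    -- intros t ht. apply avoids_Im. rewrite (hline_Im _ _ ht), I2. lra.
  + intros t ht. assert (ha : avoids t x) by (apply avoids_Im; rewrite (hline_Im _ _ ht), I2; lra).
   assert (Eg := geomX_eq x t ha).
   assert (EE : e2pi (x - t) * e2pi (t - x) = 1).
   { rewrite <- e2pi_plus. recast (RtoC 0). apply e2pi_0. }
   replace (geomX x t) with (e2pi (x - t) * (e2pi (t - x) * geomX x t)) at 1.
   * rewrite Eg. ring.
   * rewrite Cmult_assoc, EE. ring.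
  + lra.
  + exact Hf.
  + apply avoided_cont; [apply hline_cont |].
   intros t ht. apply avoids_Im. rewrite (hline_Im _ _ ht), I1. lra.
  + intro s. apply ccont_e2pi, ccont_minus; [| cc]. apply (ccont_clamp (hline v1)), hline_cont.
  + intros t ht. assert (hI := hline_Im _ _ ht). rewrite I1 in hI.
   assert (ha : avoids t x) by (apply avoids_Im; lra).
   assert (hA : Cmod (e2pi (t - x)) = q).
   { rewrite Cmod_e2pi, Im_minus, hI. unfold q. f_equal. ring. }
   split; [lra | split].
   * unfold geomX. rewrite Cmod_inv by exact ha. apply Rinv_le_contravar; [lra |].
    generalize (Cmod_triang_inv 1 (e2pi (t - x))). rewrite Cmod_1, hA. lra.
   * rewrite geomX_eq by exact ha. ring.
  + intro n. rewrite (pint_ext _ _ _ (fun t => f t * (e2pi (IZR (Z.of_nat n) * t) * e2pi (- (INR n * x))))).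
   * apply H'.
   * intros t _. rewrite <- e2pi_plus, <- e2pi_INR_mult. do 2 f_equal. rewrite <- INR_IZR_INZ. ring.
 - apply Kgood_strip.
 - intros t ht. unfold strip. rewrite (hline_Im _ _ ht), I1.
  eapply Rle_trans; [apply Rabs_triang |]. rewrite Rabs_R1. lra.
 - intros t ht. unfold strip. rewrite (hline_Im _ _ ht), I2.
  eapply Rle_trans; [apply Rabs_triang |]. rewrite Rabs_Ropp, Rabs_R1. lra.
 - unfold strip. lra.
 - apply hline_above. lra.
 - apply hline_below. lra.
 - apply Hf.
Qed.

(** An entire integrand may be integrated over the line through [s] instead of 0, where
    quasi-periodicity is applied. *)
Lemma fcoef_shift (f : C -> C) (s c : C) (d : Z) : Entire f -> (forall t, f (t + s) = c * e2pi (- (IZR d * t)) * f t) ->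
 forall I, fcoef f I = c * e2pi (IZR I * s) * fcoef f (I - d).
Proof.
 intros Hf H I. unfold fcoef.
 assert (HfI : forall J, Entire (fun t => f t * e2pi (IZR J * t))) by (intro J; apply Entire_mult; [exact Hf | apply Entire_e2pi]).
 rewrite (pint_hline_Entire _ 0 s) by apply HfI.
 transitivity (pint (hline 0) (fun _ => 1) (fun t => f (t + s) * e2pi (IZR I * (t + s)))).
 - apply cint_ext. intro r. unfold hline. rewrite Cplus_0_r. reflexivity.
 - rewrite <- pint_scal; [| apply hline_path | apply Entire_pcont; [apply hline_cont | apply HfI]].
  apply pint_ext. intros t _. rewrite H.
  recast (IZR I * s + IZR I * t).
  rewrite e2pi_plus, minus_IZR, RtoC_minus.
  recast (IZR I * t + - (IZR d * t)). rewrite e2pi_plus. ring.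
Qed.

(** Quasi-periodicity links coefficients at distance [d] by a nonzero factor, so a theta function of
    degree [d] is determined by [d] consecutive coefficients. *)
Lemma quasi_periodic_zero (f : C -> C) (s c : C) (d : nat) : Entire f -> c <> 0 -> (0 < d)%nat ->
 (forall t, f (t + s) = c * e2pi (- (INR d * t)) * f t) ->
 (forall i : nat, (i < d)%nat -> fcoef f (Z.of_nat i) = 0) -> forall x, f x = 0.
Proof.
 intros Hf hc hd H H0. apply fourier_zero; [exact Hf |].
 assert (Hs := fcoef_shift f s c (Z.of_nat d) Hf).
 assert (Hs' : forall I, fcoef f I = c * e2pi (IZR I * s) * fcoef f (I - Z.of_nat d)).
 { apply Hs. intro t. now rewrite <- INR_IZR_INZ. }
 assert (Hu : forall n : nat, fcoef f (Z.of_nat n) = 0).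
 { induction n as [n IH] using (well_founded_induction lt_wf).
  destruct (Nat.lt_ge_cases n d) as [h | h]; [now apply H0 |].
  rewrite Hs'. recast (Z.of_nat (n - d)) by lia.
  rewrite IH by lia. ring. }
 assert (Hd : forall n : nat, fcoef f (- Z.of_nat n) = 0).
 { induction n as [n IH] using (well_founded_induction lt_wf).
  destruct (Nat.eq_dec n 0) as [-> | hn]; [apply (Hu 0%nat) |].
  assert (E : fcoef f (- Z.of_nat n + Z.of_nat d) = 0).
  { destruct (Nat.le_gt_cases n d) as [h | h].
   - recast (Z.of_nat (d - n)) by lia. apply Hu.
   - recast (- Z.of_nat (n - d))%Z by lia. apply IH. lia. }
  rewrite Hs' in E. recast (- Z.of_nat n)%Z in E by lia.
  apply NNPP. intro hne. revert E. apply Cmult_neq_0; [apply Cmult_neq_0 | exact hne];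
   [exact hc | apply e2pi_neq_0]. }
 intro I. destruct (Z_le_dec 0 I).
 - recast (Z.of_nat (Z.to_nat I)) by lia. apply Hu.
 - recast (- Z.of_nat (Z.to_nat (- I)))%Z by lia. apply Hd.
Qed.

Lemma fcoef_plus f g I : Entire f -> Entire g -> fcoef (fun t => f t + g t) I = fcoef f I + fcoef g I.
Proof.
 intros Hf Hg. unfold fcoef. rewrite <- pint_plus.
 - apply pint_ext. intros; ring.
 - apply hline_path.
 - apply Entire_pcont; [apply hline_cont |]. apply Entire_mult; [assumption | apply Entire_e2pi].
 - apply Entire_pcont; [apply hline_cont |]. apply Entire_mult; [assumption | apply Entire_e2pi].
Qed.

Lemma fcoef_scal c f I : Entire f -> fcoef (fun t => c * f t) I = c * fcoef f I.
Proof.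
 intros Hf. unfold fcoef. rewrite <- pint_scal.
 - apply pint_ext. intros; ring.
 - apply hline_path.
 - apply Entire_pcont; [apply hline_cont |]. apply Entire_mult; [assumption | apply Entire_e2pi].
Qed.

Lemma fcoef_ext f g I : (forall t, f t = g t) -> fcoef f I = fcoef g I.
Proof. intro H. now recast f by now apply functional_extensionality. Qed.

(** The multiplicative theta function: the Jacobi product stripped of its constant and of its
    half-integer exponential. Unlike [theta] it is 1-periodic, so it falls under [Entire]. *)
Definition th0 (x s : C) : C := poch x s * poch (s - x) s.

Lemma poch_period x s (m : Z) : poch (x + IZR m) s = poch x s.
Proof.
 unfold poch. do 2 f_equal. apply functional_extensionality. intro k.
 recast (x + INR k * s + IZR m). now rewrite e2pi_plus_IZR.
Qed.

Lemma th0_period x s (m : Z) : th0 (x + IZR m) s = th0 x s.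
Proof.
 unfold th0. rewrite poch_period. f_equal.
 recast (s - x + IZR (- m)) by (rewrite opp_IZR, RtoC_opp; ring).
 apply poch_period.
Qed.

Lemma th0_shift x s : 0 < Im s -> th0 (x + s) s = - e2pi (- x) * th0 x s.
Proof.
 intro hs. unfold th0. recast (- x).
 rewrite (poch_step (- x) s), (poch_step x s) by exact hs.
 recast (s - x).
 rewrite e2pi_opp. assert (hz := e2pi_neq_0 x). field; auto.
Qed.

Lemma th0_opp x s : 0 < Im s -> th0 (- x) s = - e2pi (- x) * th0 x s.
Proof.
 intro hs. unfold th0. recast (x + s).
 rewrite (poch_step (- x) s), (poch_step x s) by exact hs.
 recast (s - x).
 rewrite e2pi_opp. assert (hz := e2pi_neq_0 x). field; auto.
Qed.

Lemma th0_neq_0 x s : 0 < Im s -> (forall k : Z, 1 - e2pi (x + IZR k * s) <> 0) -> th0 x s <> 0.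
Proof.
 intros hs H. apply Cmult_neq_0; apply poch_neq_0; try exact hs; intro k.
 - rewrite INR_IZR_INZ. apply H.
 - replace (s - x + INR k * s) with (- (x + IZR (- Z.of_nat (S k)) * s)).
  + apply one_minus_e2pi_opp, H.
  + rewrite opp_IZR, <- INR_IZR_INZ, S_INR, RtoC_opp, RtoC_plus. ring.
Qed.

Lemma th0_factor x s : 0 < Im s -> th0 x s = (1 - e2pi x) * (poch (x + s) s * poch (s - x) s).
Proof. intro hs. unfold th0. rewrite (poch_step x s) by exact hs. ring. Qed.

Lemma Entire_poch I c s : 0 < Im s -> Entire (fun t => poch (IZR I * t + c) s).
Proof. intros hs M. apply RatLim_poch; [apply Kgood_strip | exact hs]. Qed.

Lemma Entire_th0 c s : 0 < Im s -> Entire (fun t => th0 (t + c) s).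
Proof.
 intro hs. unfold th0. apply Entire_mult.
 - apply (Entire_ext (fun t => poch (IZR 1 * t + c) s)); [| now apply Entire_poch].
  intros; f_equal; ring.
 - apply (Entire_ext (fun t => poch (IZR (-1) * t + (s - c)) s)); [| now apply Entire_poch].
  intros; f_equal; ring.
Qed.

Lemma th0_cont c s x : 0 < Im s -> continuous (T := C_UniformSpace) (U := C_UniformSpace) (fun t => th0 (t + c) s) x.
Proof. intro hs. apply Entire_cont. now apply Entire_th0. Qed.

(** * The theta series *)
Fixpoint sumc (f : nat -> C) (n : nat) : C :=
 match n with O => f O | S m => sumc f m + f (S m) end.

Lemma Cseries_Clim f : Cseries f = Clim (sumc f).
Proof.
 assert (E : sum_n (G := C_R_NormedModule) f = sumc f).
 { apply functional_extensionality. intro n. induction n as [| n IH].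
  - rewrite (sum_O (G := C_R_NormedModule)). reflexivity.
  - rewrite (sum_Sn (G := C_R_NormedModule)), IH. reflexivity. }
 unfold Cseries, Clim. f_equal. apply functional_extensionality. intro l.
 unfold is_series, Clim_to. now rewrite E.
Qed.

Lemma half_pow_exp (n : nat) : ((/ 2) ^ n = exp (- (INR n * ln 2)))%R.
Proof.
 rewrite exp_Ropp, pow_inv. f_equal.
 rewrite <- (exp_ln (2 ^ n)) by (apply pow_lt; lra). f_equal. apply ln_pow. lra.
Qed.

(** The square is completed in h = n + 1/2. The summand ln 2 in [be] is what leaves a factor (1/2)^n
    over, so Gaussian series converge geometrically on strips. *)
Lemma gauss_geom (b M : R) : 0 < b -> 0 <= M -> exists D : R, 0 <= D /\ forall n : nat,
 exp (- (PI * b * (INR n + 1 / 2) ^ 2)) * exp (2 * PI * (INR n + 1) * M) <= D * (/ 2) ^ n.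
Proof.
 intros hb hM. set (al := (PI * b)%R). assert (hal : 0 < al) by (apply Rmult_lt_0_compat; [apply PI_RGT_0 | lra]).
 set (be := (2 * PI * M + ln 2)%R). set (ga := (2 * PI * M)%R).
 exists (exp (be ^ 2 / (4 * al) + ga)). split; [left; apply exp_pos |]. intro n.
 rewrite half_pow_exp, <- !exp_plus. apply exp_le.
 assert (hln : 0 < ln 2) by (rewrite <- ln_1; apply ln_increasing; lra).
 assert (hga : 0 <= ga) by (unfold ga; generalize PI_RGT_0; nra).
 set (h := (INR n + 1 / 2)%R).
 assert (Q : be * h - al * h ^ 2 <= be ^ 2 / (4 * al)).
 { apply Rmult_le_reg_l with (4 * al)%R; [lra |].
  recast (be ^ 2)%R by (field; lra).
  assert (0 <= (be - 2 * al * h) ^ 2)%R by apply pow2_ge_0. nra. }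
 unfold be in Q at 1. unfold ga in *. fold al.
 recast (h + 1 / 2)%R by (unfold h; lra).
 recast (h - 1 / 2)%R by (unfold h; lra).
 lra.
Qed.

Definition gsum (beta : nat -> C) (I : nat -> Z) (n : nat) (t : C) : C :=
 sumc (fun j => beta j * e2pi (IZR (I j) * t)) n.

Definition gser (beta : nat -> C) (I : nat -> Z) (t : C) : C := Clim (fun n => gsum beta I n t).

Lemma gser_conv b beta I M : 0 < b ->
 (forall j : nat, Cmod (beta j) <= exp (- (PI * b * (INR j + 1 / 2) ^ 2))) ->
 (forall j : nat, Rabs (IZR (I j)) <= INR j + 1) ->
 exists D, 0 <= D /\ forall t, strip M t ->
  Clim_to (fun n => gsum beta I n t) (gser beta I t) /\
  forall n, Cmod (gser beta I t - gsum beta I n t) <= D * (/ 2) ^ n.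
Proof.
 intros hb hbeta hI.
 destruct (gauss_geom b (Rabs M) hb (Rabs_pos M)) as [D [hD HD]].
 exists (D / (1 - / 2))%R. split; [apply Rdiv_le_0_compat; lra |]. intros t ht.
 destruct (geom_cauchy (fun n => gsum beta I n t) D (/ 2)) as [l [Hl Hd]]; try lra.
 { intro n. unfold gsum. simpl sumc.
  recast (beta (S n) * e2pi (IZR (I (S n)) * t)).
  rewrite Cmod_mult. apply Rle_trans with (D * (/ 2) ^ S n)%R.
  - eapply Rle_trans; [| apply HD]. apply Rmult_le_compat; try apply Cmod_ge_0; [apply hbeta |].
   eapply Rle_trans; [apply (Cmod_e2pi_bound (Rabs M)) |].
   + unfold strip in ht. generalize (Rle_abs M). lra.
   + apply exp_le. apply Rmult_le_compat_r; [apply Rabs_pos |].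
    apply Rmult_le_compat_l; [generalize PI_RGT_0; lra | apply hI].
  - apply Rmult_le_compat_l; [exact hD |]. simpl. assert (0 <= (/ 2) ^ n)%R by (apply pow_le; lra). lra. }
 unfold gser. rewrite (Clim_eq _ _ Hl). cc.
Qed.

Lemma Entire_gsum beta I n : Entire (gsum beta I n).
Proof.
 unfold gsum. induction n as [| n IH]; simpl.
 - apply Entire_scal, Entire_e2pi.
 - apply Entire_plus; [exact IH | apply Entire_scal, Entire_e2pi].
Qed.

Lemma Entire_gser b beta I : 0 < b ->
 (forall j : nat, Cmod (beta j) <= exp (- (PI * b * (INR j + 1 / 2) ^ 2))) ->
 (forall j : nat, Rabs (IZR (I j)) <= INR j + 1) -> Entire (gser beta I).
Proof.
 intros hb hbeta hI M. destruct (gser_conv b beta I M hb hbeta hI) as [D [hD H]].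
 apply RatLim_unif. intros eps he.
 destruct (pow_lt_1_zero (/ 2) ltac:(rewrite Rabs_pos_eq; lra) (eps / (D + 1))%R) as [N HN].
 { apply Rdiv_lt_0_compat; lra. }
 exists (gsum beta I N). split; [apply Entire_gsum |]. intros t ht.
 eapply Rle_lt_trans; [now apply H |].
 specialize (HN N (Nat.le_refl _)). assert (h0 : 0 <= (/ 2) ^ N) by (apply pow_le; lra).
 rewrite Rabs_pos_eq in HN by exact h0.
 apply (Rmult_lt_compat_l (D + 1)) in HN; [| lra].
 recast eps in HN by (field; lra). nra.
Qed.

Lemma fcoef_e2pi c I : fcoef (fun t => c * e2pi (IZR I * t)) 0 = if Z.eq_dec I 0 then c else 0.
Proof.
 rewrite fcoef_scal by apply Entire_e2pi. unfold fcoef.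
 rewrite (pint_ext _ _ _ (fun t => e2pi (IZR I * t))).
 - rewrite pint_e2pi by apply hline_path. destruct Z.eq_dec; ring.
 - intros t _. rewrite Cmult_0_l, e2pi_0. ring.
Qed.

Lemma fcoef_gser b beta I : 0 < b ->
 (forall j : nat, Cmod (beta j) <= exp (- (PI * b * (INR j + 1 / 2) ^ 2))) ->
 (forall j : nat, Rabs (IZR (I j)) <= INR j + 1) ->
 (forall j : nat, I (S j) <> 0%Z) ->
 fcoef (gser beta I) 0 = if Z.eq_dec (I O) 0 then beta O else 0.
Proof.
 intros hb hbeta hI hne.
 assert (Hn : forall n, fcoef (gsum beta I n) 0 = if Z.eq_dec (I O) 0 then beta O else 0).
 { induction n as [| n IH]; unfold gsum in *; simpl sumc.
  - apply fcoef_e2pi.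
  - rewrite fcoef_plus, IH, fcoef_e2pi.
   + destruct (Z.eq_dec (I (S n)) 0) as [h | h]; [now apply hne in h | ring].
   + apply (Entire_gsum beta I n).
   + apply Entire_scal, Entire_e2pi. }
 destruct (gser_conv b beta I 0 hb hbeta hI) as [D [hD H]].
 assert (HE := Entire_gser b beta I hb hbeta hI).
 destruct (pint_le _ _ (hline_path 0)) as [L [hL HL]].
 apply Ceq_minus. apply (Cmod_geom_zero _ (D * L) (/ 2)); [lra |]. intro n.
 rewrite <- (Hn n).
 replace (fcoef (gser beta I) 0 - fcoef (gsum beta I n) 0)
  with (fcoef (fun t => gser beta I t + (- (1)) * gsum beta I n t) 0).
 2: { rewrite fcoef_plus, fcoef_scal; [ring | apply Entire_gsum | exact HE | apply Entire_scal, Entire_gsum]. }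
 recast (D * (/ 2) ^ n * L)%R. unfold fcoef. apply HL.
 - apply Entire_pcont; [apply hline_cont |]. apply Entire_mult; [| apply Entire_e2pi].
  apply Entire_plus; [exact HE | apply Entire_scal, Entire_gsum].
 - intros t ht. rewrite Cmult_0_l, e2pi_0, Cmult_1_r.
  recast (gser beta I t - gsum beta I n t).
  apply H. unfold strip. rewrite (hline_Im _ _ ht), Im_RtoC, Rabs_R0. lra.
Qed.

Definition thcoef (s : C) (j : Z) : C :=
 let h : C := RtoC (IZR j + 1 / 2)%R in Cexp (Ci * PI * s * (h * h) + Ci * PI * h).

(** Once e(- x/2) is factored out of the theta series, the half-integer j + 1/2 becomes the integer
    j + 1. *)
Definition thterm (s : C) (j : Z) (t : C) : C := thcoef s j * e2pi (IZR (j + 1) * t).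

Definition thpos (s : C) : C -> C := gser (fun j => thcoef s (Z.of_nat j)) (fun j => (Z.of_nat j + 1)%Z).

Definition thneg (s : C) : C -> C :=
 gser (fun j => thcoef s (- Z.of_nat (S j))) (fun j => (- Z.of_nat (S j) + 1)%Z).

Lemma Cmod_thcoef s j : Cmod (thcoef s j) = exp (- (PI * Im s * (IZR j + 1 / 2) ^ 2)).
Proof. unfold thcoef. rewrite Cmod_Cexp. f_equal. unfold Re, Im. simpl. ring. Qed.

Lemma IZR_opp_S (j : nat) : IZR (- Z.of_nat (S j)) = (- (INR j + 1))%R.
Proof. rewrite opp_IZR, <- INR_IZR_INZ, S_INR. reflexivity. Qed.

Lemma thpos_hyp s : (forall j : nat, Cmod (thcoef s (Z.of_nat j)) <= exp (- (PI * Im s * (INR j + 1 / 2) ^ 2))) /\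
 (forall j : nat, Rabs (IZR (Z.of_nat j + 1)) <= INR j + 1).
Proof.
 split; intro j.
 - rewrite Cmod_thcoef, <- INR_IZR_INZ. lra.
 - rewrite plus_IZR, <- INR_IZR_INZ, Rabs_pos_eq; [lra |]. generalize (pos_INR j). lra.
Qed.

Lemma thneg_hyp s : (forall j : nat, Cmod (thcoef s (- Z.of_nat (S j))) <= exp (- (PI * Im s * (INR j + 1 / 2) ^ 2))) /\
 (forall j : nat, Rabs (IZR (- Z.of_nat (S j) + 1)) <= INR j + 1).
Proof.
 split; intro j.
 - rewrite Cmod_thcoef, IZR_opp_S. right. do 2 f_equal. field.
 - rewrite plus_IZR, IZR_opp_S. recast (- INR j)%R.
  rewrite Rabs_Ropp, Rabs_pos_eq; [lra | apply pos_INR].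
Qed.

Lemma thpos_lim s t : 0 < Im s -> Clim_to (sumc (fun j => thterm s (Z.of_nat j) t)) (thpos s t).
Proof.
 intro hs. destruct (gser_conv _ _ _ (Rabs (Im t)) hs (proj1 (thpos_hyp s)) (proj2 (thpos_hyp s))) as [D [_ H]].
 apply H. unfold strip. lra.
Qed.

Lemma thneg_lim s t : 0 < Im s -> Clim_to (sumc (fun j => thterm s (- Z.of_nat (S j)) t)) (thneg s t).
Proof.
 intro hs. destruct (gser_conv _ _ _ (Rabs (Im t)) hs (proj1 (thneg_hyp s)) (proj2 (thneg_hyp s))) as [D [_ H]].
 apply H. unfold strip. lra.
Qed.

Lemma sumc_ext f g n : (forall j, f j = g j) -> sumc f n = sumc g n.
Proof. intro H. induction n as [| n IH]; simpl; rewrite ?IH, H; reflexivity. Qed.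

Lemma sumc_scal c f n : sumc (fun j => c * f j) n = c * sumc f n.
Proof. induction n as [| n IH]; simpl; [reflexivity | rewrite IH; ring]. Qed.

Lemma sumc_shift f n : sumc f (S n) = f O + sumc (fun j => f (S j)) n.
Proof. induction n as [| n IH]; [reflexivity |]. simpl in *. rewrite IH. ring. Qed.

Lemma theta_summand s j x :
 (let h : C := RtoC (IZR j + 1 / 2)%R in Cexp (Ci * PI * s * (h * h) + 2 * PI * Ci * h * (x + 1 / 2)))
 = e2pi (- (x / 2)) * thterm s j x.
Proof.
 unfold thterm, thcoef, e2pi. cbv zeta. rewrite <- !Cexp_plus. apply (f_equal Cexp).
 rewrite plus_IZR. csimp. rewrite RtoC_div by lra. field.
Qed.

Definition Theta1 (s x : C) : C := - (thpos s x + thneg s x).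

Lemma theta_Theta1 x s : 0 < Im s -> theta x s = e2pi (- (x / 2)) * Theta1 s x.
Proof.
 intro hs. unfold theta, Cseries_Z, Theta1. rewrite !Cseries_Clim.
 rewrite (Clim_eq _ (e2pi (- (x / 2)) * thpos s x)), (Clim_eq _ (e2pi (- (x / 2)) * thneg s x)); [ring | |].
 - apply (Clim_to_ext (fun n => e2pi (- (x / 2)) * sumc (fun j => thterm s (- Z.of_nat (S j)) x) n)).
  + intro n. rewrite <- sumc_scal. apply sumc_ext. intro j. symmetry. apply theta_summand.
  + apply Clim_to_mult; [apply Clim_to_const | now apply thneg_lim].
 - apply (Clim_to_ext (fun n => e2pi (- (x / 2)) * sumc (fun j => thterm s (Z.of_nat j) x) n)).
  + intro n. rewrite <- sumc_scal. apply sumc_ext. intro j. symmetry. apply theta_summand.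
  + apply Clim_to_mult; [apply Clim_to_const | now apply thpos_lim].
Qed.

Lemma Cexp_PI : Cexp (Ci * PI) = - (1).
Proof.
 unfold Cexp. recast 0%R by (unfold Re; simpl; ring).
 recast PI by (unfold Im; simpl; ring).
 rewrite exp_0, cos_PI, sin_PI. C_eq.
Qed.

Lemma thterm_shift s j t : thterm s j (t + s) = - e2pi (- t) * thterm s (j + 1) t.
Proof.
 unfold thterm, thcoef. cbv zeta. recast (Cexp (Ci * PI) * e2pi (- t)) by (rewrite Cexp_PI; ring).
 unfold e2pi. rewrite <- !Cexp_plus.
 transitivity (Cexp (Ci * PI * s * (RtoC (IZR (j + 1) + 1 / 2) * RtoC (IZR (j + 1) + 1 / 2)) + Ci * PI * RtoC (IZR (j + 1) + 1 / 2)
   + (2 * PI * Ci * (IZR (j + 1 + 1) * t)) + (Ci * PI + 2 * PI * Ci * - t) - 2 * PI * Ci * 1)).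
 - apply (f_equal Cexp). rewrite !plus_IZR. csimp. rewrite RtoC_div by lra. field.
 - unfold Cminus at 1. rewrite Cexp_plus.
  replace (Cexp (- (2 * PI * Ci * 1))) with (RtoC 1).
  + rewrite Cmult_1_r. f_equal; ring.
  + rewrite Cexp_opp. change (Cexp (2 * PI * Ci * 1)) with (e2pi 1). rewrite e2pi_1. field.
Qed.

Lemma Clim_to_plus a b l m : Clim_to a l -> Clim_to b m -> Clim_to (fun n => a n + b n) (l + m).
Proof.
 intros Ha Hb. apply Clim_to_eps. intros eps he.
 destruct (proj1 (Clim_to_eps _ _) Ha (eps / 2)%R ltac:(lra)) as [N1 H1].
 destruct (proj1 (Clim_to_eps _ _) Hb (eps / 2)%R ltac:(lra)) as [N2 H2].
 exists (Nat.max N1 N2). intros n hn. specialize (H1 n ltac:(lia)). specialize (H2 n ltac:(lia)).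
 recast ((a n - l) + (b n - m)).
 eapply Rle_lt_trans; [apply Cmod_triangle | lra].
Qed.

(** The translation by [s] moves the index j to j + 1. The term of index 0 thereby leaves the
    positive half of the series and joins the negative half. *)
Lemma Theta1_shift s t : 0 < Im s -> Theta1 s (t + s) = - e2pi (- t) * Theta1 s t.
Proof.
 intro hs. set (k := - e2pi (- t)).
 assert (E1 : thpos s (t + s) = k * (thpos s t - thterm s 0 t)).
 { apply (Clim_to_unique (sumc (fun j => thterm s (Z.of_nat j) (t + s)))); [now apply thpos_lim |].
  apply (Clim_to_ext (fun n => k * (sumc (fun j => thterm s (Z.of_nat j) t) (S n) - thterm s 0 t))).
  - intro n. rewrite sumc_shift. change (Z.of_nat 0) with 0%Z.
   rewrite (sumc_ext (fun j => thterm s (Z.of_nat j) (t + s)) (fun j => k * thterm s (Z.of_nat (S j)) t)).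
   + rewrite sumc_scal. ring.
   + intro j. rewrite thterm_shift. fold k. do 2 f_equal. lia.
  - apply Clim_to_mult; [apply Clim_to_const |].
   apply (Clim_to_minus_const (fun n => sumc (fun j => thterm s (Z.of_nat j) t) (S n))).
   apply (Clim_to_S (sumc _)). now apply thpos_lim. }
 assert (E2 : thneg s (t + s) = k * (thterm s 0 t + thneg s t)).
 { apply (Clim_to_unique (fun n => sumc (fun j => thterm s (- Z.of_nat (S j)) (t + s)) (S n))).
  - apply (Clim_to_S (sumc _)). now apply thneg_lim.
  - apply (Clim_to_ext (fun n => k * (thterm s 0 t + sumc (fun j => thterm s (- Z.of_nat (S j)) t) n))).
   + intro n. rewrite sumc_shift.
    rewrite (sumc_ext (fun j => thterm s (- Z.of_nat (S (S j))) (t + s)) (fun j => k * thterm s (- Z.of_nat (S j)) t)).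
    * rewrite sumc_scal, thterm_shift. fold k. change (- Z.of_nat 1 + 1)%Z with 0%Z. ring.
    * intro j. rewrite thterm_shift. fold k. do 2 f_equal. lia.
   + apply Clim_to_mult; [apply Clim_to_const |].
    apply Clim_to_plus; [apply Clim_to_const | now apply thneg_lim]. }
 unfold Theta1. rewrite E1, E2. ring.
Qed.

Lemma Entire_thpos s : 0 < Im s -> Entire (thpos s).
Proof. intro hs. exact (Entire_gser (Im s) _ _ hs (proj1 (thpos_hyp s)) (proj2 (thpos_hyp s))). Qed.

Lemma Entire_thneg s : 0 < Im s -> Entire (thneg s).
Proof. intro hs. exact (Entire_gser (Im s) _ _ hs (proj1 (thneg_hyp s)) (proj2 (thneg_hyp s))). Qed.

Lemma Entire_Theta1 s : 0 < Im s -> Entire (Theta1 s).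
Proof.
 intro hs. apply (Entire_ext (fun t => (- (1)) * (thpos s t + thneg s t))); [intro; unfold Theta1; ring |].
 apply Entire_scal, Entire_plus; [now apply Entire_thpos | now apply Entire_thneg].
Qed.

(** Only j = -1 has exponent j + 1 = 0. It is the first term of the negative half, and its
    coefficient is an exponential. *)
Lemma fcoef_Theta1 s : 0 < Im s -> fcoef (Theta1 s) 0 <> 0.
Proof.
 intro hs.
 assert (Hp := Entire_thpos s hs). assert (Hn := Entire_thneg s hs).
 replace (fcoef (Theta1 s) 0) with (fcoef (fun t => (- (1)) * (thpos s t + thneg s t)) 0).
 2: { apply fcoef_ext. intro t. unfold Theta1. ring. }
 rewrite fcoef_scal, fcoef_plus by (try apply Entire_plus; assumption).
 assert (E1 : fcoef (thpos s) 0 = 0).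
 { exact (fcoef_gser (Im s) _ _ hs (proj1 (thpos_hyp s)) (proj2 (thpos_hyp s)) ltac:(intro j; cbv beta; lia)). }
 assert (E2 : fcoef (thneg s) 0 = thcoef s (-1)).
 { exact (fcoef_gser (Im s) _ _ hs (proj1 (thneg_hyp s)) (proj2 (thneg_hyp s)) ltac:(intro j; cbv beta; lia)). }
 rewrite E1, E2, Cplus_0_l. apply Cmult_neq_0.
 - intro E. apply C1_nz. recast (- - (RtoC 1)). rewrite E. ring.
 - apply Cexp_neq_0.
Qed.

(** The Jacobi triple product up to its constant: both sides are theta functions of degree 1, hence
    proportional by one Fourier coefficient. The value of the constant cancels in all later uses. *)
Lemma theta_th0 s : 0 < Im s -> exists k : C, k <> 0 /\ forall x, theta x s = k * e2pi (- (x / 2)) * th0 x s.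
Proof.
 intro hs.
 assert (H0 : Entire (fun t => th0 t s)).
 { apply (Entire_ext (fun t => th0 (t + 0) s)); [intro t; now rewrite Cplus_0_r | now apply Entire_th0]. }
 assert (H1 := Entire_Theta1 s hs). assert (hne := fcoef_Theta1 s hs).
 set (a := fcoef (Theta1 s) 0) in *. set (b := fcoef (fun t => th0 t s) 0).
 assert (E : forall x, a * th0 x s + (- b) * Theta1 s x = 0).
 { apply (quasi_periodic_zero _ s (- (1)) 1).
  - apply Entire_plus; now apply Entire_scal.
  - intro E. apply C1_nz. recast (- - (RtoC 1)). rewrite E. ring.
  - lia.
  - intro t. rewrite th0_shift, Theta1_shift by exact hs. simpl. rewrite Cmult_1_l. ring.
  - intros i hi. recast 0%nat by lia. simpl.
   rewrite fcoef_plus, !fcoef_scal by (try apply Entire_scal; assumption). fold a b. ring. }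
 (* The half period s/2 is not in the lattice, so [th0] does not vanish there; with b = 0 the
    relation [E] would fail at this point. *)
 assert (hb : b <> 0).
 { intro hb. set (x := RtoC (/ 2) * s).
  assert (n0 : th0 x s <> 0).
  { apply th0_neq_0; [exact hs |]. intros k.
   recast (x + IZR k * s - 0).
   apply (proj2 (avoids_iff (x + IZR k * s) 0)).
   intros m Em. apply (f_equal Im) in Em. unfold x, Im in Em. simpl in Em.
   unfold Im in hs.
   assert (Ek : ((1 / 2 + IZR k) * snd s = 0)%R) by lra.
   apply Rmult_integral in Ek. destruct Ek as [Ek | Ek]; [| lra].
   assert (Ek' : IZR (2 * k + 1) = 0%R) by (rewrite plus_IZR, mult_IZR; lra).
   apply eq_IZR in Ek'. lia. }
  specialize (E x). rewrite hb in E.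
  apply (Cmult_neq_0 a (th0 x s) hne n0). rewrite <- E. ring. }
 exists (a / b). split.
 - apply Cmult_neq_0; [exact hne |]. intro E0. apply C1_nz. rewrite <- (Cinv_r b hb), E0. ring.
 - intro x. rewrite theta_Theta1 by exact hs.
  replace (Theta1 s x) with (a / b * th0 x s); [ring |].
  apply Ceq_minus. recast (/ b * (a * th0 x s + - b * Theta1 s x)) by (field; exact hb).
  rewrite E. ring.
Qed.

Lemma theta_opp x s : 0 < Im s -> theta (- x) s = - theta x s.
Proof.
 intro hs. destruct (theta_th0 s hs) as [k [_ E]]. rewrite !E, th0_opp by exact hs.
 recast (- (x / 2) + x) by field. rewrite e2pi_plus, e2pi_opp.
 assert (h1 := e2pi_neq_0 x). rewrite (e2pi_opp x). field. split; [| exact h1].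
 apply e2pi_neq_0.
Qed.

Lemma theta_0 s : 0 < Im s -> theta 0 s = 0.
Proof.
 intro hs. assert (E := theta_opp 0 s hs). recast (RtoC 0) in E.
 assert (E2 : 2 * theta 0 s = 0).
 { recast (theta 0 s + theta 0 s). rewrite E at 1. ring. }
 apply NNPP. intro h. revert E2. apply Cmult_neq_0; [| exact h]. intro E3. apply RtoC_inj in E3. lra.
Qed.

Lemma theta_shift x s : 0 < Im s -> theta (x + s) s = - e2pi (- x - s / 2) * theta x s.
Proof.
 intro hs. destruct (theta_th0 s hs) as [k [_ E]]. rewrite !E, th0_shift by exact hs.
 recast (- (x / 2) + - (s / 2)) by field.
 recast (- x + - (s / 2)). rewrite !e2pi_plus. ring.
Qed.

Lemma theta_neq_0_iff x s : 0 < Im s -> theta x s <> 0 <-> th0 x s <> 0.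
Proof.
 intro hs. destruct (theta_th0 s hs) as [k [hk E]]. rewrite E. split.
 - intros H H0. apply H. rewrite H0. ring.
 - intro H. apply Cmult_neq_0; [apply Cmult_neq_0; [exact hk | apply e2pi_neq_0] | exact H].
Qed.

Lemma linear_dep_3 (a1 b1 a2 b2 a3 b3 : C) : exists x1 x2 x3 : C,
 (x1 <> 0 \/ x2 <> 0 \/ x3 <> 0) /\ x1 * a1 + x2 * a2 + x3 * a3 = 0 /\ x1 * b1 + x2 * b2 + x3 * b3 = 0.
Proof.
 assert (G : forall a1 b1 a2 b2 a3 b3 : C, a1 <> 0 -> exists x1 x2 x3 : C,
  (x1 <> 0 \/ x2 <> 0 \/ x3 <> 0) /\ x1 * a1 + x2 * a2 + x3 * a3 = 0 /\ x1 * b1 + x2 * b2 + x3 * b3 = 0).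
 { clear. intros a1 b1 a2 b2 a3 b3 h.
  set (c2 := b2 - a2 / a1 * b1). set (c3 := b3 - a3 / a1 * b1).
  assert (K : forall x2 x3, x2 * c2 + x3 * c3 = 0 ->
   - (x2 * a2 + x3 * a3) / a1 * a1 + x2 * a2 + x3 * a3 = 0 /\
   - (x2 * a2 + x3 * a3) / a1 * b1 + x2 * b2 + x3 * b3 = 0).
  { intros x2 x3 H. split; [field; exact h |].
   rewrite <- H. unfold c2, c3. field. exact h. }
  destruct (Ceq_dec c2 0) as [e2 | n2].
  - exists (- (1 * a2 + 0 * a3) / a1), 1, 0. split; [right; left; apply C1_nz |].
   apply K. rewrite e2. ring.
  - exists (- (c3 * a2 + - c2 * a3) / a1), c3, (- c2). split; [right; right | apply K; ring].
   intro E. apply n2. recast (- - c2). rewrite E. ring. }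
 destruct (Ceq_dec a1 0) as [e1 | n1]; [| now apply G].
 destruct (Ceq_dec a2 0) as [e2 | n2].
 2: { destruct (G a2 b2 a1 b1 a3 b3 n2) as [x2 [x1 [x3 [hx [E1 E2]]]]].
    exists x1, x2, x3. split; [tauto | split]; [rewrite <- E1 | rewrite <- E2]; ring. }
 destruct (Ceq_dec a3 0) as [e3 | n3].
 2: { destruct (G a3 b3 a1 b1 a2 b2 n3) as [x3 [x1 [x2 [hx [E1 E2]]]]].
    exists x1, x2, x3. split; [tauto | split]; [rewrite <- E1 | rewrite <- E2]; ring. }
 subst a1 a2 a3. destruct (Ceq_dec b1 0) as [h1 | h1].
 - exists 1, 0, 0. split; [left; apply C1_nz | split; [ring | rewrite h1; ring]].
 - exists b2, (- b1), 0. split; [right; left | split; ring].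
  intro E. apply h1. recast (- - b1). rewrite E. ring.
Qed.

(* The functions u |-> theta(u+v) theta(u-v) lie in a two-dimensional space,
  so three of them are linearly dependent; evaluating the relation at v, w, z
  determines its coefficients up to a factor. *)
Lemma theta_three_term s u v w z : 0 < Im s ->
 theta (u + v) s * theta (u - v) s * (theta (w + z) s * theta (w - z) s)
 - theta (u + w) s * theta (u - w) s * (theta (v + z) s * theta (v - z) s)
 + theta (u + z) s * theta (u - z) s * (theta (v + w) s * theta (v - w) s) = 0.
Proof.
 intro hs. set (br := fun x y => theta (x + y) s * theta (x - y) s).
 change (br u v * br w z - br u w * br v z + br u z * br v w = 0).
 destruct (theta_th0 s hs) as [k [hk Eth]].
 set (F := fun y x => th0 (x + y) s * th0 (x - y) s).
 assert (EF : forall x y, br x y = k * k * e2pi (- x) * F y x).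
 { intros x y. unfold br, F. rewrite !Eth.
  replace (e2pi (- x)) with (e2pi (- ((x + y) / 2)) * e2pi (- ((x - y) / 2))); [ring |].
  rewrite <- e2pi_plus. f_equal. field. }
 assert (HE : forall y, Entire (F y)).
 { intro y. apply Entire_mult; [now apply Entire_th0 |].
  apply (Entire_ext (fun x => th0 (x + - y) s)); [intro; reflexivity | now apply Entire_th0]. }
 assert (Hq : forall y t, F y (t + s) = 1 * e2pi (- (INR 2 * t)) * F y t).
 { intros y t. unfold F.
  recast (t + y + s). recast (t - y + s).
  rewrite !th0_shift by exact hs.
  replace (e2pi (- (INR 2 * t))) with (e2pi (- (t + y)) * e2pi (- (t - y))); [ring |].
  rewrite <- e2pi_plus. f_equal. simpl. rewrite RtoC_plus. ring. }
 destruct (linear_dep_3 (fcoef (F v) 0) (fcoef (F v) 1) (fcoef (F w) 0) (fcoef (F w) 1)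
       (fcoef (F z) 0) (fcoef (F z) 1)) as [al [be [ga [hne [E0 E1]]]]].
 assert (Hrel : forall x, al * F v x + (be * F w x + ga * F z x) = 0).
 { apply (quasi_periodic_zero _ s 1 2).
  - apply Entire_plus; [| apply Entire_plus]; apply Entire_scal, HE.
  - apply C1_nz.
  - lia.
  - intro t. rewrite !Hq. ring.
  - intros i hi.
   rewrite !fcoef_plus, !fcoef_scal by (try apply Entire_plus; try apply Entire_scal; apply HE).
   assert (hi' : i = 0%nat \/ i = 1%nat) by lia. destruct hi' as [-> | ->].
   + change (Z.of_nat 0) with 0%Z. rewrite <- E0. ring.
   + change (Z.of_nat 1) with 1%Z. rewrite <- E1. ring. }
 assert (Hbr : forall x, al * br x v + be * br x w + ga * br x z = 0).
 { intro x. rewrite !EF. transitivity (k * k * e2pi (- x) * (al * F v x + (be * F w x + ga * F z x))); [ring |].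
  rewrite Hrel. ring. }
 assert (Hanti : forall x y, br y x = - br x y).
 { intros x y. unfold br. recast (- (x - y)). rewrite theta_opp by exact hs.
  rewrite (Cplus_comm y x). ring. }
 assert (Hdiag : forall x, br x x = 0).
 { intro x. unfold br. recast (RtoC 0). rewrite theta_0 by exact hs. ring. }
 assert (Hv := Hbr v). assert (Hw := Hbr w). assert (Hz := Hbr z).
 rewrite Hdiag in Hv, Hw, Hz. rewrite (Hanti v w) in Hw. rewrite (Hanti v z), (Hanti w z) in Hz.
 specialize (Hbr u).
 set (p := br v w) in *. set (q := br v z) in *. set (r := br w z) in *.
 set (fv := br u v) in *. set (fw := br u w) in *. set (fz := br u z) in *.
 assert (D : forall a b c : C, a <> 0 -> a * b + c = 0 -> b = - c / a).
 { intros a b c ha H. replace c with (- (a * b)); [field; exact ha |].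
  recast (a * b + c - a * b). rewrite H. ring. }
 (* Whichever coefficient is nonzero, the relations at v, w, z give two of [p], [q], [r] as
    multiples of the third, and the claim becomes a multiple of the relation at u. *)
 destruct hne as [h | [h | h]].
 - assert (e1 : p = - (- ga * r) / al).
  { apply D; [exact h |]. transitivity (- (al * - p + be * 0 + ga * r)); [ring | rewrite Hw; ring]. }
  assert (e2 : q = - (be * r) / al).
  { apply D; [exact h |]. transitivity (- (al * - q + be * - r + ga * 0)); [ring | rewrite Hz; ring]. }
  transitivity (r / al * (al * fv + be * fw + ga * fz)); [rewrite e1, e2; field; exact h | rewrite Hbr; ring].
 - assert (e1 : p = - (ga * q) / be).
  { apply D; [exact h |]. rewrite <- Hv. ring. }
  assert (e2 : r = - (al * q) / be).
  { apply D; [exact h |]. transitivity (- (al * - q + be * - r + ga * 0)); [ring | rewrite Hz; ring]. }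
  transitivity (- q / be * (al * fv + be * fw + ga * fz)); [rewrite e1, e2; field; exact h | rewrite Hbr; ring].
 - assert (e1 : q = - (be * p) / ga).
  { apply D; [exact h |]. rewrite <- Hv. ring. }
  assert (e2 : r = - (- al * p) / ga).
  { apply D; [exact h |]. rewrite <- Hw. ring. }
  transitivity (p / ga * (al * fv + be * fw + ga * fz)); [rewrite e1, e2; field; exact h | rewrite Hbr; ring].
Qed.

(** The function (exp z - 1) / z written as an integral, so that it is continuous at 0 without a
    case distinction. *)
Definition expJ (z : C) : C := cint (fun r => Cexp (RtoC r * z)) 0 1.

Lemma Cexp_expJ z : Cexp z - 1 = z * expJ z.
Proof.
 unfold expJ. rewrite <- cint_scal.
 - rewrite (cint_derive (fun r => Cexp (RtoC r * z))).
  + rewrite Cmult_1_l, Cmult_0_l, Cexp_0. reflexivity.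
  + intro x. recast ((1 * z + x * 0) * Cexp (x * z)).
   apply cderive_Cexp, cderive_mult; [apply cderive_id | apply cderive_const].
  + cc.
 - cc.
Qed.

Lemma expJ_0 : expJ 0 = 1.
Proof.
 unfold expJ. rewrite (cint_ext _ (fun _ => 1)).
 - rewrite cint_const. recast 1%R. ring.
 - intro r. rewrite Cmult_0_r. apply Cexp_0.
Qed.

Lemma expJ_cont z : continuous (T := C_UniformSpace) (U := C_UniformSpace) expJ z.
Proof.
 apply (ccont_cint_param (T := C_UniformSpace) (fun z r => Cexp (RtoC r * z))).
 intros y r. apply ccont_Cexp, ccont_mult.
 - apply ccont_RtoC. apply (continuous_snd (U := C_UniformSpace) (V := R_UniformSpace)).
 - apply (continuous_fst (U := C_UniformSpace) (V := R_UniformSpace)).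
Qed.

Lemma poch_cont I c s x : 0 < Im s ->
 continuous (T := C_UniformSpace) (U := C_UniformSpace) (fun t => poch (IZR I * t + c) s) x.
Proof. intro hs. apply Entire_cont. now apply Entire_poch. Qed.

Lemma poch_self_neq_0 s : 0 < Im s -> poch s s <> 0.
Proof.
 intro hs. apply poch_neq_0; [exact hs |]. intro k.
 recast (s + INR k * s - 0).
 apply avoids_Im. unfold Im in *. simpl. generalize (pos_INR k). nra.
Qed.

(** The simple zero is explicit: 1 - e(y) = - 2 pi i y [expJ](2 pi i y). The quotient theta(y)/y
    thus extends to the continuous function [H], whose value at 0 is the derivative. *)
Lemma dtheta_0 s k : 0 < Im s -> (forall x, theta x s = k * e2pi (- (x / 2)) * th0 x s) ->
 dtheta 0 s = - (2 * PI * Ci) * k * (poch s s * poch s s).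
Proof.
 intros hs E. unfold dtheta, C_derive. apply is_C_lim_unique.
 set (H := fun x => - (2 * PI * Ci) * k * e2pi (- (x / 2)) *
       (poch (IZR 1 * x + s) s * poch (IZR (-1) * x + s) s) * expJ (2 * PI * Ci * x)).
 assert (Hc : continuous (T := C_UniformSpace) (U := C_UniformSpace) H (RtoC 0)).
 { unfold H. apply ccont_mult; [apply ccont_mult; [apply ccont_mult | apply ccont_mult] |].
  - cc.
  - apply ccont_e2pi, ccont_opp, ccont_mult; [cc | cc].
  - now apply poch_cont.
  - now apply poch_cont.
  - apply (ccont_comp (fun x => 2 * PI * Ci * x) expJ); [| apply expJ_cont].
   cc. }
 assert (H0 : H 0 = - (2 * PI * Ci) * k * (poch s s * poch s s)).
 { unfold H. rewrite !Cmult_0_r, expJ_0, !Cplus_0_l.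
  recast (RtoC 0) by field. rewrite e2pi_0. ring. }
 rewrite <- H0.
 assert (EH : forall y : C, y <> 0 -> H y = (theta y s - theta 0 s) / (y - 0)).
 { intros y hy. unfold H.
  rewrite theta_0 by exact hs. rewrite E, th0_factor by exact hs.
  recast (y + s) by (simpl; ring).
  recast (s - y) by (simpl; ring).
  recast (- (Cexp (2 * PI * Ci * y) - 1)) by (unfold e2pi; ring).
  rewrite Cexp_expJ. field; auto. }
 apply (filterlim_ext_loc H).
 - exists (mkposreal 1 Rlt_0_1). cc.
 - intros P HP. destruct (Hc P HP) as [eps He]. exists eps. cc.
Qed.

(** * The kernel *)
Definition kern (T m x : C) : C := dtheta 0 T * theta (x + m) T / (theta x T * theta m T).

Definition kernc (T : C) : C := - (2 * PI * Ci) * (poch T T * poch T T).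

(** The unknown constant of the triple product cancels, so [kernc] is [dtheta 0 T] divided by that
    constant. *)
Lemma kern_th0 T m x : 0 < Im T -> th0 x T <> 0 -> th0 m T <> 0 ->
 kern T m x = kernc T * th0 (x + m) T / (th0 x T * th0 m T).
Proof.
 intros hT hx hm. destruct (theta_th0 T hT) as [k [hk E]]. unfold kern, kernc.
 rewrite (dtheta_0 T k hT E), !E.
 recast (- (x / 2) + - (m / 2)) by field. rewrite e2pi_plus.
 assert (h1 := e2pi_neq_0 (- (x / 2))). assert (h2 := e2pi_neq_0 (- (m / 2))).
 field. cc.
Qed.

Lemma Cprod_split f m k l : (m <= S k)%nat -> (k <= l)%nat -> Cprod f m l = Cprod f m k * Cprod f (S k) l.
Proof. intros h1 h2. apply Iter.iter_nat_Chasles; auto; intros; ring. Qed.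

Lemma Cprod_point f k : Cprod f k k = f k.
Proof. apply Iter.iter_nat_point. intro; ring. Qed.

Lemma Cprod_S f m k : (m <= S k)%nat -> Cprod f m (S k) = Cprod f m k * f (S k).
Proof. intro h. rewrite (Cprod_split f m k (S k)) by lia. now rewrite Cprod_point. Qed.

Lemma Cprod_ext f g m k : (forall j, (m <= j <= k)%nat -> f j = g j) -> Cprod f m k = Cprod g m k.
Proof. apply Iter.iter_nat_ext_loc. Qed.

Lemma Cprod_lt f m k : (k < m)%nat -> Cprod f m k = 1.
Proof. intro h. unfold Cprod, Iter.iter_nat. now recast 0%nat by lia. Qed.

Lemma Cprod_induct (P : C -> Prop) f m k : P 1 -> (forall x y, P x -> P y -> P (x * y)) ->
 (forall j, (m <= j <= k)%nat -> P (f j)) -> P (Cprod f m k).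
Proof.
 intros P1 Pm. induction k as [| k IH]; intro H.
 - destruct m as [| m]; [rewrite Cprod_point; apply H; lia | rewrite Cprod_lt by lia; exact P1].
 - destruct (Nat.le_gt_cases m (S k)) as [h | h]; [| rewrite Cprod_lt by lia; exact P1].
  rewrite Cprod_S by exact h. apply Pm; [apply IH; intros; apply H; lia | apply H; lia].
Qed.

Lemma Cprod_neq_0 (f : nat -> C) m k : (forall j, (m <= j <= k)%nat -> f j <> RtoC 0) -> Cprod f m k <> 0.
Proof. apply (Cprod_induct (fun x => x <> 0)); [apply C1_nz | apply Cmult_neq_0]. Qed.

Lemma Cprod_mult f g m k : Cprod (fun j => f j * g j) m k = Cprod f m k * Cprod g m k.
Proof.
 induction k as [| k IH].
 - destruct m as [| m]; [now rewrite !Cprod_point | rewrite !Cprod_lt by lia; ring].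
 - destruct (Nat.le_gt_cases m (S k)) as [h | h]; [| rewrite !Cprod_lt by lia; ring].
  rewrite !Cprod_S, IH by exact h. ring.
Qed.

Notation csum f m k := (sum_n_m (G := C_AbelianMonoid) f m k : C).

Lemma csum_lt (f : nat -> C) m k : (k < m)%nat -> csum f m k = 0.
Proof. intro h. now apply (sum_n_m_zero (G := C_AbelianMonoid)). Qed.

Lemma csum_S (f : nat -> C) m k : (m <= S k)%nat -> csum f m (S k) = csum f m k + f (S k).
Proof. intro h. now rewrite (sum_n_Sm (G := C_AbelianMonoid)) by exact h. Qed.

Lemma csum_split (f : nat -> C) m k l : (m <= S k)%nat -> (k <= l)%nat -> csum f m l = csum f m k + csum f (S k) l.
Proof. intros h1 h2. now apply (sum_n_m_Chasles (G := C_AbelianMonoid)). Qed.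

Lemma csum_ext (f g : nat -> C) m k : (forall j, (m <= j <= k)%nat -> f j = g j) -> csum f m k = csum g m k.
Proof. intro H. now apply (sum_n_m_ext_loc (G := C_AbelianMonoid)). Qed.

Lemma csum_scal (c : C) (f : nat -> C) m k : csum (fun j => c * f j) m k = c * csum f m k.
Proof.
 induction k as [| k IH].
 - destruct m as [| m]; [now rewrite !(sum_n_n (G := C_AbelianMonoid)) | rewrite !csum_lt by lia; ring].
 - destruct (Nat.le_gt_cases m (S k)) as [h | h]; [| rewrite !csum_lt by lia; ring].
  rewrite !csum_S, IH by exact h. ring.
Qed.

Lemma Cprod_e2pi (f : nat -> C) m k : Cprod (fun j => e2pi (f j)) m k = e2pi (csum f m k).
Proof.
 induction k as [| k IH].
 - destruct m as [| m]; [now rewrite Cprod_point, (sum_n_n (G := C_AbelianMonoid)) |].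
  rewrite Cprod_lt, csum_lt by lia. symmetry. apply e2pi_0.
 - destruct (Nat.le_gt_cases m (S k)) as [h | h].
  + rewrite Cprod_S, csum_S, IH, e2pi_plus by exact h. reflexivity.
  + rewrite Cprod_lt, csum_lt by lia. symmetry. apply e2pi_0.
Qed.

Lemma csum_telescope (A : nat -> C) n : csum (fun c => A (c - 1)%nat - A c) 1 n = A O - A n.
Proof.
 induction n as [| n IH]; [rewrite csum_lt by lia; ring |].
 rewrite csum_S, IH by lia. recast n by lia. ring.
Qed.

Lemma RatLim_Cprod S K (F : nat -> C -> C) m k : Kgood S K ->
 (forall j, (m <= j <= k)%nat -> RatLim S K (F j)) -> RatLim S K (fun t => Cprod (fun j => F j t) m k).
Proof.
 intros HK. induction k as [| k IH]; intro H.
 - destruct m as [| m].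
  + apply (RatLim_ext _ _ (F O)); [intros; now rewrite Cprod_point | apply H; lia].
  + apply (RatLim_ext _ _ (fun _ => 1)); [intros; now rewrite Cprod_lt by lia | apply RatLim_const].
 - destruct (Nat.le_gt_cases m (Datatypes.S k)) as [h | h].
  + apply (RatLim_ext _ _ (fun t => Cprod (fun j => F j t) m k * F (Datatypes.S k) t)).
   * intros t _. now rewrite Cprod_S by exact h.
   * apply RatLim_mult; [exact HK | apply IH; intros; apply H; lia | apply H; lia].
  + apply (RatLim_ext _ _ (fun _ => 1)); [intros; now rewrite Cprod_lt by lia | apply RatLim_const].
Qed.

(** * Ratios of theta functions *)
Lemma theta_ratio_th0 y y' s : 0 < Im s -> th0 y' s <> 0 ->
 theta y s / theta y' s = e2pi ((y' - y) / 2) * (th0 y s / th0 y' s).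
Proof.
 intros hs h. destruct (theta_th0 s hs) as [k [hk E]]. rewrite !E.
 recast (- (y / 2) - - (y' / 2)) by field. rewrite e2pi_minus.
 assert (h1 := e2pi_neq_0 (- (y' / 2))). field. cc.
Qed.

Lemma theta_ratio_shift y y' s : 0 < Im s -> th0 y' s <> 0 ->
 theta (y + s) s / theta (y' + s) s = e2pi (y' - y) * (theta y s / theta y' s).
Proof.
 intros hs h. rewrite !theta_shift by exact hs.
 assert (h' := proj2 (theta_neq_0_iff y' s hs) h).
 recast (- y' - s / 2 + (y' - y)). rewrite e2pi_plus.
 assert (h1 := e2pi_neq_0 (- y' - s / 2)). field. cc.
Qed.

Implicit Types (Lam z : nat -> C) (tau p eta lam mu nu : C).

Definition thz Lam z (eta s t : C) (j : nat) : C := th0 (t - z j - eta * Lam j) s.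

(* The two weight functions differ only in the range of the product: the indices below [a] ([d = true]) or above. *)
Definition lo (d : bool) (a : nat) : nat := if d then 1%nat else (a + 1)%nat.

Definition hi (d : bool) (n a : nat) : nat := if d then (a - 1)%nat else n.

Definition weight (d : bool) (n : nat) Lam (a : nat) (t : C) z (lam s eta : C) : C :=
 if d then omega Lam a t z lam s eta else omega_dual n Lam a t z lam s eta.

Lemma weight_eq d n Lam z a (t lam s eta : C) : weight d n Lam a t z lam s eta =
 theta (lam + 2 * eta + t - z a - eta * Lam a - 2 * eta * csum Lam (lo d a) (hi d n a)) s / theta (t - z a - eta * Lam a) s *
 Cprod (fun j => theta (t - z j + eta * Lam j) s / theta (t - z j - eta * Lam j) s) (lo d a) (hi d n a).
Proof. now destruct d. Qed.

Lemma lo_hi d n a j : (1 <= a <= n)%nat -> (lo d a <= j <= hi d n a)%nat -> (1 <= j <= n)%nat.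
Proof. destruct d; simpl; lia. Qed.

Lemma Cprod_lo_hi d n a f : (1 <= a <= n)%nat ->
 Cprod f 1 n = Cprod f (lo d a) (hi d n a) * f a * Cprod f (lo (negb d) a) (hi (negb d) n a).
Proof.
 intro h. rewrite (Cprod_split f 1 (a - 1) n), (Cprod_split f (S (a - 1)) a n) by lia.
 replace (S (a - 1)) with a by lia. rewrite Cprod_point.
 destruct d; simpl; replace (a + 1)%nat with (S a) by lia; ring.
Qed.

(** What the product of theta ratios contributes is exactly the sum of Lambda_j subtracted in the
    first theta. The multiplier therefore depends neither on [a] nor on the direction [d]. *)
Lemma weight_shift d n Lam z a (t lam s eta : C) : 0 < Im s -> (1 <= a <= n)%nat ->
 (forall j, (1 <= j <= n)%nat -> thz Lam z eta s t j <> 0) ->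
 weight d n Lam a (t + s) z lam s eta = e2pi (- (lam + 2 * eta)) * weight d n Lam a t z lam s eta.
Proof.
 intros hs ha H. rewrite !weight_eq. unfold thz in H. set (S1 := csum Lam (lo d a) (hi d n a)).
 rewrite (Cprod_ext _ (fun j => e2pi (- (2 * eta) * Lam j) *
  (theta (t - z j + eta * Lam j) s / theta (t - z j - eta * Lam j) s))).
 - rewrite Cprod_mult, Cprod_e2pi, csum_scal. fold S1.
  recast (lam + 2 * eta + t - z a - eta * Lam a - 2 * eta * S1 + s).
  recast (t - z a - eta * Lam a + s).
  rewrite theta_ratio_shift by (auto; apply H; lia).
  recast ((t - z a - eta * Lam a - (lam + 2 * eta + t - z a - eta * Lam a - 2 * eta * S1)) + - (2 * eta) * S1).
  rewrite e2pi_plus. ring.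
 - intros j hj. recast (t - z j + eta * Lam j + s). recast (t - z j - eta * Lam j + s).
  rewrite theta_ratio_shift by (auto; apply H; exact (lo_hi d n a j ha hj)). do 2 f_equal. ring.
Qed.

(** The weight function multiplied by all its denominators [thz], hence entire in t. The ranges
    given by [d] and [negb d] complement each other around [a]. *)
Definition num (d : bool) (n : nat) Lam z (a : nat) (lam s eta t : C) : C :=
 e2pi (- (lam + 2 * eta) / 2) *
 (th0 (lam + 2 * eta + t - z a - eta * Lam a - 2 * eta * csum Lam (lo d a) (hi d n a)) s
  * (Cprod (fun j => th0 (t - z j + eta * Lam j) s) (lo d a) (hi d n a)
   * Cprod (fun j => th0 (t - z j - eta * Lam j) s) (lo (negb d) a) (hi (negb d) n a))).

Lemma Cprod_div (f g : nat -> C) m k : (forall j, (m <= j <= k)%nat -> g j <> 0) ->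
 Cprod (fun j => f j / g j) m k = Cprod f m k / Cprod g m k.
Proof.
 intro H. assert (Hn := Cprod_neq_0 g m k H).
 replace (Cprod f m k) with (Cprod (fun j => f j / g j) m k * Cprod g m k); [field; exact Hn |].
 rewrite <- Cprod_mult. apply Cprod_ext. intros j hj. field; auto.
Qed.

Lemma Cprod_ratio_th0 Lam z eta s t m k : 0 < Im s ->
 (forall j, (m <= j <= k)%nat -> thz Lam z eta s t j <> 0) ->
 Cprod (fun j => theta (t - z j + eta * Lam j) s / theta (t - z j - eta * Lam j) s) m k =
 e2pi (- eta * csum Lam m k) * (Cprod (fun j => th0 (t - z j + eta * Lam j) s) m k / Cprod (thz Lam z eta s t) m k).
Proof.
 intros hs H.
 rewrite (Cprod_ext _ (fun j => e2pi (- eta * Lam j) * (th0 (t - z j + eta * Lam j) s / thz Lam z eta s t j))).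
 - now rewrite Cprod_mult, Cprod_e2pi, csum_scal, Cprod_div.
 - intros j hj. rewrite theta_ratio_th0 by (auto; now apply H). unfold thz. do 2 f_equal. field.
Qed.

Lemma weight_clean d n Lam z a (t lam s eta : C) : 0 < Im s -> (1 <= a <= n)%nat ->
 (forall j, (1 <= j <= n)%nat -> thz Lam z eta s t j <> 0) ->
 weight d n Lam a t z lam s eta * Cprod (thz Lam z eta s t) 1 n = num d n Lam z a lam s eta t.
Proof.
 intros hs ha H. rewrite weight_eq, (Cprod_lo_hi d n a) by exact ha. unfold num.
 assert (H' := fun j hj => H j (lo_hi d n a j ha hj)).
 rewrite Cprod_ratio_th0, theta_ratio_th0 by (auto; apply H; lia).
 assert (h1 := Cprod_neq_0 _ _ _ H'). assert (h2 := H a ha).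
 change (fun j => th0 (t - z j - eta * Lam j) s) with (thz Lam z eta s t).
 change (thz Lam z eta s t a) with (th0 (t - z a - eta * Lam a) s) in *.
 set (S1 := csum Lam (lo d a) (hi d n a)).
 recast ((t - z a - eta * Lam a - (lam + 2 * eta + t - z a - eta * Lam a - 2 * eta * S1)) / 2 + - eta * S1) by field.
 rewrite e2pi_plus. field; auto.
Qed.

(** * The telescoping identity *)
Definition Rfac Lam z (eta T t : C) (j : nat) : C :=
 theta (t - z j + eta * Lam j) T / theta (t - z j - eta * Lam j) T.

(** Second argument of the kernel after [c] steps of the telescope: it runs from mu - 2 eta at c = 0
    to mu + 2 eta at c = n, the sum of all Lambda_j being 2. *)
Definition shiftM Lam eta mu (c : nat) : C := mu - 2 * eta + 2 * eta * csum Lam 1 c.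

Definition telA (n : nat) Lam z (eta T mu t t' : C) (c : nat) : C :=
 kern T (shiftM Lam eta mu c) (t - t') *
 (Cprod (Rfac Lam z eta T t') 1 c * Cprod (Rfac Lam z eta T t) (c + 1) n).

(** The ratios with index other than [c] are common to all terms. With M = [shiftM c] and a = eta
    Lambda_c, what is left is the theta three-term relation divided by the denominators. *)
Lemma weight_product_telescopes n Lam z eta T mu t t' c :
 (0 < Im T)%R -> (1 <= c <= n)%nat -> csum Lam 1 n = 2 ->
 theta (t - t') T <> 0 ->
 (forall j, (1 <= j <= n)%nat -> thz Lam z eta T t j <> 0) ->
 (forall j, (1 <= j <= n)%nat -> thz Lam z eta T t' j <> 0) ->
 theta (shiftM Lam eta mu (c - 1)) T <> 0 -> theta (shiftM Lam eta mu c) T <> 0 ->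
 omega_dual n Lam c t z mu T eta * Q Lam c mu T eta * omega Lam c t' z (- mu) T eta =
 telA n Lam z eta T mu t t' (c - 1) - telA n Lam z eta T mu t t' c.
Proof.
 intros hT hc HL ht Ht Ht' M0 M1.
 unfold telA, omega_dual, omega, Q, kern.
 assert (ES : csum Lam 1 c = csum Lam 1 (c - 1) + Lam c).
 { transitivity (csum Lam 1 (S (c - 1))); [f_equal; lia |].
  rewrite csum_S by lia. now recast c by lia. }
 (* The total 2 converts the upper sum in the dual weight into a lower sum, so both weights are
    expressed by the same M. *)
 assert (ED : csum Lam (c + 1) n = 2 - csum Lam 1 c).
 { assert (G : forall x y w : C, w = x + y -> y = w - x) by (intros; subst; ring).
  apply G. rewrite <- HL, (csum_split Lam 1 c n) by lia. now recast (S c) by lia. }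
 assert (EP : Cprod (Rfac Lam z eta T t') 1 c = Cprod (Rfac Lam z eta T t') 1 (c - 1) * Rfac Lam z eta T t' c).
 { transitivity (Cprod (Rfac Lam z eta T t') 1 (S (c - 1))); [f_equal; lia |].
  rewrite Cprod_S by lia. now recast c by lia. }
 assert (EQ : Cprod (Rfac Lam z eta T t) (c - 1 + 1) n = Rfac Lam z eta T t c * Cprod (Rfac Lam z eta T t) (c + 1) n).
 { recast c by lia. rewrite (Cprod_split _ c c n) by lia.
  rewrite Cprod_point. now recast (S c) by lia. }
 rewrite EP, EQ, ED. clear EP EQ ED.
 change (Cprod (fun j => theta (t - z j + eta * Lam j) T / theta (t - z j - eta * Lam j) T) (c + 1) n)
  with (Cprod (Rfac Lam z eta T t) (c + 1) n).
 change (Cprod (fun j => theta (t' - z j + eta * Lam j) T / theta (t' - z j - eta * Lam j) T) 1 (c - 1))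
  with (Cprod (Rfac Lam z eta T t') 1 (c - 1)).
 set (P1 := Cprod (Rfac Lam z eta T t') 1 (c - 1)). set (P2 := Cprod (Rfac Lam z eta T t) (c + 1) n).
 assert (hx := proj2 (theta_neq_0_iff _ T hT) (Ht c hc)).
 assert (hx' := proj2 (theta_neq_0_iff _ T hT) (Ht' c hc)).
 unfold Rfac, shiftM in *. rewrite ES in *. set (S0 := csum Lam 1 (c - 1)) in *.
 set (a := eta * Lam c) in *. set (x := t - z c) in *. set (x' := t' - z c) in *.
 set (M := mu - 2 * eta + 2 * eta * (S0 + Lam c)) in *.
 recast (M + x - a) by (unfold M, x; ring).
 recast (x' + a - M) by (unfold M, x', a; ring).
 recast (x - x') in * by (unfold x, x'; ring).
 recast (M - 2 * a) in * by (unfold M, a; ring).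
 recast (2 * a) by (unfold a; ring).
 clearbody M x x' a.
 (* The arguments solve u + v = M + x - a, u - v = x' + a - M, w + z = 2a, w - z = x - x'. The other
    eight thetas are then those of the two ends of the telescoping difference. *)
 assert (W := theta_three_term T ((x + x') / 2) (M - a + (x - x') / 2) (a + (x - x') / 2) (a - (x - x') / 2) hT).
 recast (M + x - a) in W by field.
 recast (x' + a - M) in W by field.
 recast (2 * a) in W by field.
 recast (x - x') in W by field.
 recast (x + a) in W by field.
 recast (x' - a) in W by field.
 recast M in W by field.
 recast (x - x' + (M - 2 * a)) in W by field.
 recast (x' + a) in W by field.
 recast (x - a) in W by field.
 recast (x - x' + M) in W by field.
 recast (M - 2 * a) in W by field.
 set (k := dtheta 0 T). set (u1 := theta (M + x - a) T) in *. set (u2 := theta (x' + a - M) T) in *.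
 set (u3 := theta (2 * a) T) in *. set (u4 := theta (x - x') T) in *. set (u5 := theta (x + a) T) in *.
 set (u6 := theta (x' - a) T) in *. set (u7 := theta M T) in *. set (u8 := theta (x - x' + (M - 2 * a)) T) in *.
 set (u9 := theta (x' + a) T) in *. set (u10 := theta (x - a) T) in *. set (u11 := theta (x - x' + M) T) in *.
 set (u12 := theta (M - 2 * a) T) in *.
 transitivity (k * P1 * P2 / (u4 * u6 * u7 * u10 * u12) * (u1 * u2 * (u3 * u4))); [field; repeat split; assumption |].
 replace (u1 * u2 * (u3 * u4)) with (u5 * u6 * (u7 * u8) - u9 * u10 * (u11 * u12)).
 - field. cc.
 - transitivity (u5 * u6 * (u7 * u8) - u9 * u10 * (u11 * u12) +
   (u1 * u2 * (u3 * u4) - u5 * u6 * (u7 * u8) + u9 * u10 * (u11 * u12))); [rewrite W; ring | ring].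
Qed.

(** * Functional equations of the phase function and the integrand cleared of spurious poles *)

Definition Om_ok (a x s r : C) : Prop :=
 (forall j k : nat, 1 - e2pi (x + a + INR j * s + INR k * r) <> 0) /\
 (forall j k : nat, 1 - e2pi (s + r - x + a + INR j * s + INR k * r) <> 0).

Lemma Om_ok_sym a x s r : Om_ok a x s r -> Om_ok a x r s.
Proof.
 intros [H1 H2]. split; intros j k.
 - recast (x + a + INR k * s + INR j * r). apply H1.
 - recast (s + r - x + a + INR k * s + INR j * r). apply H2.
Qed.

Lemma Omega_eq a x s r : 0 < Im s -> 0 < Im r -> Om_ok a x s r ->
 Omega a x s r = dpoch (x - a) s r * dpoch (s + r - x - a) s r / (dpoch (x + a) s r * dpoch (s + r - x + a) s r)
 /\ dpoch (x + a) s r <> 0 /\ dpoch (s + r - x + a) s r <> 0.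
Proof. intros hs hr [H1 H2]. split; [now apply Omega_dpoch | split; now apply dpoch_neq_0]. Qed.

Lemma Omega_sym a x s r : 0 < Im s -> 0 < Im r -> Om_ok a x s r -> Omega a x s r = Omega a x r s.
Proof.
 intros hs hr H.
 rewrite (proj1 (Omega_eq a x s r hs hr H)), (proj1 (Omega_eq a x r s hr hs (Om_ok_sym _ _ _ _ H))).
 rewrite !(dpoch_sym _ s r). now rewrite (Cplus_comm s r).
Qed.

(** A shift by one period changes each of the four double products by one Pochhammer symbol with the
    other period as base; the four symbols pair up into two values of [th0]. *)
Lemma Omega_shift a x s r : 0 < Im s -> 0 < Im r -> Om_ok a x s r -> Om_ok a (x + s) s r ->
 th0 (x - a) r <> 0 ->
 Omega a (x + s) s r = th0 (x + a) r / th0 (x - a) r * Omega a x s r.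
Proof.
 intros hs hr H H' h0.
 destruct (Omega_eq a x s r hs hr H) as [-> [n1 n2]].
 destruct (Omega_eq a (x + s) s r hs hr H') as [-> [n3 n4]].
 recast (r - x - a).
 recast (r - x + a) in *.
 recast (x - a + s). recast (x + a + s) in *.
 assert (E1 := dpoch_step' (x - a) s r hs hr). assert (E2 := dpoch_step' (x + a) s r hs hr).
 assert (E3 := dpoch_step' (r - x - a) s r hs hr). assert (E4 := dpoch_step' (r - x + a) s r hs hr).
 recast (s + r - x - a) in E3.
 recast (s + r - x + a) in E4.
 rewrite E1, E3. rewrite E2 in n1 |- *. rewrite E4 in n4 |- *.
 unfold th0 in *. recast (r - x - a). recast (r - x + a) in *.
 assert (G : forall u v : C, u * v <> 0 -> u <> 0 /\ v <> 0).
 { intros u v h. split; intro E; apply h; rewrite E; ring. }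
 destruct (G _ _ n1) as [m1 _]. destruct (G _ _ h0) as [m2 m3].
 field; auto.
Qed.

(** [dpoch_three_term] is applied to all four double products; for the two with reflected argument
    the roles of tau and p are exchanged. *)
Lemma Omega_three_term a x tau p : 0 < Im tau -> 0 < Im p ->
 Om_ok a x tau p -> Om_ok a x tau (tau + p) -> Om_ok a (x + p) (tau + p) p ->
 Omega a x tau (tau + p) * Omega a (x + p) (tau + p) p = Omega a x tau p.
Proof.
 intros h1 h2 H H1 H2. set (T := tau + p) in *.
 assert (hT : 0 < Im T) by (unfold T; rewrite Im_plus; lra).
 destruct (Omega_eq a x tau p h1 h2 H) as [-> [n1 n2]].
 destruct (Omega_eq a x tau T h1 hT H1) as [-> [n3 n4]].
 destruct (Omega_eq a (x + p) T p hT h2 H2) as [-> [n5 n6]].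
 recast (T - x - a).
 recast (T - x + a) in *.
 recast (x - a + p). recast (x + a + p) in *.
 fold T in n2 |- *.
 assert (E1 := dpoch_three_term (x - a) tau p h1 h2). assert (E2 := dpoch_three_term (x + a) tau p h1 h2).
 assert (E3 := dpoch_three_term (T - x - a) p tau h2 h1). assert (E4 := dpoch_three_term (T - x + a) p tau h2 h1).
 rewrite (Cplus_comm p tau) in E3, E4. fold T in E1, E2, E3, E4.
 recast (tau + T - x - a) in E3.
 recast (tau + T - x + a) in E4.
 rewrite (dpoch_sym _ p T), (dpoch_sym _ T tau), (dpoch_sym _ p tau) in E3.
 rewrite (dpoch_sym _ p T), (dpoch_sym _ T tau), (dpoch_sym _ p tau) in E4.
 rewrite <- E1, <- E2, <- E3, <- E4. field. cc.
Qed.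

(** [Omega] with the factor th0(x - a) taken out. At x = t - z_j, a = eta Lambda_j this factor is
    the denominator [thz] of the weights, so it cancels. *)
Definition Hfac (a x s r : C) : C :=
 dpoch (x - a + r) s r * dpoch (s + r - x - a) s r / (dpoch (x + a) s r * dpoch (s - x + a) s r).

Lemma Omega_Hfac a x s r : 0 < Im s -> 0 < Im r -> Om_ok a x s r ->
 (forall j k : nat, 1 - e2pi (s - x + a + INR j * s + INR k * r) <> 0) ->
 Omega a x s r = Hfac a x s r * th0 (x - a) s.
Proof.
 intros hs hr H H0. destruct (Omega_eq a x s r hs hr H) as [-> [n1 n2]].
 assert (n3 : dpoch (s - x + a) s r <> 0) by now apply dpoch_neq_0.
 unfold Hfac, th0.
 assert (E1 := dpoch_step (x - a) s r hs hr). assert (E2 := dpoch_step (s - x + a) s r hs hr).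
 recast (s + r - x + a) in E2.
 recast (s - x + a).
 rewrite E1, E2. rewrite E2 in n3.
 assert (m : poch (s - x + a) s <> 0) by (intro E; apply n3; rewrite E; ring).
 field. cc.
Qed.

(** True poles of [Omega] times a weight of period [s]. In the upper family k starts at 1: the poles
    of the weight at z + eta Lambda - k s, k >= 0, are cancelled by zeros of [Omega], and only those
    with k >= 1 survive in the row l = 0. *)
Definition PhiS (n : nat) Lam z (eta s r w : C) : Prop :=
 (exists j k l : nat, (1 <= j <= n)%nat /\ w = z j + eta * Lam j + INR (S k) * s + INR l * r) \/
 (exists j k l : nat, (1 <= j <= n)%nat /\ w = z j - eta * Lam j - INR k * s - INR l * r).

(** [s] is always the period of the weight and [r] the other one. The periods of [Omega] are swapped
    for d = false, so that [s], [r] = [p], [T] yields the factor with periods (T, p) occurring in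
    u. *)
Definition Phi (d : bool) (n : nat) Lam z (eta s r : C) (a : nat) (lam t : C) : C :=
 Cprod (fun j => if d then Omega (eta * Lam j) (t - z j) s r else Omega (eta * Lam j) (t - z j) r s) 1 n
 * weight d n Lam a t z lam s eta.

Definition Phic (d : bool) (n : nat) Lam z (eta s r : C) (a : nat) (lam t : C) : C :=
 Cprod (fun j => Hfac (eta * Lam j) (t - z j) s r) 1 n * num d n Lam z a lam s eta t.

Lemma PhiS_ok n Lam z (eta s r t : C) : (forall w, PhiS n Lam z eta s r w -> avoids t w) ->
 forall j, (1 <= j <= n)%nat -> Om_ok (eta * Lam j) (t - z j) s r /\
 forall k l : nat, 1 - e2pi (s - (t - z j) + eta * Lam j + INR k * s + INR l * r) <> 0.
Proof.
 intros H j hj.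
 assert (U : forall k l : nat, 1 - e2pi (s - (t - z j) + eta * Lam j + INR k * s + INR l * r) <> 0).
 { intros k l.
  recast (- (t - (z j + eta * Lam j + INR (S k) * s + INR l * r))) by (rewrite S_INR, RtoC_plus; ring).
  apply one_minus_e2pi_opp. apply H. left. exists j, k, l. auto. }
 split; [split | exact U].
 - intros k l.
  recast (t - (z j - eta * Lam j - INR k * s - INR l * r)).
  apply H. right. exists j, k, l. auto.
 - intros k l.
  recast (s - (t - z j) + eta * Lam j + INR k * s + INR (S l) * r) by (rewrite S_INR, RtoC_plus; ring).
  apply U.
Qed.

Lemma Phi_eq d n Lam z (eta s r : C) a (lam t : C) : 0 < Im s -> 0 < Im r ->
 (forall w, PhiS n Lam z eta s r w -> avoids t w) ->
 Phi d n Lam z eta s r a lam t = Cprod (fun j => Omega (eta * Lam j) (t - z j) s r) 1 n * weight d n Lam a t z lam s eta.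
Proof.
 intros hs hr H. unfold Phi. f_equal. apply Cprod_ext. intros j hj.
 destruct d; [reflexivity |]. symmetry. apply Omega_sym; try assumption. now apply PhiS_ok with n.
Qed.

Lemma Phi_clean d n Lam z (eta s r : C) a (lam t : C) : 0 < Im s -> 0 < Im r -> (1 <= a <= n)%nat ->
 (forall w, PhiS n Lam z eta s r w -> avoids t w) ->
 (forall j, (1 <= j <= n)%nat -> thz Lam z eta s t j <> 0) ->
 Phi d n Lam z eta s r a lam t = Phic d n Lam z eta s r a lam t.
Proof.
 intros hs hr ha H Ht. rewrite Phi_eq by assumption. unfold Phic. rewrite <- weight_clean by assumption.
 rewrite (Cprod_ext (fun j => Omega _ _ _ _) (fun j => Hfac (eta * Lam j) (t - z j) s r * thz Lam z eta s t j)).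
 - rewrite Cprod_mult. ring.
 - intros j hj. destruct (PhiS_ok n Lam z eta s r t H j hj) as [h1 h2]. now apply Omega_Hfac.
Qed.

Lemma Cprod_Rfac Lam z (eta r t : C) n : 0 < Im r -> csum Lam 1 n = 2 ->
 (forall j, (1 <= j <= n)%nat -> thz Lam z eta r t j <> 0) ->
 Cprod (fun j => th0 (t - z j + eta * Lam j) r / th0 (t - z j - eta * Lam j) r) 1 n =
 e2pi (2 * eta) * Cprod (Rfac Lam z eta r t) 1 n.
Proof.
 intros hr HL H.
 rewrite (Cprod_ext _ (fun j => e2pi (eta * Lam j) * Rfac Lam z eta r t j)).
 - rewrite Cprod_mult, Cprod_e2pi, csum_scal, HL. do 2 f_equal. ring.
 - intros j hj. unfold Rfac. rewrite theta_ratio_th0; [| exact hr | now apply H].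
  rewrite Cmult_assoc, <- e2pi_plus.
  recast (RtoC 0) by field.
  rewrite e2pi_0. ring.
Qed.

(** A full product of theta ratios in the period [r] is absorbed by translating t by [s]. The factor
    e(2 eta), which comes from the sum being 2, cancels part of the multiplier of the weight and
    leaves e(lam). *)
Lemma Phi_shift d n Lam z (eta s r : C) a (lam t : C) : 0 < Im s -> 0 < Im r -> (1 <= a <= n)%nat ->
 csum Lam 1 n = 2 ->
 (forall w, PhiS n Lam z eta s r w -> avoids t w) ->
 (forall w, PhiS n Lam z eta s r w -> avoids (t + s) w) ->
 (forall j, (1 <= j <= n)%nat -> thz Lam z eta s t j <> 0) ->
 (forall j, (1 <= j <= n)%nat -> thz Lam z eta r t j <> 0) ->
 Phi d n Lam z eta s r a lam t * Cprod (Rfac Lam z eta r t) 1 n = e2pi lam * Phi d n Lam z eta s r a lam (t + s).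
Proof.
 intros hs hr ha HL H H' Ht Hr.
 assert (Hok := PhiS_ok n Lam z eta s r t H). assert (Hok' := PhiS_ok n Lam z eta s r (t + s) H').
 rewrite !Phi_eq, weight_shift by assumption.
 rewrite (Cprod_ext (fun j => Omega _ (t + s - z j) _ _) (fun j =>
  (th0 (t - z j + eta * Lam j) r / th0 (t - z j - eta * Lam j) r) * Omega (eta * Lam j) (t - z j) s r)).
 - rewrite Cprod_mult, Cprod_Rfac by assumption.
  replace (e2pi (2 * eta)) with (e2pi (lam + 2 * eta) / e2pi lam).
  + rewrite e2pi_opp. assert (h1 := e2pi_neq_0 lam). assert (h2 := e2pi_neq_0 (lam + 2 * eta)).
   field. cc.
  + rewrite <- e2pi_minus. f_equal. ring.
 - intros j hj. recast (t - z j + s).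
  apply Omega_shift; try assumption; [apply Hok, hj | | now apply Hr].
  recast (t + s - z j). apply Hok', hj.
Qed.

Lemma RatLim_Hfac (S K : C -> Prop) (a z0 s r : C) : Kgood S K -> 0 < Im s -> 0 < Im r ->
 (forall k l : nat, S (z0 + a + INR (Datatypes.S k) * s + INR l * r)) ->
 (forall k l : nat, S (z0 - a - INR k * s - INR l * r)) ->
 RatLim S K (fun t => Hfac a (t - z0) s r).
Proof.
 intros HK hs hr H1 H2.
 apply (RatLim_ext _ _ (fun t =>
  (dpoch (IZR 1 * t + (- z0 - a + r)) s r * dpoch (IZR (-1) * t + (s + r + z0 - a)) s r) *
  (/ dpoch (IZR 1 * t + (- z0 + a)) s r * / dpoch (IZR (-1) * t + (s + z0 + a)) s r))).
 - destruct (RatLim_dpoch_inv S K 1 (- z0 + a) s r HK hs hr (or_introl eq_refl)) as [_ n1].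
  { intros k l. simpl. recast (z0 - a - INR k * s - INR l * r).
   apply H2. }
  destruct (RatLim_dpoch_inv S K (-1) (s + z0 + a) s r HK hs hr (or_intror eq_refl)) as [_ n2].
  { intros k l. simpl. recast (z0 + a + INR (Datatypes.S k) * s + INR l * r) by (rewrite S_INR, RtoC_plus; ring). apply H1. }
  intros t ht. specialize (n1 t ht). specialize (n2 t ht). unfold Hfac.
  recast (IZR 1 * t + (- z0 - a + r)) by (simpl; ring).
  recast (IZR (-1) * t + (s + r + z0 - a)) by (simpl; ring).
  recast (IZR 1 * t + (- z0 + a)) by (simpl; ring).
  recast (IZR (-1) * t + (s + z0 + a)) by (simpl; ring).
  field. cc.
 - apply RatLim_mult; [exact HK | |]; apply RatLim_mult; try exact HK; try (now apply RatLim_dpoch).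
  + apply RatLim_dpoch_inv; auto. intros k l. simpl.
   recast (z0 - a - INR k * s - INR l * r). apply H2.
  + apply RatLim_dpoch_inv; auto. intros k l. simpl.
   recast (z0 + a + INR (Datatypes.S k) * s + INR l * r) by (rewrite S_INR, RtoC_plus; ring). apply H1.
Qed.

Lemma RatLim_th0 S K c s : Kgood S K -> 0 < Im s -> RatLim S K (fun t => th0 (t + c) s).
Proof. intros HK hs. apply Entire_RatLim; [exact HK | now apply Entire_th0]. Qed.

Lemma RatLim_th0' S K (f : C -> C) c s : Kgood S K -> 0 < Im s -> (forall t, f t = t + c) ->
 RatLim S K (fun t => th0 (f t) s).
Proof.
 intros HK hs E. apply (RatLim_ext _ _ (fun t => th0 (t + c) s)); [intros; now rewrite E | now apply RatLim_th0].
Qed.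

Lemma RatLim_num S K d n Lam z a (lam s eta : C) : Kgood S K -> 0 < Im s ->
 RatLim S K (num d n Lam z a lam s eta).
Proof.
 intros HK hs. unfold num. apply RatLim_scal; [exact HK |].
 apply RatLim_mult; [exact HK | | apply RatLim_mult; [exact HK | |]].
 - apply (RatLim_th0' S K _ (lam + 2 * eta - z a - eta * Lam a - 2 * eta * csum Lam (lo d a) (hi d n a))); auto.
  intro t. ring.
 - apply (RatLim_Cprod S K (fun j t => th0 (t - z j + eta * Lam j) s)); [exact HK |]. intros j _.
  apply (RatLim_th0' S K _ (- z j + eta * Lam j)); auto. intro t. ring.
 - apply (RatLim_Cprod S K (fun j t => th0 (t - z j - eta * Lam j) s)); [exact HK |]. intros j _.
  apply (RatLim_th0' S K _ (- z j - eta * Lam j)); auto. intro t. ring.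
Qed.

Lemma RatLim_Phic d n Lam z (eta s r : C) a lam K : 0 < Im s -> 0 < Im r ->
 Kgood (PhiS n Lam z eta s r) K -> RatLim (PhiS n Lam z eta s r) K (Phic d n Lam z eta s r a lam).
Proof.
 intros hs hr HK. unfold Phic. apply RatLim_mult; [exact HK | | now apply RatLim_num].
 apply (RatLim_Cprod _ K (fun j t => Hfac (eta * Lam j) (t - z j) s r)); [exact HK |].
 intros j hj. apply RatLim_Hfac; try assumption.
 - intros k l. left. exists j, k, l. auto.
 - intros k l. right. exists j, k, l. auto.
Qed.

Definition UL (n : nat) Lam z (tau p eta w : C) : Prop :=
 upper_pole n Lam z tau p eta w \/ lower_pole n Lam z tau p eta w.

Lemma PhiS_left_UL n Lam z (tau p eta w : C) : PhiS n Lam z eta tau (tau + p) w -> UL n Lam z tau p eta w.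
Proof.
 intros [[j [k [l [hj ->]]]] | [j [k [l [hj ->]]]]].
 - left. exists j, (S k + l)%nat, l. split; [exact hj |]. rewrite plus_INR, RtoC_plus. ring.
 - right. exists j, (k + l)%nat, l. split; [exact hj |]. rewrite plus_INR, RtoC_plus. ring.
Qed.

Lemma PhiS_right_UL n Lam z (tau p eta w : C) : PhiS n Lam z eta p (tau + p) w -> UL n Lam z tau p eta (w - p).
Proof.
 intros [[j [k [l [hj ->]]]] | [j [k [l [hj ->]]]]].
 - left. exists j, l, (k + l)%nat. split; [exact hj |]. rewrite plus_INR, RtoC_plus, S_INR, RtoC_plus. ring.
 - right. exists j, l, (S k + l)%nat. split; [exact hj |]. rewrite plus_INR, RtoC_plus, S_INR, RtoC_plus. ring.
Qed.

(** The integrand of u with its removable singularities filled in, split by the three-term relation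
    of [Omega]. The second factor is taken at t + p, and e(mu + 2 eta) undoes the multiplier of the
    dual weight. *)
Definition u_clean (n : nat) Lam (a b : nat) z (lam mu tau p eta t : C) : C :=
 e2pi (mu + 2 * eta) *
 (Phic true n Lam z eta tau (tau + p) a lam t * Phic false n Lam z eta p (tau + p) b mu (t + p)).

Lemma avoids_shift t w v : avoids t (w - v) -> avoids (t + v) w.
Proof. unfold avoids. now recast (t + v - w). Qed.

Lemma RatLim_u_clean n Lam z a b lam mu tau p eta K : 0 < Im tau -> 0 < Im p ->
 Kgood (UL n Lam z tau p eta) K -> RatLim (UL n Lam z tau p eta) K (u_clean n Lam a b z lam mu tau p eta).
Proof.
 intros h1 h2 HK. assert (hT : 0 < Im (tau + p)) by (rewrite Im_plus; lra).
 assert (G : forall S' v, (forall w, S' w -> UL n Lam z tau p eta (w - v)) -> Kgood S' (fun t => K (t - v))).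
 { intros S' v HS. destruct HK as [[M HM] HKd]. split.
  - exists (M + Rabs (Im v))%R. intros t ht. specialize (HM _ ht). rewrite Im_minus in HM.
   recast ((Im t - Im v) + Im v)%R. eapply Rle_trans; [apply Rabs_triang | lra].
  - intros w hw. destruct (HKd _ (HS w hw)) as [d [hd H]]. exists d. split; [exact hd |].
   intros t ht. specialize (H _ ht). now recast (t - w) in H. }
 unfold u_clean. apply RatLim_scal; [exact HK |]. apply RatLim_mult; [exact HK | |].
 - apply (RatLim_incl (PhiS n Lam z eta tau (tau + p)) _ (fun t => K (t - 0)) K).
  + apply PhiS_left_UL.
  + intros t ht. now recast t.
  + apply RatLim_Phic; try assumption. apply G. intros w hw.
   recast w. now apply PhiS_left_UL.
 - apply (RatLim_shift (PhiS n Lam z eta p (tau + p)) _ (fun t => K (t - p))).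
  + apply PhiS_right_UL.
  + intros t ht. now recast t.
  + apply RatLim_Phic; try assumption. apply G. apply PhiS_right_UL.
Qed.

Lemma u_integrand_clean n Lam z a b (lam mu tau p eta t : C) : 0 < Im tau -> 0 < Im p ->
 (1 <= a <= n)%nat -> (1 <= b <= n)%nat ->
 (forall w, UL n Lam z tau p eta w -> avoids t w) ->
 (forall j, (1 <= j <= n)%nat -> thz Lam z eta tau t j <> 0) ->
 (forall j, (1 <= j <= n)%nat -> thz Lam z eta p t j <> 0) ->
 u_integrand n Lam a b z lam mu tau p eta t = u_clean n Lam a b z lam mu tau p eta t.
Proof.
 intros h1 h2 ha hb H Ht Hp. set (T := tau + p).
 assert (hT : 0 < Im T) by (unfold T; rewrite Im_plus; lra).
 assert (A1 : forall w, PhiS n Lam z eta tau T w -> avoids t w) by (intros; apply H; now apply PhiS_left_UL).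
 assert (A2 : forall w, PhiS n Lam z eta p T w -> avoids (t + p) w).
 { intros w hw. apply avoids_shift, H. now apply PhiS_right_UL. }
 unfold u_clean. fold T. rewrite <- !Phi_clean; try assumption.
 - unfold u_integrand, Phi. rewrite weight_shift by assumption. unfold weight. cbv iota.
  rewrite (Cprod_ext (fun j => Omega (eta * Lam j) (t - z j) tau p) (fun j =>
   Omega (eta * Lam j) (t - z j) tau T * Omega (eta * Lam j) (t + p - z j) T p)).
  + rewrite Cprod_mult, e2pi_opp. assert (hz := e2pi_neq_0 (mu + 2 * eta)). field; auto.
  + intros j hj. recast (t - z j + p). symmetry. apply Omega_three_term; try assumption.
   * split; intros k l.
    -- recast (t - (z j - eta * Lam j - INR k * tau - INR l * p)).
      apply H. right. exists j, k, l. auto.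
    -- recast (- (t - (z j + eta * Lam j + INR (S k) * tau + INR (S l) * p))) by (rewrite !S_INR, !RtoC_plus; ring).
      apply one_minus_e2pi_opp, H. left. exists j, (S k), (S l). auto.
   * apply (PhiS_ok n Lam z eta tau T t A1 j hj).
   * destruct (PhiS_ok n Lam z eta p T (t + p) A2 j hj) as [k1 _]. apply Om_ok_sym in k1.
    recast (t + p - z j). exact k1.
 - intros j hj. unfold thz. recast (t - z j - eta * Lam j + p).
  rewrite th0_shift by exact h2. apply Cmult_neq_0; [| now apply Hp].
  intro E. apply (e2pi_neq_0 (- (t - z j - eta * Lam j))). recast (- - e2pi (- (t - z j - eta * Lam j))).
  rewrite E. ring.
Qed.

(** * Double integrals *)
Lemma norm_C_Cmod (x : C) : norm (V := C_R_NormedModule) x = Cmod x.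
Proof. destruct x as [a b]. unfold norm; simpl. unfold prod_norm, norm, Cmod; simpl. unfold abs; simpl. f_equal.
 recast (Rabs a * Rabs a)%R. recast (Rabs b * Rabs b)%R. rewrite <- !Rabs_mult, !Rabs_right; nra. Qed.

Lemma cint_Cmod_le (f : R -> C) (g : R -> R) : (forall x, ccont f x) -> (forall x, continuous g x) ->
 (forall x, (0 <= x <= 1)%R -> Cmod (f x) <= g x) -> Cmod (cint f 0 1) <= RInt g 0 1.
Proof.
 intros hf hg H. rewrite <- norm_C_Cmod.
 apply (norm_RInt_le (V := C_R_NormedModule) f g 0 1); [lra | | now apply is_cint_cont |].
 - intros x hx. rewrite norm_C_Cmod. now apply H.
 - apply (RInt_correct (V := R_CompleteNormedModule)), (ex_RInt_continuous (V := R_CompleteNormedModule)). cc.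
Qed.

Lemma ccont_fst {T U : UniformSpace} (f : T -> C) (u : T * U) : ccont f (fst u) ->
 continuous (T := prod_UniformSpace T U) (U := C_UniformSpace) (fun u => f (fst u)) u.
Proof. intro H. apply (continuous_comp (fun u : T * U => fst u) f u); [apply continuous_fst | exact H]. Qed.

Lemma ccont_snd {T U : UniformSpace} (f : U -> C) (u : T * U) : ccont f (snd u) ->
 continuous (T := prod_UniformSpace T U) (U := C_UniformSpace) (fun u => f (snd u)) u.
Proof. intro H. apply (continuous_comp (fun u : T * U => snd u) f u); [apply continuous_snd | exact H]. Qed.

Lemma pint_param {T : UniformSpace} g dg (F : T -> C -> C) x : period_path g dg ->
 (forall y r, continuous (T := prod_UniformSpace T R_UniformSpace) (U := C_UniformSpace)
         (fun u => F (fst u) (g (clamp (snd u)))) (y, r)) ->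
 ccont (fun y => pint g dg (F y)) x.
Proof.
 intros [_ [hd _]] H. unfold pint. apply (ccont_cint_param (fun y s => F y (g (clamp s)) * dg (clamp s))).
 intros y r. apply ccont_mult; [apply H |]. apply (ccont_snd (fun s => dg (clamp s))). cc.
Qed.

(** All good regions at once, since the contours vary while the pole set stays fixed. *)
Definition Mer (S : C -> Prop) (f : C -> C) : Prop := forall K, Kgood S K -> RatLim S K f.

Lemma Mer_pcont S f g : (forall s, ccont g s) -> (forall w, S w -> avoided g w) -> Mer S f -> pcont g f.
Proof.
 intros hg H hf. assert (K := Kgood_on_paths S g g hg hg (fun w h => conj (H w h) (H w h))).
 apply (pcont_RatLim g S _ f hg (fun t h => or_introl h) K (hf _ K)).
Qed.

Lemma Mer_bounded S f g : (forall s, ccont g s) -> (forall w, S w -> avoided g w) -> Mer S f ->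
 exists M, 0 < M /\ forall t, on_path g t -> Cmod (f t) <= M.
Proof.
 intros hg H hf. assert (K := Kgood_on_paths S g g hg hg (fun w h => conj (H w h) (H w h))).
 destruct (RatLim_bounded S _ f K (hf _ K)) as [M [h1 h2]]. exists M. cc.
Qed.

Lemma Kgood_shift (S S' K : C -> Prop) v : (forall w, S w -> S' (w - v)) -> Kgood S' K -> Kgood S (fun t => K (t - v)).
Proof.
 intros HS [[M HM] HK]. split.
 - exists (M + Rabs (Im v))%R. intros t ht. specialize (HM _ ht). rewrite Im_minus in HM.
  recast ((Im t - Im v) + Im v)%R. eapply Rle_trans; [apply Rabs_triang | lra].
 - intros w hw. destruct (HK _ (HS w hw)) as [d [hd H]]. exists d. split; [exact hd |].
  intros t ht. specialize (H _ ht). now recast (t - w) in H.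
Qed.

Lemma Mer_shift (S : C -> Prop) v f : Mer S f -> Mer (fun w => S (w + v)) (fun t => f (t + v)).
Proof.
 intros H K HK. apply (RatLim_shift S _ (fun t => K (t - v))).
 - intros w hw. now recast w.
 - intros t ht. now recast t.
 - apply H. apply (Kgood_shift S (fun w => S (w + v))); [| exact HK]. intros w hw. now recast w.
Qed.

Lemma Kgood_incl (S S' K : C -> Prop) : (forall w, S w -> S' w) -> Kgood S' K -> Kgood S K.
Proof. intros H [h1 h2]. split; auto. Qed.

Lemma Mer_incl (S S' : C -> Prop) f : (forall w, S w -> S' w) -> Mer S f -> Mer S' f.
Proof. intros H hf K HK. apply (RatLim_incl S S' K K f H (fun t h => h)). apply hf. now apply (Kgood_incl S S'). Qed.

Lemma Mer_mult S f h : Mer S f -> Mer S h -> Mer S (fun t => f t * h t).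
Proof. intros hf hh K HK. now apply RatLim_mult; auto. Qed.

Lemma Mer_indep S g1 dg1 g2 dg2 f : period_path g1 dg1 -> period_path g2 dg2 ->
 (forall w, S w -> same_side g1 g2 w) -> Mer S f -> pint g1 dg1 f = pint g2 dg2 f.
Proof.
 intros P1 P2 H hf.
 assert (K := Kgood_on_paths S g1 g2 (period_path_cont _ _ P1) (period_path_cont _ _ P2)
  (fun w h => same_side_avoided _ _ _ (H w h))).
 apply (pint_indep S _ g1 dg1 g2 dg2 f P1 P2 H K); auto.
Qed.

Definition tr (v : C) (g : R -> C) (s : R) : C := g s + v.

Lemma tr_path v g dg : period_path g dg -> period_path (tr v g) dg.
Proof.
 intros [h1 [h2 h3]]. unfold tr. split; [| split; [exact h2 |]].
 - intro s. recast (dg s + RtoC 0). apply cderive_plus; [apply h1 | apply cderive_const].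
 - rewrite h3. ring.
Qed.

Lemma pint_tr v g dg f : pint (tr v g) dg f = pint g dg (fun t => f (t + v)).
Proof. reflexivity. Qed.

Lemma on_path_tr v g t : on_path (tr v g) t -> on_path g (t - v).
Proof. intros [r [hr ->]]. exists r. split; [exact hr |]. unfold tr. ring. Qed.

Lemma joined_tr v g w e : e = p_infty \/ e = m_infty -> joined_to g (w - v) e -> joined_to (tr v g) w e.
Proof.
 intros he [c [h1 [h2 [h3 h4]]]]. exists (fun s => c s + v). split; [| split; [| split]].
 - cc.
 - rewrite h2. ring.
 - apply (is_lim_ext (fun s => Im (c s) + Im v)%R); [intro; now rewrite Im_plus |].
  apply (is_lim_plus _ _ _ e (Im v)); [exact h3 | apply is_lim_const | destruct he as [-> | ->]; reflexivity].
 - intros s r m hs hr E. apply (h4 s r m hs hr). unfold tr in E.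
  recast (c s + v - v). rewrite E. ring.
Qed.

Lemma above_tr v g w : passes_above g (w - v) -> passes_above (tr v g) w.
Proof. apply joined_tr. now right. Qed.

Lemma below_tr v g w : passes_below g (w - v) -> passes_below (tr v g) w.
Proof. apply joined_tr. now left. Qed.

(** The kernel without [kernc / th0 m T]: this part is entire in m, and the poles in mu are left
    outside the integrals. *)
Definition kth (T m x : C) : C := th0 (x + m) T / th0 x T.

Lemma kth_shift T m x : 0 < Im T -> th0 x T <> 0 -> kth T m (x + T) = e2pi (- m) * kth T m x.
Proof.
 intros hT h. unfold kth. recast (x + m + T). rewrite !th0_shift by exact hT.
 recast (- x + - m). rewrite e2pi_plus. assert (n := e2pi_neq_0 (- x)). field. cc.
Qed.

(** [kth] with its simple pole at t = w divided out; the poles w + k T with nonzero k remain. *)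
Definition kreg (T m w t : C) : C :=
 th0 (t - w + m) T * (/ poch (IZR 1 * t + (T - w)) T * / poch (IZR (-1) * t + (T + w)) T).

Definition lattice_pole (T w v : C) : Prop := exists k : Z, k <> 0%Z /\ v = w + IZR k * T.

Lemma kreg_Mer T m w : 0 < Im T -> Mer (lattice_pole T w) (kreg T m w).
Proof.
 intros hT K HK. unfold kreg. apply RatLim_mult; [exact HK | | apply RatLim_mult; [exact HK | |]].
 - apply (RatLim_th0' _ K _ (- w + m)); auto. intro; ring.
 - apply RatLim_poch_inv; auto. intro i. exists (- Z.of_nat (S i))%Z. split; [lia |].
  rewrite (opp_IZR (Z.of_nat (S i))), <- INR_IZR_INZ, S_INR, RtoC_opp, RtoC_plus. simpl. ring.
 - apply RatLim_poch_inv; auto. intro i. exists (Z.of_nat (S i))%Z. split; [lia |].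
  rewrite <- INR_IZR_INZ, S_INR, RtoC_plus. simpl. ring.
Qed.

Lemma kth_kreg T m w t : 0 < Im T -> th0 (t - w) T <> 0 -> kth T m (t - w) = kreg T m w t * geomX w t.
Proof.
 intros hT h. unfold kth, kreg, geomX. rewrite (th0_factor (t - w)) in h |- * by exact hT.
 recast (t - w + T) by (simpl; ring).
 recast (T - (t - w)) by (simpl; ring).
 assert (G : forall u v : C, u * v <> 0 -> u <> 0 /\ v <> 0).
 { intros u v k. split; intro E; apply k; rewrite E; ring. }
 destruct (G _ _ h) as [a b]. destruct (G _ _ b) as [c d]. field. cc.
Qed.

Lemma kreg_at T m w : 0 < Im T -> kreg T m w w = th0 m T / (poch T T * poch T T).
Proof.
 intro hT. unfold kreg. recast m.
 recast T by (simpl; ring). recast T by (simpl; ring).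
 assert (h := poch_self_neq_0 T hT). field. exact h.
Qed.

Definition kres (T m : C) : C := th0 m T / (poch T T * poch T T).

Lemma Kgood_point (S K : C -> Prop) w : Kgood S K -> (forall v, S v -> avoids w v) -> Kgood S (fun t => K t \/ t = w).
Proof.
 intros [[M HM] HK] H. split.
 - exists (Rmax M (Rabs (Im w))). intros t [ht | ->]; [eapply Rle_trans; [apply HM, ht | apply Rmax_l] | apply Rmax_r].
 - intros v hv. destruct (HK v hv) as [d [hd h]]. assert (h0 := proj1 (Cmod_gt_0 _) (H v hv)).
  exists (Rmin d (Cmod (1 - e2pi (w - v)))). split; [now apply Rmin_pos |].
  intros t [ht | ->]; [eapply Rle_trans; [apply Rmin_l | now apply h] | apply Rmin_r].
Qed.

Lemma th0_on_path T g t w : 0 < Im T -> on_path g t -> (forall k : Z, avoided g (w + IZR k * T)) -> th0 (t - w) T <> 0.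
Proof.
 intros hT ht H. apply th0_neq_0; [exact hT |]. intro k. specialize (H (- k)%Z t ht). unfold avoids in H.
 replace (t - (w + IZR (- k) * T)) with (t - w + IZR k * T) in H; [exact H |].
 rewrite opp_IZR, RtoC_opp. ring.
Qed.

Lemma kernel_residue S g1 dg1 g2 dg2 f T m w : 0 < Im T -> period_path g1 dg1 -> period_path g2 dg2 ->
 (forall v, S v -> same_side g1 g2 v) -> (forall v, S v -> avoids w v) ->
 (forall k : Z, k <> 0%Z -> same_side g1 g2 (w + IZR k * T)) ->
 passes_above g1 w -> passes_below g2 w -> Mer S f ->
 pint g1 dg1 (fun t => f t * kth T m (t - w)) - pint g2 dg2 (fun t => f t * kth T m (t - w)) = kres T m * f w.
Proof.
 intros hT P1 P2 H1 H2 H3 A B Hf.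
 assert (a1 := joined_avoided _ _ _ A). assert (a2 := joined_avoided _ _ _ B).
 assert (av : forall k : Z, avoided g1 (w + IZR k * T) /\ avoided g2 (w + IZR k * T)).
 { intro k. destruct (Z.eq_dec k 0) as [-> | hk].
  - recast w by (simpl; ring). now split.
  - now apply same_side_avoided, H3. }
 set (S' := fun v => S v \/ lattice_pole T w v).
 assert (HS : forall v, S' v -> same_side g1 g2 v).
 { intros v [hv | [k [hk ->]]]; auto. }
 assert (K0 := Kgood_on_paths S' g1 g2 (period_path_cont _ _ P1) (period_path_cont _ _ P2)
  (fun v h => same_side_avoided _ _ _ (HS v h))).
 assert (K := Kgood_point _ _ w K0).
 rewrite (pint_ext g1 _ _ (fun t => (f t * kreg T m w t) * geomX w t)).
 2:{ intros t ht. rewrite kth_kreg; [ring | exact hT |]. apply (th0_on_path T g1); auto. intro; apply av. }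
 rewrite (pint_ext g2 _ _ (fun t => (f t * kreg T m w t) * geomX w t)).
 2:{ intros t ht. rewrite kth_kreg; [ring | exact hT |]. apply (th0_on_path T g2); auto. intro; apply av. }
 assert (Hw : forall v, S' v -> avoids w v).
 { intros v [hv | [k [hk ->]]]; [now apply H2 |].
  apply avoids_Im. rewrite Im_plus, Im_mult, Im_RtoC, Re_RtoC.
  assert (IZR k <> 0%R) by (apply not_0_IZR; exact hk).
  nra. }
 rewrite (pint_residue S' _ g1 dg1 g2 dg2 (fun t => f t * kreg T m w t) w P1 P2 HS (K Hw)); auto.
 - rewrite kreg_at by exact hT. unfold kres. ring.
 - apply Mer_mult; [| | exact (K Hw)].
  + apply (Mer_incl S); [now left | exact Hf].
  + apply (Mer_incl (lattice_pole T w)); [now right | now apply kreg_Mer].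
Qed.

(** Relative position of the contour [g] of t and the contour [g'] of t' modulo T: for j = 0, [g]
    runs above [g'] and below [g'] + T; for j = -1, below [g'] and above [g'] - T. *)
Definition stacked (T : C) (j : Z) (g g' : R -> C) : Prop := forall t', on_path g' t' -> forall k : Z,
 ((k <= j)%Z -> passes_above g (t' + IZR k * T)) /\ ((j < k)%Z -> passes_below g (t' + IZR k * T)).

Lemma stacked_avoided T j g g' t' k : stacked T j g g' -> on_path g' t' -> avoided g (t' + IZR k * T).
Proof.
 intros H ht. destruct (H t' ht k) as [a b]. destruct (Z_le_gt_dec k j) as [h | h].
 - exact (joined_avoided _ _ _ (a h)).
 - exact (joined_avoided _ _ _ (b ltac:(lia))).
Qed.

Lemma stacked_th0 T j g g' t t' : 0 < Im T -> stacked T j g g' -> on_path g t -> on_path g' t' -> th0 (t - t') T <> 0.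
Proof. intros hT H h h'. apply (th0_on_path T g); auto. intro k. exact (stacked_avoided _ _ _ _ _ k H h'). Qed.

Definition dint (T m : C) (g dg g' dg' : R -> C) (phi psi : C -> C) : C :=
 pint g' dg' (fun t' => psi t' * pint g dg (fun t => phi t * kth T m (t - t'))).

Lemma kth_joint_cont {U : UniformSpace} T (mu : U -> C) (f : U -> C) u : 0 < Im T ->
 ccont mu u -> ccont f u -> th0 (f u) T <> 0 -> ccont (fun u => kth T (mu u) (f u)) u.
Proof.
 intros hT h1 h2 h3. unfold kth.
 assert (C0 : forall x, continuous (T := C_UniformSpace) (U := C_UniformSpace) (fun t => th0 t T) x).
 { intro x. apply (ccont_ext (fun t => th0 (t + 0) T)); [intro; f_equal; ring | now apply th0_cont]. }
 apply ccont_div; [| | exact h3].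
 - apply (ccont_comp (fun u => f u + mu u) (fun t => th0 t T)); [cc | apply C0].
 - apply (ccont_comp f (fun t => th0 t T)); [exact h2 | apply C0].
Qed.

Lemma inner_cont {U : UniformSpace} T j g dg g' (phi : C -> C) (mu : U -> C) (y : U -> R) u : 0 < Im T ->
 period_path g dg -> (forall s, ccont g' s) -> stacked T j g g' -> pcont g phi ->
 (forall v, ccont mu v) -> (forall v, continuous y v) ->
 ccont (fun v => pint g dg (fun t => phi t * kth T (mu v) (t - g' (clamp (y v))))) u.
Proof.
 intros hT P hg' H hphi hmu hy.
 apply (pint_param g dg (fun v t => phi t * kth T (mu v) (t - g' (clamp (y v)))) u P).
 intros v r. apply ccont_mult; [now apply (ccont_snd (fun r => phi (g (clamp r)))) |].
 apply kth_joint_cont; [exact hT | now apply (ccont_fst mu) | |].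
 - apply ccont_minus.
  + apply (ccont_snd (fun r => g (clamp r))), ccont_clamp, (period_path_cont _ _ P).
  + apply (ccont_fst (fun v => g' (clamp (y v)))).
   apply (continuous_comp y (fun r => g' (clamp r))); [apply hy |]. cc.
 - cbn [fst snd]. apply (stacked_th0 T j g g'); auto; apply on_path_clamp.
Qed.

Lemma inner_pcont T m j g dg g' (phi : C -> C) : 0 < Im T -> period_path g dg -> (forall s, ccont g' s) ->
 stacked T j g g' -> pcont g phi -> pcont g' (fun t' => pint g dg (fun t => phi t * kth T m (t - t'))).
Proof.
 intros hT P hg' H hphi s. apply (inner_cont T j g dg g' phi (fun _ : R => m) (fun s : R => s) s); auto.
 - intro; cc.
 - cc.
Qed.

Lemma inner_integrand_pcont T m j g dg g' (phi : C -> C) t' : 0 < Im T -> period_path g dg ->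
 stacked T j g g' -> pcont g phi -> on_path g' t' -> pcont g (fun t => phi t * kth T m (t - t')).
Proof.
 intros hT P H hphi ht' s. apply ccont_mult; [apply hphi |].
 apply kth_joint_cont; [exact hT | cc | |].
 - cc.
 - apply (stacked_th0 T j g g'); auto. apply on_path_clamp.
Qed.

Lemma dint_cont T j g dg g' dg' phi psi (m0 : C) : 0 < Im T -> period_path g dg -> period_path g' dg' ->
 stacked T j g g' -> pcont g phi -> pcont g' psi ->
 continuous (T := C_UniformSpace) (U := C_UniformSpace) (fun m => dint T m g dg g' dg' phi psi) m0.
Proof.
 intros hT P P' H hphi hpsi. unfold dint.
 apply (pint_param g' dg' (fun m t' => psi t' * pint g dg (fun t => phi t * kth T m (t - t'))) m0 P').
 intros m r. apply ccont_mult; [now apply (ccont_snd (fun r => psi (g' (clamp r)))) |].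
 apply (inner_cont T j g dg g' phi (fun v : prod_UniformSpace C_UniformSpace R_UniformSpace => fst v)
  (fun v => snd v)); auto.
 - cc.
 - intro v. apply (ccont_fst (fun m => m)). cc.
 - intro v. apply continuous_snd.
Qed.

Lemma dint_plus T m j g dg g' dg' f h psi : 0 < Im T -> period_path g dg -> period_path g' dg' ->
 stacked T j g g' -> pcont g f -> pcont g h -> pcont g' psi ->
 dint T m g dg g' dg' (fun t => f t + h t) psi = dint T m g dg g' dg' f psi + dint T m g dg g' dg' h psi.
Proof.
 intros hT P P' H hf hh hpsi. unfold dint. assert (cg' := period_path_cont _ _ P').
 rewrite <- pint_plus; [| exact P' | apply pcont_mult; [exact hpsi | now apply (inner_pcont T m j)] ..].
 apply pint_ext. intros t' ht'.
 rewrite (pint_ext g dg _ (fun t => f t * kth T m (t - t') + h t * kth T m (t - t'))) by (intros; ring).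
 rewrite pint_plus; [ring | exact P | now apply (inner_integrand_pcont T m j g dg g') ..].
Qed.

Lemma dint_scal T m j g dg g' dg' c f psi : 0 < Im T -> period_path g dg -> period_path g' dg' ->
 stacked T j g g' -> pcont g f -> pcont g' psi ->
 dint T m g dg g' dg' (fun t => c * f t) psi = c * dint T m g dg g' dg' f psi.
Proof.
 intros hT P P' H hf hpsi. unfold dint. assert (cg' := period_path_cont _ _ P').
 rewrite <- pint_scal; [| exact P' | apply pcont_mult; [exact hpsi | now apply (inner_pcont T m j)]].
 apply pint_ext. intros t' ht'.
 rewrite (pint_ext g dg _ (fun t => c * (f t * kth T m (t - t')))) by (intros; ring).
 rewrite pint_scal; [ring | exact P | now apply (inner_integrand_pcont T m j g dg g')].
Qed.

Lemma dint_ext T m g dg g' dg' f h psi : (forall t, on_path g t -> f t = h t) ->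
 dint T m g dg g' dg' f psi = dint T m g dg g' dg' h psi.
Proof. intro H. apply pint_ext. intros t' _. f_equal. apply pint_ext. intros t ht. now rewrite H. Qed.

(** [B] depends on the contours only: the denominator of the kernel is integrated once and for all.
    The bound thus serves every [phi] and every [m] simultaneously. *)
Lemma dint_bound T j g dg g' dg' : 0 < Im T -> period_path g dg -> period_path g' dg' ->
 stacked T j g g' ->
 exists B, 0 < B /\ forall phi psi m M M' Q, pcont g phi -> pcont g' psi -> 0 <= M -> 0 <= M' ->
  (forall t, on_path g t -> Cmod (phi t) <= M) -> (forall t, on_path g' t -> Cmod (psi t) <= Q) ->
  (forall t t', on_path g t -> on_path g' t' -> Cmod (th0 (t - t' + m) T) <= M') ->
  Cmod (dint T m g dg g' dg' phi psi) <= M * M' * Q * B.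
Proof.
 intros hT P P' H. assert (cg' := period_path_cont _ _ P').
 set (w := fun y r : R => Cmod (dg (clamp r) * / th0 (g (clamp r) - g' (clamp y)) T)).
 assert (C0 : forall x, continuous (T := C_UniformSpace) (U := C_UniformSpace) (fun t => th0 t T) x).
 { intro x. apply (ccont_ext (fun t => th0 (t + 0) T)); [intro; f_equal; ring | now apply th0_cont]. }
 assert (cw : forall y r, continuous (T := prod_UniformSpace R_UniformSpace R_UniformSpace) (U := C_UniformSpace)
  (fun u => RtoC (w (fst u) (snd u))) (y, r)).
 { intros y r. apply ccont_RtoC, ccont_Cmod, ccont_mult.
  - apply (ccont_snd (fun r => dg (clamp r))), ccont_clamp, P.
  - apply ccont_inv.
   + apply (ccont_comp (fun u : R * R => g (clamp (snd u)) - g' (clamp (fst u))) (fun t => th0 t T)); [| apply C0].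
    apply ccont_minus; [apply (ccont_snd (fun r => g (clamp r))) | apply (ccont_fst (fun r => g' (clamp r)))];
     cc.
   + cbn [fst snd]. apply (stacked_th0 T j g g'); auto; apply on_path_clamp. }
 assert (cN := ccont_cint_param (fun y r => RtoC (w y r))).
 destruct (ccont_bounded (fun y => cint (fun r => RtoC (w y r)) 0 1) 0 1 (fun x => cN x cw)) as [N [hN HN]].
 destruct (pint_le g' dg' P') as [B' [hB' HB']].
 exists (N * B')%R. split; [repeat apply Rmult_lt_0_compat; assumption |].
 intros phi psi m M M' Q hphi hpsi hM hM' H1 HQ H2. unfold dint.
 recast ((Q * (M * M' * N)) * B')%R.
 apply HB'. { apply pcont_mult; [exact hpsi | now apply (inner_pcont T m j)]. }
 intros t' [y [hy ->]]. rewrite Cmod_mult.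
 apply Rmult_le_compat; try apply Cmod_ge_0.
 { apply HQ. now exists y. }
 assert (cwy : forall r, ccont (fun r => RtoC (w y r)) r).
 { intro r. apply (continuous_comp_2 (fun _ : R => y) (fun s : R => s) (fun y r => RtoC (w y r)) r).
  - cc.
  - cc.
  - apply cw. }
 assert (E : RInt (w y) 0 1 <= N).
 { eapply Rle_trans; [| apply (HN y hy)].
  assert (I := is_cint_Re _ _ _ _ (is_cint_cont _ 0 1 cwy)).
  rewrite (is_RInt_unique (w y) 0 1 _ I). eapply Rle_trans; [apply Rle_abs | apply Cmod_Re]. }
 eapply Rle_trans; [| apply Rmult_le_compat_l with (r2 := N); [now apply Rmult_le_pos | exact E]].
 unfold pint.
 replace (M * M' * RInt (w y) 0 1)%R with (RInt (fun r => M * M' * w y r)%R 0 1).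
 2:{ apply (RInt_scal (V := R_CompleteNormedModule) (w y) 0 1 (M * M')%R).
   apply (ex_RInt_continuous (V := R_CompleteNormedModule)). intros r _. exact (ccont_Re _ _ (cwy r)). }
 apply cint_Cmod_le.
 - apply (pint_cont g dg (fun t => phi t * kth T m (t - g' y)) P).
  apply (inner_integrand_pcont T m j g dg g'); auto. exists y; auto.
 - intro r. apply (continuous_scal_r (V := R_NormedModule) (M * M')%R (w y)). exact (ccont_Re _ _ (cwy r)).
 - intros r hr. unfold w, kth. rewrite !(clamp_id _ hr), !(clamp_id _ hy).
  recast (phi (g r) * th0 (g r - g' y + m) T * (dg r * / th0 (g r - g' y) T)) by (unfold Cdiv; ring).
  rewrite Cmod_mult, Cmod_mult. apply Rmult_le_compat_r; [apply Cmod_ge_0 |].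
  apply Rmult_le_compat; try apply Cmod_ge_0; [apply H1 | apply H2]; eexists; eauto.
Qed.

(* The pole of the kernel at [t = t'] is crossed when the inner contour is lowered. *)
Lemma dint_cross T m Sphi g2 dg2 g1 dg1 g' dg' phi psi : 0 < Im T ->
 period_path g1 dg1 -> period_path g2 dg2 -> period_path g' dg' ->
 stacked T 0 g2 g' -> stacked T (-1) g1 g' -> Mer Sphi phi -> pcont g' psi ->
 (forall v, Sphi v -> same_side g2 g1 v /\ avoided g' v) ->
 dint T m g2 dg2 g' dg' phi psi = dint T m g1 dg1 g' dg' phi psi + kres T m * pint g' dg' (fun t => phi t * psi t).
Proof.
 intros hT P1 P2 P' H2 H1 hphi hpsi HS. assert (cg' := period_path_cont _ _ P').
 assert (c2 : pcont g2 phi).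
 { apply (Mer_pcont Sphi); auto; [exact (period_path_cont _ _ P2) |].
  intros v hv. exact (proj1 (same_side_avoided _ _ _ (proj1 (HS v hv)))). }
 assert (c1 : pcont g1 phi).
 { apply (Mer_pcont Sphi); auto; [exact (period_path_cont _ _ P1) |].
  intros v hv. exact (proj2 (same_side_avoided _ _ _ (proj1 (HS v hv)))). }
 assert (c' : pcont g' phi).
 { apply (Mer_pcont Sphi); auto. intros v hv. apply (HS v hv). }
 unfold dint. rewrite <- pint_scal by (auto using pcont_mult).
 rewrite <- pint_plus; [| exact P' | |].
 2:{ apply pcont_mult; [exact hpsi | now apply (inner_pcont T m (-1))]. }
 2:{ cc. }
 apply pint_ext. intros t' ht'.
 rewrite <- (Cmult_comm (psi t')), Cmult_assoc, (Cmult_comm (kres T m) (psi t')), <- Cmult_assoc, <- Cmult_plus_distr_l.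
 f_equal. rewrite <- (kernel_residue Sphi g2 dg2 g1 dg1 phi T m t' hT P2 P1); auto.
 - ring.
 - intros v hv. apply (HS v hv).
 - intros v hv. apply (proj2 (HS v hv) t' ht').
 - intros k hk. destruct (H2 t' ht' k) as [a b]. destruct (H1 t' ht' k) as [c d].
  destruct (Z_le_gt_dec k 0) as [h | h]; [left; split; [apply a | apply c] | right; split; [apply b | apply d]]; lia.
 - destruct (H2 t' ht' 0%Z) as [a _]. recast (t' + IZR 0 * T) by (simpl; ring). apply a. lia.
 - destruct (H1 t' ht' 0%Z) as [_ b]. recast (t' + IZR 0 * T) by (simpl; ring). apply b. lia.
Qed.

Lemma on_path_tr' v g t : on_path g t -> on_path (tr v g) (t + v).
Proof. intros [r [hr ->]]. now exists r. Qed.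

Lemma stacked_tr T j k g g' v v' : stacked T j g g' -> v' = v - IZR (k - j) * T -> stacked T k (tr v g) (tr v' g').
Proof.
 intros H -> t' ht' i. apply on_path_tr in ht'. destruct (H _ ht' (i - (k - j))%Z) as [a b].
 assert (E : t' - (v - IZR (k - j) * T) + IZR (i - (k - j)) * T = t' + IZR i * T - v).
 { rewrite (minus_IZR i), RtoC_minus. ring. }
 rewrite E in a, b. split; intro h; [apply above_tr, a | apply below_tr, b]; lia.
Qed.

Lemma tr_0 g : tr 0 g = g.
Proof. apply functional_extensionality. intro s. unfold tr. ring. Qed.

(** Translating both variables by T turns phi(t + T) into phi. As all poles of [phi] lie below, the
    inner contour can be moved back down; it meets only the pole t = t', which contributes the
    single integral. *)
Lemma dint_low_step T m Sphi g dg g' dg' phi psi : 0 < Im T -> period_path g dg -> period_path g' dg' ->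
 stacked T 0 g g' -> Mer Sphi phi -> pcont g' psi ->
 (forall v, Sphi v -> passes_above g v /\ passes_above g (v - T) /\ avoided g' (v - T)) ->
 dint T m g dg g' dg' (fun t => phi (t + T)) psi =
 e2pi m * dint T m g dg g' dg' phi psi + kres T m * pint g' dg' (fun t => phi (t + T) * psi t).
Proof.
 intros hT P P' H hphi hpsi HS. assert (cg := period_path_cont _ _ P). assert (cg' := period_path_cont _ _ P').
 assert (H1 : stacked T (-1) g (tr T g')).
 { rewrite <- (tr_0 g). apply (stacked_tr T 0); [exact H | simpl; ring]. }
 assert (E := dint_cross T m Sphi (tr T g) dg g dg (tr T g') dg' phi (fun t => psi (t - T)) hT P
  (tr_path _ _ _ P) (tr_path _ _ _ P')).
 rewrite pint_tr in E.
 rewrite (pint_ext g' dg' (fun t => phi (t + T) * psi t) (fun t => phi (t + T) * psi (t + T - T)))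
  by (intros; do 2 f_equal; ring).
 replace (dint T m g dg g' dg' (fun t => phi (t + T)) psi) with
  (dint T m (tr T g) dg (tr T g') dg' phi (fun t => psi (t - T))).
 2:{ unfold dint. rewrite pint_tr. apply pint_ext. intros t' _. rewrite pint_tr.
   recast t'. apply (f_equal (Cmult (psi t'))). apply pint_ext. intros t _.
   do 2 f_equal. ring. }
 replace (e2pi m * dint T m g dg g' dg' phi psi) with (dint T m g dg (tr T g') dg' phi (fun t => psi (t - T))).
 2:{ assert (cp : pcont g phi).
   { apply (Mer_pcont Sphi); auto. intros v hv. destruct (HS v hv) as [a _]. exact (joined_avoided _ _ _ a). }
   unfold dint. rewrite pint_tr, <- pint_scal; [| exact P' | apply pcont_mult; [exact hpsi | now apply (inner_pcont T m 0)]].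
   apply pint_ext. intros t' ht'. recast t'.
   rewrite Cmult_assoc, (Cmult_comm (e2pi m)), <- Cmult_assoc. f_equal.
   rewrite <- pint_scal by (try exact P; now apply (inner_integrand_pcont T m 0 g dg g')).
   apply pint_ext. intros t ht. rewrite Cmult_assoc, (Cmult_comm (e2pi m)), <- Cmult_assoc. f_equal.
   recast (t - (t' + T) + T). rewrite kth_shift; [| exact hT |].
   - rewrite Cmult_assoc, <- e2pi_plus. recast (RtoC 0). rewrite e2pi_0. ring.
   - apply (stacked_th0 T (-1) g (tr T g')); auto. now apply on_path_tr'. }
 apply E; auto.
 - apply (stacked_tr T 0); [exact H | simpl; ring].
 - intro s. change (ccont (fun s => psi (g' (clamp s) + T - T)) s). apply (ccont_ext (fun s => psi (g' (clamp s)))).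
  + intro; f_equal; ring.
  + apply hpsi.
 - intros v hv. destruct (HS v hv) as [a [b c]]. split.
  + left. split; [now apply above_tr | exact a].
  + intros t ht. apply on_path_tr in ht. specialize (c _ ht). apply avoids_shift in c.
   now recast t in c.
Qed.

(** Mirror image: with all poles of [phi] above, the inner contour is lowered by T and again meets
    only t = t'. *)
Lemma dint_up_step T m Sphi g dg g' dg' phi psi : 0 < Im T -> period_path g dg -> period_path g' dg' ->
 stacked T 0 g g' -> Mer Sphi phi -> pcont g' psi ->
 (forall v, Sphi v -> passes_below g v /\ passes_below g (v + T) /\ avoided g' v) ->
 dint T m g dg g' dg' phi psi =
 e2pi m * dint T m g dg g' dg' (fun t => phi (t - T)) psi + kres T m * pint g' dg' (fun t => phi t * psi t).
Proof.
 intros hT P P' H hphi hpsi HS. assert (cg := period_path_cont _ _ P). assert (cg' := period_path_cont _ _ P').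
 assert (H1 : stacked T (-1) (tr (- T) g) g').
 { rewrite <- (tr_0 g'). apply (stacked_tr T 0); [exact H | simpl; ring]. }
 rewrite (dint_cross T m Sphi g dg (tr (- T) g) dg g' dg' phi psi); auto using tr_path.
 - f_equal. unfold dint.
  assert (cp : pcont g (fun t => phi (t - T))).
  { apply (Mer_pcont (fun v => Sphi (v - T))); auto.
   - intros v hv. destruct (HS _ hv) as [a [b _]]. recast v in b. exact (joined_avoided _ _ _ b).
   - exact (Mer_shift Sphi (- T) phi hphi). }
  rewrite <- pint_scal; [| exact P' | apply pcont_mult; [exact hpsi | now apply (inner_pcont T m 0)]].
  apply pint_ext. intros t' ht'. rewrite pint_tr.
  rewrite Cmult_assoc, (Cmult_comm (e2pi m)), <- Cmult_assoc. f_equal.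
  rewrite <- pint_scal by (try exact P; now apply (inner_integrand_pcont T m 0 g dg g')).
  apply pint_ext. intros t ht. rewrite Cmult_assoc, (Cmult_comm (e2pi m)), <- Cmult_assoc. f_equal.
  recast (t + - T - t' + T). rewrite kth_shift; [| exact hT |].
  + rewrite Cmult_assoc, <- e2pi_plus. recast (RtoC 0). rewrite e2pi_0. ring.
  + apply (stacked_th0 T (-1) (tr (- T) g) g'); auto. now apply on_path_tr'.
 - intros v hv. destruct (HS v hv) as [a [b c]]. split; [| exact c]. right. split; [exact a |].
  apply below_tr. recast (v + T). exact b.
Qed.

(** * Independence of the double integral of the pair of contours *)

Definition crossing_data (T : C) (g1 dg1 g1' dg1' g2 dg2 g2' dg2' : R -> C) (Spsi : C -> Prop) (psi : C -> C) : Prop :=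
 (0 < Im T)%R /\ (period_path g1 dg1 /\ period_path g1' dg1' /\ period_path g2 dg2 /\ period_path g2' dg2') /\
 (stacked T 0 g1 g1' /\ stacked T 0 g2 g2') /\ Mer Spsi psi /\ (forall v, Spsi v -> same_side g1' g2' v).

(** All translates are demanded at once, so that functions with such poles form a class stable under
    t -> t + T. The offset [S N] for the outer contours is that of phi(t + T) in the single
    integral. *)
Definition low_pole (T : C) (g1 g1' g2 g2' : R -> C) (w : C) : Prop := forall N : nat,
 passes_above g1 (w - INR N * T) /\ passes_above g2 (w - INR N * T) /\
 passes_above g1' (w - INR (S N) * T) /\ passes_above g2' (w - INR (S N) * T).

Definition up_pole (T : C) (g1 g1' g2 g2' : R -> C) (w : C) : Prop := forall N : nat,
 passes_below g1 (w + INR N * T) /\ passes_below g2 (w + INR N * T) /\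
 passes_below g1' (w + INR N * T) /\ passes_below g2' (w + INR N * T).

Definition dgap (T m : C) (g1 dg1 g1' dg1' g2 dg2 g2' dg2' : R -> C) (psi phi : C -> C) : C :=
 dint T m g1 dg1 g1' dg1' phi psi - dint T m g2 dg2 g2' dg2' phi psi.

Lemma crossing_pcont T g1 dg1 g1' dg1' g2 dg2 g2' dg2' Spsi psi :
 crossing_data T g1 dg1 g1' dg1' g2 dg2 g2' dg2' Spsi psi -> pcont g1' psi /\ pcont g2' psi.
Proof.
 intros (hT & (P1 & P1' & P2 & P2') & (H1 & H2) & hpsi & HS).
 split; apply (Mer_pcont Spsi); auto; try (now apply (period_path_cont _ _ P1')); try (now apply (period_path_cont _ _ P2'));
  intros v hv; apply (same_side_avoided _ _ _ (HS v hv)).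
Qed.

(** The single integrals produced by [dint_low_step] for the two pairs agree by Cauchy's theorem.
    They cancel in the difference, which then obeys a purely multiplicative relation. *)
Lemma dgap_low_step T m g1 dg1 g1' dg1' g2 dg2 g2' dg2' Spsi psi phi :
 crossing_data T g1 dg1 g1' dg1' g2 dg2 g2' dg2' Spsi psi -> Mer (low_pole T g1 g1' g2 g2') phi ->
 dgap T m g1 dg1 g1' dg1' g2 dg2 g2' dg2' psi phi =
 e2pi (- m) * dgap T m g1 dg1 g1' dg1' g2 dg2 g2' dg2' psi (fun t => phi (t + T)).
Proof.
 intros D hphi. destruct (crossing_pcont _ _ _ _ _ _ _ _ _ _ _ D) as [c1 c2].
 destruct D as (hT & (P1 & P1' & P2 & P2') & (H1 & H2) & hpsi & HSp).
 set (S := low_pole T g1 g1' g2 g2') in *.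
 assert (HS' : forall v, S v -> (passes_above g1 v /\ passes_above g1 (v - T) /\ passes_above g1' (v - T)) /\
   (passes_above g2 v /\ passes_above g2 (v - T) /\ passes_above g2' (v - T))).
 { intros v hv. destruct (hv 0%nat) as (a & b & c & d). destruct (hv 1%nat) as (a' & b' & _ & _).
  simpl in *. recast v in *. recast (v - T) in *. tauto. }
 unfold dgap.
 rewrite (dint_low_step T m S g1 dg1 g1' dg1' phi psi), (dint_low_step T m S g2 dg2 g2' dg2' phi psi); auto.
 2:{ intros v hv. destruct (HS' v hv) as [_ (a & b & c)]. repeat split; auto. exact (joined_avoided _ _ _ c). }
 2:{ intros v hv. destruct (HS' v hv) as [(a & b & c) _]. repeat split; auto. exact (joined_avoided _ _ _ c). }
 rewrite (Mer_indep (fun v => S (v + T) \/ Spsi v) g1' dg1' g2' dg2' (fun t => phi (t + T) * psi t)); auto.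
 - rewrite e2pi_opp. assert (n := e2pi_neq_0 m). field. exact n.
 - intros v [hv | hv]; [| now apply HSp]. destruct (HS' _ hv) as [(_ & _ & a) (_ & _ & b)].
  recast v in *. now left.
 - apply Mer_mult.
  + apply (Mer_incl (fun v => S (v + T))); [auto | now apply Mer_shift].
  + apply (Mer_incl Spsi); auto.
Qed.

Lemma dgap_up_step T m g1 dg1 g1' dg1' g2 dg2 g2' dg2' Spsi psi phi :
 crossing_data T g1 dg1 g1' dg1' g2 dg2 g2' dg2' Spsi psi -> Mer (up_pole T g1 g1' g2 g2') phi ->
 dgap T m g1 dg1 g1' dg1' g2 dg2 g2' dg2' psi phi =
 e2pi m * dgap T m g1 dg1 g1' dg1' g2 dg2 g2' dg2' psi (fun t => phi (t + - T)).
Proof.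
 intros D hphi. destruct (crossing_pcont _ _ _ _ _ _ _ _ _ _ _ D) as [c1 c2].
 destruct D as (hT & (P1 & P1' & P2 & P2') & (H1 & H2) & hpsi & HSp).
 set (S := up_pole T g1 g1' g2 g2') in *.
 assert (HS' : forall v, S v -> (passes_below g1 v /\ passes_below g1 (v + T) /\ passes_below g1' v) /\
   (passes_below g2 v /\ passes_below g2 (v + T) /\ passes_below g2' v)).
 { intros v hv. destruct (hv 0%nat) as (a & b & c & d). destruct (hv 1%nat) as (a' & b' & _ & _).
  simpl in *. recast v in *. recast (v + T) in *. tauto. }
 unfold dgap.
 rewrite (dint_up_step T m S g1 dg1 g1' dg1' phi psi), (dint_up_step T m S g2 dg2 g2' dg2' phi psi); auto.
 2:{ intros v hv. destruct (HS' v hv) as [_ (a & b & c)]. repeat split; auto. exact (joined_avoided _ _ _ c). }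
 2:{ intros v hv. destruct (HS' v hv) as [(a & b & c) _]. repeat split; auto. exact (joined_avoided _ _ _ c). }
 rewrite (Mer_indep (fun v => S v \/ Spsi v) g1' dg1' g2' dg2' (fun t => phi t * psi t)); auto.
 - unfold Cminus. ring.
 - intros v [hv | hv]; [| now apply HSp]. destruct (HS' _ hv) as [(_ & _ & a) (_ & _ & b)]. now right.
 - apply Mer_mult; [apply (Mer_incl S) | apply (Mer_incl Spsi)]; auto.
Qed.

Lemma Mer_shift_closed (P : C -> Prop) v f : (forall w, P w -> P (w - v)) -> Mer P f -> Mer P (fun t => f (t + v)).
Proof.
 intros H hf. apply (Mer_incl (fun w => P (w + v))); [| now apply Mer_shift].
 intros w hw. recast (w + v - v). now apply H.
Qed.

Lemma shift_iterate (L : (C -> C) -> C) (P : C -> Prop) (v q : C) :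
 (forall w, P w -> P (w - v)) -> (forall f, Mer P f -> L f = q * L (fun t => f (t + v))) ->
 forall N f, Mer P f -> Mer P (fun t => f (t + INR N * v)) /\ L f = Cpow q N * L (fun t => f (t + INR N * v)).
Proof.
 intros HP HL. induction N as [| N IH]; intros f hf.
 - recast f by (apply functional_extensionality; intro; f_equal; simpl; ring).
  split; [exact hf | simpl; ring].
 - destruct (IH _ (Mer_shift_closed P v f HP hf)) as [h1 h2].
  recast (fun t => f (t + INR N * v + v)) by (apply functional_extensionality; intro; f_equal; rewrite S_INR, RtoC_plus; ring).
  split; [exact h1 |]. rewrite (HL f hf), h2. simpl. ring.
Qed.

Lemma low_pole_shift T g1 g1' g2 g2' w : low_pole T g1 g1' g2 g2' w -> low_pole T g1 g1' g2 g2' (w - T).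
Proof.
 intros H N. specialize (H (S N)). recast (w - INR (S N) * T) by (rewrite S_INR, RtoC_plus; ring).
 recast (w - INR (S (S N)) * T) by (rewrite (S_INR (S N)), RtoC_plus; ring). exact H.
Qed.

Lemma up_pole_shift T g1 g1' g2 g2' w : up_pole T g1 g1' g2 g2' w -> up_pole T g1 g1' g2 g2' (w - - T).
Proof.
 intros H N. specialize (H (S N)). recast (w + INR (S N) * T) by (rewrite S_INR, RtoC_plus; ring).
 exact H.
Qed.

Lemma Rat_Mer S f : Rat S f -> Mer S f.
Proof. intros H K _. now apply RatLim_Rat. Qed.

Lemma low_pole_above T g1 g1' g2 g2' w : low_pole T g1 g1' g2 g2' w -> passes_above g1 w /\ passes_above g2 w.
Proof. intro H. destruct (H 0%nat) as (a & b & _). simpl in a, b. recast w in *. now split. Qed.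

Lemma up_pole_below T g1 g1' g2 g2' w : up_pole T g1 g1' g2 g2' w -> passes_below g1 w /\ passes_below g2 w.
Proof. intro H. destruct (H 0%nat) as (a & b & _). simpl in a, b. recast w in *. now split. Qed.

Lemma dgap_bound T g1 dg1 g1' dg1' g2 dg2 g2' dg2' Spsi psi m :
 crossing_data T g1 dg1 g1' dg1' g2 dg2 g2' dg2' Spsi psi ->
 exists B, 0 < B /\ forall phi M, 0 <= M -> pcont g1 phi -> pcont g2 phi ->
  (forall t, on_path g1 t \/ on_path g2 t -> Cmod (phi t) <= M) ->
  Cmod (dgap T m g1 dg1 g1' dg1' g2 dg2 g2' dg2' psi phi) <= M * B.
Proof.
 intro D. destruct (crossing_pcont _ _ _ _ _ _ _ _ _ _ _ D) as [c1 c2].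
 destruct D as (hT & (P1 & P1' & P2 & P2') & (H1 & H2) & hpsi & HS).
 destruct (dint_bound T 0 g1 dg1 g1' dg1' hT P1 P1' H1) as [B1 [hB1 HB1]].
 destruct (dint_bound T 0 g2 dg2 g2' dg2' hT P2 P2' H2) as [B2 [hB2 HB2]].
 destruct (Mer_bounded Spsi psi g1' (period_path_cont _ _ P1') (fun v h => proj1 (same_side_avoided _ _ _ (HS v h))) hpsi)
  as [Q1 [hQ1 HQ1]].
 destruct (Mer_bounded Spsi psi g2' (period_path_cont _ _ P2') (fun v h => proj2 (same_side_avoided _ _ _ (HS v h))) hpsi)
  as [Q2 [hQ2 HQ2]].
 assert (HN : exists N, 0 <= N /\ forall t t', (on_path g1 t /\ on_path g1' t') \/ (on_path g2 t /\ on_path g2' t') ->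
  Cmod (th0 (t - t' + m) T) <= N).
 { destruct (path_Im_bounded g1 (period_path_cont _ _ P1)) as [M1 [_ h1]].
  destruct (path_Im_bounded g1' (period_path_cont _ _ P1')) as [M1' [_ h1']].
  destruct (path_Im_bounded g2 (period_path_cont _ _ P2)) as [M2 [_ h2]].
  destruct (path_Im_bounded g2' (period_path_cont _ _ P2')) as [M2' [_ h2']].
  destruct (RatLim_bounded _ _ _ (Kgood_strip (Rmax (M1 + M1') (M2 + M2'))) (Entire_th0 m T hT _)) as [N [h H]].
  exists N. split; [lra |]. intros t t' ht. apply (H (t - t')). unfold strip. rewrite Im_minus.
  eapply Rle_trans; [apply Rabs_triang |]. rewrite Rabs_Ropp.
  destruct ht as [[a b] | [a b]];
   [eapply Rle_trans; [| apply Rmax_l]; specialize (h1 _ a); specialize (h1' _ b)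
   | eapply Rle_trans; [| apply Rmax_r]; specialize (h2 _ a); specialize (h2' _ b)]; lra. }
 destruct HN as [N [hN HN]].
 assert (hQB1 : 0 <= Q1 * B1) by (apply Rmult_le_pos; lra). assert (hQB2 : 0 <= Q2 * B2) by (apply Rmult_le_pos; lra).
 exists (N * (Q1 * B1 + Q2 * B2) + 1)%R. split; [nra |]. intros phi M hM p1 p2 H. unfold dgap.
 assert (b1 := HB1 phi psi m M N Q1 p1 c1 hM hN (fun t h => H t (or_introl h)) HQ1 (fun t t' h h' => HN t t' (or_introl (conj h h')))).
 assert (b2 := HB2 phi psi m M N Q2 p2 c2 hM hN (fun t h => H t (or_intror h)) HQ2 (fun t t' h h' => HN t t' (or_intror (conj h h')))).
 unfold Cminus. eapply Rle_trans; [apply Cmod_triangle |]. rewrite Cmod_opp. nra.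
Qed.

Lemma geom_bound_zero (z : C) (q B : R) (N0 : nat) : (0 <= q < 1)%R ->
 (forall N, (N0 <= N)%nat -> Cmod z <= B * q ^ N) -> z = 0.
Proof.
 intros hq H. apply (Cmod_geom_zero z (B * q ^ N0) q hq). intro n. rewrite Rmult_assoc, <- pow_add. apply H. lia.
Qed.

Lemma exp_INR_mult (x : R) (n : nat) : exp (INR n * x) = (exp x ^ n)%R.
Proof.
 induction n as [| n IH]; [simpl; rewrite Rmult_0_l; apply exp_0 |].
 rewrite S_INR, Rmult_plus_distr_r, exp_plus, IH, Rmult_1_l. simpl. ring.
Qed.

Lemma nat_above (x : R) : exists N : nat, x <= INR N.
Proof.
 exists (Z.to_nat (up (Rabs x))). destruct (archimed (Rabs x)) as [a _]. assert (h := Rabs_pos x).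
 assert (0 <= up (Rabs x))%Z by (apply le_IZR; lra).
 rewrite INR_IZR_INZ, Z2Nat.id by assumption. generalize (Rle_abs x). lra.
Qed.

(* A power of the translation by [T] makes a monomial with all its poles on one side small on the contours,
  once the exponent of its leading exponential is chosen large enough. *)
Lemma geomXs_small w k M : exists N0 : R, 0 < N0 /\ forall t v, Rabs (Im t) <= M -> N0 <= Rabs (Im v) ->
 Cmod (geomXs (repeat w k) (t + v)) <= 2 ^ k.
Proof.
 exists (Rabs M + Rabs (Im w) + 1)%R. assert (h0 := Rabs_pos M). assert (h1 := Rabs_pos (Im w)). split; [lra |].
 intros t v ht hv. assert (hX : Cmod (geomX w (t + v)) <= 2).
 { unfold geomX. set (x := t + v - w). assert (hM := Rle_abs M).
  assert (hx : 1 <= Rabs (Im x)).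
  { assert (E : Im v = (Im x + (- Im t + Im w))%R) by (unfold x; rewrite Im_minus, Im_plus; ring).
   rewrite E in hv. assert (a := Rabs_triang (Im x) (- Im t + Im w)). assert (b := Rabs_triang (- Im t) (Im w)).
   rewrite Rabs_Ropp in b. lra. }
  assert (P3 := PI2_3_2). assert (E1 := exp_ineq1 1 ltac:(lra)).
  assert (hb : 1 / 2 <= Cmod (1 - e2pi x)).
  { destruct (Rle_dec 0 (Im x)) as [hs | hs].
   - rewrite Rabs_right in hx by lra. apply Cmod_one_minus. rewrite Cmod_e2pi, exp_Ropp.
    assert (a : 2 <= exp (2 * PI * Im x)).
    { apply Rle_trans with (exp 1); [lra | apply exp_le; nra]. }
    unfold Rdiv. rewrite Rmult_1_l. apply Rinv_le_contravar; lra.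
   - rewrite Rabs_left in hx by lra. assert (a : 2 <= Cmod (e2pi x)).
    { rewrite Cmod_e2pi. apply Rle_trans with (exp 1); [lra | apply exp_le; nra]. }
    assert (b := Cmod_triang_inv (e2pi x) 1). rewrite Cmod_1, Cmod_minus_sym in b. lra. }
  rewrite Cmod_inv by (intro E; rewrite E, Cmod_0 in hb; lra). recast (/ (1 / 2))%R by field. apply Rinv_le_contravar; lra. }
 rewrite geomXs_repeat. induction k as [| k IH]; simpl; [rewrite Cmod_1; lra |].
 rewrite Cmod_mult. apply Rmult_le_compat; auto using Cmod_ge_0.
Qed.

Lemma monomial_annihilated (L : (C -> C) -> C) (P K : C -> Prop) (v q w : C) (B M : R) (k : nat) :
 Im v <> 0%R -> q <> 0 -> P w -> (forall w, P w -> P (w - v)) ->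
 (forall f, Mer P f -> L f = q * L (fun t => f (t + v))) ->
 (forall t, K t -> Rabs (Im t) <= M) ->
 (forall f D, 0 <= D -> Mer P f -> (forall t, K t -> Cmod (f t) <= D) -> Cmod (L f) <= D * B) ->
 exists I, L (ratmono I (repeat w (S k))) = 0.
Proof.
 intros hv hq hw HP HL HM HB. destruct (geomXs_small w (S k) M) as [N0 [hN0 HN0]].
 assert (av := Rabs_pos_lt _ hv). assert (P3 := PI2_3_2). assert (hq0 := proj1 (Cmod_gt_0 q) hq).
 destruct (nat_above (N0 / Rabs (Im v))) as [n0 hn0].
 assert (hn : forall N, (n0 <= N)%nat -> N0 <= Rabs (Im (INR N * v))).
 { intros N h. apply le_INR in h. rewrite Im_mult, Im_RtoC, Re_RtoC, Rmult_0_l, Rplus_0_r, Rabs_mult.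
  rewrite (Rabs_right (INR N)) by (assert (a := pos_INR N); lra).
  apply Rle_trans with (N0 / Rabs (Im v) * Rabs (Im v))%R; [right; field; lra | apply Rmult_le_compat_r; lra]. }
 destruct (nat_above ((Rabs (ln (Cmod q)) + 1) / Rabs (Im v))) as [n1 hn1].
 (* I has the sign of Im v and is large enough for exp(-2 pi I Im v) to beat the modulus of [q];
    each translation then gains the factor [r] < 1. *)
 assert (HI : exists I : Z, Rabs (ln (Cmod q)) + 1 <= IZR I * Im v).
 { assert (a : Rabs (ln (Cmod q)) + 1 <= INR n1 * Rabs (Im v)).
  { apply Rle_trans with ((Rabs (ln (Cmod q)) + 1) / Rabs (Im v) * Rabs (Im v))%R; [right; field; lra | apply Rmult_le_compat_r; lra]. }
  destruct (Rle_or_lt 0 (Im v)) as [h | h].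
  - exists (Z.of_nat n1). rewrite <- INR_IZR_INZ. now rewrite (Rabs_right (Im v)) in a by lra.
  - exists (- Z.of_nat n1)%Z. rewrite (opp_IZR (Z.of_nat n1)), <- INR_IZR_INZ. rewrite (Rabs_left (Im v)) in a by lra. lra. }
 destruct HI as [I hI]. exists I. set (f := ratmono I (repeat w (S k))).
 assert (Hf : Mer P f).
 { apply Rat_Mer, Rat_mono, Forall_forall. intros x hx. apply repeat_spec in hx. now subst x. }
 set (r := (Cmod q * exp (- (2 * PI * (IZR I * Im v))))%R).
 assert (hr : (0 <= r < 1)%R).
 { assert (e : r = exp (ln (Cmod q) + - (2 * PI * (IZR I * Im v)))) by (rewrite exp_plus, exp_ln by exact hq0; reflexivity).
  rewrite e. split; [left; apply exp_pos |]. rewrite <- exp_0. apply exp_increasing.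
  assert (a := Rle_abs (ln (Cmod q))). assert (a' := Rabs_pos (ln (Cmod q))). nra. }
 set (D := (exp (2 * PI * Rabs (IZR I) * M) * 2 ^ S k)%R).
 assert (hD : 0 <= D) by (apply Rmult_le_pos; [left; apply exp_pos | apply pow_le; lra]).
 apply (geom_bound_zero _ r (D * B) n0 hr). intros N hN.
 destruct (shift_iterate L P v q HP HL N f Hf) as [h1 h2]. rewrite h2, Cmod_mult, Cmod_pow.
 set (E := exp (- (2 * PI * (IZR I * Im v)))) in *.
 assert (b : Cmod (L (fun t => f (t + INR N * v)%C)) <= E ^ N * D * B).
 { apply HB; [apply Rmult_le_pos; [apply pow_le; left; apply exp_pos | exact hD] | exact h1 |].
  intros t ht. unfold f, ratmono, D. rewrite Cmod_mult, <- Rmult_assoc.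
  apply Rmult_le_compat; try apply Cmod_ge_0; [| apply HN0; [now apply HM | now apply hn]].
  rewrite Cmult_plus_distr_l, e2pi_plus, Cmod_mult, Rmult_comm.
  apply Rmult_le_compat; try apply Cmod_ge_0; [| now apply Cmod_e2pi_bound, HM].
  right. unfold E. rewrite <- exp_INR_mult, Cmod_e2pi, !Im_mult, Re_mult, !Im_RtoC, !Re_RtoC. f_equal. ring. }
 eapply Rle_trans; [apply Rmult_le_compat_l; [apply pow_le, Cmod_ge_0 | exact b] |].
 right. unfold r. rewrite Rpow_mult_distr. ring.
Qed.

(** [Rat_functional] applied to the difference of the two double integrals. Poles below are handled
    by translating by T, poles above by translating by - T. *)
Theorem dgap_zero T m g1 dg1 g1' dg1' g2 dg2 g2' dg2' Spsi psi Sphi phi :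
 crossing_data T g1 dg1 g1' dg1' g2 dg2 g2' dg2' Spsi psi -> th0 m T <> 0 -> Mer Sphi phi ->
 (forall v, Sphi v -> low_pole T g1 g1' g2 g2' v \/ up_pole T g1 g1' g2 g2' v) ->
 dgap T m g1 dg1 g1' dg1' g2 dg2 g2' dg2' psi phi = 0.
Proof.
 intros D hm hphi HS. destruct (crossing_pcont _ _ _ _ _ _ _ _ _ _ _ D) as [c1 c2].
 destruct (dgap_bound _ _ _ _ _ _ _ _ _ _ _ m D) as [B [hB HB]].
 pose proof D as D'.
 destruct D as (hT & (P1 & P1' & P2 & P2') & (H1 & H2) & hpsi & HSp).
 assert (k1 := period_path_cont _ _ P1). assert (k2 := period_path_cont _ _ P2).
 assert (Hav : forall v, Sphi v -> avoided g1 v /\ avoided g2 v).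
 { intros v hv. destruct (HS v hv) as [h | h];
   [apply low_pole_above in h | apply up_pole_below in h]; destruct h as [a b];
   split; [exact (joined_avoided _ _ _ a) | exact (joined_avoided _ _ _ b)
       | exact (joined_avoided _ _ _ a) | exact (joined_avoided _ _ _ b)]. }
 assert (q1 : forall f, Mer Sphi f -> pcont g1 f).
 { intros f hf. apply (Mer_pcont Sphi); auto. intros v hv. apply (Hav v hv). }
 assert (q2 : forall f, Mer Sphi f -> pcont g2 f).
 { intros f hf. apply (Mer_pcont Sphi); auto. intros v hv. apply (Hav v hv). }
 set (L := dgap T m g1 dg1 g1' dg1' g2 dg2 g2' dg2' psi) in *.
 assert (Lext : forall f h, (forall t, on_path g1 t \/ on_path g2 t -> f t = h t) -> L f = L h).
 { intros f h E. unfold L, dgap. rewrite (dint_ext T m g1 dg1 g1' dg1' f h), (dint_ext T m g2 dg2 g2' dg2' f h); auto. }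
 assert (Lscal : forall c f, Mer Sphi f -> L (fun t => c * f t) = c * L f).
 { intros c f hf. unfold L, dgap. rewrite (dint_scal T m 0 g1), (dint_scal T m 0 g2); auto. ring. }
 assert (Lplus : forall f h, Mer Sphi f -> Mer Sphi h -> L (fun t => f t + h t) = L f + L h).
 { intros f h hf hh. unfold L, dgap. rewrite (dint_plus T m 0 g1), (dint_plus T m 0 g2); auto. ring. }
 assert (LRat : forall f, Rat Sphi f -> L f = 0).
 { apply (Rat_functional Sphi (fun t => on_path g1 t \/ on_path g2 t)); auto using Rat_Mer.
  - intros t w ht hw. destruct (Hav w hw) as [a b]. destruct ht as [ht | ht]; [now apply a | now apply b].
  (* On e(I t) the relation reads L = e(- m + I T) L. A nonzero L would put m in the lattice Z + Z
     T, which [th0 m T <> 0] excludes. *)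
  - intro I. assert (E := dgap_low_step T m g1 dg1 g1' dg1' g2 dg2 g2' dg2' Spsi psi
    (ratmono I nil) D' (Rat_Mer _ _ (Rat_mono _ I nil (Forall_nil _)))).
   fold L in E.
   replace (fun t => ratmono I nil (t + T)) with (fun t => e2pi (IZR I * T) * ratmono I nil t) in E.
   2:{ apply functional_extensionality. intro t. unfold ratmono. simpl.
     rewrite Cmult_plus_distr_l, e2pi_plus. ring. }
   rewrite (Lscal (e2pi (IZR I * T)) (ratmono I nil)) in E by (apply Rat_Mer, Rat_mono, Forall_nil). rewrite Cmult_assoc, <- e2pi_plus in E.
   destruct (Ceq_dec (L (ratmono I nil)) 0) as [h | h]; [exact h |]. exfalso. apply hm.
   assert (E1 : e2pi (- m + IZR I * T) = 1).
   { recast (e2pi (- m + IZR I * T) * L (ratmono I nil) / L (ratmono I nil)) by (field; exact h).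
    rewrite <- E. field. exact h. }
   apply e2pi_eq_1 in E1. destruct E1 as [k E1]. replace m with (IZR I * T + IZR (- k)).
   2:{ rewrite opp_IZR, RtoC_opp, <- E1. ring. }
   rewrite th0_period. clear - hT.
   assert (G : forall n : nat, th0 (INR n * T) T = 0).
   { induction n as [| n IH].
    - rewrite th0_factor by exact hT. simpl. recast (RtoC 0). rewrite e2pi_0. ring.
    - recast (INR n * T + T) by (rewrite S_INR, RtoC_plus; ring).
     rewrite th0_shift, IH by exact hT. ring. }
   destruct (Z_le_gt_dec 0 I) as [hI | hI].
   + rewrite <- (Z2Nat.id I) by exact hI. rewrite <- INR_IZR_INZ. apply G.
   + replace (IZR I * T) with (- (INR (Z.to_nat (- I)) * T)).
    * rewrite th0_opp, G by exact hT. ring.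
    * rewrite INR_IZR_INZ, Z2Nat.id, opp_IZR, RtoC_opp by lia. ring.
  - intros w k hw. destruct (path_Im_bounded g1 k1) as [M1 [hM1 h1]]. destruct (path_Im_bounded g2 k2) as [M2 [hM2 h2]].
   set (M := Rmax M1 M2).
   assert (hM : forall t, on_path g1 t \/ on_path g2 t -> Rabs (Im t) <= M).
   { intros t [ht | ht]; [eapply Rle_trans; [apply h1, ht | apply Rmax_l] | eapply Rle_trans; [apply h2, ht | apply Rmax_r]]. }
   destruct (HS w hw) as [hl | hu].
   + apply (monomial_annihilated L (low_pole T g1 g1' g2 g2') (fun t => on_path g1 t \/ on_path g2 t) T (e2pi (- m)) w B M k);
     auto using e2pi_neq_0, low_pole_shift; try lra.
    * intros f hf. now apply (dgap_low_step T m g1 dg1 g1' dg1' g2 dg2 g2' dg2' Spsi).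
    * intros f D hD hf HfD. apply HB; auto; [apply (Mer_pcont _ _ _ k1 (fun v h => joined_avoided _ _ _ (proj1 (low_pole_above _ _ _ _ _ _ h))) hf)
      | apply (Mer_pcont _ _ _ k2 (fun v h => joined_avoided _ _ _ (proj2 (low_pole_above _ _ _ _ _ _ h))) hf)].
   + apply (monomial_annihilated L (up_pole T g1 g1' g2 g2') (fun t => on_path g1 t \/ on_path g2 t) (- T) (e2pi m) w B M k);
     auto using e2pi_neq_0, up_pole_shift; try (rewrite Im_opp; lra).
    * intros f hf. now apply (dgap_up_step T m g1 dg1 g1' dg1' g2 dg2 g2' dg2' Spsi).
    * intros f D hD hf HfD. apply HB; auto; [apply (Mer_pcont _ _ _ k1 (fun v h => joined_avoided _ _ _ (proj1 (up_pole_below _ _ _ _ _ _ h))) hf)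
      | apply (Mer_pcont _ _ _ k2 (fun v h => joined_avoided _ _ _ (proj2 (up_pole_below _ _ _ _ _ _ h))) hf)]. }
 apply (eq_of_Cmod_small _ _ B). intros eps he.
 assert (K := Kgood_on_paths Sphi g1 g2 k1 k2 Hav).
 destruct (hphi _ K eps he) as [r [hr Hr]].
 assert (E : L phi = L (fun t => phi t + (- (1)) * r t)).
 { rewrite (Lplus phi (fun t => - (1) * r t) hphi (Rat_Mer _ _ (Rat_scal _ _ _ hr))).
  rewrite (Lscal (- (1)) r (Rat_Mer _ _ hr)), (LRat r hr). ring. }
 recast (L phi). rewrite E, Rmult_comm.
 assert (Hd : Mer Sphi (fun t => phi t + (- (1)) * r t)).
 { intros K' HK'. apply RatLim_plus; [now apply hphi |]. apply RatLim_Rat. now apply Rat_scal. }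
 apply HB; auto; [lra |]. intros t ht. left. recast (phi t - r t). now apply Hr.
Qed.

Open Scope R_scope.

(** * Separating contours *)
(** Cantor's nested intervals: step n keeps an outer third of the current interval that does not
    contain [v n]. *)
Lemma avoid_sequence (v : nat -> R) (a b : R) : a < b -> exists d, a <= d <= b /\ forall n, d <> v n.
Proof.
 intro hab.
 set (step := fun (I : R * R) (x : R) =>
  if Rle_dec x ((fst I + snd I) / 2) then ((fst I + 2 * snd I) / 3, snd I) else (fst I, (2 * fst I + snd I) / 3)).
 set (I := fix I (n : nat) : R * R := match n with O => (a, b) | S n => step (I n) (v n) end).
 assert (H0 : forall n, fst (I n) < snd (I n)).
 { induction n as [| n IH]; simpl; [exact hab |]. unfold step. destruct Rle_dec; simpl; lra. }
 assert (H1 : forall n, fst (I n) <= fst (I (S n)) /\ snd (I (S n)) <= snd (I n)).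
 { intro n. specialize (H0 n). simpl. unfold step. destruct Rle_dec; simpl; lra. }
 assert (H2 : forall n, v n < fst (I (S n)) \/ snd (I (S n)) < v n).
 { intro n. specialize (H0 n). simpl. unfold step. destruct Rle_dec; simpl; [left | right]; lra. }
 assert (H3 : forall n k, fst (I n) <= fst (I (n + k)%nat) /\ snd (I (n + k)%nat) <= snd (I n)).
 { intros n k. induction k as [| k IH].
  - rewrite Nat.add_0_r. lra.
  - rewrite Nat.add_succ_r. specialize (H1 (n + k)%nat). lra. }
 assert (H4 : forall n m, fst (I n) <= snd (I m)).
 { intros n m. destruct (Nat.le_ge_cases n m) as [h | h].
  - specialize (H3 n (m - n)%nat). recast m in H3 by lia. specialize (H0 m). lra.
  - specialize (H3 m (n - m)%nat). recast n in H3 by lia. specialize (H0 n). lra. }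
 destruct (completeness (fun x => exists n, x = fst (I n))) as [d [hd1 hd2]].
 { exists b. intros x [n ->]. apply (H4 n 0%nat). }
 { exists a. now exists 0%nat. }
 assert (Hd : forall n, fst (I n) <= d <= snd (I n)).
 { intro n. split; [apply hd1; now exists n |]. apply hd2. intros x [m ->]. apply H4. }
 exists d. split; [exact (Hd 0%nat) |]. intros n E. specialize (Hd (S n)). destruct (H2 n); lra.
Qed.

(** * Periodic functions of class C1 with prescribed values *)

Definition C1 (f : R -> R) : Prop :=
 exists df : R -> R, (forall x, is_derive f x (df x)) /\ (forall x, continuous df x).

Lemma C1_cont f : C1 f -> forall x, continuous f x.
Proof. intros [df [h _]] x. apply (ex_derive_continuous f x). now exists (df x). Qed.

Lemma C1_const c : C1 (fun _ => c).
Proof. exists (fun _ => 0). split; intro x; [exact (is_derive_const (K := R_AbsRing) (V := R_NormedModule) c x) | apply continuous_const]. Qed.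

Lemma C1_id : C1 (fun x => x).
Proof. exists (fun _ => 1). split; intro x; [exact (is_derive_id (K := R_AbsRing) x) | apply continuous_const]. Qed.

Lemma C1_plus f g : C1 f -> C1 g -> C1 (fun x => f x + g x).
Proof.
 intros [df [f1 f2]] [dg [g1 g2]]. exists (fun x => df x + dg x). split; intro x.
 - now apply (is_derive_plus f g).
 - now apply (continuous_plus df dg).
Qed.

Lemma C1_mult f g : C1 f -> C1 g -> C1 (fun x => f x * g x).
Proof.
 intros Hf Hg. assert (cf := C1_cont f Hf). assert (cg := C1_cont g Hg).
 destruct Hf as [df [f1 f2]]. destruct Hg as [dg [g1 g2]]. exists (fun x => df x * g x + f x * dg x). split; intro x.
 - apply (is_derive_mult f g x); auto. intros; apply Rmult_comm.
 - apply (continuous_plus (fun x => df x * g x) (fun x => f x * dg x)).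
  + now apply (continuous_mult df g).
  + now apply (continuous_mult f dg).
Qed.

Lemma C1_inv f : C1 f -> (forall x, f x <> 0) -> C1 (fun x => / f x).
Proof.
 intros Hf H. assert (cf := C1_cont f Hf). destruct Hf as [df [f1 f2]].
 exists (fun x => - df x / (f x) ^ 2). split; intro x.
 - now apply is_derive_inv.
 - apply (continuous_mult (fun x => - df x) (fun x => / (f x) ^ 2)).
  + now apply (continuous_opp df).
  + apply (continuous_comp f (fun y => / y ^ 2)); [apply cf |].
   apply (ex_derive_continuous (fun y => / y ^ 2)). auto_derive. cc.
Qed.

Lemma C1_comp (h f : R -> R) : C1 h -> C1 f -> C1 (fun x => h (f x)).
Proof.
 intros [dh [h1 h2]] Hf. assert (cf := C1_cont f Hf). destruct Hf as [df [f1 f2]].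
 exists (fun x => df x * dh (f x)). split; intro x.
 - now apply (is_derive_comp h f).
 - apply (continuous_mult df (fun x => dh (f x))); [apply f2 |]. now apply (continuous_comp f dh).
Qed.

Lemma C1_sin : C1 sin.
Proof. exists cos. split; intro x; [apply is_derive_sin | apply continuous_cos]. Qed.

Lemma C1_cos : C1 cos.
Proof. exists (fun x => - sin x). split; intro x; [apply is_derive_cos | apply (continuous_opp sin), continuous_sin]. Qed.

Definition sq (c x : R) : R := sin (PI * (x - c)) * sin (PI * (x - c)).

Lemma sq_ge_0 c x : 0 <= sq c x.
Proof. unfold sq. nra. Qed.

Lemma sq_0 c x : sq c x = 0 <-> exists m : Z, x = c + IZR m.
Proof.
 assert (P := PI_RGT_0). unfold sq. split.
 - intro H. assert (E : sin (PI * (x - c)) = 0) by nra. apply sin_eq_0_0 in E. destruct E as [k E].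
  exists k. nra.
 - intros [m ->]. recast (IZR m * PI).
  rewrite (sin_eq_0_1 (IZR m * PI)); [ring | now exists m].
Qed.

Lemma sq_period c x : sq c (x + 1) = sq c x.
Proof. unfold sq. recast (PI * (x - c) + PI). rewrite neg_sin. ring. Qed.

Lemma C1_sq c : C1 (sq c).
Proof.
 assert (H : C1 (fun x => sin (PI * (x + - c)))).
 { apply (C1_comp sin (fun x => PI * (x + - c))); [apply C1_sin |].
  apply C1_mult; [apply C1_const |]. apply C1_plus; [apply C1_id | apply C1_const]. }
 exact (C1_mult _ _ H H).
Qed.

Definition sqs (l : list (R * R)) (x : R) : R := fold_right (fun (p : R * R) a => sq (fst p) x * a) 1 l.

(* One point at a time: away from the new point [c] the function is damped by a factor vanishing at all
  the earlier ones. *)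
Lemma periodic_interpolation (l : list (R * R)) (lo hi : R) : lo <= hi ->
 (forall p : R * R, In p l -> lo <= snd p <= hi) ->
 (forall p q : R * R, In p l -> In q l -> (exists m : Z, fst p = fst q + IZR m) -> snd p = snd q) ->
 exists g, C1 g /\ (forall x, g (x + 1) = g x) /\ (forall x, lo <= g x <= hi) /\ forall p : R * R, In p l -> g (fst p) = snd p.
Proof.
 intro hlh. induction l as [| [c v] l IH]; intros H1 H2.
 - exists (fun _ => lo). repeat split; [apply C1_const | lra | lra | intros p []].
 - destruct IH as [g [g1 [g2 [g3 g4]]]].
  { intros p hp. apply H1. now right. }
  { intros p q hp hq. apply H2; now right. }
  assert (gZ : forall (n : nat) x, g (x + INR n) = g x).
  { induction n as [| n IHn]; intro x; [simpl; now rewrite Rplus_0_r |].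
   rewrite S_INR, <- Rplus_assoc, g2. apply IHn. }
  destruct (classic (exists p, In p l /\ exists m : Z, c = fst p + IZR m)) as [[p [hp [m hm]]] | hn].
  + exists g. repeat split; auto; try apply g3. intros q [<- | hq]; [| now apply g4]. cbn [fst snd].
   transitivity (snd p); [| symmetry; apply (H2 (c, v) p); [now left | now right | now exists m]].
   rewrite <- (g4 p hp), hm. destruct (Z_le_gt_dec 0 m) as [h | h].
   * rewrite <- (Z2Nat.id m h), <- INR_IZR_INZ. apply gZ.
   * rewrite <- (gZ (Z.to_nat (- m)) (fst p + IZR m)). f_equal. rewrite INR_IZR_INZ, Z2Nat.id, opp_IZR by lia. ring.
  + assert (w0 : forall x, 0 <= sqs l x).
   { intro x. clear - l. induction l as [| p l IHl]; simpl; [lra |]. apply Rmult_le_pos; [apply sq_ge_0 | exact IHl]. }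
   assert (wc : 0 < sqs l c).
   { clear - hn. induction l as [| p l IHl]; simpl; [lra |]. apply Rmult_lt_0_compat.
    - destruct (sq_ge_0 (fst p) c) as [h | h]; [exact h |]. exfalso. apply hn. exists p. split; [now left |].
     apply sq_0. now symmetry.
    - apply IHl. intros [q [hq E]]. apply hn. exists q. split; [now right | exact E]. }
   assert (wz : forall p : R * R, In p l -> sqs l (fst p) = 0).
   { clear - l. induction l as [| q l IHl]; intros p []; simpl.
    - subst q. assert (E : sq (fst p) (fst p) = 0) by (apply sq_0; exists 0%Z; ring). nra.
    - rewrite IHl by assumption. ring. }
   assert (wp : forall x, sqs l (x + 1) = sqs l x).
   { intro x. clear - l. induction l as [| q l IHl]; simpl; [reflexivity |]. now rewrite sq_period, IHl. }
   assert (wC : C1 (sqs l)).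
   { clear - l. induction l as [| q l IHl]; simpl; [apply C1_const |]. exact (C1_mult _ _ (C1_sq _) IHl). }
   assert (D : forall x, 0 < sqs l x + sq c x).
   { intro x. destruct (sq_ge_0 c x) as [h | h]; [specialize (w0 x); lra |].
    symmetry in h. rewrite h. apply sq_0 in h. destruct h as [m hm]. rewrite Rplus_0_r.
    replace (sqs l x) with (sqs l c); [exact wc |]. clear - hm. induction l as [| q l IHl]; simpl; [reflexivity |].
    rewrite IHl. f_equal. unfold sq. rewrite hm. recast (PI * (c - fst q) + IZR m * PI).
    rewrite sin_plus, (sin_eq_0_1 (IZR m * PI)) by now exists m.
    assert (E := sin2_cos2 (IZR m * PI)). rewrite (sin_eq_0_1 (IZR m * PI)) in E by now exists m.
    unfold Rsqr in E. nra. }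
   (* [b] is 1 at the new point, where [sq c] vanishes, and 0 at the earlier ones, where [sqs l]
      does. A convex combination with weight [b] therefore corrects the new value, keeps the old
      ones and stays between [lo] and [hi]. *)
   set (b := fun x => sqs l x * / (sqs l x + sq c x)).
   assert (b01 : forall x, 0 <= b x <= 1).
   { intro x. specialize (D x). specialize (w0 x). assert (h := sq_ge_0 c x). unfold b. split.
    - apply Rmult_le_pos; [exact w0 | left; now apply Rinv_0_lt_compat].
    - apply (Rmult_le_reg_r (sqs l x + sq c x)); [exact D |]. rewrite Rmult_assoc, Rinv_l by lra. lra. }
   assert (hv := H1 (c, v) (or_introl eq_refl)). cbn in hv.
   exists (fun x => g x + b x * (v + - 1 * g x)). repeat split.
   * apply C1_plus; [exact g1 |]. apply C1_mult.
    -- apply C1_mult; [exact wC |]. apply C1_inv; [apply C1_plus; [exact wC | apply C1_sq] |].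
      intro x. specialize (D x). lra.
    -- apply C1_plus; [apply C1_const |]. apply C1_mult; [apply C1_const | exact g1].
   * intro x. unfold b. now rewrite wp, sq_period, g2.
   * specialize (b01 x). specialize (g3 x). nra.
   * specialize (b01 x). specialize (g3 x). nra.
   * intros p [<- | hp]; cbn [fst snd].
    -- unfold b. assert (E : sq c c = 0) by (apply sq_0; exists 0%Z; ring). rewrite E. field. lra.
    -- unfold b. rewrite wz by exact hp. rewrite (g4 p hp). ring.
Qed.

Open Scope C_scope.

(** Bending of the coordinate lines, of period 1 in y. The different powers r and r^2 make
    coincidences for arbitrarily small r impossible unless the cosines and the sines agree
    separately. *)
Definition wig (r y : R) : R := (r * cos (2 * PI * y) + r * r * sin (2 * PI * y))%R.

Definition Yc (T w : C) : R := (Im w / Im T)%R.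

Definition Xc (T : C) (r : R) (w : C) : R := (Re w - wig r (Yc T w) - Yc T w * Re T)%R.

(** Coordinates on C with height y in units of Im T; the line x = const is the direction of T bent
    by [wig]. Adding 1 moves x by 1, adding T moves y by 1. *)
Definition pt (T : C) (r x y : R) : C := RtoC (x + wig r y) + RtoC y * T.

Lemma wig_Z r y (k : Z) : wig r (y + IZR k) = wig r y.
Proof.
 unfold wig. destruct (cos_sin_period_Z k) as [c s].
 recast (2 * PI * y + 2 * PI * IZR k)%R.
 rewrite cos_plus, sin_plus, c, s. ring.
Qed.

Lemma Im_pt T r x y : Im (pt T r x y) = (y * Im T)%R.
Proof. unfold pt. rewrite Im_plus, Im_mult, !Im_RtoC, Re_RtoC. ring. Qed.

Lemma Re_pt T r x y : Re (pt T r x y) = (x + wig r y + y * Re T)%R.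
Proof. unfold pt. rewrite Re_plus, Re_mult, !Re_RtoC, Im_RtoC. ring. Qed.

Lemma Yc_pt T r x y : 0 < Im T -> Yc T (pt T r x y) = y.
Proof. intro h. unfold Yc. rewrite Im_pt. field. lra. Qed.

Lemma Xc_pt T r x y : 0 < Im T -> Xc T r (pt T r x y) = x.
Proof. intro h. unfold Xc. rewrite Yc_pt, Re_pt by exact h. ring. Qed.

Lemma pt_XY T r w : 0 < Im T -> pt T r (Xc T r w) (Yc T w) = w.
Proof. intro h. apply C_ext; [rewrite Re_pt; unfold Xc; ring | rewrite Im_pt; unfold Yc; field; lra]. Qed.

Lemma Yc_plus T u v : Yc T (u + v) = (Yc T u + Yc T v)%R.
Proof. unfold Yc. rewrite Im_plus. lra. Qed.

Lemma Yc_scal T (x : R) v : Yc T (x * v) = (x * Yc T v)%R.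
Proof. unfold Yc. rewrite Im_mult, Im_RtoC, Re_RtoC. lra. Qed.

Lemma Yc_R T (x : R) : Yc T x = 0%R.
Proof. unfold Yc. rewrite Im_RtoC. lra. Qed.

Lemma Xc_Z T r w (m : Z) : Xc T r (w + IZR m) = (Xc T r w + IZR m)%R.
Proof. unfold Xc. rewrite Yc_plus, Yc_R, Re_plus, Re_RtoC, Rplus_0_r. ring. Qed.

Lemma pt_shift T r x y (k : Z) : pt T r x (y + IZR k) = pt T r x y + IZR k * T.
Proof. unfold pt. rewrite wig_Z, !RtoC_plus. ring. Qed.

Definition graph (T : C) (r : R) (g : R -> R) (d s : R) : C := pt T r s (g s + d).

Definition periodic (g : R -> R) : Prop := forall x, g (x + 1)%R = g x.

Lemma periodic_Z g (m : Z) x : periodic g -> g (x + IZR m)%R = g x.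
Proof.
 intro H. assert (G : forall (n : nat) x, g (x + INR n)%R = g x).
 { induction n as [| n IHn]; intro y; [simpl; now rewrite Rplus_0_r |].
  rewrite S_INR, <- Rplus_assoc, H. apply IHn. }
 destruct (Z_le_gt_dec 0 m) as [h | h].
 - rewrite <- (Z2Nat.id m h), <- INR_IZR_INZ. apply G.
 - rewrite <- (G (Z.to_nat (- m)) (x + IZR m)%R). f_equal. rewrite INR_IZR_INZ, Z2Nat.id, opp_IZR by lia. ring.
Qed.

Lemma graph_path T r g d : C1 g -> periodic g -> exists dg, period_path (graph T r g d) dg.
Proof.
 intros Hg Hp.
 assert (H1 : C1 (fun s => (g s + d)%R)) by (apply C1_plus; [exact Hg | apply C1_const]).
 assert (H2 : C1 (wig r)).
 { apply C1_plus; (apply C1_mult; [apply C1_const |]).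
  - apply (C1_comp cos (fun y => (2 * PI * y)%R)); [apply C1_cos | apply C1_mult; [apply C1_const | apply C1_id]].
  - apply (C1_comp sin (fun y => (2 * PI * y)%R)); [apply C1_sin | apply C1_mult; [apply C1_const | apply C1_id]]. }
 assert (HA : C1 (fun s => (s + wig r (g s + d) + (g s + d) * Re T)%R)).
 { apply C1_plus; [apply C1_plus; [apply C1_id | now apply (C1_comp (wig r))] |].
  apply C1_mult; [exact H1 | apply C1_const]. }
 assert (HB : C1 (fun s => ((g s + d) * Im T)%R)) by (apply C1_mult; [exact H1 | apply C1_const]).
 destruct HA as [dA [a1 a2]]. destruct HB as [dB [b1 b2]].
 exists (fun s => (dA s, dB s)). split; [| split].
 - intro s. apply (cderive_ext (fun s => ((s + wig r (g s + d) + (g s + d) * Re T)%R, ((g s + d) * Im T)%R))).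
  + intro x. apply C_ext; unfold graph; [rewrite Re_pt | rewrite Im_pt]; reflexivity.
  + now apply cderive_pair.
 - intro s. now apply ccont_pair.
 - unfold graph. recast (g 0%R) by (rewrite <- (Hp 0%R); f_equal; ring).
  unfold pt. recast (0 + wig r (g 0 + d) + 1)%R. rewrite (RtoC_plus _ 1). ring.
Qed.

Lemma graph_not_hit T r g d w y s (m : Z) : 0 < Im T -> periodic g ->
 y <> (g (Xc T r w) + d)%R -> pt T r (Xc T r w) y <> graph T r g d s + IZR m.
Proof.
 intros hT hp hy E. apply hy.
 assert (E1 := f_equal (Yc T) E). rewrite Yc_plus, Yc_R in E1. unfold graph in E1. rewrite !Yc_pt in E1 by exact hT.
 assert (E2 := f_equal (Xc T r) E). rewrite Xc_Z in E2. unfold graph in E2. rewrite !Xc_pt in E2 by exact hT.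
 rewrite E2, periodic_Z by exact hp. lra.
Qed.

(** The joining curve is the bent coordinate line through [w]; it can meet the graph of [g + d],
    even modulo Z, only at one height. *)
Lemma vertical_joined T r g d w (e : R) (l : Rbar) : 0 < Im T -> periodic g ->
 is_lim (fun s : R => ((Yc T w + e * s) * Im T)%R) p_infty l ->
 (forall s, 0 <= s -> (Yc T w + e * s)%R <> (g (Xc T r w) + d)%R) ->
 joined_to (graph T r g d) w l.
Proof.
 intros hT hp hl hs. exists (fun s => pt T r (Xc T r w) (Yc T w + e * s)).
 split; [| split; [| split]].
 - intro s. unfold pt.
  assert (c1 : continuous (fun s : R => (Yc T w + e * s)%R) s).
  { apply (ex_derive_continuous (fun s : R => (Yc T w + e * s)%R)). auto_derive. exact I. }
  apply ccont_plus; [apply ccont_RtoC | cc].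
  apply (continuous_comp (fun s : R => (Yc T w + e * s)%R) (fun y => (Xc T r w + wig r y)%R)); [exact c1 |].
  apply (ex_derive_continuous (fun y => (Xc T r w + wig r y)%R)). unfold wig. auto_derive. exact I.
 - recast (Yc T w). now apply pt_XY.
 - apply (is_lim_ext (fun s : R => ((Yc T w + e * s) * Im T)%R)); [| exact hl]. intro s. now rewrite Im_pt.
 - intros s q m h _. apply graph_not_hit; auto.
Qed.

Lemma graph_above T r g d w : 0 < Im T -> periodic g -> Yc T w < g (Xc T r w) + d ->
 passes_above (graph T r g d) w.
Proof.
 intros hT hp h. apply (vertical_joined T r g d w (-1)); auto.
 - replace m_infty with (Rbar_mult (Rbar_plus (Yc T w) (Rbar_mult (-1)%R p_infty)) (Im T)).
  + apply is_lim_mult; [apply (is_lim_plus _ _ _ (Yc T w) m_infty) | apply is_lim_const |].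
   * apply is_lim_const.
   * replace m_infty with (Rbar_mult (-1)%R p_infty).
    -- apply (is_lim_scal_l (fun s => s)). apply is_lim_id.
    -- simpl. destruct Rle_dec as [a | a]; [exfalso; lra | reflexivity].
   * simpl. destruct Rle_dec; [exfalso; lra | reflexivity].
   * simpl. destruct Rle_dec; [exfalso; lra |]. simpl. lra.
  + simpl. destruct Rle_dec as [a | a]; [exfalso; lra |]. simpl. destruct Rle_dec as [b | b]; [| exfalso; lra].
   destruct Rle_lt_or_eq_dec as [c | c]; [reflexivity | exfalso; lra].
 - intros; lra.
Qed.

Lemma graph_below T r g d w : 0 < Im T -> periodic g -> g (Xc T r w) + d < Yc T w ->
 passes_below (graph T r g d) w.
Proof.
 intros hT hp h. apply (vertical_joined T r g d w 1); auto.
 - apply (is_lim_ext (fun s => (Im T * (s + Yc T w))%R)); [intro; ring |].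
  assert (E : Rbar_mult (Im T) p_infty = p_infty).
  { simpl. destruct Rle_dec as [b | b]; [| exfalso; lra].
   destruct Rle_lt_or_eq_dec as [c | c]; [reflexivity | exfalso; lra]. }
  assert (L : is_lim (fun s => (Im T * (s + Yc T w))%R) p_infty (Rbar_mult (Im T) p_infty)).
  { apply (is_lim_scal_l (fun s => s + Yc T w)%R). apply (is_lim_plus _ _ _ p_infty (Yc T w)).
   - apply is_lim_id.
   - apply is_lim_const.
   - reflexivity. }
  rewrite E in L. exact L.
 - intros; lra.
Qed.

(** Adding k T to a point of the lower graph raises its height by exactly k, so only the offsets [d]
    and [d'] have to be compared. *)
Lemma graph_stacked T r g d d' (j : Z) : 0 < Im T -> periodic g ->
 (IZR j < d - d' < IZR (j + 1))%R -> stacked T j (graph T r g d) (graph T r g d').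
Proof.
 intros hT hp h t' [s [_ ->]] k.
 assert (E : graph T r g d' s + IZR k * T = pt T r s (g s + d' + IZR k)) by (unfold graph; now rewrite pt_shift).
 rewrite E. split; intro hk.
 - apply graph_above; auto. rewrite Yc_pt, Xc_pt by exact hT. apply IZR_le in hk. lra.
 - apply graph_below; auto. rewrite Yc_pt, Xc_pt by exact hT. assert (hk' : (j + 1 <= k)%Z) by lia. apply IZR_le in hk'. lra.
Qed.

(* Points that are not congruent modulo Z + Z T lie on different vertical lines once the coordinate lines
  are bent slightly. *)
Lemma generic_pair T u l : 0 < Im T -> exists r0, 0 < r0 /\ forall r, (0 < r < r0)%R ->
 (exists m : Z, Xc T r u = (Xc T r l + IZR m)%R) -> exists k m : Z, u = l + IZR k * T + IZR m.
Proof.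
 intro hT. set (y := Yc T u). set (y' := Yc T l).
 set (D := (Re u - y * Re T - (Re l - y' * Re T))%R).
 set (c := (cos (2 * PI * y) - cos (2 * PI * y'))%R). set (s := (sin (2 * PI * y) - sin (2 * PI * y'))%R).
 (* [D] is the difference of the unbent x coordinates; congruence of the bent ones says that D
    misses an integer by r (c + r s). *)
 assert (HX : forall r m, Xc T r u = (Xc T r l + IZR m)%R -> (D - IZR m = r * (c + r * s))%R).
 { intros r m E. unfold Xc in E. fold y y' in E. unfold wig in E. unfold D, c, s. nra. }
 assert (hcs : (Rabs c <= 2 /\ Rabs s <= 2)%R).
 { assert (a := COS_bound (2 * PI * y)). assert (b := COS_bound (2 * PI * y')).
  assert (a' := SIN_bound (2 * PI * y)). assert (b' := SIN_bound (2 * PI * y')).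
  split; apply Rabs_le; unfold c, s; lra. }
 assert (hsmall : forall r, (0 < r < 1)%R -> Rabs (r * (c + r * s)) <= 4 * r).
 { intros r hr. rewrite Rabs_mult, (Rabs_right r) by lra.
  assert (a := Rabs_triang c (r * s)). rewrite Rabs_mult, (Rabs_right r) in a by lra.
  nra. }
 (* If D is an integer, c + r s must vanish for small r; then c = 0 and s = 0, and the heights
    differ by an integer. If not, the distance [del] from D to Z excludes any coincidence for small
    r. *)
 destruct (classic (exists m0, D = IZR m0)) as [[m0 hm0] | hD].
 - assert (hz : forall r m, (0 < r < 1 / 4)%R -> Xc T r u = (Xc T r l + IZR m)%R -> (c + r * s = 0)%R).
  { intros r m hr E. apply HX in E. assert (a := hsmall r ltac:(lra)). rewrite <- E, hm0, <- minus_IZR in a.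
   assert (b : Rabs (IZR (m0 - m)) < 1) by lra. rewrite <- abs_IZR in b. apply (lt_IZR _ 1) in b.
   rewrite hm0, <- minus_IZR in E. recast 0%Z in E by lia.
   nra. }
  destruct (Req_dec c 0) as [hc | hc].
  + exists (1 / 4)%R. split; [lra |]. intros r hr [m E]. specialize (hz r m hr E).
   assert (hs : s = 0%R) by (apply (Rmult_eq_reg_l r); [lra | lra]).
   assert (E1 : e2pi (y - y') = 1).
   { rewrite e2pi_minus.
    replace (e2pi y) with (e2pi y'); [field; apply e2pi_neq_0 |].
    assert (F : forall x : R, e2pi x = (cos (2 * PI * x), sin (2 * PI * x))%R).
    { intro x. unfold e2pi, Cexp. assert (e : 2 * PI * Ci * x = (0, 2 * PI * x)%R) by (apply C_ext; simpl; ring).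
     rewrite e. simpl. rewrite exp_0, !Rmult_1_l. reflexivity. }
    rewrite !F. unfold c, s in hc, hs. apply C_ext; simpl; lra. }
   rewrite <- RtoC_minus in E1. apply e2pi_eq_1 in E1. destruct E1 as [k E1]. apply RtoC_inj in E1.
   exists k, m0. apply C_ext.
   * rewrite !Re_plus, Re_mult, !Re_RtoC, Im_RtoC, <- hm0, <- E1. unfold D. ring.
   * rewrite !Im_plus, Im_mult, !Im_RtoC, Re_RtoC, <- E1. unfold y, y', Yc. field. lra.
  + exists (Rmin (1 / 4) (Rabs c / 4)). assert (h0 := Rabs_pos_lt c hc). split; [apply Rmin_pos; lra |].
   intros r hr [m E]. assert (h1 := Rmin_l (1 / 4) (Rabs c / 4)). assert (h2 := Rmin_r (1 / 4) (Rabs c / 4)).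
   specialize (hz r m ltac:(lra) E). exfalso.
   assert (F : (Rabs c = r * Rabs s)%R).
   { recast (- (r * s))%R by lra. rewrite Rabs_Ropp, Rabs_mult, (Rabs_right r) by lra. reflexivity. }
   nra.
 - set (z := up D). destruct (archimed D) as [a1 a2].
  assert (h1 : IZR (z - 1) < D).
  { rewrite minus_IZR. destruct (Req_dec D (IZR z - 1)) as [e | e]; [exfalso; apply hD; exists (z - 1)%Z; now rewrite minus_IZR |].
   fold z in a1, a2. lra. }
  set (del := Rmin (IZR z - D) (D - IZR (z - 1))).
  assert (hdel : 0 < del) by (unfold del; apply Rmin_pos; fold z in a1; lra).
  exists (Rmin (1 / 4) (del / 8)). split; [apply Rmin_pos; lra |].
  intros r hr [m E]. assert (k1 := Rmin_l (1 / 4) (del / 8)). assert (k2 := Rmin_r (1 / 4) (del / 8)).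
  apply HX in E. assert (a := hsmall r ltac:(lra)). rewrite <- E in a. exfalso.
  assert (b1 := Rmin_l (IZR z - D) (D - IZR (z - 1))). assert (b2 := Rmin_r (IZR z - D) (D - IZR (z - 1))). fold del in b1, b2.
  apply Rabs_le_between in a. destruct (Z_le_gt_dec z m) as [h | h].
  + apply IZR_le in h. lra.
  + assert (h' : (m <= z - 1)%Z) by lia. apply IZR_le in h'. lra.
Qed.

Lemma generic_pairs T (lu ll : list C) : 0 < Im T -> exists r, forall u l, In u lu -> In l ll ->
 (exists m : Z, Xc T r u = (Xc T r l + IZR m)%R) -> exists k m : Z, u = l + IZR k * T + IZR m.
Proof.
 intro hT.
 assert (G : forall lp : list (C * C), exists r0, 0 < r0 /\ forall r, (0 < r < r0)%R -> forall p : C * C, In p lp ->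
  (exists m : Z, Xc T r (fst p) = (Xc T r (snd p) + IZR m)%R) -> exists k m : Z, fst p = snd p + IZR k * T + IZR m).
 { induction lp as [| p lp [r0 [h0 H0]]].
  - exists 1%R. split; [lra | intros r _ p []].
  - destruct (generic_pair T (fst p) (snd p) hT) as [r1 [h1 H1]]. exists (Rmin r0 r1). split; [now apply Rmin_pos |].
   intros r hr. assert (a := Rmin_l r0 r1). assert (b := Rmin_r r0 r1).
   intros q [<- | hq]; [apply H1; lra | apply H0; auto; lra]. }
 destruct (G (list_prod lu ll)) as [r0 [h0 H0]]. exists (r0 / 2)%R. intros u l hu hl.
 apply (H0 (r0 / 2)%R ltac:(lra) (u, l)). now apply in_prod.
Qed.

Definition upt Lam z tau p eta (q : nat * (nat * nat)) : C :=
 z (fst q) + eta * Lam (fst q) + INR (fst (snd q)) * tau + INR (snd (snd q)) * p.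

Definition lpt Lam z tau p eta (q : nat * (nat * nat)) : C :=
 z (fst q) - eta * Lam (fst q) - INR (fst (snd q)) * tau - INR (snd (snd q)) * p.

(** Height to be interpolated at [w]: 1/2 above every listed lower pole on the same coordinate line
    modulo Z, and [lo] when there is none. *)
Definition height (T : C) (lo : R) (ll : list C) (r : R) (w : C) : R :=
 fold_right (fun l acc => if excluded_middle_informative (exists m : Z, Xc T r w = (Xc T r l + IZR m)%R)
  then Rmax (Yc T l + 1 / 2) acc else acc) lo ll.

Lemma height_lo T lo ll r w : lo <= height T lo ll r w.
Proof.
 induction ll as [| l ll IH]; simpl; [lra |]. destruct excluded_middle_informative; [| exact IH].
 eapply Rle_trans; [exact IH | apply Rmax_r].
Qed.

Lemma height_ge T lo ll r w l : In l ll -> (exists m : Z, Xc T r w = (Xc T r l + IZR m)%R) ->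
 Yc T l + 1 / 2 <= height T lo ll r w.
Proof.
 intros h H. induction ll as [| l' ll IH]; [destruct h |]. simpl. destruct h as [-> | h].
 - destruct excluded_middle_informative as [_ | n]; [apply Rmax_l | contradiction].
 - destruct excluded_middle_informative; [eapply Rle_trans; [now apply IH | apply Rmax_r] | now apply IH].
Qed.

Lemma height_cases T lo ll r w : height T lo ll r w = lo \/
 exists l, In l ll /\ (exists m : Z, Xc T r w = (Xc T r l + IZR m)%R) /\ height T lo ll r w = (Yc T l + 1 / 2)%R.
Proof.
 induction ll as [| l ll IH]; simpl; [now left |].
 destruct excluded_middle_informative as [e | _].
 - destruct (Rmax_case_strong (Yc T l + 1 / 2) (height T lo ll r w)
   (fun x => x = (Yc T l + 1 / 2)%R \/ x = height T lo ll r w)) as [E | E]; [now left | now right | |].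
  + right. exists l. cc.
  + rewrite E. destruct IH as [IH | [l' [h1 h2]]]; [now left | right; exists l'; auto].
 - destruct IH as [IH | [l' [h1 h2]]]; [now left | right; exists l'; auto].
Qed.

Lemma height_congr T lo ll r w w' (m : Z) : Xc T r w = (Xc T r w' + IZR m)%R -> height T lo ll r w = height T lo ll r w'.
Proof.
 intro E. induction ll as [| l ll IH]; simpl; [reflexivity |]. rewrite IH.
 destruct excluded_middle_informative as [e | n], excluded_middle_informative as [e' | n']; try reflexivity; exfalso.
 - apply n'. destruct e as [k e]. exists (k - m)%Z. rewrite minus_IZR. lra.
 - apply n. destruct e' as [k e]. exists (k + m)%Z. rewrite plus_IZR. lra.
Qed.

Lemma finite_bound (f : nat -> R) n : exists B, 0 <= B /\ forall j, (j <= n)%nat -> Rabs (f j) <= B.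
Proof.
 induction n as [| n [B [h H]]].
 - exists (Rabs (f O)). split; [apply Rabs_pos |]. intros j hj. recast O by lia. lra.
 - exists (Rmax B (Rabs (f (S n)))). split; [eapply Rle_trans; [exact h | apply Rmax_l] |].
  intros j hj. destruct (Nat.eq_dec j (S n)) as [-> | hn]; [apply Rmax_r |].
  eapply Rle_trans; [apply H; lia | apply Rmax_l].
Qed.

(** Only finitely many poles have heights that matter. On a common coordinate line an upper pole
    exceeds a lower one by K T modulo Z, and nonresonance forces K >= 1: a gap of at least 1 in
    height, with room for a margin 1/2 on each side. *)
Lemma separating_height n Lam z tau p eta : 0 < Im tau -> 0 < Im p ->
 nonresonant n Lam z tau p eta ->
 exists (r : R) (g : R -> R), C1 g /\ periodic g /\
  (forall w, upper_pole n Lam z tau p eta w -> g (Xc (tau + p) r w) + 1 / 2 <= Yc (tau + p) w) /\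
  (forall w, lower_pole n Lam z tau p eta w -> Yc (tau + p) w + 1 / 2 <= g (Xc (tau + p) r w)).
Proof.
 intros ht hp Hres. set (T := tau + p). assert (hT : 0 < Im T) by (unfold T; rewrite Im_plus; lra).
 assert (yt : 0 < Yc T tau) by (unfold Yc; apply Rdiv_lt_0_compat; assumption).
 assert (yp : 0 < Yc T p) by (unfold Yc; apply Rdiv_lt_0_compat; assumption).
 destruct (finite_bound (fun j => Yc T (z j + eta * Lam j)%C) n) as [B1 [hB1 HB1]].
 destruct (finite_bound (fun j => Yc T (z j - eta * Lam j)%C) n) as [B2 [hB2 HB2]].
 set (B := (B1 + B2)%R).
 (* [B] bounds the heights of the base points z_j +- eta Lambda_j. Beyond the index [N] the added
    heights exceed 2 B + 5, which puts the pole outside the band from [lo] to [hi] with the required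
    margin. *)
 destruct (nat_above ((2 * B + 5) / Yc T tau)) as [N1 hN1]. destruct (nat_above ((2 * B + 5) / Yc T p)) as [N2 hN2].
 set (N := (N1 + N2)%nat).
 assert (hNt : forall k, (N < k)%nat -> 2 * B + 5 <= INR k * Yc T tau).
 { intros k hk. apply (Rmult_le_reg_r (/ Yc T tau)); [now apply Rinv_0_lt_compat |].
  rewrite Rmult_assoc, Rinv_r, Rmult_1_r by lra. eapply Rle_trans; [exact hN1 |]. apply le_INR. lia. }
 assert (hNp : forall k, (N < k)%nat -> 2 * B + 5 <= INR k * Yc T p).
 { intros k hk. apply (Rmult_le_reg_r (/ Yc T p)); [now apply Rinv_0_lt_compat |].
  rewrite Rmult_assoc, Rinv_r, Rmult_1_r by lra. eapply Rle_trans; [exact hN2 |]. apply le_INR. lia. }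
 assert (YU : forall q, Yc T (upt Lam z tau p eta q) =
  (Yc T (z (fst q) + eta * Lam (fst q)) + INR (fst (snd q)) * Yc T tau + INR (snd (snd q)) * Yc T p)%R).
 { intro q. unfold upt. now rewrite !(Yc_plus _ (_ + _ * tau)), !(Yc_plus _ _ (_ * tau)), !Yc_scal. }
 assert (YL : forall q, Yc T (lpt Lam z tau p eta q) =
  (Yc T (z (fst q) - eta * Lam (fst q)) - INR (fst (snd q)) * Yc T tau - INR (snd (snd q)) * Yc T p)%R).
 { intro q. unfold lpt.
  recast (z (fst q) - eta * Lam (fst q) + RtoC (- INR (fst (snd q))) * tau + RtoC (- INR (snd (snd q))) * p) by (rewrite !RtoC_opp; ring).
  rewrite !(Yc_plus _ (_ + _ * tau)), !(Yc_plus _ _ (_ * tau)), !Yc_scal. ring. }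
 assert (pos : forall (k : nat) y, 0 < y -> 0 <= INR k * y).
 { intros k y hy. apply Rmult_le_pos; [apply pos_INR | lra]. }
 set (idx := list_prod (seq 1 n) (list_prod (seq 0 (S N)) (seq 0 (S N)))).
 assert (Hidx : forall j k l, (1 <= j <= n)%nat -> (k <= N)%nat -> (l <= N)%nat -> In (j, (k, l)) idx).
 { intros j k l hj hk hl. apply in_prod; [apply in_seq; lia |]. apply in_prod; apply in_seq; lia. }
 assert (Hidx' : forall q, In q idx -> (1 <= fst q <= n)%nat).
 { intros [j kl] hq. apply in_prod_iff in hq. destruct hq as [hq _]. apply in_seq in hq. simpl. lia. }
 set (lu := map (upt Lam z tau p eta) idx). set (ll := map (lpt Lam z tau p eta) idx).
 assert (lu_up : forall w, In w lu -> upper_pole n Lam z tau p eta w /\ - B <= Yc T w).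
 { intros w hw. apply in_map_iff in hw. destruct hw as [q [<- hq]]. assert (hj := Hidx' q hq). split.
  - exists (fst q), (fst (snd q)), (snd (snd q)). cc.
  - rewrite YU. assert (a := HB1 (fst q) ltac:(lia)). apply Rabs_le_between in a.
   assert (b := pos (fst (snd q)) _ yt). assert (c := pos (snd (snd q)) _ yp). unfold B. lra. }
 assert (ll_low : forall w, In w ll -> lower_pole n Lam z tau p eta w /\ Yc T w <= B).
 { intros w hw. apply in_map_iff in hw. destruct hw as [q [<- hq]]. assert (hj := Hidx' q hq). split.
  - exists (fst q), (fst (snd q)), (snd (snd q)). cc.
  - rewrite YL. assert (a := HB2 (fst q) ltac:(lia)). apply Rabs_le_between in a.
   assert (b := pos (fst (snd q)) _ yt). assert (c := pos (snd (snd q)) _ yp). unfold B. lra. }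
 destruct (generic_pairs T lu ll hT) as [r Hr].
 set (lo := (- B - 1)%R). set (hi := (B + 1 / 2)%R).
 set (pts := map (fun w => (Xc T r w, height T lo ll r w)) (lu ++ ll)).
 destruct (periodic_interpolation pts lo hi) as [g [g1 [g2 [g3 g4]]]].
 { unfold lo, hi, B. lra. }
 { intros q hq. apply in_map_iff in hq. destruct hq as [w [<- hw]]. cbn [snd]. split; [apply height_lo |].
  destruct (height_cases T lo ll r w) as [E | [l [h1 [_ E]]]]; rewrite E; [unfold lo, hi, B; lra |].
  destruct (ll_low l h1) as [_ a]. unfold hi. lra. }
 { intros q q' hq hq' [m E]. apply in_map_iff in hq. apply in_map_iff in hq'.
  destruct hq as [w [<- hw]]. destruct hq' as [w' [<- hw']]. cbn [fst snd] in *. now apply (height_congr T lo ll r w w' m). }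
 assert (gw : forall w, In w (lu ++ ll) -> g (Xc T r w) = height T lo ll r w).
 { intros w hw. apply (g4 (Xc T r w, height T lo ll r w)). apply in_map_iff. now exists w. }
 exists r, g. split; [exact g1 | split; [exact g2 | split]].
 - intros w [j [k [l [hj E]]]]. assert (Ew : w = upt Lam z tau p eta (j, (k, l))) by exact E.
  assert (Yw := YU (j, (k, l))). rewrite <- Ew in Yw. cbn [fst snd] in Yw.
  assert (a := HB1 j ltac:(lia)). apply Rabs_le_between in a.
  assert (b := pos k _ yt). assert (c := pos l _ yp). assert (hg := g3 (Xc T r w)).
  destruct (le_lt_dec k N) as [hk | hk]; [destruct (le_lt_dec l N) as [hl | hl] |].
  + assert (hw : In w lu) by (rewrite Ew; apply in_map; now apply Hidx).
   rewrite gw by (apply in_or_app; now left).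
   destruct (height_cases T lo ll r w) as [-> | [l0 [h1 [h2 ->]]]]; [destruct (lu_up w hw); unfold lo; lra |].
   destruct (Hr w l0 hw h1 h2) as [K [m EK]]. destruct (ll_low l0 h1) as [hl0 _].
   (* If K <= 0, raising the upper pole by - K copies of T = tau + p gives another upper pole,
      congruent to the lower pole modulo Z, against nonresonance. *)
   assert (hK : (1 <= K)%Z).
   { destruct (Z_le_gt_dec 1 K) as [h | h]; [exact h | exfalso].
    set (K' := Z.to_nat (- K)). apply (Hres (w + INR K' * T) l0 m); [| exact hl0 |].
    - exists j, (k + K')%nat, (l + K')%nat. split; [exact hj |]. rewrite E, !plus_INR, !RtoC_plus. unfold T. ring.
    - rewrite EK. unfold K'. rewrite INR_IZR_INZ, Z2Nat.id, opp_IZR, RtoC_opp by lia. ring. }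
   rewrite EK, !Yc_plus, Yc_R, Yc_scal. recast 1%R by (unfold Yc; field; lra).
   apply IZR_le in hK. lra.
  + assert (d := hNp l hl). unfold hi, B in *. lra.
  + assert (d := hNt k hk). unfold hi, B in *. lra.
 - intros w [j [k [l [hj E]]]]. assert (Ew : w = lpt Lam z tau p eta (j, (k, l))) by exact E.
  assert (Yw := YL (j, (k, l))). rewrite <- Ew in Yw. cbn [fst snd] in Yw.
  assert (a := HB2 j ltac:(lia)). apply Rabs_le_between in a.
  assert (b := pos k _ yt). assert (c := pos l _ yp). assert (hg := g3 (Xc T r w)).
  destruct (le_lt_dec k N) as [hk | hk]; [destruct (le_lt_dec l N) as [hl | hl] |].
  + assert (hw : In w ll) by (rewrite Ew; apply in_map; now apply Hidx).
   rewrite gw by (apply in_or_app; now right). apply height_ge; [exact hw |]. exists 0%Z. ring.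
  + assert (d := hNp l hl). unfold lo, B in *. lra.
  + assert (d := hNt k hk). unfold lo, B in *. lra.
Qed.

Lemma th0_zero x s : 0 < Im s -> th0 x s = 0 -> exists k m : Z, x = IZR k * s + IZR m.
Proof.
 intros hs H. apply NNPP. intro n. apply (th0_neq_0 x s hs); [| exact H]. intros k E. apply n.
 assert (E1 : e2pi (x + IZR k * s) = 1) by (recast (1 - (1 - e2pi (x + IZR k * s))); rewrite E; ring).
 apply e2pi_eq_1 in E1. destruct E1 as [m E1]. exists (- k)%Z, m. rewrite <- E1, opp_IZR, RtoC_opp. ring.
Qed.

Definition clear_of_zeros (n : nat) Lam z tau p eta (g : R -> C) : Prop :=
 forall t, on_path g t -> forall j, (1 <= j <= n)%nat ->
  thz Lam z eta tau t j <> 0 /\ thz Lam z eta p t j <> 0 /\ thz Lam z eta (tau + p) t j <> 0.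

(** The zeros of the three families of [thz] are countable and each excludes a single offset [d], so
    [avoid_sequence] applies. *)
Lemma clear_graph n Lam z tau p eta r g a b : 0 < Im tau -> 0 < Im p -> periodic g ->
 a < b -> exists d, (a <= d <= b)%R /\ clear_of_zeros n Lam z tau p eta (graph (tau + p) r g d).
Proof.
 intros ht hp hg hab. set (T := tau + p). assert (hT : 0 < Im T) by (unfold T; rewrite Im_plus; lra).
 set (per := fun c : nat => match c with O => tau | 1%nat => p | _ => T end).
 (* Enumeration by Cantor pairing of j, the period and an integer, the latter as a difference of two
    naturals. *)
 set (pole := fun i : nat => let q := of_nat i in let x := of_nat (fst q) in let y := of_nat (snd q) in
  z (fst x) + eta * Lam (fst x) + RtoC (INR (fst y) - INR (snd y)) * per (snd x)).
 destruct (avoid_sequence (fun i => (Yc T (pole i) - g (Xc T r (pole i)))%R) a b hab) as [d [hd H]].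
 exists d. split; [exact hd |].
 assert (G : forall t, on_path (graph T r g d) t -> forall j c, 0 < Im (per c) -> thz Lam z eta (per c) t j <> 0).
 { intros t [s [_ ->]] j c hc E. unfold thz in E. apply th0_zero in E; [| exact hc]. destruct E as [k [m E]].
  set (i := to_nat (to_nat (j, c), to_nat (Z.to_nat k, Z.to_nat (- k)))).
  assert (Ei : pole i = graph T r g d s + IZR (- m)).
  { unfold pole, i. rewrite !cancel_of_to. cbn [fst snd]. rewrite !cancel_of_to. cbn [fst snd].
   rewrite !INR_IZR_INZ, <- minus_IZR. recast k by lia.
   rewrite opp_IZR, RtoC_opp. recast (graph T r g d s - z j - eta * Lam j + z j + eta * Lam j).
   rewrite E. ring. }
  apply (H i). rewrite Ei, Yc_plus, Yc_R, Xc_Z, periodic_Z by exact hg. unfold graph.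
  rewrite Yc_pt, Xc_pt by exact hT. ring. }
 intros t ht' j hj. split; [| split]; [apply (G t ht' j 0%nat) | apply (G t ht' j 1%nat) | apply (G t ht' j 2%nat)]; assumption.
Qed.

Lemma contour_exists n Lam z tau p eta : 0 < Im tau -> 0 < Im p ->
 nonresonant n Lam z tau p eta -> exists g dg g' dg' gp dgp,
  contour n Lam z tau p eta g dg /\ contour n Lam z tau p eta g' dg' /\ contour n Lam z tau p eta gp dgp /\
  stacked (tau + p) (-1) g g' /\ stacked (tau + p) 0 gp g' /\
  clear_of_zeros n Lam z tau p eta g /\ clear_of_zeros n Lam z tau p eta g'.
Proof.
 intros ht hp Hres. assert (hT : 0 < Im (tau + p)) by (rewrite Im_plus; lra).
 destruct (separating_height n Lam z tau p eta ht hp Hres) as [r [g [g1 [g2 [g3 g4]]]]].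
 (* All offsets lie between 0 and 1/2, so the margins of [g] still separate the poles. Their order
    d1 < d2 < d3, with gaps below 1, produces the required stacking. *)
 destruct (clear_graph n Lam z tau p eta r g (1 / 20) (2 / 20) ht hp g2 ltac:(lra)) as [d1 [h1 c1]].
 destruct (clear_graph n Lam z tau p eta r g (3 / 20) (4 / 20) ht hp g2 ltac:(lra)) as [d2 [h2 c2]].
 set (d3 := (1 / 4)%R).
 destruct (graph_path (tau + p) r g d1 g1 g2) as [dg1 P1]. destruct (graph_path (tau + p) r g d2 g1 g2) as [dg2 P2].
 destruct (graph_path (tau + p) r g d3 g1 g2) as [dg3 P3].
 assert (HC : forall d dg, (0 < d < 1 / 2)%R -> period_path (graph (tau + p) r g d) dg ->
  contour n Lam z tau p eta (graph (tau + p) r g d) dg).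
 { intros d dg hd P. split; [exact P | split].
  - intros w hw. apply graph_above; auto. specialize (g4 w hw). lra.
  - intros w hw. apply graph_below; auto. specialize (g3 w hw). lra. }
 exists (graph (tau + p) r g d1), dg1, (graph (tau + p) r g d2), dg2, (graph (tau + p) r g d3), dg3.
 split; [| split; [| split; [| split; [| split; [| split]]]]]; auto.
 - apply HC; auto; lra.
 - apply HC; auto; lra.
 - apply HC; auto; unfold d3; lra.
 - apply graph_stacked; auto. simpl. lra.
 - apply graph_stacked; auto. unfold d3. simpl. lra.
Qed.

(* Riemann sums with all tags at zeros of [k] vanish. *)
Lemma is_cint_dense_zero (k : R -> C) (L : C) : is_cint k 0 1 L ->
 (forall a b : R, 0 <= a -> a < b -> b <= 1 -> exists x, (a < x < b)%R /\ k x = 0) -> L = 0.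
Proof.
 (* The function is set to 0 outside the open interval, so that every nondegenerate real interval
    contains a zero and tags can be chosen globally. *)
 intros HL Hz. set (k' := fun x : R => if Rlt_dec 0 x then if Rlt_dec x 1 then k x else RtoC 0 else RtoC 0).
 assert (HL' : is_cint k' 0 1 L).
 { apply (is_RInt_ext k k'); [| exact HL]. intros x hx. rewrite Rmin_left, Rmax_right in hx by lra. unfold k'.
  destruct Rlt_dec; [| lra]. destruct Rlt_dec; [reflexivity | lra]. }
 assert (Hz' : forall a b : R, a < b -> exists x, (a < x < b)%R /\ k' x = 0).
 { intros a b hab. destruct (Rlt_dec a 0) as [h | h].
  - exists ((a + Rmin b 0) / 2)%R. assert (m1 := Rmin_l b 0). assert (m2 := Rmin_r b 0).
   assert (m3 : a < Rmin b 0) by (now apply Rmin_glb_lt). split; [lra |]. unfold k'.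
   destruct Rlt_dec; [lra | reflexivity].
  - destruct (Rlt_dec 1 b) as [h' | h'].
   + exists ((b + Rmax a 1) / 2)%R. assert (m1 := Rmax_l a 1). assert (m2 := Rmax_r a 1).
    assert (m3 : Rmax a 1 < b) by (now apply Rmax_lub_lt). split; [lra |]. unfold k'.
    destruct Rlt_dec; [destruct Rlt_dec; [lra | reflexivity] | reflexivity].
   + destruct (Hz a b ltac:(lra) hab ltac:(lra)) as [x [hx E]]. exists x. split; [exact hx |].
    unfold k'. destruct Rlt_dec; [destruct Rlt_dec; [exact E | reflexivity] | reflexivity]. }
 assert (Hf : forall ab : R * R, exists c, ((fst ab <= snd ab)%R -> (fst ab <= c <= snd ab)%R) /\
   (fst ab = snd ab \/ k' c = 0)).
 { intros [a b]. simpl. destruct (Rtotal_order a b) as [h | [h | h]].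
  - destruct (Hz' a b h) as [x [hx E]]. exists x. intuition lra.
  - exists a. lra.
  - destruct (Hz' b a h) as [x [hx E]]. exists x. intuition lra. }
 apply choice in Hf. destruct Hf as [f Hf]. set (f2 := fun a b => f (a, b)).
 assert (Hsum : forall P, Riemann_sum (V := C_R_NormedModule) k' (SF_seq_f2 f2 P) = zero).
 { induction P as [| h P IH]; [reflexivity |]. destruct P as [| h' P]; [reflexivity |].
  rewrite SF_cons_f2 by (simpl; auto with arith). rewrite Riemann_sum_cons, IH, plus_zero_r. cbn [fst snd].
  recast h' by (destruct P; reflexivity).
  change (seq.head 0 (h' :: P)) with h'.
  destruct (Hf (h, h')) as [_ [E | E]]; simpl in E; unfold f2.
  - subst h'. recast (zero : R) by (unfold zero; simpl; ring). apply (scal_zero_l (V := C_R_NormedModule)).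
  - rewrite E. apply (scal_zero_r (V := C_R_NormedModule)). }
 apply NNPP. intro hL.
 assert (hpos : 0 < Cmod L) by now apply Cmod_gt_0.
 destruct (proj1 (filterlim_locally _ _) HL' (mkposreal _ (Rmult_lt_0_compat _ _ hpos (Rinv_0_lt_compat 4 ltac:(lra))))) as [d Hd].
 destruct (nat_above (/ d + 1)) as [n hn]. assert (hd := cond_pos d).
 destruct (Riemann_fine_unif_part f2 0 1 n) as [q1 [q2 [q3 q4]]].
 { intros a b hab. apply (Hf (a, b)). exact hab. }
 { lra. }
 assert (B : ball (M := C_R_NormedModule) L (Cmod L * / 4)%R
   (scal (sign (1 - 0)) (Riemann_sum (V := C_R_NormedModule) k' (SF_seq_f2 f2 (unif_part 0 1 n))))).
 { apply Hd.
  - eapply Rle_lt_trans; [exact q1 |]. assert (hN := pos_INR n).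
   apply (Rmult_lt_reg_r (INR n + 1)); [lra |]. recast 1%R by (field; apply Rgt_not_eq; lra).
   assert (e : (d * / d)%R = 1%R) by (field; apply Rgt_not_eq; exact hd). nra.
  - rewrite Rmin_left, Rmax_right by lra. cc. }
 rewrite Hsum in B. assert (B' : ball (M := C_UniformSpace) L (Cmod L * / 4)%R (RtoC 0)).
 { rewrite scal_zero_r in B. exact B. }
 destruct B' as [b1 b2]. unfold ball in b1, b2; simpl in b1, b2. unfold AbsRing_ball, abs, minus, plus, opp in b1, b2; simpl in b1, b2.
 assert (e := Cmod_le_Re_Im L). unfold Re, Im in e.
 rewrite Rplus_0_l, Rabs_Ropp in b1, b2. lra.
Qed.

Definition isolated_points (J : C -> Prop) : Prop :=
 forall x0, exists d, 0 < d /\ forall x, J x -> x <> x0 -> d <= Cmod (x - x0).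

Lemma isolated_or J J' : isolated_points J -> isolated_points J' -> isolated_points (fun x => J x \/ J' x).
Proof.
 intros H H' x0. destruct (H x0) as [d [h1 h2]]. destruct (H' x0) as [d' [h1' h2']].
 exists (Rmin d d'). split; [now apply Rmin_pos |]. intros x [hx | hx] hn.
 - eapply Rle_trans; [apply Rmin_l | now apply h2].
 - eapply Rle_trans; [apply Rmin_r | now apply h2'].
Qed.

(** Zeros differ by k s + m, so distinct ones are at distance at least Im s if k is nonzero and at
    least 1 otherwise. *)
Lemma isolated_lattice (c s : C) : 0 < Im s -> isolated_points (fun x => th0 (x - c) s = 0).
Proof.
 intros hs x0. set (r := Rmin (Im s) 1). assert (hr : 0 < r) by (apply Rmin_pos; lra).
 assert (r1 := Rmin_l (Im s) 1). assert (r2 := Rmin_r (Im s) 1). fold r in r1, r2.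
 assert (Hsep : forall x y, th0 (x - c) s = 0 -> th0 (y - c) s = 0 -> Cmod (x - y) < r -> x = y).
 { intros x y hx hy h. apply th0_zero in hx; [| exact hs]. apply th0_zero in hy; [| exact hs].
  destruct hx as [k [m E]]. destruct hy as [k' [m' E']].
  assert (D : x - y = RtoC (IZR (k - k')) * s + RtoC (IZR (m - m'))).
  { rewrite !minus_IZR, !RtoC_minus. recast ((x - c) - (y - c)). rewrite E, E'. ring. }
  assert (a := Cmod_Im (x - y)). assert (b := Cmod_Re (x - y)).
  rewrite D in a, b. rewrite Im_plus, Im_mult, !Im_RtoC, Re_RtoC in a.
  rewrite Re_plus, Re_mult, !Re_RtoC, Im_RtoC in b.
  assert (hk : (k - k' = 0)%Z).
  { destruct (Z.eq_dec (k - k') 0) as [e | e]; [exact e | exfalso].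
   assert (h1 : 1 <= Rabs (IZR (k - k'))) by (rewrite <- abs_IZR; apply (IZR_le 1); lia).
   recast (IZR (k - k') * Im s)%R in a.
   rewrite Rabs_mult, (Rabs_right (Im s)) in a by lra. rewrite D in h. nra. }
  rewrite hk in b, D. assert (hm : (m - m' = 0)%Z).
  { destruct (Z.eq_dec (m - m') 0) as [e | e]; [exact e | exfalso].
   assert (h1 : 1 <= Rabs (IZR (m - m'))) by (rewrite <- abs_IZR; apply (IZR_le 1); lia).
   rewrite D in h. recast (IZR (m - m')) in b. lra. }
  rewrite hm in D. apply Ceq_minus. rewrite D. ring. }
 destruct (classic (exists x1, th0 (x1 - c) s = 0 /\ x1 <> x0 /\ Cmod (x1 - x0) < r / 2)) as [[x1 [h1 [h2 h3]]] | hn].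
 - exists (Cmod (x1 - x0)). assert (hp : 0 < Cmod (x1 - x0)).
  { apply Cmod_gt_0. intro E. apply h2. now apply Ceq_minus. }
  split; [exact hp |]. intros x hx hne. destruct (Rle_or_lt (Cmod (x1 - x0)) (Cmod (x - x0))) as [h | h]; [exact h |].
  exfalso. assert (E : x = x1).
  { apply Hsep; auto. recast ((x - x0) + - (x1 - x0)).
   eapply Rle_lt_trans; [apply Cmod_triangle |]. rewrite Cmod_opp. lra. }
  rewrite E in h. lra.
 - exists (r / 2)%R. split; [lra |]. intros x hx hne. apply Rnot_lt_le. intro h. apply hn. now exists x.
Qed.

Lemma isolated_thz Lam z (eta s : C) n : 0 < Im s ->
 isolated_points (fun x => exists j, (1 <= j <= n)%nat /\ thz Lam z eta s x j = 0).
Proof.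
 intro hs. assert (G : forall P P' : C -> Prop, (forall x, P x -> P' x) -> isolated_points P' -> isolated_points P).
 { intros P P' h H x0. destruct (H x0) as [d [h1 h2]]. exists d. auto. }
 induction n as [| n IH].
 - intro x0. exists 1%R. split; [lra |]. intros x [j [hj _]]. lia.
 - apply (G _ (fun x => (exists j, (1 <= j <= n)%nat /\ thz Lam z eta s x j = 0) \/ th0 (x - (z (S n) + eta * Lam (S n))) s = 0)).
  + intros x [j [hj E]]. destruct (Nat.eq_dec j (S n)) as [-> | hn]; [right | left; exists j; split; [lia | exact E]].
   unfold thz in E. now recast (x - z (S n) - eta * Lam (S n)).
  + apply isolated_or; [exact IH | now apply isolated_lattice].
Qed.

(* Where the velocity does not vanish the path is locally injective, hence leaves a set of isolated points. *)
Lemma path_off_isolated g dg J a b : period_path g dg -> isolated_points J -> a < b ->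
 exists x, (a < x < b)%R /\ (dg x = 0 \/ ~ J (g x)).
Proof.
 intros [Hd _] HJ hab. set (s := ((a + b) / 2)%R).
 destruct (Ceq_dec (dg s) 0) as [h0 | h0]; [exists s; split; [unfold s; lra | now left] |].
 destruct (HJ (g s)) as [d [hd HJd]].
 assert (hm : 0 < Cmod (dg s)) by now apply Cmod_gt_0.
 assert (c := cderive_cont _ _ _ (Hd s)). apply ccont_eps with (eps := d) in c; [| exact hd]. destruct c as [d1 H1].
 specialize (Hd s). destruct Hd as [_ Hd].
 specialize (Hd s (fun P H => H)). specialize (Hd (mkposreal (Cmod (dg s) / 2) ltac:(lra))). destruct Hd as [d2 H2]. simpl in H2.
 set (e := Rmin (Rmin d1 d2) (b - a)). assert (he : 0 < e).
 { unfold e. apply Rmin_pos; [apply Rmin_pos; apply cond_pos | lra]. }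
 assert (e1 : e <= d1) by (unfold e; eapply Rle_trans; [apply Rmin_l | apply Rmin_l]).
 assert (e2 : e <= d2) by (unfold e; eapply Rle_trans; [apply Rmin_l | apply Rmin_r]).
 assert (e3 : e <= b - a) by apply Rmin_r.
 exists (s + e / 4)%R. split; [unfold s; lra |]. right. intro hJ.
 assert (hb : forall dd : posreal, e <= dd -> ball (M := R_UniformSpace) s dd (s + e / 4)%R).
 { intros dd hdd. unfold ball; simpl. unfold AbsRing_ball, abs, minus, plus, opp; simpl.
  recast (e / 4)%R. rewrite Rabs_right; lra. }
 specialize (H1 _ (hb d1 e1)). specialize (H2 _ (hb d2 e2)).
 assert (hne : g (s + e / 4)%R = g s).
 { apply NNPP. intro hne. specialize (HJd _ hJ hne). lra. }
 rewrite hne in H2. rewrite !norm_C_Cmod in H2.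
 assert (H3 : Cmod (g s - g s - RtoC (e / 4) * dg s) <= Cmod (dg s) / 2 * Rabs (e / 4)).
 { recast (s + e / 4 - s)%R. rewrite <- scal_R_Cmult. exact H2. }
 recast (- (RtoC (e / 4) * dg s)) in H3.
 rewrite Cmod_opp, Cmod_mult, Cmod_R, Rabs_right in H3 by lra. nra.
Qed.

Lemma contour_avoids n Lam z tau p eta g dg : contour n Lam z tau p eta g dg ->
 forall w, UL n Lam z tau p eta w -> avoided g w.
Proof.
 intros [_ [h1 h2]] w [h | h]; [exact (joined_avoided _ _ _ (h2 w h)) | exact (joined_avoided _ _ _ (h1 w h))].
Qed.

Lemma u_clean_Mer n Lam z a b lam mu tau p eta : 0 < Im tau -> 0 < Im p ->
 Mer (UL n Lam z tau p eta) (u_clean n Lam a b z lam mu tau p eta).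
Proof. intros h1 h2 K HK. now apply RatLim_u_clean. Qed.

(** The [iota] also ranges over contours through zeros of [thz], where [u_integrand] differs from
    [u_clean] by division by zero. The difference times the velocity vanishes on a dense set, hence
    integrates to 0; for [u_clean] Cauchy's theorem applies. *)
Lemma u_integral_contour n Lam z a b lam mu tau p eta g dg : 0 < Im tau -> 0 < Im p ->
 (1 <= a <= n)%nat -> (1 <= b <= n)%nat -> contour n Lam z tau p eta g dg ->
 (forall t, on_path g t -> forall j, (1 <= j <= n)%nat -> thz Lam z eta tau t j <> 0 /\ thz Lam z eta p t j <> 0) ->
 u_integral n Lam a b z lam mu tau p eta = pint g dg (u_clean n Lam a b z lam mu tau p eta).
Proof.
 intros ht hp ha hb Hc Hz. set (f := u_clean n Lam a b z lam mu tau p eta).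
 set (F := u_integrand n Lam a b z lam mu tau p eta).
 assert (Hpc : forall h dh, contour n Lam z tau p eta h dh -> pcont h f).
 { intros h dh H. apply (Mer_pcont (UL n Lam z tau p eta)); [apply (period_path_cont h dh), H | | now apply u_clean_Mer].
  exact (contour_avoids _ _ _ _ _ _ _ _ H). }
 assert (Hint : forall h dh, contour n Lam z tau p eta h dh -> is_cint (fun s => f (h s) * dh s) 0 1 (pint h dh f)).
 { intros h dh H. assert (P := proj1 H).
  apply (is_RInt_ext (fun s => f (h (clamp s)) * dh (clamp s))).
  - intros x hx. rewrite Rmin_left, Rmax_right in hx by lra. rewrite clamp_id by lra. reflexivity.
  - apply is_cint_cont, pint_cont; [exact P | exact (Hpc h dh H)]. }
 apply (iota_unique (V := C_R_CompleteNormedModule)).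
 - intros I [h [dh [Hh HI]]]. transitivity (pint h dh f).
  + apply Ceq_minus. apply (is_cint_dense_zero (fun s => F (h s) * dh s - f (h s) * dh s)).
   { apply is_cint_minus; [exact HI | exact (Hint h dh Hh)]. }
   intros x y hx hxy hy.
   destruct (path_off_isolated h dh _ x y (proj1 Hh)
    (isolated_or _ _ (isolated_thz Lam z eta tau n ht) (isolated_thz Lam z eta p n hp)) hxy) as [s [hs [E | E]]];
    exists s; (split; [exact hs |]).
   * rewrite E. ring.
   * unfold F, f. rewrite u_integrand_clean; auto; [ring | | |].
    -- intros w hw. apply (contour_avoids _ _ _ _ _ _ _ _ Hh w hw). exists s. intuition lra.
    -- intros j hj e. apply E. left. now exists j.
    -- intros j hj e. apply E. right. now exists j.
  + apply (Mer_indep (UL n Lam z tau p eta)); [apply Hh | apply Hc | | now apply u_clean_Mer].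
   intros w [hw | hw]; [right | left]; split; now apply Hh || now apply Hc.
 - exists g, dg. split; [exact Hc |]. apply (is_RInt_ext (fun s => f (g s) * dg s)); [| exact (Hint g dg Hc)].
  intros x hx. rewrite Rmin_left, Rmax_right in hx by lra. unfold f.
  assert (ho : on_path g (g x)) by (exists x; split; [lra | reflexivity]).
  rewrite <- u_integrand_clean; auto.
  + intros w hw. exact (contour_avoids _ _ _ _ _ _ _ _ Hc w hw _ ho).
  + intros j hj. apply (Hz _ ho j hj).
  + intros j hj. apply (Hz _ ho j hj).
Qed.

(** * The sum over the weights *)
(** [g] carries t, [g'] carries t' and runs above it; [gp] is an auxiliary contour for t above [g'],
    to be compared with the translated pair. *)
Definition heat_contours (n : nat) Lam z tau p eta (g dg g' dg' gp dgp : R -> C) : Prop :=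
 contour n Lam z tau p eta g dg /\ contour n Lam z tau p eta g' dg' /\ contour n Lam z tau p eta gp dgp /\
 stacked (tau + p) (-1) g g' /\ stacked (tau + p) 0 gp g' /\
 clear_of_zeros n Lam z tau p eta g /\ clear_of_zeros n Lam z tau p eta g'.

Lemma upper_intro n Lam z (tau p eta w : C) j k l : (1 <= j <= n)%nat ->
 w = z j + eta * Lam j + INR k * tau + INR l * p -> upper_pole n Lam z tau p eta w.
Proof. intros h E. now exists j, k, l. Qed.

Lemma lower_intro n Lam z (tau p eta w : C) j k l : (1 <= j <= n)%nat ->
 w = z j - eta * Lam j - INR k * tau - INR l * p -> lower_pole n Lam z tau p eta w.
Proof. intros h E. now exists j, k, l. Qed.

Ltac pole_eq := rewrite ?S_INR, ?plus_INR, ?S_INR, ?RtoC_plus; ring.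

(** Translating [g] by tau and [g'] by - p displaces them by tau + p = T relative to each other,
    which puts t above t'. By [dgap_zero] the pair may be replaced by ([gp], [g']), and lowering
    [gp] to [g] leaves the residue. *)
Lemma exchange n Lam z tau p eta a b (lam nu m : C) g dg g' dg' gp dgp :
 (0 < Im tau)%R -> 0 < Im p -> heat_contours n Lam z tau p eta g dg g' dg' gp dgp ->
 th0 m (tau + p) <> 0 ->
 let T := tau + p in let phi := Phic true n Lam z eta tau T a lam in let psi := fun t => Phic false n Lam z eta p T b nu (t + p) in
 dint T m (tr tau g) dg (tr (- p) g') dg' phi psi =
 dint T m g dg g' dg' phi psi + kres T m * pint g' dg' (fun t => phi t * psi t).
Proof.
 intros ht hp (C1 & C2 & C3 & S1 & S2 & _ & _) hm T phi psi.
 assert (hT : 0 < Im T) by (unfold T; rewrite Im_plus; lra).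
 destruct C1 as (P1 & L1 & U1). destruct C2 as (P2 & L2 & U2). destruct C3 as (P3 & L3 & U3).
 set (Sphi := PhiS n Lam z eta tau T). set (Spsi := fun w => PhiS n Lam z eta p T (w + p)).
 assert (Mphi : Mer Sphi phi) by (intros K HK; now apply RatLim_Phic).
 assert (Mpsi : Mer Spsi psi).
 { apply (Mer_shift (PhiS n Lam z eta p T) p). intros K HK. now apply RatLim_Phic. }
 assert (Hpsi : forall v, Spsi v -> same_side (tr (- p) g') g' v).
 { intros v [[j [k [l [hj E]]]] | [j [k [l [hj E]]]]].
  - right. split; [apply below_tr |]; apply U2.
   + apply (upper_intro _ _ _ _ _ _ _ j l (S k + l)); [exact hj |]. recast (v + p). rewrite E. unfold T. pole_eq.
   + apply (upper_intro _ _ _ _ _ _ _ j l (k + l)); [exact hj |]. recast (v + p - p). rewrite E. unfold T. pole_eq.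
  - left. split; [apply above_tr |]; apply L2.
   + apply (lower_intro _ _ _ _ _ _ _ j l (k + l)); [exact hj |]. recast (v + p). rewrite E. unfold T. pole_eq.
   + apply (lower_intro _ _ _ _ _ _ _ j l (S k + l)); [exact hj |]. recast (v + p - p). rewrite E. unfold T. pole_eq. }
 assert (Hphi : forall v, Sphi v -> low_pole T (tr tau g) (tr (- p) g') gp g' v \/ up_pole T (tr tau g) (tr (- p) g') gp g' v).
 { intros v [[j [k [l [hj E]]]] | [j [k [l [hj E]]]]]; [right | left]; intro N;
   (split; [| split; [| split]]).
  - apply below_tr, U1. apply (upper_intro _ _ _ _ _ _ _ j (k + l + N) (l + N)); [exact hj |]. rewrite E. unfold T. pole_eq.
  - apply U3. apply (upper_intro _ _ _ _ _ _ _ j (S k + l + N) (l + N)); [exact hj |]. rewrite E. unfold T. pole_eq.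
  - apply below_tr, U2. apply (upper_intro _ _ _ _ _ _ _ j (S k + l + N) (S l + N)); [exact hj |]. rewrite E. unfold T. pole_eq.
  - apply U2. apply (upper_intro _ _ _ _ _ _ _ j (S k + l + N) (l + N)); [exact hj |]. rewrite E. unfold T. pole_eq.
  - apply above_tr, L1. apply (lower_intro _ _ _ _ _ _ _ j (S k + l + N) (l + N)); [exact hj |]. rewrite E. unfold T. pole_eq.
  - apply L3. apply (lower_intro _ _ _ _ _ _ _ j (k + l + N) (l + N)); [exact hj |]. rewrite E. unfold T. pole_eq.
  - apply above_tr, L2. apply (lower_intro _ _ _ _ _ _ _ j (S k + l + N) (l + N)); [exact hj |]. rewrite E. unfold T. pole_eq.
  - apply L2. apply (lower_intro _ _ _ _ _ _ _ j (S k + l + N) (S l + N)); [exact hj |]. rewrite E. unfold T. pole_eq. }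
 assert (D : crossing_data T (tr tau g) dg (tr (- p) g') dg' gp dgp g' dg' Spsi psi).
 { refine (conj hT (conj (conj _ (conj _ (conj P3 P2))) (conj (conj _ S2) (conj Mpsi Hpsi)))).
  - now apply tr_path.
  - now apply tr_path.
  - apply (stacked_tr T (-1)); [exact S1 | unfold T; simpl; ring]. }
 assert (Z := dgap_zero T m _ _ _ _ _ _ _ _ Spsi psi Sphi phi D hm Mphi Hphi). unfold dgap in Z.
 transitivity (dint T m gp dgp g' dg' phi psi); [apply Ceq_minus; exact Z |].
 apply (dint_cross T m Sphi gp dgp g dg g' dg' phi psi); try assumption.
 - apply (crossing_pcont _ _ _ _ _ _ _ _ _ _ _ D).
 - intros v hv. destruct (Hphi v hv) as [h | h].
  + destruct (low_pole_above _ _ _ _ _ _ h) as [_ h1]. destruct (PhiS_left_UL n Lam z tau p eta v hv) as [h2 | h2].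
   * split; [right; split; [apply U3 | apply U1]; exact h2 | exact (joined_avoided _ _ _ (U2 _ h2))].
   * split; [left; split; [apply L3 | apply L1]; exact h2 | exact (joined_avoided _ _ _ (L2 _ h2))].
  + destruct (PhiS_left_UL n Lam z tau p eta v hv) as [h2 | h2].
   * split; [right; split; [apply U3 | apply U1]; exact h2 | exact (joined_avoided _ _ _ (U2 _ h2))].
   * split; [left; split; [apply L3 | apply L1]; exact h2 | exact (joined_avoided _ _ _ (L2 _ h2))].
Qed.

Lemma contour_incl n Lam z (tau p tau' p' eta : C) g dg :
 (forall w, upper_pole n Lam z tau' p' eta w -> upper_pole n Lam z tau p eta w) ->
 (forall w, lower_pole n Lam z tau' p' eta w -> lower_pole n Lam z tau p eta w) ->
 contour n Lam z tau p eta g dg -> contour n Lam z tau' p' eta g dg.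
Proof. intros hu hl (P & L & U). split; [exact P | split; auto]. Qed.

(** T = tau + p is a sum of the two periods, so the poles for (tau, T) are among those for (tau, p)
    and one contour serves both integrals. *)
Lemma contour_left n Lam z tau p eta g dg :
 contour n Lam z tau p eta g dg -> contour n Lam z tau (tau + p) eta g dg.
Proof.
 apply contour_incl; intros w [j [k [l [hj ->]]]]; exists j, (k + l)%nat, l; (split; [exact hj | pole_eq]).
Qed.

Lemma contour_right n Lam z tau p eta g dg :
 contour n Lam z tau p eta g dg -> contour n Lam z (tau + p) p eta g dg.
Proof.
 apply contour_incl; intros w [j [k [l [hj ->]]]]; exists j, k, (k + l)%nat; (split; [exact hj | pole_eq]).
Qed.

Lemma PhiS_right_self n Lam z (tau p eta w : C) : PhiS n Lam z eta p (tau + p) w -> UL n Lam z tau p eta w.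
Proof.
 intros [[j [k [l [hj ->]]]] | [j [k [l [hj ->]]]]].
 - left. exists j, l, (S k + l)%nat. split; [exact hj | pole_eq].
 - right. exists j, l, (k + l)%nat. split; [exact hj | pole_eq].
Qed.

Lemma PhiS_left_shift n Lam z (tau p eta w : C) : PhiS n Lam z eta tau (tau + p) w -> UL n Lam z tau p eta (w - tau).
Proof.
 intros [[j [k [l [hj ->]]]] | [j [k [l [hj ->]]]]].
 - left. exists j, (k + l)%nat, l. split; [exact hj | pole_eq].
 - right. exists j, (S k + l)%nat, l. split; [exact hj | pole_eq].
Qed.

Lemma thz_shift Lam z (eta s t : C) j : 0 < Im s -> thz Lam z eta s t j <> 0 -> thz Lam z eta s (t + s) j <> 0.
Proof.
 intros hs h. unfold thz in *. recast (t - z j - eta * Lam j + s).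
 rewrite th0_shift by exact hs. apply Cmult_neq_0; [| exact h].
 intro E. apply (e2pi_neq_0 (- (t - z j - eta * Lam j))). recast (- - e2pi (- (t - z j - eta * Lam j))).
 rewrite E. ring.
Qed.

Lemma pcont_ext g f h : (forall t, on_path g t -> f t = h t) -> pcont g f -> pcont g h.
Proof. intros H hf s. apply (ccont_ext (fun s => f (g (clamp s)))); [intro; apply H, on_path_clamp | apply hf]. Qed.

Lemma pcont_theta g (c s : C) : (forall r, ccont g r) -> 0 < Im s -> pcont g (fun t => theta (t + c) s).
Proof.
 intros hg hs. destruct (theta_th0 s hs) as [k [_ E]].
 apply (pcont_ext g (fun t => k * e2pi (- ((t + c) / 2)) * th0 (t + c) s)); [intros; now rewrite E |].
 apply pcont_mult; [apply pcont_mult; [apply pcont_const |] |].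
 - intro r. apply ccont_e2pi, ccont_opp, ccont_mult; [| apply ccont_const].
  cc.
 - intro r. apply (ccont_comp (fun r => g (clamp r)) (fun t => th0 (t + c) s)); [now apply ccont_clamp | now apply th0_cont].
Qed.

Lemma pcont_Rfac Lam z (eta s : C) g m k : (forall r, ccont g r) -> 0 < Im s ->
 (forall t j, on_path g t -> (m <= j <= k)%nat -> thz Lam z eta s t j <> 0) ->
 pcont g (fun t => Cprod (Rfac Lam z eta s t) m k).
Proof.
 intros hg hs H. assert (G : forall j, (m <= j <= k)%nat -> pcont g (fun t => Rfac Lam z eta s t j)).
 { intros j hj r. unfold Rfac. apply ccont_div.
  - assert (h := pcont_theta g (- z j + eta * Lam j) s hg hs r). cbv beta in h.
   apply (ccont_ext (fun s0 => theta (g (clamp s0) + (- z j + eta * Lam j)) s)); [| exact h].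
   intro; f_equal; ring.
  - assert (h := pcont_theta g (- z j - eta * Lam j) s hg hs r). cbv beta in h.
   apply (ccont_ext (fun s0 => theta (g (clamp s0) + (- z j - eta * Lam j)) s)); [| exact h].
   intro; f_equal; ring.
  - apply theta_neq_0_iff; [exact hs |]. apply H; [apply on_path_clamp | exact hj]. }
 clear H. destruct (le_lt_dec m k) as [h | h].
 - revert G. induction k as [| k IH]; intro G.
  + recast O in * by lia. apply (pcont_ext g (fun t => Rfac Lam z eta s t 0%nat)); [| apply G; lia].
   intros t _. now rewrite Cprod_point.
  + destruct (Nat.eq_dec m (S k)) as [-> | hm].
   * apply (pcont_ext g (fun t => Rfac Lam z eta s t (S k))); [| apply G; lia].
    intros t _. now rewrite Cprod_point.
   * apply (pcont_ext g (fun t => Cprod (Rfac Lam z eta s t) m k * Rfac Lam z eta s t (S k))).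
    -- intros t _. rewrite Cprod_S by lia. reflexivity.
    -- apply pcont_mult; [apply IH; [lia | intros; apply G; lia] | apply G; lia].
 - apply (pcont_ext g (fun _ => 1)); [intros; now rewrite Cprod_lt | apply pcont_const].
Qed.

(** The cth summand is [G (c - 1) - G c]. Each end carries the full product of theta ratios in a
    single variable, which [Phi_shift] absorbs; the contours have to be exchanged at the end c = 0
    only. *)
Lemma heat_weight_sum n Lam z tau p eta a b lam nu mu g dg g' dg' gp dgp :
 (0 < Im tau)%R -> 0 < Im p -> (1 <= a <= n)%nat -> (1 <= b <= n)%nat -> csum Lam 1 n = 2 ->
 heat_contours n Lam z tau p eta g dg g' dg' gp dgp ->
 let T := tau + p in
 (forall c, (c <= n)%nat -> th0 (shiftM Lam eta mu c) T <> 0) ->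
 let phi := Phic true n Lam z eta tau T a lam in let psi := fun t => Phic false n Lam z eta p T b nu (t + p) in
 let D := fun m => dint T m g dg g' dg' phi psi in
 csum (fun c => u_integral n Lam a c z lam mu tau T eta * Q Lam c mu T eta * u_integral n Lam c b z (- mu) nu T p eta) 1 n =
 kernc T * (e2pi (lam + (mu - 2 * eta)) / th0 (mu - 2 * eta) T *
        (D (mu - 2 * eta) + kres T (mu - 2 * eta) * pint g' dg' (fun t => phi t * psi t))
       - e2pi nu / th0 (mu + 2 * eta) T * D (mu + 2 * eta)).
Proof.
 intros ht hp ha hb HL HC T Hmu phi psi D.
 pose proof HC as (C1 & C2 & C3 & S1 & S2 & Z1 & Z2).
 assert (hT : 0 < Im T) by (unfold T; rewrite Im_plus; lra).
 assert (P1 := proj1 C1). assert (P2 := proj1 C2).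
 assert (cg := period_path_cont _ _ P1). assert (cg' := period_path_cont _ _ P2).
 assert (A1 := contour_avoids _ _ _ _ _ _ _ _ C1). assert (A2 := contour_avoids _ _ _ _ _ _ _ _ C2).
 assert (CL := contour_left _ _ _ _ _ _ _ _ C1). assert (CR := contour_right _ _ _ _ _ _ _ _ C2).
 fold T in CL, CR.
 assert (zt : forall t, on_path g t -> forall j, (1 <= j <= n)%nat -> thz Lam z eta tau t j <> 0 /\ thz Lam z eta T t j <> 0).
 { intros t h j hj. destruct (Z1 t h j hj) as (x & _ & y). now split. }
 assert (zp : forall t, on_path g' t -> forall j, (1 <= j <= n)%nat -> thz Lam z eta T t j <> 0 /\ thz Lam z eta p t j <> 0).
 { intros t h j hj. destruct (Z2 t h j hj) as (_ & x & y). now split. }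
 assert (zt1 := fun t h j hj => proj1 (zt t h j hj)). assert (ztT := fun t h j hj => proj2 (zt t h j hj)).
 assert (zpT := fun t h j hj => proj1 (zp t h j hj)). assert (zp1 := fun t h j hj => proj2 (zp t h j hj)).
 set (PhiF := Phi true n Lam z eta tau T a lam). set (PsiF := Phi false n Lam z eta p T b nu).
 assert (EPhi : forall t, on_path g t -> PhiF t = phi t).
 { intros t h. apply (Phi_clean true n Lam z eta tau T a lam t ht hT ha); [| exact (zt1 t h)].
  intros w hw. exact (A1 w (PhiS_left_UL _ _ _ _ _ _ _ hw) t h). }
 assert (EPhi' : forall t, on_path g t -> Phi true n Lam z eta tau T a lam (t + tau) = phi (t + tau)).
 { intros t h. apply (Phi_clean true n Lam z eta tau T a lam (t + tau) ht hT ha);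
   [| intros j hj; exact (thz_shift Lam z eta tau t j ht (zt1 t h j hj))].
  intros w hw. exact (avoids_shift _ _ _ (A1 _ (PhiS_left_shift _ _ _ _ _ _ _ hw) t h)). }
 assert (EPsi : forall t, on_path g' t -> PsiF t = psi (t - p)).
 { intros t h. unfold psi. recast t.
  apply (Phi_clean false n Lam z eta p T b nu t hp hT hb); [| exact (zp1 t h)].
  intros w hw. exact (A2 w (PhiS_right_self _ _ _ _ _ _ _ hw) t h). }
 assert (EPsi' : forall t, on_path g' t -> Phi false n Lam z eta p T b nu (t + p) = psi t).
 { intros t h. apply (Phi_clean false n Lam z eta p T b nu (t + p) hp hT hb);
   [| intros j hj; exact (thz_shift Lam z eta p t j hp (zp1 t h j hj))].
  intros w hw. exact (avoids_shift _ _ _ (A2 _ (PhiS_right_UL _ _ _ _ _ _ _ hw) t h)). }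
 assert (cPhi : pcont g PhiF).
 { apply (pcont_ext g phi); [intros t h; symmetry; exact (EPhi t h) |].
  apply (Mer_pcont (PhiS n Lam z eta tau T)); try assumption; [intros w hw; exact (A1 w (PhiS_left_UL _ _ _ _ _ _ _ hw)) |].
  intros K HK. exact (RatLim_Phic true n Lam z eta tau T a lam K ht hT HK). }
 assert (cPsi : pcont g' PsiF).
 { apply (pcont_ext g' (Phic false n Lam z eta p T b nu)).
  - intros t h. rewrite (EPsi t h). unfold psi. f_equal. ring.
  - apply (Mer_pcont (PhiS n Lam z eta p T)); try assumption; [intros w hw; exact (A2 w (PhiS_right_self _ _ _ _ _ _ _ hw)) |].
   intros K HK. exact (RatLim_Phic false n Lam z eta p T b nu K hp hT HK). }
 set (phc := fun c t => PhiF t * Cprod (Rfac Lam z eta T t) (c + 1) n).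
 set (psc := fun c t => PsiF t * Cprod (Rfac Lam z eta T t) 1 c).
 set (M := shiftM Lam eta mu).
 set (G := fun c => kernc T / th0 (M c) T * dint T (M c) g dg g' dg' (phc c) (psc c)).
 assert (cphc : forall c, (c <= n)%nat -> pcont g (phc c)).
 { intros c hc. apply pcont_mult; [exact cPhi |]. apply pcont_Rfac; try assumption. intros t j h hj. apply (ztT t h j). lia. }
 assert (cpsc : forall c, (c <= n)%nat -> pcont g' (psc c)).
 { intros c hc. apply pcont_mult; [exact cPsi |]. apply pcont_Rfac; try assumption. intros t j h hj. apply (zpT t h j). lia. }
 assert (sth : forall t t', on_path g t -> on_path g' t' -> th0 (t - t') T <> 0).
 { intros t t' h h'. exact (stacked_th0 T (-1) g g' t t' hT S1 h h'). }
 assert (Htel : forall c t t', (c <= n)%nat -> on_path g t -> on_path g' t' ->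
  telA n Lam z eta T mu t t' c = kernc T / th0 (M c) T * kth T (M c) (t - t') *
   (Cprod (Rfac Lam z eta T t') 1 c * Cprod (Rfac Lam z eta T t) (c + 1) n)).
 { intros c t t' hc h h'. unfold telA. rewrite kern_th0.
  - unfold kth, M. field. cc.
  - exact hT.
  - cc.
  - cc. }
 assert (Ec : forall c, (1 <= c <= n)%nat ->
  u_integral n Lam a c z lam mu tau T eta * Q Lam c mu T eta * u_integral n Lam c b z (- mu) nu T p eta =
  G (c - 1)%nat - G c).
 { intros c hc.
  rewrite (u_integral_contour n Lam z a c lam mu tau T eta g dg ht hT ha hc CL zt).
  rewrite (u_integral_contour n Lam z c b (- mu) nu T p eta g' dg' hT hp hc hb CR zp).
  set (om := fun t => omega_dual n Lam c t z mu T eta). set (om' := fun t => omega Lam c t z (- mu) T eta).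
  assert (E1 : forall t, on_path g t -> u_clean n Lam a c z lam mu tau T eta t = PhiF t * om t).
  { intros t h. rewrite <- (u_integrand_clean n Lam z a c lam mu tau T eta t ht hT ha hc
   (fun w hw => contour_avoids _ _ _ _ _ _ _ _ CL w hw t h) (zt1 t h) (ztT t h)). reflexivity. }
  assert (E2 : forall t, on_path g' t -> u_clean n Lam c b z (- mu) nu T p eta t = PsiF t * om' t).
  { intros t h. rewrite <- (u_integrand_clean n Lam z c b (- mu) nu T p eta t hT hp hc hb
   (fun w hw => contour_avoids _ _ _ _ _ _ _ _ CR w hw t h) (zpT t h) (zp1 t h)).
   unfold u_integrand, PsiF, Phi, weight, om'. cbv iota. ring. }
  rewrite (pint_ext g dg _ _ E1), (pint_ext g' dg' _ _ E2).
  assert (q1 : pcont g (fun t => PhiF t * om t)).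
  { apply (pcont_ext g _ _ E1), (Mer_pcont (UL n Lam z tau T eta)); try assumption; [| apply (u_clean_Mer n Lam z a c lam mu tau T eta ht hT)].
   exact (contour_avoids _ _ _ _ _ _ _ _ CL). }
  assert (q2 : pcont g' (fun t => PsiF t * om' t)).
  { apply (pcont_ext g' _ _ E2), (Mer_pcont (UL n Lam z T p eta)); try assumption; [| apply (u_clean_Mer n Lam z c b (- mu) nu T p eta hT hp)].
   exact (contour_avoids _ _ _ _ _ _ _ _ CR). }
  rewrite <- pint_scal by assumption.
  unfold G. unfold dint.
  assert (W : forall c, (c <= n)%nat -> pcont g' (fun t' => psc c t' * pint g dg (fun t => phc c t * kth T (M c) (t - t')))).
  { intros k hk. apply pcont_mult; [exact (cpsc k hk) |]. apply (inner_pcont T (M k) (-1)); try assumption. cc. }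
  rewrite <- !pint_scal by (try exact P2; apply W; lia).
  rewrite <- pint_minus; [| exact P2 | apply pcont_mult; [apply pcont_const | apply W; lia] ..].
  apply pint_ext. intros t' h'.
  assert (W' : forall c, (c <= n)%nat -> pcont g (fun t => phc c t * kth T (M c) (t - t'))).
  { intros k hk. apply (inner_integrand_pcont T (M k) (-1) g dg g'); try assumption. cc. }
  transitivity (pint g dg (fun t => PsiF t' * (PhiF t * (om t * Q Lam c mu T eta * om' t')))).
  { transitivity ((Q Lam c mu T eta * (PsiF t' * om' t')) * pint g dg (fun t => PhiF t * om t)); [ring |].
   rewrite <- pint_scal by assumption. apply pint_ext. intros; ring. }
  rewrite (Cmult_assoc _ (psc (c - 1)%nat t')), (Cmult_assoc _ (psc c t')).
  rewrite <- !pint_scal by (try exact P1; apply W'; lia).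
  rewrite <- pint_minus; [| exact P1 | apply pcont_mult; [apply pcont_const | apply W'; lia] ..].
  apply pint_ext. intros t h. unfold om, om'.
  rewrite (weight_product_telescopes n Lam z eta T mu t t' c); try assumption.
  - rewrite !Htel by (try assumption; lia). unfold phc, psc. ring.
  - apply theta_neq_0_iff; [exact hT | exact (sth _ _ h h')].
  - cc.
  - cc.
  - apply theta_neq_0_iff; [exact hT | apply Hmu; lia].
  - apply theta_neq_0_iff; [exact hT | apply Hmu; lia]. }
 rewrite (csum_ext _ (fun c => G (c - 1)%nat - G c)) by exact Ec.
 rewrite csum_telescope.
 assert (EM0 : M 0%nat = mu - 2 * eta) by (unfold M, shiftM; rewrite csum_lt by lia; ring).
 assert (EMn : M n = mu + 2 * eta) by (unfold M, shiftM; rewrite HL; ring).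
 assert (h0 := Hmu 0%nat ltac:(lia)). assert (hn := Hmu n ltac:(lia)). fold M in h0, hn. rewrite EM0 in h0. rewrite EMn in hn.
 (* At c = n the ratios are all in t'. The translation by p turns the second factor into [psi] on
    the original contour, so no contour moves. *)
 assert (GN : G n = kernc T * (e2pi nu / th0 (mu + 2 * eta) T * D (mu + 2 * eta))).
 { unfold G. rewrite EMn. transitivity (kernc T / th0 (mu + 2 * eta) T * (e2pi nu * D (mu + 2 * eta))); [| unfold Cdiv; ring].
  apply (f_equal (Cmult _)). unfold D, dint.
  rewrite <- pint_scal.
  - apply pint_ext. intros t' h'. unfold psc, PsiF.
   rewrite (Phi_shift false n Lam z eta p T b nu t'); try assumption.
   + rewrite EPsi' by exact h'. rewrite <- Cmult_assoc. do 2 apply (f_equal (Cmult _)).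
    apply pint_ext. intros t h. unfold phc. rewrite Cprod_lt by lia. rewrite EPhi by exact h. ring.
   + intros w hw. exact (A2 w (PhiS_right_self _ _ _ _ _ _ _ hw) t' h').
   + intros w hw. exact (avoids_shift _ _ _ (A2 _ (PhiS_right_UL _ _ _ _ _ _ _ hw) t' h')).
   + cc.
   + cc.
  - exact P2.
  - apply pcont_mult.
   + apply (Mer_pcont (fun w => PhiS n Lam z eta p T (w + p))); try assumption.
    * intros w hw. recast (w + p - p). exact (A2 _ (PhiS_right_UL _ _ _ _ _ _ _ hw)).
    * apply (Mer_shift (PhiS n Lam z eta p T) p). intros K HK. exact (RatLim_Phic false n Lam z eta p T b nu K hp hT HK).
   + apply (inner_pcont T _ (-1)); try assumption. apply (pcont_ext g PhiF); try assumption. }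
 (* At c = 0 the ratios are all in t: the first factor becomes phi(t + tau), and the second is
    psi(t' - p). Bringing both back to [phi] and [psi] translates the contours, and the kernel,
    shifted by T, gives e(- m). *)
 assert (G0 : G 0%nat = kernc T * (e2pi (lam + (mu - 2 * eta)) / th0 (mu - 2 * eta) T *
   (D (mu - 2 * eta) + kres T (mu - 2 * eta) * pint g' dg' (fun t => phi t * psi t)))).
 { unfold D. unfold phi, psi. unfold T in h0 |- *.
  rewrite <- (exchange n Lam z tau p eta a b lam nu (mu - 2 * eta) g dg g' dg' gp dgp ht hp HC h0).
  fold T. fold psi. fold phi. fold T in h0. unfold G. rewrite EM0.
  transitivity (kernc T / th0 (mu - 2 * eta) T * (e2pi (lam + (mu - 2 * eta)) *
   dint T (mu - 2 * eta) (tr tau g) dg (tr (- p) g') dg' phi psi)); [| unfold Cdiv; ring].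
  apply (f_equal (Cmult _)). set (m := mu - 2 * eta). unfold dint. rewrite pint_tr.
  assert (Hk : forall t t', on_path g t -> on_path g' t' -> kth T m (t + tau - (t' + - p)) = e2pi (- m) * kth T m (t - t')).
  { intros t t' h h'. recast (t - t' + T) by (unfold T; ring).
   apply kth_shift; [exact hT | exact (sth _ _ h h')]. }
  assert (cphi0 : pcont g (fun t => phi (t + tau))).
  { apply (Mer_pcont (fun w => PhiS n Lam z eta tau T (w + tau))); try assumption.
   - intros w hw. recast (w + tau - tau). exact (A1 _ (PhiS_left_shift _ _ _ _ _ _ _ hw)).
   - apply (Mer_shift (PhiS n Lam z eta tau T) tau). intros K HK. exact (RatLim_Phic true n Lam z eta tau T a lam K ht hT HK). }
  transitivity (pint g' dg' (fun t' => e2pi lam * (PsiF t' * pint g dg (fun t => phi (t + tau) * kth T m (t - t'))))).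
  - apply pint_ext. intros t' h'. unfold psc. rewrite Cprod_lt by lia.
   rewrite Cmult_1_r, Cmult_assoc, (Cmult_comm (e2pi lam)), <- Cmult_assoc. apply (f_equal (Cmult _)).
   rewrite <- pint_scal by (try exact P1; apply (inner_integrand_pcont T m (-1) g dg g'); assumption).
   apply pint_ext. intros t h. unfold phc, PhiF. simpl (0 + 1)%nat.
   rewrite (Phi_shift true n Lam z eta tau T a lam t); try assumption.
   + rewrite EPhi' by exact h. ring.
   + intros w hw. exact (A1 w (PhiS_left_UL _ _ _ _ _ _ _ hw) t h).
   + intros w hw. exact (avoids_shift _ _ _ (A1 _ (PhiS_left_shift _ _ _ _ _ _ _ hw) t h)).
   + cc.
   + cc.
  - rewrite <- pint_scal.
   + apply pint_ext. intros t' h'. rewrite (EPsi t' h'). change (t' - p) with (t' + - p).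
    rewrite e2pi_plus, <- Cmult_assoc. apply (f_equal (Cmult _)). rewrite Cmult_assoc, (Cmult_comm (e2pi m)), <- Cmult_assoc.
    apply (f_equal (Cmult _)). rewrite pint_tr.
    rewrite (pint_ext g dg (fun t => phi (t + tau) * kth T m (t + tau - (t' + - p)))
     (fun t => e2pi (- m) * (phi (t + tau) * kth T m (t - t')))) by (intros t h; rewrite Hk by assumption; ring).
    rewrite pint_scal by (try exact P1; apply (inner_integrand_pcont T m (-1) g dg g'); assumption).
    rewrite Cmult_assoc, <- e2pi_plus. recast (RtoC 0). rewrite e2pi_0. ring.
   + exact P2.
   + apply (pcont_ext g' (fun t' => PsiF t' * pint g dg (fun t => phi (t + tau) * kth T m (t + tau - (t' + - p))))).
    * intros t' h'. rewrite (EPsi t' h'). reflexivity.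
    * apply pcont_mult; [exact cPsi |].
     apply (pcont_ext g' (fun t' => pint g dg (fun t => (e2pi (- m) * phi (t + tau)) * kth T m (t - t')))).
     -- intros t' h'. apply pint_ext. intros t h. rewrite Hk by assumption. ring.
     -- apply (inner_pcont T m (-1)); try assumption. cc. }
 rewrite G0, GN. ring.
Qed.

(** * The Gaussian integral on a line *)
Lemma cderive_caratheodory (f q : R -> C) (x : R) : (forall y, f y - f x = RtoC (y - x) * q y) -> ccont q x ->
 cderive f x (q x).
Proof.
 intros H Hq. split; [apply is_linear_scal_l |]. intros y hy.
 assert (hy' := is_filter_lim_locally_unique _ _ hy). subst y. intro eps.
 destruct (proj1 (ccont_eps _ _) Hq eps (cond_pos eps)) as [d Hd]. exists d. intros y By. specialize (Hd y By).
 rewrite norm_C_Cmod. 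
 change (Cmod (f y - f x - scal (K := R_Ring) (V := C_R_NormedModule) (y - x)%R (q x)) <= eps * Rabs (y - x))%R.
 rewrite scal_R_Cmult, H.
 recast (RtoC (y - x) * (q y - q x)).
 rewrite Cmod_mult, Cmod_R, Rmult_comm. apply Rmult_le_compat_r; [apply Rabs_pos | lra].
Qed.

(** Differentiation under the integral. [expJ] writes the difference quotient of the exponential as
    a function jointly continuous in the parameter and t, and [cderive_caratheodory] applies. *)
Lemma Carg_param (c e : R -> C) (w0 w1 : C) (x : R) : (forall t, ccont c t) -> (forall t, ccont e t) ->
 let w := fun x : R => w0 + RtoC x * w1 in
 cderive (fun x => cint (fun t => c t * Cexp (- (w x * w x) * e t)) 0 1) x
  (cint (fun t => c t * (- (2 * w1 * w x) * e t) * Cexp (- (w x * w x) * e t)) 0 1).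
Proof.
 intros hc he w.
 assert (cw : forall y, ccont w y).
 { intro y. apply ccont_plus; [apply ccont_const |]. cc. }
 set (F := fun (y t : R) => (c t * (- (w1 * (w y + w x)) * e t) * Cexp (- (w x * w x) * e t)) *
  expJ (- (w y * w y) * e t - - (w x * w x) * e t)).
 assert (cF : forall y t, continuous (T := prod_UniformSpace R_UniformSpace R_UniformSpace) (U := C_UniformSpace)
  (fun u => F (fst u) (snd u)) (y, t)).
 { intros y t. assert (c1 := ccont_fst w (y, t) (cw _)). assert (c2 := ccont_snd c (y, t) (hc _)).
  assert (c3 := ccont_snd e (y, t) (he _)). unfold F.
  apply ccont_mult; [apply ccont_mult; [apply ccont_mult; [exact c2 |] |] |].
  - cc.
  - cc.
  - apply (ccont_comp (fun u : R * R => - (w (fst u) * w (fst u)) * e (snd u) - - (w x * w x) * e (snd u)) expJ);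
    [| apply expJ_cont].
   cc. }
 assert (cs : forall y t, ccont (fun t => c t * Cexp (- (w y * w y) * e t)) t).
 { cc. }
 assert (E : cint (fun t => c t * (- (2 * w1 * w x) * e t) * Cexp (- (w x * w x) * e t)) 0 1 = cint (F x) 0 1).
 { apply cint_ext. intro t. unfold F. recast (RtoC 0).
  rewrite expJ_0. ring. }
 rewrite E. apply (cderive_caratheodory _ (fun y => cint (F y) 0 1)).
 - intro y. rewrite <- cint_minus by (intro; apply cs).
  rewrite <- cint_scal.
  2:{ intro t. apply (continuous_comp_2 (fun _ : R => y) (fun s : R => s) F t);
    [apply continuous_const | apply continuous_id | apply cF]. }
  apply cint_ext. intro t. unfold F. set (z := - (w x * w x) * e t). set (z' := - (w y * w y) * e t).
  assert (Ez : z' - z = RtoC (y - x) * (- (w1 * (w y + w x)) * e t)).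
  { unfold z, z', w. rewrite RtoC_minus. ring. }
  recast (Cexp z * Cexp (z' - z)) by (rewrite <- Cexp_plus; f_equal; ring).
  recast (c t * Cexp z * (Cexp (z' - z) - 1)).
  rewrite Cexp_expJ, Ez at 1. ring.
 - apply ccont_cint_param, cF.
Qed.

(** The integral of exp(- v^2) from 0 to w, that is, the error function up to a constant, rescaled
    to [0,1] so that w may be complex. *)
Definition Ef (w : C) : C := w * cint (fun t => 1 * Cexp (- (w * w) * RtoC (t * t))) 0 1.

Definition Ig (w : C) : C := cint (fun t => RtoC (/ (1 + t * t)) * Cexp (- (w * w) * RtoC (1 + t * t))) 0 1.

Lemma continuous_sq t : continuous (fun t : R => (t * t)%R) t.
Proof. apply (ex_derive_continuous (fun t : R => (t * t)%R)). auto_derive. exact I. Qed.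

(** The product rule produces w1 times the integral of d/dt (t exp(- w^2 t^2)), which is exp(-
    w^2). *)
Lemma cderive_Ef (w0 w1 : C) (x : R) :
 cderive (fun x => Ef (w0 + RtoC x * w1)) x (w1 * Cexp (- ((w0 + RtoC x * w1) * (w0 + RtoC x * w1)))).
Proof.
 set (w := fun x : R => w0 + RtoC x * w1).
 assert (ct : forall t : R, ccont (fun t => RtoC (t * t)) t) by (intro; apply ccont_RtoC, continuous_sq).
 assert (H := Carg_param (fun _ => RtoC 1) (fun t => RtoC (t * t)) w0 w1 x (fun t => ccont_const _ _) ct). cbv zeta in H. fold w in H.
 assert (Hw : cderive w x w1).
 { replace w1 with (RtoC 0 + (RtoC 1 * w1 + RtoC x * RtoC 0)) at 1 by ring.
  apply (cderive_plus (fun _ => w0)); [apply cderive_const |]. apply cderive_mult; [apply cderive_id | apply cderive_const]. }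
 assert (D := cderive_mult _ _ _ _ _ Hw H).
 change (cderive (fun x => Ef (w x)) x (w1 * Cexp (- (w x * w x)))).
 replace (w1 * Cexp (- (w x * w x))) with (w1 * cint (fun t => RtoC 1 * Cexp (- (w x * w x) * RtoC (t * t))) 0 1 +
  w x * cint (fun t => RtoC 1 * (- (2 * w1 * w x) * RtoC (t * t)) * Cexp (- (w x * w x) * RtoC (t * t))) 0 1); [exact D |].
 set (v := - (w x * w x)).
 assert (c1 : forall t, ccont (fun t => RtoC 1 * Cexp (v * RtoC (t * t))) t).
 { cc. }
 assert (c2 : forall t, ccont (fun t => RtoC 1 * (- (2 * w1 * w x) * RtoC (t * t)) * Cexp (v * RtoC (t * t))) t).
 { cc. }
 rewrite <- !cint_scal by assumption.
 rewrite <- cint_plus; [| exact (fun t => ccont_mult _ _ t (ccont_const _ _) (c1 t))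
  | exact (fun t => ccont_mult _ _ t (ccont_const _ _) (c2 t))].
 assert (DF : forall t : R, cderive (fun t : R => w1 * (RtoC t * Cexp (v * RtoC (t * t)))) t
   (w1 * (RtoC 1 * Cexp (v * RtoC (t * t)) + RtoC t * (v * RtoC (2 * t) * Cexp (v * RtoC (t * t)))))).
 { intro t. apply cderive_scal, cderive_mult; [apply cderive_id |]. apply cderive_Cexp, cderive_scal.
  apply (cderive_RtoC (fun t : R => (t * t)%R)). auto_derive; [exact I | ring]. }
 rewrite (cint_ext _ (fun t => w1 * (RtoC 1 * Cexp (v * RtoC (t * t)) + RtoC t * (v * RtoC (2 * t) * Cexp (v * RtoC (t * t)))))).
 - rewrite (cint_derive (fun t : R => w1 * (RtoC t * Cexp (v * RtoC (t * t)))) _ 0 1).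
  + recast v by (rewrite Rmult_1_l; ring). ring.
  + exact DF.
  + intro t. apply ccont_mult; [apply ccont_const |]. apply ccont_plus; [apply c1 |].
   apply ccont_mult; [apply ccont_RtoC, continuous_id |]. apply ccont_mult.
   * apply ccont_mult; [cc |]. apply ccont_RtoC.
    apply (ex_derive_continuous (fun t : R => (2 * t)%R)). auto_derive. exact I.
   * cc.
 - intro t. unfold v. rewrite !RtoC_mult. ring.
Qed.

(** Along the ray from 0 to w the derivatives of Ef^2 and of [Ig] cancel, and [Ig 0] is the integral
    of 1 / (1 + t^2), that is pi / 4. *)
Lemma Ef_Ig (w : C) : Ef w * Ef w + Ig w = PI / 4.
Proof.
 assert (pos : forall t : R, (1 + t * t <> 0)%R) by (intro; nra).
 assert (ct : forall t : R, ccont (fun t => RtoC (1 + t * t)) t).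
 { intro. apply ccont_RtoC. apply (ex_derive_continuous (fun t : R => (1 + t * t)%R)). auto_derive. exact I. }
 assert (ci : forall t : R, ccont (fun t => RtoC (/ (1 + t * t))) t).
 { intro. apply ccont_RtoC. apply (ex_derive_continuous (fun t : R => (/ (1 + t * t))%R)). auto_derive. apply pos. }
 set (f := fun x : R => Ef (RtoC 0 + RtoC x * w) * Ef (RtoC 0 + RtoC x * w) + Ig (RtoC 0 + RtoC x * w)).
 assert (Df : forall x, cderive f x (RtoC 0)).
 { intro x. assert (H1 := cderive_Ef 0 w x).
  assert (H2 := Carg_param _ _ 0 w x ci ct). cbv zeta in H2.
  assert (H := cderive_plus _ _ _ _ _ (cderive_mult _ _ _ _ _ H1 H1) H2). fold f in H.
  set (y := RtoC 0 + RtoC x * w) in *. set (X := Cexp (- (y * y))) in *.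
  match type of H with is_derive _ _ (?a + ?b) => replace (RtoC 0) with (a + b) at 1 end; [exact H |].
  rewrite (cint_ext _ (fun t => (- (2 * w * y) * X) * (RtoC 1 * Cexp (- (y * y) * RtoC (t * t))))).
  - rewrite cint_scal.
   + unfold Ef. fold y. ring.
   + intro t. apply ccont_mult; [cc |]. apply ccont_Cexp, ccont_mult; [cc |].
    apply ccont_RtoC, continuous_sq.
  - intro t. recast (- (y * y) + - (y * y) * RtoC (t * t)) by (rewrite RtoC_plus; ring).
   rewrite Cexp_plus. fold X. rewrite RtoC_inv by apply pos. field. intro E. apply RtoC_inj in E. nra. }
 assert (E := cint_derive f (fun _ => RtoC 0) 0 1 Df (fun x => ccont_const _ _)).
 rewrite cint_const in E.
 recast (f 1%R) by (unfold f; replace (RtoC 0 + RtoC 1 * w) with w by ring; reflexivity).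
 replace (PI / 4) with (f 0%R).
 - apply Ceq_minus. rewrite <- E. ring.
 - unfold f. recast (RtoC 0). unfold Ef. rewrite !Cmult_0_l, Cplus_0_l. unfold Ig.
  rewrite (cint_ext _ (fun t => RtoC (/ (1 + t * t)))).
  + rewrite (cint_derive (fun t => RtoC (atan t))).
   * rewrite atan_1, atan_0, <- RtoC_minus, Rminus_0_r. unfold Rdiv. rewrite RtoC_mult, RtoC_inv by lra. reflexivity.
   * intro t. apply cderive_RtoC. exact (is_derive_atan t).
   * exact ci.
  + intro t. recast (RtoC 0). rewrite Cexp_0. ring.
Qed.

Lemma Ig_bound (w : C) : 0 <= Re (w * w) -> Cmod (Ig w) <= exp (- Re (w * w)).
Proof.
 intro h. recast ((1 - 0) * exp (- Re (w * w)))%R. apply (cint_le _ 0 1 _ Rle_0_1).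
 - intro t. apply ccont_mult.
  + apply ccont_RtoC. apply (ex_derive_continuous (fun t : R => (/ (1 + t * t))%R)). auto_derive. nra.
  + apply ccont_Cexp, ccont_mult; [apply ccont_const |]. apply ccont_RtoC.
   apply (ex_derive_continuous (fun t : R => (1 + t * t)%R)). auto_derive. exact I.
 - intros t _. rewrite Cmod_mult, Cmod_R, Cmod_Cexp.
  assert (h1 : (0 < / (1 + t * t) <= 1)%R).
  { split; [apply Rinv_0_lt_compat; nra |]. rewrite <- Rinv_1. apply Rinv_le_contravar; nra. }
  rewrite Rabs_right by lra. rewrite Re_mult, Im_RtoC, Re_RtoC, Re_opp.
  assert (e := exp_pos (- Re (w * w))).
  apply Rle_trans with (1 * exp (- Re (w * w)))%R; [| lra].
  apply Rmult_le_compat; try lra; [left; apply exp_pos |]. apply exp_le. nra.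
Qed.

Lemma Ef_real_pos (r : R) : 0 < r -> 0 < Re (Ef r).
Proof.
 intro hr.
 set (h := fun t : R => exp (- (r * r) * (t * t))).
 assert (ch : forall t, continuous h t).
 { intro t. apply (ex_derive_continuous h). unfold h. auto_derive. exact I. }
 assert (E : Ef r = RtoC (r * RInt h 0 1)).
 { unfold Ef. rewrite RtoC_mult. f_equal.
  apply is_cint_unique. apply (is_cint_ext (fun t => RtoC (h t))).
  - intro t. unfold h. rewrite Cmult_1_l, <- Cexp_real. f_equal. now rewrite !RtoC_mult, RtoC_opp, RtoC_mult.
  - apply is_cint_pair.
   + apply (RInt_correct (V := R_CompleteNormedModule)), (ex_RInt_continuous (V := R_CompleteNormedModule)). cc.
   + assert (Z := is_RInt_const (V := R_NormedModule) 0 1 0%R).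
    assert (e : scal (1 - 0)%R (0%R : R_NormedModule) = 0%R) by (unfold scal; simpl; unfold mult; simpl; ring).
    rewrite e in Z. exact Z. }
 rewrite E, Re_RtoC. apply Rmult_lt_0_compat; [exact hr |].
 apply RInt_gt_0; [lra | intros; apply exp_pos | intros; apply ch].
Qed.

Lemma Ef_cont_line (w0 w1 : C) (x : R) : ccont (fun x : R => Ef (w0 + RtoC x * w1)) x.
Proof. exact (cderive_cont _ _ _ (cderive_Ef w0 w1 x)). Qed.

(* The hyperbolic region Re w > 0, Re (w^2) >= 2 is convex and there Ef never meets the imaginary axis,
  since Ef^2 stays close to PI / 4. *)
Lemma Ef_Re_pos (w : C) : 0 < Re w -> 2 <= Re (w * w) -> 0 < Re (Ef w).
Proof.
 intros h1 h2. rewrite Re_mult in h2.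
 (* If Re (Ef v) = 0 then Ef^2 has real part at most 0, whereas pi/4 - Re (Ig v) is positive, [Ig]
    being at most exp(-2) < 1/4. *)
 assert (reg : forall v : C, 2 <= Re (v * v) -> Re (Ef v) <> 0%R).
 { intros v hv E. assert (H := Ef_Ig v). assert (B := Ig_bound v ltac:(lra)).
  assert (a : exp (- Re (v * v)) <= / 4).
  { apply Rle_trans with (exp (- (2))); [apply exp_le; lra |]. rewrite exp_Ropp. apply Rinv_le_contravar; [lra |].
   assert (e1 := exp_ineq1 1 ltac:(lra)). recast (1 + 1)%R. rewrite exp_plus. nra. }
  assert (b := Rle_trans _ _ _ (Cmod_Re (Ig v)) B).
  assert (P := f_equal Re H). rewrite Re_plus, Re_mult, E in P.
  assert (Ep : Re (PI / 4) = (PI / 4)%R) by (replace (PI / 4) with (RtoC (PI / 4)); [reflexivity | unfold Rdiv; rewrite RtoC_mult, RtoC_inv by lra; reflexivity]).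
  rewrite Ep in P. apply Rabs_le_between in b. assert (P3 := PI2_3_2). nra. }
 (* The segment from 2 to w stays in the convex region. [Ef] is positive at 2, so a sign change of
    its real part would give a zero on the segment. *)
 set (f := fun x : R => Re (Ef (RtoC 2 + RtoC x * (w - RtoC 2)))).
 assert (cf : forall x, continuous f x) by (intro x; apply ccont_Re, Ef_cont_line).
 assert (nz : forall x, (0 <= x <= 1)%R -> f x <> 0%R).
 { intros x hx. apply reg. rewrite Re_mult, Re_plus, Im_plus, Re_mult, Im_mult, Re_minus, Im_minus, !Re_RtoC, !Im_RtoC.
  set (u := Re w) in *. set (v := Im w) in *.
  assert (hu : 1 <= u) by nra.
  recast (x * x * (u * u - v * v) + 4 * (x * (1 - x)) * u + 4 * ((1 - x) * (1 - x)))%R.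
  assert (0 <= x * (1 - x))%R by nra. nra. }
 destruct (Rle_or_lt (Re (Ef w)) 0) as [h | h]; [exfalso | exact h].
 assert (f1 : f 1%R = Re (Ef w)) by (unfold f; do 2 f_equal; ring).
 assert (f0 : f 0%R = Re (Ef (RtoC 2))) by (unfold f; do 2 f_equal; ring).
 assert (p0 := Ef_real_pos 2 ltac:(lra)). rewrite <- f0 in p0. rewrite <- f1 in h.
 destruct (IVT_gen f 0 1 0) as [x [hx Ex]].
 - intro y. apply continuity_pt_filterlim, cf.
 - rewrite Rmin_right, Rmax_left by lra. lra.
 - rewrite Rmin_left, Rmax_right in hx by lra. now apply (nz x hx).
Qed.

(** With c = sqrt(pi)/2 one has (Ef - c)(Ef + c) = - Ig, and the second factor is at least 1/2
    because Re Ef > 0: this selects the square root. *)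
Lemma Ef_near (w : C) : 0 < Re w -> 2 <= Re (w * w) ->
 Cmod (Ef w - RtoC (sqrt PI / 2)) <= 2 * exp (- Re (w * w)).
Proof.
 intros h1 h2. assert (hp := Ef_Re_pos w h1 h2). assert (B := Ig_bound w ltac:(lra)). assert (H := Ef_Ig w).
 assert (P := PI_RGT_0). set (c := (sqrt PI / 2)%R).
 assert (hs : 1 <= sqrt PI) by (rewrite <- sqrt_1; apply sqrt_le_1_alt; assert (h := PI2_3_2); lra).
 assert (hc : RtoC c * RtoC c = PI / 4).
 { rewrite <- RtoC_mult. unfold c. recast (sqrt PI * sqrt PI / 4)%R by field.
  rewrite sqrt_sqrt by lra. unfold Rdiv. now rewrite RtoC_mult, RtoC_inv by lra. }
 assert (E : (Ef w - RtoC c) * (Ef w + RtoC c) = - Ig w).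
 { recast (Ef w * Ef w - RtoC c * RtoC c). rewrite hc, <- H. ring. }
 assert (Em := f_equal Cmod E). rewrite Cmod_mult, Cmod_opp in Em.
 assert (hl : 1 / 2 <= Cmod (Ef w + RtoC c)).
 { eapply Rle_trans; [| apply Cmod_Re]. rewrite Re_plus, Re_RtoC. eapply Rle_trans; [| apply Rle_abs]. unfold c. lra. }
 assert (a := Cmod_ge_0 (Ef w - RtoC c)). nra.
Qed.

Lemma Ef_opp w : Ef (- w) = - Ef w.
Proof. unfold Ef. recast (w * w). ring. Qed.

Notation is_cint_line f l :=
 (is_RInt_gen (V := C_R_NormedModule) f (Rbar_locally m_infty) (Rbar_locally p_infty) (l : C)).

Lemma is_cint_line_primitive (f F : R -> C) (lp lm : C) : (forall a b, is_cint f a b (F b - F a)) ->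
 (forall eps : R, 0 < eps -> exists N : R, forall x, N <= x -> Cmod (F x - lp) < eps) ->
 (forall eps : R, 0 < eps -> exists N : R, forall x, x <= - N -> Cmod (F x - lm) < eps) ->
 is_cint_line f (lp - lm).
Proof.
 intros HF Hp Hm P [eps HP].
 destruct (Hp (eps / 2)%R) as [N1 H1]; [destruct eps; simpl; lra |].
 destruct (Hm (eps / 2)%R) as [N2 H2]; [destruct eps; simpl; lra |].
 apply (Filter_prod _ _ _ (fun a => a < - N2)%R (fun b => N1 < b)%R).
 - now exists (- N2)%R.
 - now exists N1.
 - intros a b ha hb. simpl. exists (F b - F a). split; [apply HF |]. apply HP.
  assert (c : Cmod ((F b - F a) - (lp - lm)) < eps).
  { recast ((F b - lp) + - (F a - lm)).
   eapply Rle_lt_trans; [apply Cmod_triangle |]. rewrite Cmod_opp.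
   specialize (H1 b ltac:(lra)). specialize (H2 a ltac:(lra)). lra. }
  assert (c1 := Cmod_Re ((F b - F a) - (lp - lm))). assert (c2 := Cmod_Im ((F b - F a) - (lp - lm))).
  split; unfold ball; simpl; unfold AbsRing_ball, abs, minus, plus, opp; simpl.
  + eapply Rle_lt_trans; [exact c1 | exact c].
  + eapply Rle_lt_trans; [exact c2 | exact c].
Qed.

Lemma quadratic_large (a b c : R) : 0 < a -> exists N, 1 <= N /\ forall x, N <= x -> x <= a * (x * x) + b * x + c.
Proof.
 intro ha. exists ((Rabs b + Rabs c + 1) / a + 1)%R. assert (h1 := Rabs_pos b). assert (h2 := Rabs_pos c).
 assert (h0 : 0 <= (Rabs b + Rabs c + 1) / a) by (apply Rmult_le_pos; [lra | left; now apply Rinv_0_lt_compat]).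
 split; [lra |]. intros x hx.
 assert (hax : Rabs b + Rabs c + 1 <= a * x).
 { apply Rle_trans with (a * ((Rabs b + Rabs c + 1) / a))%R; [right; field; lra | apply Rmult_le_compat_l; lra]. }
 assert (b1 := Rle_abs (- b)). assert (c1 := Rle_abs (- c)). rewrite Rabs_Ropp in b1, c1. nra.
Qed.

Lemma exp_neg_small (eps : R) : 0 < eps -> exists N, 0 < N /\ forall x, N <= x -> exp (- x) < eps.
Proof.
 intro he. exists (/ eps)%R. assert (hi := Rinv_0_lt_compat _ he). split; [exact hi |]. intros x hx.
 assert (h := exp_ineq1 x ltac:(lra)). rewrite exp_Ropp. rewrite <- (Rinv_inv eps).
 apply Rinv_lt_contravar; [apply Rmult_lt_0_compat; lra | lra].
Qed.

Lemma gaussian_line (A beta : C) : 0 < Re A -> 0 < Re (A * A) ->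
 is_cint_line (fun x : R => Cexp (- ((A * beta + x * A) * (A * beta + x * A)))) (RtoC (sqrt PI) / A).
Proof.
 intros h1 h2. set (w := fun x : R => A * beta + RtoC x * A).
 assert (hA : A <> 0) by (intro E; rewrite E in h1; simpl in h1; lra).
 assert (hw : forall x, Re (w x) = (Re A * x + Re (A * beta))%R).
 { intro x. unfold w. rewrite Re_plus, (Re_mult (RtoC x)), Re_RtoC, Im_RtoC. ring. }
 assert (hw2 : forall x, Re (w x * w x) = (Re (A * A) * (x * x) + 2 * Re (A * A * beta) * x + Re (A * A * (beta * beta)))%R).
 { intro x. recast (RtoC (x * x) * (A * A) + RtoC (2 * x) * (A * A * beta) + A * A * (beta * beta)) by (unfold w; rewrite !RtoC_mult; ring).
  rewrite !Re_plus, !(Re_mult (RtoC _)), !Re_RtoC, !Im_RtoC. ring. }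
 set (c := RtoC (sqrt PI / 2)).
 (* The sign [s] treats both ends of the line at once; at the negative end it is undone by the
    oddness of [Ef]. *)
 assert (Hlim : forall s : R, (s = 1 \/ s = -1)%R -> forall eps : R, 0 < eps -> exists N, 0 < N /\
  forall x, N <= x -> Cmod (Ef (RtoC s * w (s * x)%R) - c) < eps).
 { intros s hs eps he. assert (ss : (s * s = 1)%R) by (destruct hs as [-> | ->]; ring).
  destruct (exp_neg_small (eps / 2)%R ltac:(lra)) as [N1 [hN1 H1]].
  destruct (quadratic_large (Re (A * A)) (2 * Re (A * A * beta) * s) (Re (A * A * (beta * beta))) h2) as [N2 [hN2 H2]].
  set (N3 := ((Rabs (Re (A * beta)) + 1) / Re A)%R).
  exists (Rmax (Rmax N1 2) (Rmax N2 N3)). assert (m1 := Rmax_l (Rmax N1 2) (Rmax N2 N3)). assert (m2 := Rmax_r (Rmax N1 2) (Rmax N2 N3)).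
  assert (m3 := Rmax_l N1 2). assert (m4 := Rmax_r N1 2). assert (m5 := Rmax_l N2 N3). assert (m6 := Rmax_r N2 N3).
  split; [lra |]. intros x hx.
  assert (q : x <= Re (RtoC s * w (s * x)%R * (RtoC s * w (s * x)%R))).
  { recast (RtoC (s * s) * (w (s * x)%R * w (s * x)%R)) by (rewrite RtoC_mult; ring).
   rewrite ss, Cmult_1_l, hw2. specialize (H2 x ltac:(lra)).
   nra. }
  assert (p : 0 < Re (RtoC s * w (s * x)%R)).
  { rewrite Re_mult, Re_RtoC, Im_RtoC, hw.
   assert (hx3 : Rabs (Re (A * beta)) + 1 <= Re A * x).
   { apply Rle_trans with (Re A * N3)%R; [right; unfold N3; field; lra | apply Rmult_le_compat_l; lra]. }
   assert (e1 := Rle_abs (Re (A * beta))). assert (e2 := Rle_abs (- Re (A * beta))). rewrite Rabs_Ropp in e2.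
   nra. }
  eapply Rle_lt_trans; [apply (Ef_near _ p); lra |].
  assert (e : exp (- Re (RtoC s * w (s * x)%R * (RtoC s * w (s * x)%R))) <= exp (- x)) by (apply exp_le; lra).
  specialize (H1 x ltac:(lra)). lra. }
 assert (hA0 : 0 < Cmod A) by now apply Cmod_gt_0.
 replace (RtoC (sqrt PI) / A) with (/ A * c - / A * (- c)).
 2:{ recast ((c + c) / A) by (unfold Cdiv; ring). unfold c. rewrite <- RtoC_plus.
   recast (sqrt PI) by field. reflexivity. }
 apply (is_cint_line_primitive _ (fun x => / A * Ef (w x))).
 - intros a b. assert (cf : forall x : R, ccont (fun x : R => Cexp (- (w x * w x))) x).
  { intro x. assert (cw : ccont w x).
   { apply ccont_plus; [apply ccont_const |]. cc. }
   cc. }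
  rewrite <- (cint_derive (fun x => / A * Ef (w x)) (fun x => Cexp (- (w x * w x)))).
  + apply is_cint_cont. exact cf.
  + intro x. recast (/ A * (A * Cexp (- (w x * w x)))) by (field; exact hA).
   apply cderive_scal. apply cderive_Ef.
  + exact cf.
 - intros eps he. destruct (Hlim 1%R (or_introl eq_refl) (eps * Cmod A)%R) as [N [_ H]]; [now apply Rmult_lt_0_compat |].
  exists N. intros x hx. specialize (H x hx). rewrite Rmult_1_l, Cmult_1_l in H.
  recast (/ A * (Ef (w x) - c)). rewrite Cmod_mult, Cmod_inv by exact hA.
  apply (Rmult_lt_reg_l (Cmod A)); [exact hA0 |]. rewrite <- Rmult_assoc, Rinv_r by lra. lra.
 - intros eps he. destruct (Hlim (-1)%R (or_intror eq_refl) (eps * Cmod A)%R) as [N [_ H]]; [now apply Rmult_lt_0_compat |].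
  exists N. intros x hx. specialize (H (- x)%R ltac:(lra)). recast x in H.
  recast (- RtoC 1) in H by (rewrite <- RtoC_opp; f_equal; ring).
  recast (- w x) in H. rewrite Ef_opp in H.
  recast (- (/ A * (- Ef (w x) - c))). rewrite Cmod_opp, Cmod_mult, Cmod_inv by exact hA.
  apply (Rmult_lt_reg_l (Cmod A)); [exact hA0 |]. rewrite <- Rmult_assoc, Rinv_r by lra. lra.
Qed.

Lemma cint_primitive (f : R -> C) x : (forall x, ccont f x) -> cderive (fun x => cint f 0 x) x (f x).
Proof.
 intro H. apply (is_derive_RInt (V := C_R_NormedModule) f (fun x => cint f 0 x) 0 x).
 - exists (mkposreal 1 Rlt_0_1). intros y _. now apply is_cint_cont.
 - apply H.
Qed.

Lemma cderive_shift (f : R -> C) (v x : R) (l : C) : cderive f (x + v)%R l -> cderive (fun x => f (x + v)%R) x l.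
Proof.
 intro H. assert (D := is_derive_comp (K := R_AbsRing) (V := C_R_NormedModule) f (fun x : R => (x + v)%R) x l 1%R H).
 recast (scal (K := R_Ring) (V := C_R_NormedModule) 1%R l) by apply (scal_one (V := C_R_NormedModule)). apply D.
 auto_derive; [exact I | ring].
Qed.

(** The difference has as primitive minus the integral of f over the window from x - v to x + v,
    which tends to 0 at both ends. This replaces a shift of the line of integration. *)
Lemma cint_line_difference (f : R -> C) (v : R) : 0 < v -> (forall x, ccont f x) ->
 (forall eps : R, 0 < eps -> exists N : R, forall x, N <= Rabs x -> Cmod (f x) <= eps) ->
 is_cint_line (fun x => f (x + - v)%R - f (x + v)%R) (RtoC 0).
Proof.
 intros hv hf H. recast (RtoC 0 - RtoC 0).
 set (G := fun x => cint f 0 x). set (F := fun x => G (x + - v)%R - G (x + v)%R).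
 assert (EF : forall x, F x = - cint f (x + - v) (x + v)).
 { intro x. unfold F, G. assert (E := RInt_Chasles (V := C_R_CompleteNormedModule) f 0 (x + - v) (x + v)
   (ex_cint_cont f _ _ hf) (ex_cint_cont f _ _ hf)).
  rewrite <- E. change (@plus _) with Cplus. ring. }
 assert (Hsmall : forall eps : R, 0 < eps -> exists N, forall x, N <= Rabs x -> Cmod (F x) < eps).
 { intros eps he. destruct (H (eps / (4 * v))%R) as [N HN]; [apply Rdiv_lt_0_compat; lra |].
  exists (N + v)%R. intros x hx. rewrite EF, Cmod_opp.
  assert (hB : Cmod (cint f (x + - v) (x + v)) <= (x + v - (x + - v)) * (eps / (4 * v))).
  { apply cint_le; [lra | exact hf |]. intros y hy. apply HN.
   assert (t := Rabs_triang_inv x (x - y)). recast y in t.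
   assert (t2 : Rabs (x - y) <= v) by (apply Rabs_le; lra). lra. }
  recast (eps / 2)%R in hB by (field; lra). lra. }
 apply (is_cint_line_primitive _ F).
 - intros a b. assert (cs : forall u x : R, ccont (fun x => f (x + u)%R) x).
  { intros u x. apply (continuous_comp (fun x : R => (x + u)%R) f); [| apply hf].
   apply (ex_derive_continuous (fun x : R => (x + u)%R)). auto_derive. exact I. }
  assert (cd : forall x, ccont (fun x => f (x + - v)%R - f (x + v)%R) x) by (intro; apply ccont_minus; apply cs).
  rewrite <- (cint_derive F (fun x => f (x + - v)%R - f (x + v)%R)).
  + now apply is_cint_cont.
  + intro x. apply cderive_minus; apply cderive_shift; now apply cint_primitive.
  + exact cd.
 - intros eps he. destruct (Hsmall eps he) as [N HN]. exists (Rabs N). intros x hx.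
  recast (F x). apply HN. assert (a := Rle_abs N). assert (b := Rle_abs x). lra.
 - intros eps he. destruct (Hsmall eps he) as [N HN]. exists (Rabs N). intros x hx.
  recast (F x). apply HN. assert (a := Rle_abs N). assert (b := Rle_abs (- x)).
  rewrite Rabs_Ropp in b. lra.
Qed.

(** * Lines avoiding the zeros of theta *)
(** The radii d / ((j+1)(j+2)) telescope, so intervals of these radii have total length at most 2 d
    = eps. *)
Lemma almost_every_separated (P : nat -> R) : almost_every (fun sigma =>
 exists d, 0 < d /\ forall j, d / ((INR j + 1) * (INR j + 2)) <= Rabs (sigma - P j)).
Proof.
 intros eps he. set (d := (eps / 2)%R). set (w := fun j => (d / ((INR j + 1) * (INR j + 2)))%R).
 assert (hp : forall j, 0 < (INR j + 1) * (INR j + 2)) by (intro j; assert (h := pos_INR j); nra).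
 assert (hw : forall j, 0 < w j) by (intro j; apply Rdiv_lt_0_compat; [unfold d; lra | apply hp]).
 exists (fun j => P j - w j)%R, (fun j => P j + w j)%R. split; [| split].
 - intro j. specialize (hw j). lra.
 - intros x hx. apply NNPP. intro hn. apply hx. exists d. split; [unfold d; lra |].
  intro j. fold (w j). apply Rnot_lt_le. intro hlt. apply hn. exists j. apply Rabs_lt_between in hlt. lra.
 - intro N. apply Rle_trans with (2 * d * (1 - / (INR N + 2)))%R.
  + right. induction N as [| N IH].
   * rewrite sum_O. unfold w. simpl. field.
   * rewrite sum_Sn, IH. change (@plus _) with Rplus. unfold w. assert (h := pos_INR N). rewrite S_INR. field. lra.
  + assert (h := pos_INR N). assert (hi : 0 < / (INR N + 2)) by (apply Rinv_0_lt_compat; lra). unfold d. nra.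
Qed.

Lemma to_nat_le x y : INR (to_nat (x, y)) <= (INR x + INR y + 1) ^ 2.
Proof.
 assert (H := to_nat_spec x y). apply (f_equal INR) in H. rewrite plus_INR, !mult_INR, (S_INR (y + x)), plus_INR in H. change (INR 2) with (1 + 1)%R in H.
 assert (hx := pos_INR x). assert (hy := pos_INR y). nra.
Qed.

(** The real point obtained by projecting k T - kap along the direction eta. *)
Definition rho (T eta kap : C) (k : R) : R :=
 (Re (k * T - kap) - Re eta * (Im (k * T - kap) / Im eta))%R.

Definition rho_seq (T eta : C) (kap : nat -> C) (j : nat) : R :=
 let q := of_nat j in let a := of_nat (fst q) in let k := of_nat (snd a) in let m := of_nat (snd q) in
 (rho T eta (kap (fst a)) (INR (fst k) - INR (snd k)) + INR (fst m) - INR (snd m))%R.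

Definition rho_idx (c : nat) (k m : Z) : nat :=
 to_nat (to_nat (c, to_nat (Z.to_nat k, Z.to_nat (- k))), to_nat (Z.to_nat m, Z.to_nat (- m))).

Lemma Z_split (k : Z) : (INR (Z.to_nat k) - INR (Z.to_nat (- k)) = IZR k)%R.
Proof. rewrite !INR_IZR_INZ, <- minus_IZR. f_equal. lia. Qed.

Lemma Z_split_abs (k : Z) : (INR (Z.to_nat k) + INR (Z.to_nat (- k)) = Rabs (IZR k))%R.
Proof. rewrite !INR_IZR_INZ, <- plus_IZR, <- abs_IZR. f_equal. lia. Qed.

Lemma rho_seq_idx T eta kap c k m : rho_seq T eta kap (rho_idx c k m) = (rho T eta (kap c) (IZR k) + IZR m)%R.
Proof.
 unfold rho_seq, rho_idx. rewrite !cancel_of_to. cbn [fst snd]. rewrite !cancel_of_to. cbn [fst snd].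
 rewrite !cancel_of_to. cbn [fst snd]. rewrite Z_split, <- (Z_split m). ring.
Qed.

(** Cantor pairing is quadratic, so the nested index is a polynomial in |k| and |m|: it is at most
    36 K^8 M^4. Hence the excluded radii decrease only polynomially. *)
Lemma rho_idx_le (k m : Z) : let j := rho_idx 0 k m in
 ((INR j + 1) * (INR j + 2) <= 1600 * (Rabs (IZR k) + 1) ^ 16 * (Rabs (IZR m) + 1) ^ 8)%R.
Proof.
 intro j. set (K := (Rabs (IZR k) + 1)%R). set (M := (Rabs (IZR m) + 1)%R).
 assert (hK : 1 <= K) by (unfold K; assert (h := Rabs_pos (IZR k)); lra).
 assert (hM : 1 <= M) by (unfold M; assert (h := Rabs_pos (IZR m)); lra).
 assert (a1 := to_nat_le (Z.to_nat k) (Z.to_nat (- k))). rewrite Z_split_abs in a1. fold K in a1.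
 assert (a2 := to_nat_le (Z.to_nat m) (Z.to_nat (- m))). rewrite Z_split_abs in a2. fold M in a2.
 set (A1 := to_nat (Z.to_nat k, Z.to_nat (- k))) in *. set (A2 := to_nat (Z.to_nat m, Z.to_nat (- m))) in *.
 assert (a3 := to_nat_le 0 A1). simpl (INR 0) in a3.
 assert (a4 := to_nat_le (to_nat (0%nat, A1)) A2). fold (rho_idx 0 k m) in a4. fold j in a4.
 change (to_nat (to_nat (0%nat, A1), A2)) with j in a4. set (A3 := to_nat (0%nat, A1)) in *.
 assert (p1 := pos_INR A1). assert (p2 := pos_INR A2). assert (p3 := pos_INR A3). assert (p4 := pos_INR j).
 assert (K2 : 1 <= K ^ 2) by nra. assert (M2 : 1 <= M ^ 2) by nra.
 assert (b3 : INR A3 <= 4 * (K ^ 2) ^ 2) by nra.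
 set (X := (K ^ 2)%R) in *. set (Y := (M ^ 2)%R) in *. assert (X2 : 1 <= X ^ 2) by nra. set (W := (X ^ 2)%R) in *.
 assert (b4 : INR A3 + INR A2 + 1 <= 6 * (W * Y)) by nra.
 assert (WY : 1 <= W * Y) by nra. set (U := (W * Y)%R) in *.
 assert (b5 : INR j <= 36 * U ^ 2) by nra. assert (U2 : 1 <= U ^ 2) by nra. set (V := (U ^ 2)%R) in *.
 apply Rle_trans with (1600 * V ^ 2)%R; [nra |]. right. unfold V, U, W, X, Y. ring.
Qed.

Lemma pow_le_exp (N : nat) (y : R) : (0 < N)%nat -> 0 <= y -> y ^ N <= INR N ^ N * exp y.
Proof.
 intros hN hy. assert (hN' : 0 < INR N) by now apply lt_0_INR.
 assert (h : y <= INR N * exp (y / INR N)).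
 { apply Rle_trans with (INR N * (y / INR N))%R; [right; field; lra |]. apply Rmult_le_compat_l; [lra |].
  assert (e := exp_ineq1_le (y / INR N)). lra. }
 apply Rle_trans with ((INR N * exp (y / INR N)) ^ N)%R; [apply pow_incr; lra |].
 rewrite Rpow_mult_distr, <- exp_INR_mult. right. do 2 f_equal. field. lra.
Qed.

Lemma sin_lower (x : R) : (0 <= x <= 2)%R -> x / 3 <= sin x.
Proof.
 intro hx. destruct (pre_sin_bound x 0 ltac:(lra) ltac:(lra)) as [h _].
 unfold sin_approx, sin_term in h. simpl in h. nra.
Qed.

Lemma one_minus_e2pi_real (y : R) : Rabs y <= 1 / 2 -> Rabs y <= Cmod (1 - e2pi y).
Proof.
 intro hy. assert (P3 := PI2_3_2). assert (P4 := PI_4).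
 assert (hF : forall x : R, e2pi x = (cos (2 * PI * x), sin (2 * PI * x))%R).
 { intro x. unfold e2pi, Cexp. assert (e : 2 * PI * Ci * x = (0, 2 * PI * x)%R) by (apply C_ext; simpl; ring).
  rewrite e. simpl. rewrite exp_0, !Rmult_1_l. reflexivity. }
 assert (E : 1 - e2pi y = e2pi (y / 2)%R * (e2pi (- (y / 2))%R - e2pi (y / 2)%R)).
 { rewrite RtoC_opp. set (h := RtoC (y / 2)). recast (h + h) by (unfold h; rewrite <- RtoC_plus; f_equal; field).
  rewrite e2pi_plus. recast (e2pi h * e2pi (- h) - e2pi h * e2pi h).
  rewrite <- (e2pi_plus h (- h)). recast (RtoC 0). now rewrite e2pi_0. }
 rewrite E, Cmod_mult, Cmod_e2pi, Im_RtoC, Rmult_0_r, Ropp_0, exp_0, Rmult_1_l.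
 eapply Rle_trans; [| apply Cmod_Im]. rewrite Im_minus, !hF. cbn [Im snd].
 recast (- (PI * y))%R by field. recast (PI * y)%R by field.
 rewrite sin_neg. recast (- (2 * sin (PI * y)))%R. rewrite Rabs_Ropp.
 destruct (Rle_or_lt 0 y) as [h | h].
 - rewrite (Rabs_right y) in * by lra. assert (s := sin_lower (PI * y) ltac:(nra)).
  eapply Rle_trans; [| apply Rle_abs]. nra.
 - rewrite (Rabs_left y) in * by lra. assert (s := sin_lower (PI * - y) ltac:(nra)).
  recast (- (PI * y))%R in s. rewrite sin_neg in s.
  eapply Rle_trans; [| apply Rabs_maj2]. nra.
Qed.

Lemma near_integer (r : R) : exists m : Z, Rabs (r - IZR m) <= 1 / 2.
Proof. exists (up (r - 1 / 2)). destruct (archimed (r - 1 / 2)) as [a b]. apply Rabs_le. lra. Qed.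

(** A small divisor estimate. The nearest integer m grows at most linearly with k, so the separation
    of sigma is at least an inverse polynomial in k; an exponential bound is enough here. *)
Lemma separated_lower T eta kap sigma d : kap 0%nat = - (2 * eta) -> Im eta <> 0%R -> 0 < d ->
 (forall j, d / ((INR j + 1) * (INR j + 2)) <= Rabs (sigma - rho_seq T eta kap j)) ->
 exists c, 0 < c /\ forall k : Z, c * exp (- Rabs (IZR k)) <= Cmod (1 - e2pi (sigma - rho T eta 0 (IZR k))%R).
Proof.
 intros h0 he hd H. set (r1 := rho T eta 0 1).
 assert (hr : forall k : R, rho T eta 0 k = (k * r1)%R).
 { intro k. unfold r1, rho. rewrite !Re_minus, !Im_minus, !Re_mult, !Im_mult, !Re_RtoC, !Im_RtoC. lra. }
 (* [kap 0] is - 2 eta, parallel to the line, so the projections do not see it. *)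
 assert (hk0 : forall k : R, rho T eta (kap 0%nat) k = rho T eta 0 k).
 { intro k. rewrite h0. unfold rho. rewrite !Re_minus, !Im_minus, Re_opp, Im_opp, !Re_mult, !Im_mult, !Re_RtoC, !Im_RtoC. field; auto. }
 set (C0 := (Rabs sigma + Rabs r1 + 2)%R). assert (p1 := Rabs_pos sigma). assert (p2 := Rabs_pos r1).
 (* The exponents 16 of K and 8 of M add up to K^24 once M <= C0 K; [pow_le_exp] with N = 24 trades
    this power for an exponential. *)
 set (B := (1600 * C0 ^ 8 * (INR 24 ^ 24 * exp 1))%R).
 assert (hB : 0 < B).
 { unfold B. apply Rmult_lt_0_compat; [apply Rmult_lt_0_compat; [lra | apply pow_lt; unfold C0; lra] |].
  apply Rmult_lt_0_compat; [apply pow_lt, lt_0_INR; lia | apply exp_pos]. }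
 exists (d / B)%R. split; [now apply Rdiv_lt_0_compat |]. intro k.
 destruct (near_integer (sigma - rho T eta 0 (IZR k))) as [m hm].
 replace (e2pi (sigma - rho T eta 0 (IZR k))%R) with (e2pi (sigma - rho T eta 0 (IZR k) - IZR m)%R).
 2:{ rewrite <- (e2pi_plus_IZR _ m). f_equal. rewrite <- RtoC_plus. f_equal. ring. }
 eapply Rle_trans; [| now apply one_minus_e2pi_real].
 specialize (H (rho_idx 0 k m)). rewrite rho_seq_idx, hk0 in H.
 recast (sigma - rho T eta 0 (IZR k) - IZR m)%R in H.
 eapply Rle_trans; [| exact H]. set (j := rho_idx 0 k m) in *.
 assert (hj := rho_idx_le k m). fold j in hj. cbv zeta in hj.
 set (K := (Rabs (IZR k) + 1)%R) in *. assert (hK : 1 <= K) by (unfold K; assert (h := Rabs_pos (IZR k)); lra).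
 assert (hM : Rabs (IZR m) + 1 <= C0 * K).
 { rewrite hr in hm. recast (sigma - IZR k * r1 + - (sigma - IZR k * r1 - IZR m))%R.
  assert (t1 := Rabs_triang (sigma - IZR k * r1) (- (sigma - IZR k * r1 - IZR m))).
  assert (t2 := Rabs_triang sigma (- (IZR k * r1))). rewrite Rabs_Ropp in t1, t2. rewrite Rabs_mult in t2.
  change (sigma + - (IZR k * r1))%R with (sigma - IZR k * r1)%R in t2.
  assert (hk : (Rabs (IZR k) = K - 1)%R) by (unfold K; ring). rewrite hk in t2. unfold C0. nra. }
 assert (hpos : 0 < (INR j + 1) * (INR j + 2)) by (assert (h := pos_INR j); nra).
 assert (hJ : (INR j + 1) * (INR j + 2) <= B * exp (Rabs (IZR k))).
 { eapply Rle_trans; [exact hj |].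
  apply Rle_trans with (1600 * K ^ 16 * (C0 * K) ^ 8)%R.
  - apply Rmult_le_compat_l; [apply Rmult_le_pos; [lra | apply pow_le; lra] |].
   apply pow_incr. split; [assert (h := Rabs_pos (IZR m)); lra | exact hM].
  - recast (1600 * C0 ^ 8 * K ^ 24)%R. unfold B. rewrite !Rmult_assoc.
   apply Rmult_le_compat_l; [lra |]. apply Rmult_le_compat_l; [apply pow_le; unfold C0; lra |].
   rewrite <- exp_plus. recast K by (unfold K; ring). apply pow_le_exp; [lia | lra]. }
 rewrite exp_Ropp. unfold Rdiv at 1. rewrite Rmult_assoc, <- Rinv_mult. unfold Rdiv.
 apply Rmult_le_compat_l; [lra |]. apply Rinv_le_contravar; assumption.
Qed.

Lemma lattice_on_line (T eta kap : C) (sigma x : R) (k m : Z) : Im eta <> 0%R ->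
 eta * x + sigma + kap = IZR k * T + IZR m -> sigma = (rho T eta kap (IZR k) + IZR m)%R.
Proof.
 intros he E. assert (E' : IZR k * T - kap = eta * x + sigma - IZR m).
 { recast (eta * x + sigma + kap - kap - IZR m). rewrite E. ring. }
 unfold rho. rewrite E', !Re_minus, !Im_minus, !Re_plus, !Im_plus, Re_mult, Im_mult, !Re_RtoC, !Im_RtoC. field; auto.
Qed.

(** A zero on the line would make sigma equal to one of the enumerated projections, at distance 0
    instead of a positive one. *)
Lemma separated_avoids T eta kap sigma d : 0 < Im T -> Im eta <> 0%R -> 0 < d ->
 (forall j, d / ((INR j + 1) * (INR j + 2)) <= Rabs (sigma - rho_seq T eta kap j)) ->
 forall (c : nat) (x : R), th0 (eta * x + sigma + kap c) T <> 0.
Proof.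
 intros hT he hd H c x. apply th0_neq_0; [exact hT |]. intros k E.
 assert (E1 : e2pi (eta * x + sigma + kap c + IZR k * T) = 1).
 { recast (1 - (1 - e2pi (eta * x + sigma + kap c + IZR k * T))). rewrite E. ring. }
 apply e2pi_eq_1 in E1. destruct E1 as [m E1].
 assert (L := lattice_on_line T eta (kap c) sigma x (- k) m he).
 rewrite opp_IZR, RtoC_opp in L. specialize (L ltac:(rewrite <- E1; ring)).
 specialize (H (rho_idx c (- k) m)). rewrite rho_seq_idx, opp_IZR in H.
 set (j := rho_idx c (- k) m) in *.
 assert (h : (sigma - (rho T eta (kap c) (- IZR k) + IZR m) = 0)%R) by lra. rewrite h, Rabs_R0 in H.
 assert (hp : 0 < d / ((INR j + 1) * (INR j + 2))).
 { apply Rdiv_lt_0_compat; [exact hd |]. assert (a := pos_INR j). nra. }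
 lra.
Qed.

Lemma th0_shift_Z x0 s (k : Z) : 0 < Im s -> exists c : C, c <> 0 /\
 forall x, th0 (x0 + x + IZR k * s) s = c * e2pi (- (IZR k * x)) * th0 (x0 + x) s.
Proof.
 intro hs.
 assert (P : forall n : nat, exists c : C, c <> 0 /\ forall x, th0 (x + INR n * s) s = c * e2pi (- (INR n * x)) * th0 x s).
 { induction n as [| n [c [hc IH]]].
  - exists 1. split; [exact C1_nz |]. intro x. simpl. recast x.
   recast (RtoC 0). rewrite e2pi_0. ring.
  - exists (- c * e2pi (- (INR n * s))). split.
   + apply Cmult_neq_0; [| apply e2pi_neq_0]. intro E. apply hc. recast (- - c). rewrite E. ring.
   + intro x. recast (x + s + INR n * s) by (rewrite S_INR, RtoC_plus; ring).
    rewrite IH, th0_shift by exact hs.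
    recast (- (INR n * x) + - x) by (rewrite S_INR, RtoC_plus; ring).
    recast (- (INR n * x) + - (INR n * s)). rewrite !e2pi_plus. ring. }
 assert (Q : exists c : C, c <> 0 /\ forall x, th0 (x + IZR k * s) s = c * e2pi (- (IZR k * x)) * th0 x s).
 { destruct (Z_le_gt_dec 0 k) as [h | h].
  - destruct (P (Z.to_nat k)) as [c H]. rewrite INR_IZR_INZ, Z2Nat.id in H by exact h. now exists c.
  - destruct (P (Z.to_nat (- k))) as [c [hc H]]. set (j := - IZR k).
   assert (Ej : RtoC (INR (Z.to_nat (- k))) = j) by (unfold j; rewrite INR_IZR_INZ, Z2Nat.id, opp_IZR, RtoC_opp by lia; reflexivity).
   rewrite Ej in H. recast (- j) by (unfold j; ring).
   exists (/ c * e2pi (- (j * (j * s)))). split.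
   + apply Cmult_neq_0; [| apply e2pi_neq_0]. intro E. apply C1_nz. recast (c * / c) by (field; exact hc). rewrite E. ring.
   + intro x. specialize (H (x + - j * s)). recast x in H. rewrite H.
    recast (j * x).
    recast (- (j * x) + j * (j * s)). rewrite e2pi_plus, !e2pi_opp.
    assert (n1 := e2pi_neq_0 (j * x)). assert (n2 := e2pi_neq_0 (j * (j * s))). field. cc. }
 destruct Q as [c [hc H]]. exists (c * e2pi (- (IZR k * x0))). split; [apply Cmult_neq_0; [exact hc | apply e2pi_neq_0] |].
 intro x. rewrite H. recast (- (IZR k * x0) + - (IZR k * x)). rewrite e2pi_plus. ring.
Qed.

(* Moving [m] into a fundamental strip costs only exponentials on the contours. *)
Lemma dint_reduce T m0 j g dg g' dg' phi psi (k : Z) : 0 < Im T -> period_path g dg -> period_path g' dg' ->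
 stacked T j g g' -> pcont g phi -> pcont g' psi -> th0 (m0 + IZR k * T) T <> 0 ->
 dint T (m0 + IZR k * T) g dg g' dg' phi psi / th0 (m0 + IZR k * T) T =
 dint T m0 g dg g' dg' (fun t => phi t * e2pi (- (IZR k * t))) (fun t => psi t * e2pi (IZR k * t)) / th0 m0 T.
Proof.
 intros hT P P' H hphi hpsi hz. destruct (th0_shift_Z m0 T k hT) as [c [hc Hc]].
 assert (E0 := Hc (RtoC 0)). recast (m0 + IZR k * T) in E0.
 recast m0 in E0. recast (RtoC 0) in E0.
 rewrite e2pi_0, Cmult_1_r in E0. assert (h0 : th0 m0 T <> 0) by (intro E; apply hz; rewrite E0, E; ring).
 assert (cg := period_path_cont _ _ P). assert (cg' := period_path_cont _ _ P').
 assert (ce : forall h (a : C), (forall s, ccont h s) -> pcont h (fun t => e2pi (a * t))).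
 { intros h a hh s. cc. }
 assert (Ed : dint T (m0 + IZR k * T) g dg g' dg' phi psi =
  c * dint T m0 g dg g' dg' (fun t => phi t * e2pi (- (IZR k * t))) (fun t => psi t * e2pi (IZR k * t))).
 { assert (cphi' : pcont g (fun t => phi t * e2pi (- (IZR k * t)))).
  { apply pcont_mult; [exact hphi |]. apply (pcont_ext g (fun t => e2pi ((- IZR k) * t))); [intros; f_equal; ring | now apply ce]. }
  unfold dint. rewrite <- pint_scal; [| exact P' |].
  2:{ apply pcont_mult; [apply pcont_mult; [exact hpsi | now apply ce] | now apply (inner_pcont T m0 j)]. }
  apply pint_ext. intros t' h'.
  transitivity (psi t' * (c * e2pi (IZR k * t') * pint g dg (fun t => phi t * e2pi (- (IZR k * t)) * kth T m0 (t - t')))); [| ring].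
  apply (f_equal (Cmult _)). rewrite <- pint_scal; [| exact P | now apply (inner_integrand_pcont T m0 j g dg g')].
  apply pint_ext. intros t h. unfold kth.
  recast (m0 + (t - t') + IZR k * T). rewrite Hc.
  recast (t - t' + m0).
  recast (IZR k * t' + - (IZR k * t)). rewrite e2pi_plus. unfold Cdiv. ring. }
 rewrite Ed, E0. field. cc.
Qed.

(** In the strip 0 <= Im m <= Im T only the factors 1 - e(m) and 1 - e(T - m) of the product can be
    small; the zeros of the remaining factors keep the distance Im T from the strip. *)
Lemma th0_inv_bound T : 0 < Im T -> exists M, 0 < M /\ forall m : C, (0 <= Im m <= Im T)%R -> th0 m T <> 0 ->
 Cmod (/ th0 m T) <= M * (/ Cmod (1 - e2pi m) * / Cmod (1 - e2pi (T - m))).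
Proof.
 intro hT. set (K := fun t : C => (0 <= Im t <= Im T)%R).
 set (S0 := fun w : C => (exists i : nat, w = IZR (- (1)) * (T + INR i * T)) \/ (exists i : nat, w = IZR (- -1) * (T + T + INR i * T))).
 assert (P3 := PI2_3_2).
 assert (HK : Kgood S0 K).
 { split.
  - exists (Im T). intros t ht. apply Rabs_le. unfold K in ht. lra.
  - assert (hq : exp (- (2 * PI * Im T)) < 1) by (rewrite <- exp_0; apply exp_increasing; nra).
   exists (1 - exp (- (2 * PI * Im T)))%R. split; [lra |]. intros t ht. unfold K in ht.
   destruct H as [[i ->] | [i ->]]; assert (hi := pos_INR i).
   + assert (c := Cmod_triang_inv 1 (e2pi (t - IZR (- (1)) * (T + INR i * T)))). rewrite Cmod_1, Cmod_e2pi in c.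
    eapply Rle_trans; [| exact c]. apply Rplus_le_compat_l, Ropp_le_contravar, exp_le.
    rewrite Im_minus, Im_mult, Im_plus, Re_plus, Im_mult, !Im_RtoC, !Re_RtoC. simpl (- (1))%Z.
    assert (0 <= INR i * Im T)%R by (apply Rmult_le_pos; lra). nra.
   + assert (c := Cmod_triang_inv (e2pi (t - IZR (- -1) * (T + T + INR i * T))) 1). rewrite Cmod_1, Cmod_minus_sym, Cmod_e2pi in c.
    eapply Rle_trans; [| exact c]. set (y := Im T) in *.
    assert (a : 2 * PI * y <= - (2 * PI * Im (t - IZR (- -1) * (T + T + INR i * T)))).
    { rewrite Im_minus, Im_mult, !Im_plus, !Re_plus, Im_mult, !Im_RtoC, !Re_RtoC. simpl (- -1)%Z. fold y.
     assert (0 <= INR i * y)%R by (apply Rmult_le_pos; lra). nra. }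
    apply exp_le in a. assert (b := exp_ineq1_le (2 * PI * y)). assert (hh := exp_pos (2 * PI * y)).
    rewrite exp_Ropp. assert (e : (exp (2 * PI * y) * / exp (2 * PI * y) = 1)%R) by (apply Rinv_r; lra).
    assert (f : 0 < / exp (2 * PI * y)) by now apply Rinv_0_lt_compat.
    set (u := exp (2 * PI * y)) in *. set (v := (/ u)%R) in *.
    assert (w : 0 <= (u - 1) * (u - 1) * v) by (apply Rmult_le_pos; [apply Rle_0_sqr | lra]).
    nra. }
 destruct (RatLim_poch_inv S0 K 1 T T HK hT (or_introl eq_refl)) as [R1 N1]; [intro i; left; now exists i |].
 destruct (RatLim_poch_inv S0 K (-1) (T + T) T HK hT (or_intror eq_refl)) as [R2 N2]; [intro i; right; now exists i |].
 destruct (RatLim_bounded S0 K _ HK R1) as [M1 [hM1 HM1]]. destruct (RatLim_bounded S0 K _ HK R2) as [M2 [hM2 HM2]].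
 exists (M1 * M2)%R. split; [now apply Rmult_lt_0_compat |]. intros m hm hz.
 specialize (HM1 m hm). specialize (HM2 m hm). specialize (N1 m hm). specialize (N2 m hm).
 recast (m + T) in * by (simpl; ring). recast (T - m + T) in * by (simpl; ring).
 assert (E : th0 m T = (1 - e2pi m) * (1 - e2pi (T - m)) * (poch (m + T) T * poch (T - m + T) T)).
 { unfold th0. rewrite (poch_step m T hT), (poch_step (T - m) T hT). ring. }
 rewrite E in hz |- *.
 assert (G : forall u v : C, u * v <> 0 -> u <> 0 /\ v <> 0).
 { intros u v k. split; intro e; apply k; rewrite e; ring. }
 destruct (G _ _ hz) as [z1 z2]. destruct (G _ _ z1) as [z3 z4].
 recast ((/ poch (m + T) T * / poch (T - m + T) T) * (/ (1 - e2pi m) * / (1 - e2pi (T - m)))) by (field; repeat split; assumption).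
 rewrite !Cmod_mult, (Cmod_inv (1 - e2pi m)), (Cmod_inv (1 - e2pi (T - m))) by assumption.
 apply Rmult_le_compat_r.
 - apply Rmult_le_pos; left; apply Rinv_0_lt_compat; now apply Cmod_gt_0.
 - apply Rmult_le_compat; auto using Cmod_ge_0.
Qed.

(** Compares a point with its projection r along eta. The modulus of e(v eta) alone keeps 1 - e(r +
    v eta) above B |v|, and moving to r costs at most A |v|, so the loss is a bounded factor. *)
Lemma one_minus_slanted eta (Y : R) : Im eta <> 0%R -> 0 < Y -> exists c, 0 < c /\
 forall r v : R, Rabs (v * Im eta) <= Y -> c * Cmod (1 - e2pi r) <= Cmod (1 - e2pi (r + v * eta)).
Proof.
 intros he hY. assert (P3 := PI2_3_2).
 assert (hie : 0 < Rabs (Im eta)) by now apply Rabs_pos_lt.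
 set (V := (Y / Rabs (Im eta))%R).
 set (A := (2 * PI * Cmod eta * exp (2 * PI * Cmod eta * V))%R).
 set (B := (2 * PI * Rabs (Im eta) * exp (- (2 * PI * Y)))%R).
 assert (hA : 0 <= A).
 { unfold A. assert (h := Cmod_ge_0 eta). apply Rmult_le_pos; [| left; apply exp_pos]. nra. }
 assert (hB : 0 < B) by (unfold B; apply Rmult_lt_0_compat; [nra | apply exp_pos]).
 assert (hAB : 0 <= A / B) by (apply Rmult_le_pos; [lra | left; now apply Rinv_0_lt_compat]).
 exists (/ (1 + A / B))%R. split; [apply Rinv_0_lt_compat; lra |]. intros r v hv.
 assert (hv' : Rabs v <= V).
 { unfold V. apply (Rmult_le_reg_r (Rabs (Im eta))); [exact hie |]. rewrite <- Rabs_mult.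
  recast Y by (field; lra). exact hv. }
 assert (hr : Cmod (e2pi r) = 1%R) by (rewrite Cmod_e2pi, Im_RtoC, Rmult_0_r, Ropp_0; apply exp_0).
 set (X := Cmod (1 - e2pi (r + v * eta))).
 assert (h1 : B * Rabs v <= X).
 { set (y := (2 * PI * (v * Im eta))%R).
  assert (hm : Cmod (e2pi (r + v * eta)) = exp (- y)).
  { rewrite Cmod_e2pi. f_equal. unfold y. rewrite Im_plus, Im_mult, !Im_RtoC, Re_RtoC. ring. }
  assert (t1 := Cmod_triang_inv 1 (e2pi (r + v * eta))). assert (t2 := Cmod_triang_inv (e2pi (r + v * eta)) 1).
  rewrite Cmod_minus_sym in t2. rewrite Cmod_1, hm in t1, t2. fold X in t1, t2.
  assert (hy : Rabs y = (2 * PI * (Rabs v * Rabs (Im eta)))%R).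
  { unfold y. rewrite (Rabs_mult (2 * PI)), (Rabs_mult v), (Rabs_right (2 * PI)) by lra. ring. }
  rewrite Rabs_mult in hv.
  assert (hyY : Rabs y <= 2 * PI * Y) by (rewrite hy; nra).
  assert (eb : exp (- (2 * PI * Y)) <= 1) by (rewrite <- exp_0; apply exp_le; nra).
  assert (ep := exp_pos (- (2 * PI * Y))). assert (ya := Rabs_pos y).
  recast (Rabs y * exp (- (2 * PI * Y)))%R by (rewrite hy; unfold B; ring).
  destruct (Rle_or_lt 0 y) as [h | h].
  - rewrite (Rabs_right y) in * by lra. assert (e1 := exp_ineq1_le y). assert (e2 : exp (- (2 * PI * Y)) <= exp (- y)) by (apply exp_le; lra).
   assert (e3 : (exp y * exp (- y) = 1)%R) by (rewrite <- exp_plus, Rplus_opp_r; apply exp_0). nra.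
  - rewrite (Rabs_left y) in * by lra. assert (e1 := exp_ineq1_le (- y)). nra. }
 assert (h2 : Cmod (e2pi (v * eta) - 1) <= A * Rabs v).
 { unfold e2pi. eapply Rle_trans; [apply Cexp_minus_1_le |].
  assert (hc : Cmod (2 * PI * Ci * (v * eta)) = (2 * PI * Cmod eta * Rabs v)%R).
  { rewrite !Cmod_mult, !Cmod_R, Cmod_Ci, (Rabs_right 2), (Rabs_right PI) by lra. ring. }
  rewrite hc. unfold A. assert (hce := Cmod_ge_0 eta). assert (hav := Rabs_pos v).
  assert (ee : exp (2 * PI * Cmod eta * Rabs v) <= exp (2 * PI * Cmod eta * V)).
  { apply exp_le. apply Rmult_le_compat_l; [apply Rmult_le_pos; lra | exact hv']. }
  assert (h0 : 0 <= 2 * PI * Cmod eta * Rabs v) by (repeat (apply Rmult_le_pos; [| assumption]); lra).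
  nra. }
 assert (h3 : Cmod (1 - e2pi r) <= X + A * Rabs v).
 { recast ((1 - e2pi (r + v * eta)) + e2pi r * (e2pi (v * eta) - 1)) by (rewrite e2pi_plus; ring).
  eapply Rle_trans; [apply Cmod_triangle |]. rewrite Cmod_mult, hr, Rmult_1_l. fold X. lra. }
 apply (Rmult_le_reg_l (1 + A / B)); [lra |]. rewrite <- Rmult_assoc, Rinv_r, Rmult_1_l by lra.
 eapply Rle_trans; [exact h3 |]. rewrite Rmult_plus_distr_r, Rmult_1_l. apply Rplus_le_compat_l.
 unfold Rdiv. rewrite Rmult_assoc. apply Rmult_le_compat_l; [exact hA |].
 apply (Rmult_le_reg_l B); [exact hB |]. rewrite <- (Rmult_assoc B (/ B)), Rinv_r by lra. lra.
Qed.

Lemma Cmod_one_minus_e2pi_opp (w : C) : Cmod (1 - e2pi (- w)) = (Cmod (1 - e2pi w) * exp (2 * PI * Im w))%R.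
Proof.
 replace (1 - e2pi (- w)) with (- (e2pi (- w) * (1 - e2pi w))).
 - rewrite Cmod_opp, Cmod_mult, Cmod_e2pi, Im_opp, Rmult_comm. f_equal. f_equal. ring.
 - rewrite e2pi_opp. assert (n := e2pi_neq_0 w). field. exact n.
Qed.

(** After reduction to the fundamental strip, the twists e(k t) on the bounded contours and the
    small divisors each cost a factor exponential in |k|, and |k| is at most linear in |x|. *)
Lemma dint_line_growth T eta sigma j g dg g' dg' phi psi (Mphi Mpsi c : R) : 0 < Im T -> Im eta <> 0%R ->
 period_path g dg -> period_path g' dg' -> stacked T j g g' -> pcont g phi -> pcont g' psi ->
 0 < Mphi -> (forall t, on_path g t -> Cmod (phi t) <= Mphi) ->
 0 < Mpsi -> (forall t, on_path g' t -> Cmod (psi t) <= Mpsi) ->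
 0 < c -> (forall k : Z, c * exp (- Rabs (IZR k)) <= Cmod (1 - e2pi (sigma - rho T eta 0 (IZR k))%R)) ->
 exists C0, 0 < C0 /\ forall x, th0 (line eta sigma x) T <> 0 ->
  Cmod (dint T (line eta sigma x) g dg g' dg' phi psi / th0 (line eta sigma x) T) <= exp (C0 * (1 + Rabs x)).
Proof.
 intros hT he P P' H hphi hpsi hMphi HMphi hMpsi HMpsi hc Hc.
 assert (P3 := PI2_3_2).
 destruct (dint_bound T j g dg g' dg' hT P P' H) as [B [hB HB]].
 destruct (path_Im_bounded g (period_path_cont _ _ P)) as [M1 [hM1 h1]].
 destruct (path_Im_bounded g' (period_path_cont _ _ P')) as [M2 [hM2 h2]].
 destruct (RatLim_bounded _ _ _ (Kgood_strip (M1 + M2 + Im T)) (Entire_th0 0 T hT _)) as [N [hN HN]].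
 destruct (th0_inv_bound T hT) as [M [hM HM]].
 destruct (one_minus_slanted eta (Im T) he hT) as [c1 [hc1 Hc1]].
 set (L := (2 * PI * M1 + 2 * PI * M2 + 2)%R).
 assert (hL : 0 < L) by (unfold L; assert (0 < PI * M1)%R by (apply Rmult_lt_0_compat; lra);
  assert (0 < PI * M2)%R by (apply Rmult_lt_0_compat; lra); lra).
 set (c2 := (c1 * c)%R). assert (hc2 : 0 < c2) by (apply Rmult_lt_0_compat; assumption).
 set (D := (Mphi * N * Mpsi * B * M * (/ c2 * / c2) * exp (1 + 2 * PI * Im T))%R).
 assert (hD : 0 < D).
 { unfold D. assert (h := Rinv_0_lt_compat _ hc2). assert (e := exp_pos (1 + 2 * PI * Im T)).
  repeat (apply Rmult_lt_0_compat; try assumption). }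
 set (kap := (Rabs (Im eta) / Im T + 1)%R).
 assert (hkap : 0 < kap).
 { unfold kap. assert (h := Rabs_pos (Im eta)). assert (0 <= Rabs (Im eta) / Im T)%R by (apply Rmult_le_pos; [exact h | left; now apply Rinv_0_lt_compat]). lra. }
 exists (Rabs (ln D) + L * kap)%R. split.
 { assert (h := Rabs_pos (ln D)). nra. }
 intros x hz. set (m := line eta sigma x) in *.
 assert (Em : Im m = (x * Im eta)%R) by (unfold m, line; rewrite Im_plus, Im_mult, !Im_RtoC, Re_RtoC; ring).
 (* The number of periods T by which m is moved into the strip. *)
 set (k := (up (Im m / Im T) - 1)%Z).
 destruct (archimed (Im m / Im T)) as [ar1 ar2].
 assert (hk : (0 <= Im m / Im T - IZR k <= 1)%R) by (unfold k; rewrite minus_IZR; lra).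
 set (m0 := m - IZR k * T). assert (Em0 : m = m0 + IZR k * T) by (unfold m0; ring).
 assert (Im0 : Im m0 = ((Im m / Im T - IZR k) * Im T)%R).
 { unfold m0. rewrite Im_minus, Im_mult, Im_RtoC, Re_RtoC. field. lra. }
 assert (hm0 : (0 <= Im m0 <= Im T)%R) by (rewrite Im0; nra).
 assert (hkx : Rabs (IZR k) <= kap * (1 + Rabs x)).
 { recast (Im m / Im T + - (Im m / Im T - IZR k))%R.
  eapply Rle_trans; [apply Rabs_triang |]. rewrite Rabs_Ropp, (Rabs_right (_ - _)) by lra.
  assert (e : Rabs (Im m / Im T) = (Rabs x * (Rabs (Im eta) / Im T))%R).
  { rewrite Em. unfold Rdiv. rewrite !Rabs_mult, (Rabs_right (/ Im T)); [ring |].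
   apply Rle_ge; left; now apply Rinv_0_lt_compat. }
  rewrite e. assert (hx := Rabs_pos x). unfold kap. assert (h := Rabs_pos (Im eta)).
  assert (0 <= Rabs (Im eta) / Im T)%R by (apply Rmult_le_pos; [exact h | left; now apply Rinv_0_lt_compat]). nra. }
 assert (hz0 : th0 m0 T <> 0).
 { destruct (th0_shift_Z m0 T k hT) as [a [ha Ha]]. intro E. apply hz. rewrite Em0.
  recast (m0 + RtoC 0 + IZR k * T). rewrite Ha. recast m0. rewrite E. ring. }
 rewrite Em0, (dint_reduce T m0 j g dg g' dg' phi psi k) by (try assumption; now rewrite <- Em0).
 unfold Cdiv. rewrite Cmod_mult.
 set (K := Rabs (IZR k)) in *. assert (hK : 0 <= K) by apply Rabs_pos.
 assert (ce : forall h (a : C), (forall s, ccont h s) -> pcont h (fun t => e2pi (a * t))).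
 { intros h a hh s. cc. }
 assert (b1 : Cmod (dint T m0 g dg g' dg' (fun t => phi t * e2pi (- (IZR k * t)))%C (fun t => psi t * e2pi (IZR k * t))%C) <=
  (Mphi * exp (2 * PI * K * M1)) * N * (Mpsi * exp (2 * PI * K * M2)) * B).
 { apply HB.
  - apply pcont_mult; [exact hphi |].
   apply (pcont_ext g (fun t => e2pi ((- IZR k) * t))); [intros; f_equal; ring | apply ce, (period_path_cont _ _ P)].
  - cc.
  - apply Rmult_le_pos; [lra | left; apply exp_pos].
  - lra.
  - intros t ht. rewrite Cmod_mult. apply Rmult_le_compat; try apply Cmod_ge_0; [now apply HMphi |].
   recast (IZR (- k) * t) by (rewrite opp_IZR, RtoC_opp; ring).
   eapply Rle_trans; [apply Cmod_e2pi_bound, h1, ht |]. rewrite opp_IZR, Rabs_Ropp. reflexivity.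
  - intros t ht. rewrite Cmod_mult. apply Rmult_le_compat; try apply Cmod_ge_0; [now apply HMpsi |].
   apply Cmod_e2pi_bound, h2, ht.
  - intros t t' ht ht'. recast (t - t' + m0 + 0). apply (HN (t - t' + m0)).
   unfold strip. rewrite Im_plus, Im_minus. specialize (h1 _ ht). specialize (h2 _ ht').
   apply Rabs_le_between in h1. apply Rabs_le_between in h2. apply Rabs_le. lra. }
 (* Applied twice: with q = k for 1 - e(m0), and with q = k + 1 for 1 - e(T - m0), whose argument is
    the opposite of m - (k + 1) T. *)
 assert (low : forall (q : Z) (w : C), w = RtoC (sigma - rho T eta 0 (IZR q)) + RtoC (x - IZR q * (Im T / Im eta)) * eta ->
  Rabs (Im w) <= Im T -> c2 * exp (- Rabs (IZR q)) <= Cmod (1 - e2pi w)).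
 { intros q w -> hw. rewrite Im_plus, Im_mult, !Im_RtoC, Re_RtoC in hw.
  eapply Rle_trans; [| apply Hc1].
  - unfold c2. rewrite Rmult_assoc. apply Rmult_le_compat_l; [lra | apply Hc].
  - eapply Rle_trans; [| exact hw]. right. f_equal. ring. }
 assert (Ew : forall q : Z, m - IZR q * T = RtoC (sigma - rho T eta 0 (IZR q)) + RtoC (x - IZR q * (Im T / Im eta)) * eta).
 { intro q. unfold m, line, rho. apply C_ext.
  - rewrite Re_minus, !Re_plus, !Re_mult, !Re_RtoC, !Im_RtoC, Re_minus, Im_minus, Re_mult, Im_mult, !Re_RtoC, !Im_RtoC.
   lra.
  - rewrite Im_minus, !Im_plus, !Im_mult, !Re_RtoC, !Im_RtoC. field; auto. }
 assert (l1 : c2 * exp (- K) <= Cmod (1 - e2pi m0)).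
 { apply low; [apply Ew |]. apply Rabs_le. lra. }
 assert (l2 : c2 * exp (- (K + 1)) * exp (- (2 * PI * Im T)) <= Cmod (1 - e2pi (T - m0))).
 { set (w := m0 - T).
  assert (Ew' : w = m - IZR (k + 1) * T) by (unfold w, m0; rewrite plus_IZR, RtoC_plus; ring).
  assert (hw : (- Im T <= Im w <= 0)%R) by (unfold w; rewrite Im_minus; lra).
  assert (l := low (k + 1)%Z w ltac:(rewrite Ew'; apply Ew) ltac:(apply Rabs_le; lra)).
  recast (- w) by (unfold w; ring). rewrite Cmod_one_minus_e2pi_opp.
  apply Rmult_le_compat; try (left; apply exp_pos).
  - apply Rmult_le_pos; [lra | left; apply exp_pos].
  - eapply Rle_trans; [| exact l]. apply Rmult_le_compat_l; [lra |]. apply exp_le.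
   assert (t := Rabs_triang (IZR k) 1). rewrite (Rabs_right 1) in t by lra. rewrite <- plus_IZR in t. fold K in t. lra.
  - apply exp_le. nra. }
 assert (p1 : 0 < c2 * exp (- K)) by (apply Rmult_lt_0_compat; [exact hc2 | apply exp_pos]).
 assert (p2 : 0 < c2 * exp (- (K + 1)) * exp (- (2 * PI * Im T))).
 { apply Rmult_lt_0_compat; [apply Rmult_lt_0_compat; [exact hc2 |] |]; apply exp_pos. }
 assert (b2 : Cmod (/ th0 m0 T) <= M * (/ (c2 * exp (- K)) * / (c2 * exp (- (K + 1)) * exp (- (2 * PI * Im T))))).
 { eapply Rle_trans; [exact (HM m0 hm0 hz0) |]. apply Rmult_le_compat_l; [lra |].
  apply Rmult_le_compat; try (left; apply Rinv_0_lt_compat; lra); apply Rinv_le_contravar; assumption. }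
 eapply Rle_trans; [apply Rmult_le_compat; [apply Cmod_ge_0 | apply Cmod_ge_0 | exact b1 | exact b2] |].
 apply Rle_trans with (D * exp (L * K))%R.
 - right. unfold D, L. rewrite !Rinv_mult, <- !exp_Ropp, !Ropp_involutive.
  recast (2 * PI * K * M1 + 2 * PI * K * M2 + K + K)%R.
  rewrite !exp_plus. ring.
 - recast (exp (ln D)) by now apply exp_ln. rewrite <- exp_plus. apply exp_le.
  rewrite ln_exp. assert (a1 := Rle_abs (ln D)). assert (a2 := Rabs_pos (ln D)). assert (a3 := Rabs_pos x).
  assert (a4 : L * K <= L * (kap * (1 + Rabs x))) by (apply Rmult_le_compat_l; lra).
  rewrite Rmult_plus_distr_r. assert (0 <= Rabs (ln D) * Rabs x)%R by now apply Rmult_le_pos. lra.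
Qed.

(** * Evaluation of the heat integral *)

Lemma is_cint_line_scal (c : C) (f : R -> C) (l : C) : is_cint_line f l -> is_cint_line (fun x => c * f x) (c * l).
Proof.
 intros H P HP.
 assert (cc := ccont_mult (T := C_UniformSpace) (fun _ => c) (fun y => y) l (ccont_const c l) (ccont_id l)).
 assert (H' : filter_prod (Rbar_locally m_infty) (Rbar_locally p_infty)
  (fun ab => exists y, is_cint f (fst ab) (snd ab) y /\ P (c * y))) by exact (H (fun y => P (c * y)) (cc P HP)).
 unfold filtermapi. revert H'. apply filter_imp.
 intros [a b] [y [hy Py]]. exists (c * y). split; [now apply is_cint_scal | exact Py].
Qed.

Lemma is_cint_line_unique (f : R -> C) (l : C) : is_cint_line f l ->
 RInt_gen (V := C_R_CompleteNormedModule) f (Rbar_locally m_infty) (Rbar_locally p_infty) = l.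
Proof. intro H. apply (is_RInt_gen_unique (V := C_R_CompleteNormedModule) f l H). Qed.

Lemma sqrt_PI_sqr : RtoC (sqrt PI) * RtoC (sqrt PI) = PI.
Proof. rewrite <- RtoC_mult, sqrt_sqrt; [reflexivity |]. left. apply PI_RGT_0. Qed.

(** A square root of i pi eta / 4, the coefficient of x^2 in i pi mu^2 / (4 eta) on the line. The
    choice of [s] in the right half plane makes it the root with positive real part. *)
Definition gwidth (s : C) : C := RtoC (sqrt PI) * s / 4.

Definition gline (eta s d : C) (sigma x : R) : C :=
 let A := gwidth s in let beta := (sigma + d) / eta in Cexp (- ((A * beta + x * A) * (A * beta + x * A))).

Lemma gline_eq (eta d s : C) (sigma x : R) : s * s = 4 * Ci * eta -> eta <> 0 ->
 gline eta s d sigma x = Cexp (- (Ci * PI / (4 * eta) * ((line eta sigma x + d) * (line eta sigma x + d)))).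
Proof.
 intros hs he. unfold gline, gwidth. set (r := RtoC (sqrt PI)). cbv zeta.
 recast ((r * r) * (s * s) / 16 * (((sigma + d) / eta + x) * ((sigma + d) / eta + x))) by (field; exact he).
 rewrite hs. unfold r. rewrite sqrt_PI_sqr. apply (f_equal Cexp). unfold line. field; auto.
Qed.

Lemma gwidth_pos (eta s : C) : s * s = 4 * Ci * eta -> 0 < Re s -> Im eta < 0 ->
 0 < Re (gwidth s) /\ 0 < Re (gwidth s * gwidth s).
Proof.
 intros hs hr he. assert (P := PI_RGT_0). assert (sp := sqrt_lt_R0 PI P).
 assert (E : gwidth s = RtoC (sqrt PI / 4) * s).
 { unfold gwidth, Cdiv, Rdiv. rewrite RtoC_mult, RtoC_inv by lra. ring. }
 split.
 - rewrite E, Re_mult, Re_RtoC, Im_RtoC, Rmult_0_l, Rminus_0_r. nra.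
 - replace (gwidth s * gwidth s) with (RtoC (PI / 16) * (s * s)).
  + rewrite hs. recast (PI / 16 * (4 * - Im eta))%R by (rewrite !Re_mult, !Im_mult, !Re_RtoC, !Im_RtoC; unfold Ci; cbn [Re Im fst snd]; ring).
   nra.
  + rewrite E. replace (PI / 16)%R with (sqrt PI / 4 * (sqrt PI / 4))%R; [rewrite RtoC_mult; ring |].
   recast (sqrt PI * sqrt PI / 16)%R by field. rewrite sqrt_sqrt by lra. reflexivity.
Qed.

(** The exponent is quadratic in x with leading coefficient Re (i pi eta / 4) > 0, because Im eta <
    0; it absorbs any linear growth. *)
Lemma gline_decay (eta d s : C) (sigma C0 : R) : s * s = 4 * Ci * eta -> 0 < Re s -> Im eta < 0 ->
 forall eps, 0 < eps -> exists N : R, forall x : R, N <= Rabs x ->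
  Cmod (gline eta s d sigma x) * exp (C0 * (1 + Rabs x)) <= eps.
Proof.
 intros hs hr he eps heps. destruct (gwidth_pos eta s hs hr he) as [_ hA].
 set (A := gwidth s) in *. set (beta := (sigma + d) / eta).
 assert (hw2 : forall x : R, Re ((A * beta + x * A) * (A * beta + x * A)) =
   (Re (A * A) * (x * x) + 2 * Re (A * A * beta) * x + Re (A * A * (beta * beta)))%R).
 { intro x. recast (RtoC (x * x) * (A * A) + RtoC (2 * x) * (A * A * beta) + A * A * (beta * beta)) by (rewrite !RtoC_mult; ring).
  rewrite !Re_plus, !(Re_mult (RtoC _)), !Re_RtoC, !Im_RtoC. ring. }
 set (b := (2 * Re (A * A * beta))%R) in *. set (c := Re (A * A * (beta * beta))) in *.
 destruct (quadratic_large (Re (A * A)) (- (Rabs b + C0)) (c - C0) hA) as [N1 [hN1 H1]].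
 destruct (exp_neg_small eps heps) as [N2 [hN2 H2]].
 exists (Rmax N1 N2). intros x hx. assert (m1 := Rmax_l N1 N2). assert (m2 := Rmax_r N1 N2).
 left. eapply Rle_lt_trans; [| apply (H2 (Rabs x)); lra].
 unfold gline. fold A. fold beta. rewrite Cmod_Cexp, <- exp_plus. apply exp_le. rewrite Re_opp, hw2.
 specialize (H1 (Rabs x) ltac:(lra)).
 assert (hxx : (Rabs x * Rabs x = x * x)%R) by (rewrite <- Rabs_mult, Rabs_right; nra). rewrite hxx in H1.
 assert (hb : - (Rabs b * Rabs x) <= b * x).
 { rewrite <- Rabs_mult. assert (t := Rle_abs (- (b * x))). rewrite Rabs_Ropp in t. lra. }
 lra.
Qed.

(** The products [poch T T] cancel: the residue of the kernel depends neither on T nor on m, and the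
    residue term becomes a pure Gaussian in mu. *)
Lemma kernc_kres T m : 0 < Im T -> th0 m T <> 0 -> kernc T * (kres T m / th0 m T) = - (2 * PI * Ci).
Proof. intros hT h. unfold kernc, kres. assert (n := poch_self_neq_0 T hT). field. cc. Qed.

Definition prefactor (eta lam nu m : C) : C :=
 Cexp (Ci * PI / (4 * eta) * ((lam - nu) * (lam - nu))) * e2pi nu *
 Cexp (- (Ci * PI / (4 * eta) * ((m - 2 * eta + (lam - nu)) * (m - 2 * eta + (lam - nu))))).

Definition heat_exponential eta lam nu mu : C :=
 Cexp (- (Ci * PI * lam * mu / (2 * eta))) * Cexp (- (Ci * PI * (mu * mu) / (4 * eta))) *
 Cexp (- (Ci * PI * (- mu) * nu / (2 * eta))).

(* The two completions of the square that make the two halves of the integrand translates of each other. *)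
Lemma heat_exponential_minus eta lam nu mu : eta <> 0 ->
 heat_exponential eta lam nu mu * e2pi (lam + (mu - 2 * eta)) = prefactor eta lam nu (mu - 2 * eta).
Proof.
 intro he. unfold heat_exponential, prefactor, e2pi. rewrite <- !Cexp_plus. apply (f_equal Cexp). field; auto.
Qed.

Lemma heat_exponential_plus eta lam nu mu : eta <> 0 ->
 heat_exponential eta lam nu mu * e2pi nu = prefactor eta lam nu (mu + 2 * eta).
Proof.
 intro he. unfold heat_exponential, prefactor, e2pi. rewrite <- !Cexp_plus. apply (f_equal Cexp). field; auto.
Qed.

Definition heat_integrand (n : nat) Lam z tau p eta (a b : nat) lam nu mu : C :=
 csum (fun c => u n Lam a c z lam mu tau (tau + p) eta * Q Lam c mu (tau + p) eta
  * Cexp (- (Ci * PI * (mu * mu) / (4 * eta))) * u n Lam c b z (- mu) nu (tau + p) p eta) 1 n.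

(** The shift by 2 eta in mu is a shift by 2 in the parameter x, so [cint_line_difference] disposes
    of the two ends. Its decay hypothesis is [dint_line_growth] against [gline_decay]. *)
Lemma heat_line_integral n Lam z (tau p eta s : C) (a b : nat) lam nu (sigma d : R) :
 (1 <= n)%nat -> csum Lam 1 n = 2 ->
 0 < Im tau -> 0 < Im p -> Im eta < 0 -> nonresonant n Lam z tau p eta ->
 s * s = 4 * Ci * eta -> 0 < Re s -> (1 <= a <= n)%nat -> (1 <= b <= n)%nat -> 0 < d ->
 let kap := fun c => - (2 * eta) + 2 * eta * csum Lam 1 c in
 (forall j, d / ((INR j + 1) * (INR j + 2)) <= Rabs (sigma - rho_seq (tau + p) eta kap j)) ->
 is_cint_line (fun x => heat_integrand n Lam z tau p eta a b lam nu (line eta sigma x) * eta)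
  (- (2 * PI * Ci) * e2pi (- (2 * eta)) * eta * Cexp (Ci * PI / (4 * eta) * ((lam - nu) * (lam - nu))) *
   u_integral n Lam a b z lam nu tau p eta * (RtoC (sqrt PI) / gwidth s)).
Proof.
 intros hn HL ht hp heta Hres hs hr ha hb hd kap Hsep. set (T := tau + p) in *.
 assert (hT : 0 < Im T) by (unfold T; rewrite Im_plus; lra).
 assert (he0 : Im eta <> 0%R) by lra.
 assert (he : eta <> 0) by (intro E; rewrite E in heta; simpl in heta; lra).
 assert (kap0 : kap 0%nat = - (2 * eta)) by (unfold kap; rewrite csum_lt by lia; ring).
 assert (Hz := separated_avoids T eta kap sigma d hT he0 hd Hsep).
 destruct (contour_exists n Lam z tau p eta ht hp Hres) as (g & dg & g' & dg' & gp & dgp & HC).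
 pose proof HC as (C1 & C2 & C3 & S1 & S2 & Z1 & Z2).
 assert (P1 := proj1 C1). assert (P2 := proj1 C2).
 assert (cg := period_path_cont _ _ P1). assert (cg' := period_path_cont _ _ P2).
 assert (A1 := contour_avoids _ _ _ _ _ _ _ _ C1). assert (A2 := contour_avoids _ _ _ _ _ _ _ _ C2).
 set (phi := Phic true n Lam z eta tau T a lam). set (psi := fun t => Phic false n Lam z eta p T b nu (t + p)).
 assert (Mphi : Mer (PhiS n Lam z eta tau T) phi) by (intros K HK; exact (RatLim_Phic true n Lam z eta tau T a lam K ht hT HK)).
 assert (Mpsi : Mer (fun w => PhiS n Lam z eta p T (w + p)) psi).
 { apply (Mer_shift (PhiS n Lam z eta p T) p). intros K HK. exact (RatLim_Phic false n Lam z eta p T b nu K hp hT HK). }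
 assert (av1 : forall w, PhiS n Lam z eta tau T w -> avoided g w) by (intros w hw; exact (A1 w (PhiS_left_UL _ _ _ _ _ _ _ hw))).
 assert (av1' : forall w, PhiS n Lam z eta tau T w -> avoided g' w) by (intros w hw; exact (A2 w (PhiS_left_UL _ _ _ _ _ _ _ hw))).
 assert (av2 : forall w, PhiS n Lam z eta p T (w + p) -> avoided g' w).
 { intros w hw. recast (w + p - p). exact (A2 _ (PhiS_right_UL _ _ _ _ _ _ _ hw)). }
 assert (cphi := Mer_pcont _ _ _ cg av1 Mphi). assert (cphi' := Mer_pcont _ _ _ cg' av1' Mphi).
 assert (cpsi := Mer_pcont _ _ _ cg' av2 Mpsi).
 destruct (Mer_bounded _ _ _ cg av1 Mphi) as [B1 [hB1 HB1]]. destruct (Mer_bounded _ _ _ cg' av2 Mpsi) as [B2 [hB2 HB2]].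
 destruct (separated_lower T eta kap sigma d kap0 he0 hd Hsep) as [c1 [hc1 Hc1]].
 destruct (dint_line_growth T eta sigma (-1) g dg g' dg' phi psi B1 B2 c1 hT he0 P1 P2 S1 cphi cpsi hB1 HB1 hB2 HB2 hc1 Hc1)
  as [C0 [hC0 HC0]].
 set (D := fun m => dint T m g dg g' dg' phi psi) in *.
 set (U := pint g' dg' (fun t => phi t * psi t)).
 assert (EU : u_integral n Lam a b z lam nu tau p eta = e2pi (nu + 2 * eta) * U).
 { rewrite (u_integral_contour n Lam z a b lam nu tau p eta g' dg' ht hp ha hb C2).
  - unfold u_clean, U. rewrite <- pint_scal; [reflexivity | exact P2 | cc].
  - intros t h j hj. destruct (Z2 t h j hj) as (x & y & _). now split. }
 assert (hz0 : forall x, th0 (line eta sigma x) T <> 0).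
 { intro x. specialize (Hz 0%nat (x + 2)%R). rewrite kap0 in Hz. intro E. apply Hz. rewrite <- E. f_equal.
  unfold line. rewrite RtoC_plus. ring. }
 (* Both ends of the telescope as one function of the kernel argument, sampled at x - 2 and x +
    2. *)
 set (f := fun x : R => kernc T * prefactor eta lam nu (line eta sigma x) * (D (line eta sigma x) / th0 (line eta sigma x) T) * eta).
 set (K0 := Cexp (Ci * PI / (4 * eta) * ((lam - nu) * (lam - nu))) * e2pi nu).
 assert (Hpre : forall x, prefactor eta lam nu (line eta sigma x) = K0 * gline eta s (- (2 * eta) + (lam - nu)) sigma x).
 { intro x. rewrite gline_eq by assumption. unfold prefactor, K0.
  recast (line eta sigma x + (- (2 * eta) + (lam - nu))). reflexivity. }
 assert (cl : forall x : R, ccont (fun x => line eta sigma x) x).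
 { intro x. unfold line. cc. }
 assert (cf : forall x, ccont f x).
 { intro x. unfold f. apply ccont_mult; [| cc]. apply ccont_mult; [cc |].
  - unfold prefactor. cc.
  - apply ccont_div.
   + apply (ccont_comp (fun x => line eta sigma x) D); [apply cl |].
    exact (dint_cont T (-1) g dg g' dg' phi psi _ hT P1 P2 S1 cphi cpsi).
   + apply (ccont_ext (fun x => th0 (line eta sigma x + 0) T)); [intro; f_equal; ring |].
    apply (ccont_comp (fun x => line eta sigma x) (fun t => th0 (t + 0) T)); [apply cl | now apply th0_cont].
   + apply hz0. }
 assert (Hf0 : forall eps : R, 0 < eps -> exists N : R, forall x, N <= Rabs x -> Cmod (f x) <= eps).
 { intros eps heps. set (M := (Cmod (kernc T) * Cmod K0 * Cmod eta)%R).
  assert (hM : 0 <= M) by (unfold M; repeat apply Rmult_le_pos; apply Cmod_ge_0).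
  destruct (gline_decay eta (- (2 * eta) + (lam - nu)) s sigma C0 hs hr heta (eps / (M + 1)) ltac:(apply Rdiv_lt_0_compat; lra)) as [N HN].
  exists N. intros x hx. specialize (HN x hx). specialize (HC0 x (hz0 x)). fold (D (line eta sigma x)) in HC0.
  unfold f. rewrite Hpre, !Cmod_mult.
  set (X := Cmod (gline eta s (- (2 * eta) + (lam - nu)) sigma x)) in *.
  assert (hX : 0 <= X) by apply Cmod_ge_0.
  apply Rle_trans with (M * (X * exp (C0 * (1 + Rabs x))))%R.
  - unfold M. recast (Cmod (kernc T) * (Cmod K0 * X) * exp (C0 * (1 + Rabs x)) * Cmod eta)%R.
   apply Rmult_le_compat_r; [apply Cmod_ge_0 |]. apply Rmult_le_compat_l; [| exact HC0].
   repeat apply Rmult_le_pos; apply Cmod_ge_0.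
  - apply Rle_trans with (M * (eps / (M + 1)))%R; [now apply Rmult_le_compat_l |].
   apply (Rmult_le_reg_r (M + 1)); [lra |]. recast (M * eps)%R by (field; lra). nra. }
 assert (HI1 := cint_line_difference f 2 ltac:(lra) cf Hf0).
 destruct (gwidth_pos eta s hs hr heta) as [g1 g2].
 (* The residue term sits at m = mu - 2 eta, which displaces the - 2 eta of [prefactor] once more,
    to - 4 eta. *)
 assert (HI2 := gaussian_line (gwidth s) ((sigma + (- (4 * eta) + (lam - nu))) / eta) g1 g2).
 fold (gline eta s (- (4 * eta) + (lam - nu)) sigma) in HI2.
 apply (is_cint_line_scal (- (2 * PI * Ci) * U * eta * K0)) in HI2.
 assert (HI := is_RInt_gen_plus (V := C_R_NormedModule) _ _ _ _ HI1 HI2).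
 match goal with |- is_RInt_gen ?F _ _ ?l => match type of HI with is_RInt_gen ?F' _ _ ?l' =>
  replace l with l'; [replace F with F'; [exact HI |] |] end end.
 - apply functional_extensionality. intro x. change (@plus _) with Cplus.
  set (mu := line eta sigma x).
  assert (lm : forall v : R, line eta sigma (x + v)%R = mu + v * eta) by (intro v; unfold mu, line; rewrite RtoC_plus; ring).
  assert (e1 : line eta sigma (x + - (2))%R = mu - 2 * eta) by (rewrite lm, RtoC_opp; ring).
  assert (e2 : line eta sigma (x + 2)%R = mu + 2 * eta) by (rewrite lm; ring).
  assert (hm : th0 (mu - 2 * eta) T <> 0) by (rewrite <- e1; apply hz0).
  assert (hM : th0 (mu + 2 * eta) T <> 0) by (rewrite <- e2; apply hz0).
  unfold heat_integrand. fold T.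
  rewrite (csum_ext _ (fun c => heat_exponential eta lam nu mu *
   (u_integral n Lam a c z lam mu tau T eta * Q Lam c mu T eta * u_integral n Lam c b z (- mu) nu T p eta))).
  2:{ intros c hc. unfold u, heat_exponential. ring. }
  rewrite csum_scal.
  assert (W := heat_weight_sum n Lam z tau p eta a b lam nu mu g dg g' dg' gp dgp ht hp ha hb HL HC). cbv zeta in W.
  fold T in W. rewrite W; clear W.
  2:{ intros c hc. specialize (Hz c x). intro E. apply Hz. rewrite <- E. f_equal. unfold shiftM, kap, mu, line. ring. }
  fold phi. fold psi. fold U. fold (D (mu - 2 * eta)). fold (D (mu + 2 * eta)).
  unfold f. rewrite e1, e2, <- (heat_exponential_minus eta lam nu mu he), <- (heat_exponential_plus eta lam nu mu he).
  assert (E3 : K0 * gline eta s (- (4 * eta) + (lam - nu)) sigma x = heat_exponential eta lam nu mu * e2pi (lam + (mu - 2 * eta))).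
  { rewrite (heat_exponential_minus eta lam nu mu he), gline_eq by assumption. fold mu. unfold prefactor, K0.
   recast (mu + (- (4 * eta) + (lam - nu))). reflexivity. }
  recast (- (2 * PI * Ci) * U * eta * (K0 * gline eta s (- (4 * eta) + (lam - nu)) sigma x)).
  rewrite E3, <- (kernc_kres T (mu - 2 * eta) hT hm).
  change (pint g' dg' (fun t => phi t * Phic false n Lam z eta p T b nu (t + p))) with U.
  match goal with |- @eq _ ?v ?w => change (@eq C v w) end. field. cc.
 - match goal with |- @eq _ (plus ?x ?y) ?v => change (@eq C (Cplus x y) v) end. rewrite EU. unfold K0.
  replace (e2pi nu) with (e2pi (- (2 * eta)) * e2pi (nu + 2 * eta)); [ring |].
  rewrite <- e2pi_plus. f_equal. ring.
Qed.

Theorem theorem2p1 :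
  forall (n : nat) (Lam z : nat -> C) (tau p eta s : C),
    (1 <= n)%nat ->
    sum_n_m Lam 1 n = RtoC 2 ->
    (0 < Im tau)%R -> (0 < Im p)%R -> (Im eta < 0)%R ->
    nonresonant n Lam z tau p eta ->
    s * s = 4 * Ci * eta -> (0 < Re s)%R ->
    almost_every (fun sigma : R =>
      (forall (x : R) (c : nat), (1 <= c <= n)%nat ->
         Q_defined Lam c (line eta sigma x) (tau + p) eta)
      /\
      forall a b : nat, (1 <= a <= n)%nat -> (1 <= b <= n)%nat ->
      forall lam nu : C,
        let F := fun mu : C =>
          sum_n_m (fun c => u n Lam a c z lam mu tau (tau + p) eta
                            * Q Lam c mu (tau + p) eta
                            * Cexp (- (Ci * PI * (mu * mu) / (4 * eta)))
                            * u n Lam c b z (- mu) nu (tau + p) p eta) 1 n in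
        ex_line_integral eta sigma F
        /\ u n Lam a b z lam nu tau p eta
           = heat_const eta s
             * heat_T_D0 n Lam z tau p eta sigma
                 (fun c d lam' mu' => u n Lam c d z lam' mu' (tau + p) p eta)
                 a b lam nu
        /\ u n Lam a b z lam nu tau p eta
           = heat_const eta s
             * Cexp (- (Ci * PI / (4 * eta) * (lam * lam + nu * nu)))
             * line_integral eta sigma F).
Proof.
 intros n Lam z tau p eta s hn HL ht hp heta Hres hs hr.
 set (kap := fun c => - (2 * eta) + 2 * eta * csum Lam 1 c).
 assert (hT : 0 < Im (tau + p)) by (rewrite Im_plus; lra).
 assert (he0 : Im eta <> 0%R) by lra.
 assert (he : eta <> 0) by (intro E; rewrite E in heta; simpl in heta; lra).
 (* One separation property of sigma yields every clause, for all lam, nu, a, b at once; the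
    exceptional set is therefore a single null set. *)
 intros eps heps. destruct (almost_every_separated (rho_seq (tau + p) eta kap) eps heps) as [l [r [h1 [h2 h3]]]].
 exists l, r. split; [exact h1 | split; [| exact h3]]. intros sigma hsig. apply h2. clear l r h1 h2 h3.
 intros [d [hd Hsep]]. apply hsig. clear hsig.
 assert (Hz := separated_avoids (tau + p) eta kap sigma d hT he0 hd Hsep).
 assert (Hth : forall x c, theta (line eta sigma x - 2 * eta + 2 * eta * csum Lam 1 c) (tau + p) <> 0).
 { intros x c. apply theta_neq_0_iff; [exact hT |]. specialize (Hz c x). intro E. apply Hz. rewrite <- E. f_equal.
  unfold kap, line. ring. }
 split; [intros x c hc; split; apply Hth |].
 intros a b ha hb lam nu F.
 assert (HI := heat_line_integral n Lam z tau p eta s a b lam nu sigma d hn HL ht hp heta Hres hs hr ha hb hd Hsep).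
 change (is_cint_line (fun x => F (line eta sigma x) * eta)
  (- (2 * PI * Ci) * e2pi (- (2 * eta)) * eta * Cexp (Ci * PI / (4 * eta) * ((lam - nu) * (lam - nu))) *
   u_integral n Lam a b z lam nu tau p eta * (RtoC (sqrt PI) / gwidth s))) in HI.
 set (V := - (2 * PI * Ci) * e2pi (- (2 * eta)) * eta * Cexp (Ci * PI / (4 * eta) * ((lam - nu) * (lam - nu))) *
   u_integral n Lam a b z lam nu tau p eta * (RtoC (sqrt PI) / gwidth s)) in HI.
 assert (EL : line_integral eta sigma F = V) by exact (is_cint_line_unique _ _ HI).
 assert (EH : heat_T_D0 n Lam z tau p eta sigma (fun c d lam' mu' => u n Lam c d z lam' mu' (tau + p) p eta) a b lam nu =
  gauss eta lam * (gauss eta nu * V)).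
 { unfold heat_T_D0, heat_T. apply (f_equal (Cmult _)). unfold line_integral. apply is_cint_line_unique.
  (* In [heat_T_D0] the factor [gauss eta nu] stands inside the integral, so this integral is
     evaluated from [HI] by scaling. *)
  assert (HG := is_cint_line_scal (gauss eta nu) _ _ HI).
  match goal with |- is_RInt_gen ?G _ _ _ => match type of HG with is_RInt_gen ?G' _ _ _ => replace G with G'; [exact HG |] end end.
  apply functional_extensionality. intro x. set (mu := line eta sigma x). unfold heat_D0, F.
  rewrite (csum_ext (fun c => u n Lam a c z lam mu tau (tau + p) eta * Q Lam c mu (tau + p) eta *
    Cexp (- (Ci * PI * (mu * mu) / (4 * eta))) * u n Lam c b z (- mu) nu (tau + p) p eta)
   (fun c => Cexp (- (Ci * PI * (mu * mu) / (4 * eta))) * (u n Lam a c z lam mu tau (tau + p) eta * Q Lam c mu (tau + p) eta *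
    u n Lam c b z (- mu) nu (tau + p) p eta))) by (intros; ring).
  rewrite (csum_ext (fun c => u n Lam a c z lam mu tau (tau + p) eta * Q Lam c mu (tau + p) eta *
    (gauss eta nu * u n Lam c b z (- mu) nu (tau + p) p eta))
   (fun c => gauss eta nu * (u n Lam a c z lam mu tau (tau + p) eta * Q Lam c mu (tau + p) eta *
    u n Lam c b z (- mu) nu (tau + p) p eta))) by (intros; ring).
  rewrite !csum_scal. replace (gauss eta mu) with (Cexp (- (Ci * PI * (mu * mu) / (4 * eta)))); [ring |].
  unfold gauss. apply (f_equal Cexp). field; auto. }
 assert (hs0 : s <> 0) by (intro E; rewrite E in hr; simpl in hr; lra).
 assert (hpi : RtoC PI <> 0) by (intro E; apply RtoC_inj in E; assert (P := PI_RGT_0); lra).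
 assert (hsp : RtoC (sqrt PI) <> 0) by (intro E; apply hpi; rewrite <- sqrt_PI_sqr, E; ring).
 assert (EV : u n Lam a b z lam nu tau p eta = heat_const eta s * Cexp (- (Ci * PI / (4 * eta) * (lam * lam + nu * nu))) * V).
 { set (I := u_integral n Lam a b z lam nu tau p eta) in *. unfold u. fold I. unfold V, heat_const, gwidth.
  set (X := Cexp (- (Ci * PI * lam * nu / (2 * eta)))).
  assert (EX : X = Cexp (- (Ci * PI / (4 * eta) * (lam * lam + nu * nu))) * Cexp (Ci * PI / (4 * eta) * ((lam - nu) * (lam - nu)))).
  { unfold X. rewrite <- Cexp_plus. apply (f_equal Cexp). field; auto. }
  rewrite EX. set (X1 := Cexp (- (Ci * PI / (4 * eta) * (lam * lam + nu * nu)))).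
  set (X2 := Cexp (Ci * PI / (4 * eta) * ((lam - nu) * (lam - nu)))).
  recast (e2pi (2 * eta)) by (unfold e2pi; apply (f_equal Cexp); ring).
  rewrite e2pi_opp. assert (ne := e2pi_neq_0 (2 * eta)). set (Y := e2pi (2 * eta)) in *.
  (* The width contributes 4/s and the constant 1/s; together with the residue - 2 pi i and eta they
     give 4 i eta / s^2 = 1. The factor e(2 eta) in C cancels the e(- 2 eta) left by the residue
     term. *)
  transitivity (X1 * X2 * I * (4 * Ci * eta) / (s * s)); [rewrite hs |].
  - assert (hi : Ci <> 0) by (intro E; apply (f_equal Im) in E; simpl in E; lra). field. cc.
  - field. cc. }
 split; [| split].
 - exists V. exact HI.
 - rewrite EH, EV. replace (Cexp (- (Ci * PI / (4 * eta) * (lam * lam + nu * nu)))) with (gauss eta lam * gauss eta nu); [ring |].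
  unfold gauss. rewrite <- Cexp_plus. apply (f_equal Cexp). field; auto.
 - rewrite EL. exact EV.
Qed.
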